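(* Let $u_1,u_2\in C(\bar X_c)$ be Lipschitz continuous, i.e. there is $L>0$ such that $|u_i(m,t)-u_i(m',t')|\le L(\|m-m'\|_{L^2(\mathbb{R}^n)}+|t-t'|)$ for all $(m,t),(m',t')\in\bar X_c$, $i=1,2$. Assume that $u_1$ is a viscosity subsolution in $X_c$, and $u_2$ is a viscosity supersolution in $\bar X_c$, of $$-\partial_t u(m,t)+H(m,\nabla_m u(m,t))=0,\qquad u(m,T)=\psi(m).$$ Then $$u_1(m,t)-u_2(m,t)\le 0\qquad\forall (m,t)\in\bar X_c.$$
   Context: Controls and dynamics. Fix $n\ge 1$, $T>0$, $M>0$. $|\cdot|$ is the Euclidean norm (operator norm for matrices); Sobolev norms are standard, normalised so that $\|a\|_{W^{k,\infty}}$ ($k\ge1$) dominates $\sup_x|a(x)|$ and $\operatorname{ess\,sup}_x|Da(x)|$. Let $\tilde{\mathcal A}$ be the set of $a\in W^{3,\infty}(\mathbb{R}^n;\mathbb{R}^n)\cap H^1(\mathbb{R}^n;\mathbb{R}^n)$ with $\max\{\|a\|_{W^{3,\infty}},\|a\|_{H^1}\}\le M$, and $\mathcal A$ the set of $\alpha\in L^2([0,T],W^{3,\infty}(\mathbb{R}^n;\mathbb{R}^n)\cap H^1(\mathbb{R}^n;\mathbb{R}^n))$ with $\alpha(\cdot,s)\in\tilde{\mathcal A}$ for a.e. $s\in[0,T]$. For $\alpha\in\mathcal A$ the flow $\Phi_{t,s}:\mathbb{R}^n\to\mathbb{R}^n$ solves $\partial_s\Phi_{t,s}(x)=\alpha(\Phi_{t,s}(x),s)$,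 $\Phi_{t,t}(x)=x$, and $\Psi_{t,s}=\Phi_{t,s}^{-1}$. The function $m(x,s;\alpha,\bar m,t)=\bar m(\Psi_{t,s}(x))/\det D\Phi_{t,s}(\Psi_{t,s}(x))$ is the unique (distributional) solution of $\partial_s m+\operatorname{div}(\alpha m)=0$ in $\mathbb{R}^n\times(t,T)$, $m(\cdot,t)=\bar m$. State sets. Let $\tilde\Omega\subset\mathbb{R}^n$ be open and bounded, $C_U>0$, $\tilde\Omega(t)=\{x:\operatorname{dist}(x,\tilde\Omega)\le Mt\}$ for $t\in(0,T]$. Let $C=C(M,T,n)$ be a fixed constant such that $\|m(\cdot,s;\alpha,\bar m,t)\|_{W^{2,\infty}}\le C\|\bar m\|_{W^{2,\infty}}$ for all $0\le t\le s\le T$, $\alpha\in\mathcal A$, $\bar m\in W^{2,\infty}(\mathbb{R}^n)$ (such a constant exists), and $\tilde C_U=C\,C_U$. All densities are nonnegative. $X(0)$ is the set of nonnegative $\bar m\in W^{2,\infty}(\mathbb{R}^n)$ with $\max\{\|\bar m\|_{W^{2,\infty}},\|\bar m\|_{H^1}\}\le C_U$ and $\operatorname{supp}\bar m\subseteq\tilde\Omega$. For $t\in(0,T]$, $X(t)$ is the set of nonnegative $\bar m\in W^{2,\infty}(\mathbb{R}^n)$ with $\operatorname{supp}\bar m\subseteq\tilde\Omega(t)$ and $\|m(\cdot,s;\alpha,\bar m,t)\|_{W^{2,\infty}}\le\tilde C_U$ for all $s\in[t,T]$ and all $\alpha\in\mathcal A$. One has $X(s)\subseteq X(t)$ for $s\le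 t$. Constraint. $\Omega\subset\tilde\Omega$ is a nonempty open convex set with boundary regular enough for the divergence theorem, $p(x)=\operatorname{dist}(x,\Omega)$, $\delta>0$, $\langle p,m\rangle=\int_{\tilde\Omega(T)}p\,m\,dx$. $X_c(t)=\{m\in X(t):\langle p,m\rangle<\delta\}$, $\bar X_c(t)=\{m\in X(t):\langle p,m\rangle\le\delta\}$, $X_c=\bigcup_{t\in[0,T]}X_c(t)\times\{t\}$, $\bar X_c=\bigcup_{t\in[0,T]}\bar X_c(t)\times\{t\}$. Costs. $\ell:X(T)\times\tilde{\mathcal A}\to[0,+\infty)$ and $\psi:X(T)\to[0,+\infty)$ are bounded and continuous ($X(T)$ with the $L^2$ topology, $\tilde{\mathcal A}$ with the topology of $W^{3,\infty}\cap H^1$), and there are $L_\ell,L_\psi>0$ with $|\ell(m_1,a)-\ell(m_2,a)|\le L_\ell\|m_1-m_2\|_{L^2}$ and $|\psi(m_1)-\psi(m_2)|\le L_\psi\|m_1-m_2\|_{L^2}$ for all $m_1,m_2\in X(T)$, $a\in\tilde{\mathcal A}$. Hamiltonian. For $m\in X(T)$, $q\in L^2(\mathbb{R}^n)$: $H(m,q)=\sup_{a\in\tilde{\mathcal A}}\left[\langle q,\operatorname{div}(am)\rangle-\ell(m,a)\right]$, where here $\langle\cdot,\cdot\rangle$ is the $L^2(\mathbb{R}^n)$ scalar product. $\nabla_m$ denotes the $L^2$-Fréchet gradient in $m$. Viscosity solutions. Let $u\in C(\bar X_c)$ (continuity w.r.t. the $L^2\times[0,T]$ topology, which on $\bar X_c$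 is the same as the $H^1\times[0,T]$ topology; local extrema are also meant in this topology). - $u$ is a viscosity subsolution in $X_c$ if: for every $\varphi\in C^1(L^2(\mathbb{R}^n)\times[0,T])$ and every $(m_0,t_0)\in\bigcup_{t\in(0,T)}X_c(t)\times\{t\}$ that is a local maximum point of $u-\varphi$ relative to $X_c$, $-\partial_t\varphi(m_0,t_0)+H(m_0,\nabla_m\varphi(m_0,t_0))\le0$; and $u(m,T)\le\psi(m)$ for all $m\in\bar X_c(T)$. - $u$ is a viscosity supersolution in $\bar X_c$ if: for every $\varphi\in C^1(L^2(\mathbb{R}^n)\times[0,T])$ and every $(m_0,t_0)\in\bigcup_{t\in(0,T)}\bar X_c(t)\times\{t\}$ that is a local minimum point of $u-\varphi$ relative to $\bar X_c$, $-\partial_t\varphi(m_0,t_0)+H(m_0,\nabla_m\varphi(m_0,t_0))\ge0$; and $u(m,T)\ge\psi(m)$ for all $m\in\bar X_c(T)$. *)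

(* Defs.v *)
From HB Require Import structures.
From mathcomp Require Import all_boot all_order all_algebra.
From mathcomp Require Import all_classical all_reals all_analysis.
From mathcomp Require Import ess_sup_inf.

Set Implicit Arguments.
Unset Strict Implicit.
Unset Printing Implicit Defensive.

Import Order.TTheory GRing.Theory Num.Theory.
Import numFieldNormedType.Exports.

Local Open Scope classical_set_scope.
Local Open Scope ring_scope.

Fact rV_display : measure_display. Proof. exact: default_measure_display. Qed.

Section measurable_rV.
Context (R : realType) (n : nat).

Let coord : 'I_n -> 'rV[R]_n -> measurableTypeR R := fun i x => x 0 i.

HB.instance Definition _ := @isMeasurable.Build rV_display 'rV[R]_n
  (g_sigma_preimage coord) (@sigma_algebra0 _ _ _)
  (@sigma_algebraC _ _ ) (@sigma_algebra_bigcup _ _ _).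

Lemma measurable_rV_coord i : measurable_fun setT (coord i).
Proof.
move=> _ Y mY; rewrite setTI; apply: sub_sigma_algebra => /=.
rewrite -bigcup_seq/=; exists i => /=; first by rewrite mem_index_enum.
by exists Y => //; rewrite setTI.
Qed.

Lemma measurable_rVP d (T : measurableType d) (f : T -> 'rV[R]_n) :
  (forall i, measurable_fun setT (fun t => f t 0 i : measurableTypeR R)) ->
  measurable_fun setT f.
Proof.
move=> mf.
suff: (g_sigma_preimage (fun i => coord i \o f)) `<=` measurable.
  rewrite g_sigma_preimage_comp => prefS _ A mA.
  by apply: prefS; exists A.
apply: smallest_sub; first exact: sigma_algebra_measurable.
move=> A; rewrite -bigcup_seq/= => -[i _ [B mB <-]].
exact: mf.
Qed.

End measurable_rV.

Fact product_sigma_finite d1 d2 (T1 : measurableType d1)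
    (T2 : measurableType d2) (R : realType)
    (m1 : {sigma_finite_measure set T1 -> \bar R})
    (m2 : {sigma_finite_measure set T2 -> \bar R}) :
  sigma_finite setT (m1 \x m2)%E.
Proof.
have /sigma_finiteP[F [TF ndF Foo]] := sigma_finiteT m1.
have /sigma_finiteP[G [TG ndG Goo]] := sigma_finiteT m2.
exists (fun n => F n `*` G n).
  rewrite -setXTT TF TG predeqE => -[x y]; split.
    move=> [/= [n _ Fnx] [k _ Gky]]; exists (maxn n k) => //; split.
    - by move: x Fnx; exact/subsetPset/ndF/leq_maxl.
    - by move: y Gky; exact/subsetPset/ndG/leq_maxr.
  by move=> [n _ []/= ? ?]; split; exists n.
move=> k; have [? ?] := Foo k; have [? ?] := Goo k.
split; first exact: measurableX.
by rewrite product_measure1E// lte_mul_pinfty// ge0_fin_numE.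
Qed.

Section lebesgue_rV.
Context (R : realType).

Definition rV_cons n (p : measurableTypeR R * 'rV[R]_n) : 'rV[R]_n.+1 :=
  \row_i (if unlift ord0 i is Some j then p.2 0 j else p.1).

Definition rV_behead n (v : 'rV[R]_n.+1) : measurableTypeR R * 'rV[R]_n :=
  (v 0 0, \row_i v 0 (lift ord0 i)).

Lemma rV_cons0 n p : @rV_cons n p 0 0 = p.1.
Proof. by rewrite mxE unlift_none. Qed.

Lemma rV_consS n p i : @rV_cons n p 0 (lift ord0 i) = p.2 0 i.
Proof. by rewrite mxE liftK. Qed.

Lemma rV_consK n : cancel (@rV_cons n) (@rV_behead n).
Proof.
move=> [x v]; rewrite /rV_behead rV_cons0; congr pair.
by apply/rowP => i; rewrite mxE rV_consS.
Qed.

Lemma measurable_rV_cons n : measurable_fun setT (@rV_cons n).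
Proof.
apply: measurable_rVP => i; case: (unliftP ord0 i) => [j ->|->].
  under eq_fun do rewrite rV_consS.
  apply: (measurableT_comp (f := fun v : 'rV[R]_n => v 0 j : measurableTypeR R)).
    exact: measurable_rV_coord.
  exact: measurable_snd.
under eq_fun do rewrite rV_cons0.
exact: measurable_fst.
Qed.

Lemma measurable_rV_behead n : measurable_fun setT (@rV_behead n).
Proof.
apply/measurable_fun_pairP; split => /=.
  exact: (measurable_rV_coord ord0).
apply: measurable_rVP => i.
rewrite (_ : (fun _ => _) = fun v : 'rV[R]_n.+1 => v 0 (lift ord0 i)).
  exact: measurable_rV_coord.
by apply/funext => v /=; rewrite mxE.
Qed.


Section step.
Context n (mu : {sigma_finite_measure set 'rV[R]_n -> \bar R}).

Definition lebesgue_rV_step : set 'rV[R]_n.+1 -> \bar R :=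
  pushforward (@lebesgue_measure R \x mu)%E (@rV_cons n).

Let step0 : lebesgue_rV_step set0 = 0%E.
Proof. by rewrite /lebesgue_rV_step /pushforward preimage_set0 measure0. Qed.

Let step_ge0 A : (0 <= lebesgue_rV_step A)%E.
Proof. by rewrite /lebesgue_rV_step /pushforward measure_ge0. Qed.

Let step_sigma_additive : semi_sigma_additive lebesgue_rV_step.
Proof.
have mpre (A : set 'rV[R]_n.+1) : measurable A -> measurable (@rV_cons n @^-1` A).
  by move=> mA; rewrite -[X in measurable X]setTI; exact: measurable_rV_cons.
move=> F mF tF mUF; rewrite /lebesgue_rV_step /pushforward preimage_bigcup.
apply: measure_semi_sigma_additive; first by move=> k; exact: mpre.
- apply/trivIsetP => /= i j _ _ ij; rewrite -preimage_setI.
  by move/trivIsetP : tF => /(_ _ _ _ _ ij) ->//; rewrite preimage_set0.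
- by rewrite -preimage_bigcup; exact: mpre.
Qed.

HB.instance Definition _ := isMeasure.Build _ _ _
  lebesgue_rV_step step0 step_ge0 step_sigma_additive.

Lemma lebesgue_rV_step_sigma_finite : sigma_finite setT lebesgue_rV_step.
Proof.
have [F FT Foo] := product_sigma_finite (@lebesgue_measure R) mu.
exists (fun i => @rV_behead n @^-1` F i).
  by rewrite -preimage_bigcup -FT preimage_setT.
move=> i; have [mF Fi] := Foo i; split.
  by rewrite -[_ @^-1` _]setTI; exact: measurable_rV_behead.
rewrite /lebesgue_rV_step /pushforward -comp_preimage.
by rewrite (_ : _ \o _ = id) ?preimage_id//; apply/funext => p /=; rewrite rV_consK.
Qed.

HB.instance Definition _ := @Measure_isSigmaFinite.Build _ _ _
  lebesgue_rV_step lebesgue_rV_step_sigma_finite.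

End step.

Fixpoint lebesgue_rV n : {sigma_finite_measure set 'rV[R]_n -> \bar R} :=
  if n is m.+1 then lebesgue_rV_step (lebesgue_rV m)
  else \d_(0 : 'rV[R]_0).

Lemma lebesgue_rV_box n (a b : 'rV[R]_n) : (forall i, a 0 i <= b 0 i) ->
  lebesgue_rV n [set x | forall i, x 0 i \in `[a 0 i, b 0 i]] =
  (\prod_i (b 0 i - a 0 i))%:E.
Proof.
elim: n a b => [|n ih] a b ab.
  rewrite big_ord0 /= diracE mem_set// => -[]//.
rewrite /= /lebesgue_rV_step /pushforward.
set B := [set x : 'rV[R]_n | forall i, x 0 i \in `[(rV_behead a).2 0 i, (rV_behead b).2 0 i]].
rewrite (_ : _ @^-1` _ = `[a 0 0, b 0 0]%classic `*` B); last first.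
  apply/seteqP; split => -[x v] /= h.
    split => [|i] /=; first by have := h 0; rewrite rV_cons0.
    by have := h (lift ord0 i); rewrite rV_consS !mxE.
  case: h => hx hv i; case: (unliftP ord0 i) => [j ->|->].
    by have := hv j; rewrite rV_consS !mxE.
  by rewrite rV_cons0.
rewrite product_measure1E//; last first.
  rewrite (_ : B = \bigcap_(i in [set: 'I_n])
     ((fun x : 'rV[R]_n => x 0 i : measurableTypeR R) @^-1` `[(rV_behead a).2 0 i, (rV_behead b).2 0 i])); last first.
    by apply/seteqP; split => x /= h i; [move=> _|]; exact: h.
  apply: fin_bigcap_measurable; first exact: finite_finset.
  by move=> i _; rewrite -[_ @^-1` _]setTI; exact: measurable_rV_coord.
rewrite ih => [|i]; last by rewrite !mxE.
transitivity ((b 0 0 - a 0 0)%:E * (\prod_i ((rV_behead b).2 0 i - (rV_behead a).2 0 i))%:E)%E.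
  congr (_ * _)%E; apply: (etrans (lebesgue_measure_itv `[a 0 0, b 0 0])) => /=.
  rewrite lte_fin; case: ltP => [//|ba]; congr EFin; apply/esym/eqP.
  by rewrite subr_eq0 eq_le ab ba.
rewrite -EFinM big_ord_recl; congr (_ * _)%:E.
by apply: eq_bigr => i _; rewrite !mxE.
Qed.

End lebesgue_rV.

Section euclidean.
Context (R : realType) (n : nat).
Implicit Types (x y : 'rV[R]_n) (A : set 'rV[R]_n).

Definition dot_rV x y : R := \sum_i x 0 i * y 0 i.

(* The library norm on row vectors is the sup norm. *)
Definition eucl_norm x : R := Num.sqrt (dot_rV x x).

Definition eucl_dist x A : R := inf [set eucl_norm (x - y) | y in A].

End euclidean.

Section sobolev.
Context (R : realType) (n : nat).
Local Notation E := 'rV[R]_n.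
Local Notation mu := (lebesgue_rV R n).

Definition partial (i : 'I_n) (f : E -> R) : E -> R :=
  fun x => 'D_(delta_mx 0 i) f x.

Definition mdeg k (b : {ffun 'I_n -> 'I_k.+1}) : nat := (\sum_i b i)%N.

Definition mpartial k (b : {ffun 'I_n -> 'I_k.+1}) (f : E -> R) : E -> R :=
  foldr (fun i g => iter (b i) (partial i) g) f (enum 'I_n).

Definition supp (f : E -> R) : set E := closure [set x | f x != 0].

Definition test_function (phi : E -> R) : Prop :=
  (forall (s : seq 'I_n) x, differentiable (foldr partial phi s) x) /\
  compact (supp phi).

Definition loc_integrable (f : E -> R) : Prop :=
  forall K, compact K -> mu.-integrable K (EFin \o f).

Definition weak_derivative k (b : {ffun 'I_n -> 'I_k.+1}) (f g : E -> R) :=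
  [/\ measurable_fun setT f, measurable_fun setT g,
      loc_integrable f, loc_integrable g &
      forall phi, test_function phi ->
        \int[mu]_x (f x * mpartial b phi x) =
        (-1) ^+ mdeg b * \int[mu]_x (g x * phi x)].

Definition weak_derivatives k m (f : E -> 'rV[R]_m)
    (g : {ffun 'I_n -> 'I_k.+1} -> E -> 'rV[R]_m) : Prop :=
  forall b, (mdeg b <= k)%N -> forall j,
    weak_derivative b (fun x => f x 0 j) (fun x => g b x 0 j).

(* Weak derivatives being unique up to null sets, the infima below range over
   at most one value; they are +oo if some weak derivative does not exist, so
   that membership in the Sobolev space is finiteness of the norm.  As
   |Da| <= \sum_i |d_i a| for the operator norm, Wkoo_norm dominates
   ess sup |Da|. *)
Definition Wkoo_norm k m (f : E -> 'rV[R]_m) : \bar R :=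
  ereal_inf [set N | exists2 g, weak_derivatives f g &
    N = (\sum_(b : {ffun 'I_n -> 'I_k.+1} | (mdeg b <= k)%N)
           ess_sup mu (fun x => (eucl_norm (g b x))%:E))%E].

Definition H1_norm m (f : E -> 'rV[R]_m) : \bar R :=
  ereal_inf [set N | exists2 g, weak_derivatives f g &
    N = ((\sum_(b : {ffun 'I_n -> 'I_2} | (mdeg b <= 1)%N)
            \int[mu]_x (eucl_norm (g b x) ^+ 2)%:E) `^ 2^-1)%E].

Definition scalar_field (f : E -> R) : E -> 'rV[R]_1 := fun x => (f x)%:M.

Definition L2 : set (E -> R) := [set f | f \in Lfun mu 2%:E].

Definition L2_norm (f : E -> R) : R := fine 'N[mu]_2%:E[EFin \o f].

Definition L2_dist (f g : E -> R) : R := L2_norm (f \- g).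

Definition L2_inner (f g : E -> R) : R := \int[mu]_x (f x * g x).

Definition divergence (F : E -> E) : E -> R :=
  fun x => \sum_i partial i (fun y => F y 0 i) x.

(* The Gauss-Green formula on a convex open set, sigma being the surface
   measure (a measure carried by the boundary) and nu the outward unit normal
   (which for a convex set means that it lies in the normal cone). *)
Definition has_divergence_theorem (A : set E) : Prop :=
  exists (sigma : {finite_measure set E -> \bar R}) (nu : E -> E),
    [/\ sigma (~` (closure A `\` A)) = 0%E,
        measurable_fun setT nu,
        {ae sigma, forall y, eucl_norm (nu y) = 1 /\
           forall x, A x -> dot_rV (nu y) (x - y) <= 0} &
        forall F : E -> E,
          (forall x, differentiable F x) ->
          (forall i j, continuous (partial i (fun x => F x 0 j))) ->
          \int[mu]_(x in A) divergence F x = \int[sigma]_y dot_rV (F y) (nu y)].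

End sobolev.

Section controls.
Context (R : realType) (n : nat) (T M : R).
Local Notation E := 'rV[R]_n.

Definition V_norm (a : E -> E) : \bar R := maxe (Wkoo_norm 3 a) (H1_norm a).

(* Classes in W^{3,oo} /\ H^1 are represented by their continuous element. *)
Definition control_space : set (E -> E) :=
  [set a | continuous a /\ (V_norm a < +oo)%E].

Definition Atilde : set (E -> E) :=
  [set a | control_space a /\ (V_norm a <= M%:E)%E].

(* An L^2 class of controls is represented by a map that is the limit of simple
   functions at every time of [0, T] (not only at almost every time), so that
   the integrands of the flow equation are Borel measurable. *)
Definition simple_control (c : R -> E -> E) : Prop :=
  exists (N : nat) (B : 'I_N -> set R) (v : 'I_N -> E -> E),
    [/\ forall i, measurable (B i), forall i, control_space (v i) &
        forall s x, c s x = \sum_i (\1_(B i) s : R) *: v i x].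

Definition strongly_measurable (alpha : R -> E -> E) : Prop :=
  exists2 c : nat -> R -> E -> E, (forall k, simple_control (c k)) &
    forall s, 0 <= s <= T ->
      V_norm (fun x => c k s x - alpha s x) @[k --> \oo] --> 0%E.

Definition controls : set (R -> E -> E) :=
  [set alpha | [/\ forall s, 0 <= s <= T -> control_space (alpha s),
    strongly_measurable alpha,
    (\int[lebesgue_measure]_(s in `[0%R, T]) (V_norm (alpha s) ^+ 2) < +oo)%E &
    {ae lebesgue_measure, forall s, 0 <= s <= T -> Atilde (alpha s)}]].

(* The equation of the flow is understood in the sense of Caratheodory. *)
Definition is_trajectory (alpha : R -> E -> E) (t : R) (x : E)
    (gamma : R -> E) : Prop :=
  {within `[t, T], continuous gamma} /\
  forall s, t <= s <= T -> forall i : 'I_n,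
    lebesgue_measure.-integrable `[t, s]
      (fun r => (alpha r (gamma r) 0 i)%:E) /\
    gamma s 0 i = x 0 i +
      \int[lebesgue_measure]_(r in `[t, s]) alpha r (gamma r) 0 i.

Definition flow (alpha : R -> E -> E) (t s : R) (x : E) : E :=
  xget (cst x) [set gamma | is_trajectory alpha t x gamma] s.

Definition flow_inv (alpha : R -> E -> E) (t s : R) (x : E) : E :=
  xget x [set y | flow alpha t s y = x].

Definition transport (s : R) (alpha : R -> E -> E) (mbar : E -> R) (t : R) :
    E -> R :=
  fun x => let y := flow_inv alpha t s x in
           mbar y / \det ('J (flow alpha t s) y).

End controls.

Section states.
Context (R : realType) (n : nat) (T M : R).
Local Notation E := 'rV[R]_n.

(* Classes in W^{2,oo} are represented by their continuous element. *)
Definition W2oo : set (E -> R) :=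
  [set m | continuous m /\ (Wkoo_norm 2 (scalar_field m) < +oo)%E].

Definition transport_bound (C : R) : Prop :=
  forall t s alpha mbar, 0 <= t -> t <= s -> s <= T ->
    controls T M alpha -> W2oo mbar ->
    (Wkoo_norm 2 (scalar_field (transport T s alpha mbar t)) <=
     C%:E * Wkoo_norm 2 (scalar_field mbar))%E.

Context (C CU : R) (Omt : set E).

Definition enlarged (t : R) : set E := [set x | eucl_dist x Omt <= M * t].

Definition initial_states : set (E -> R) :=
  [set m | [/\ W2oo m, forall x, 0 <= m x,
    (maxe (Wkoo_norm 2 (scalar_field m)) (H1_norm (scalar_field m)) <= CU%:E)%E
    & supp m `<=` Omt]].

Definition later_states (t : R) : set (E -> R) :=
  [set m | [/\ W2oo m, forall x, 0 <= m x, supp m `<=` enlarged t &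
    forall s alpha, t <= s <= T -> controls T M alpha ->
      (Wkoo_norm 2 (scalar_field (transport T s alpha m t)) <=
       (C * CU)%:E)%E]].

Definition state_set (t : R) : set (E -> R) :=
  if t == 0 then initial_states else later_states t.

Context (Om : set E) (delta : R).

Definition constraint (m : E -> R) : \bar R :=
  (\int[lebesgue_rV R n]_(x in enlarged T) (eucl_dist x Om * m x)%:E)%E.

Definition Xc : set ((E -> R) * R) :=
  [set z | [/\ 0 <= z.2 <= T, state_set z.2 z.1 &
    (constraint z.1 < delta%:E)%E]].

Definition Xc_bar : set ((E -> R) * R) :=
  [set z | [/\ 0 <= z.2 <= T, state_set z.2 z.1 &
    (constraint z.1 <= delta%:E)%E]].

Definition running_cost (Ll : R) (ell : (E -> R) -> (E -> E) -> R) : Prop :=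
  [/\ forall m a, state_set T m -> Atilde M a -> 0 <= ell m a,
      exists B, forall m a, state_set T m -> Atilde M a -> ell m a <= B,
      forall m a, state_set T m -> Atilde M a -> forall e, 0 < e ->
        exists2 d, 0 < d & forall m' a', state_set T m' -> Atilde M a' ->
          L2_dist m' m < d -> (V_norm (fun x => a' x - a x)%R < d%:E)%E ->
          `|ell m' a' - ell m a| < e &
      forall m1 m2 a, state_set T m1 -> state_set T m2 -> Atilde M a ->
        `|ell m1 a - ell m2 a| <= Ll * L2_dist m1 m2].

Definition terminal_cost (Lpsi : R) (psi : (E -> R) -> R) : Prop :=
  [/\ forall m, state_set T m -> 0 <= psi m,
      exists B, forall m, state_set T m -> psi m <= B,
      forall m, state_set T m -> forall e, 0 < e ->
        exists2 d, 0 < d & forall m', state_set T m' ->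
          L2_dist m' m < d -> `|psi m' - psi m| < e &
      forall m1 m2, state_set T m1 -> state_set T m2 ->
        `|psi m1 - psi m2| <= Lpsi * L2_dist m1 m2].

End states.

Section viscosity.
Context (R : realType) (n : nat) (T M : R).
Local Notation E := 'rV[R]_n.
Implicit Types (D : set ((E -> R) * R)) (u phi : (E -> R) -> R -> R).

(* The representatives m, a are C^1, so that div(am) is classical. *)
Definition Hamiltonian (ell : (E -> R) -> (E -> E) -> R) (m q : E -> R) :
    \bar R :=
  ereal_sup [set (L2_inner q (divergence (fun x => m x *: a x)) - ell m a)%:E
            | a in Atilde M].

Definition continuous_L2 D u : Prop :=
  forall m t, D (m, t) -> forall e, 0 < e ->
    exists2 d, 0 < d & forall m' t', D (m', t') ->
      L2_dist m' m < d -> `|t' - t| < d -> `|u m' t' - u m t| < e.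

Definition lipschitz_L2 D (L : R) u : Prop :=
  forall m t m' t', D (m, t) -> D (m', t') ->
    `|u m t - u m' t'| <= L * (L2_dist m m' + `|t - t'|).

Definition local_max D u m0 t0 : Prop :=
  exists2 d, 0 < d & forall m t, D (m, t) ->
    L2_dist m m0 < d -> `|t - t0| < d -> u m t <= u m0 t0.

Definition local_min D u m0 t0 : Prop :=
  exists2 d, 0 < d & forall m t, D (m, t) ->
    L2_dist m m0 < d -> `|t - t0| < d -> u m0 t0 <= u m t.

(* phi is C^1 on L^2 x [0, T] with time derivative dphi (one-sided at the end
   points) and L^2-gradient grad.  Differentiability forces phi to agree on
   functions that are equal almost everywhere. *)
Definition C1_test phi (dphi : (E -> R) -> R -> R)
    (grad : (E -> R) -> R -> (E -> R)) : Prop :=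
  forall f t, L2 f -> 0 <= t <= T ->
    [/\ L2 (grad f t),
        forall e, 0 < e -> exists2 d, 0 < d &
          forall g s, L2 g -> 0 <= s <= T ->
            L2_dist g f < d -> `|s - t| < d ->
            `|phi g s - phi f t - L2_inner (grad f t) (g \- f)
              - dphi f t * (s - t)| <= e * (L2_dist g f + `|s - t|) &
        forall e, 0 < e -> exists2 d, 0 < d &
          forall g s, L2 g -> 0 <= s <= T ->
            L2_dist g f < d -> `|s - t| < d ->
            `|dphi g s - dphi f t| < e /\ L2_dist (grad g s) (grad f t) < e].

(* D is the constrained domain (Xc or Xc_bar), Dbar is Xc_bar. *)
Definition viscosity_subsolution D Dbar ell (psi : (E -> R) -> R) u : Prop :=
  (forall phi dphi grad, C1_test phi dphi grad ->
     forall m0 t0, 0 < t0 < T -> D (m0, t0) ->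
       local_max D (fun m t => u m t - phi m t) m0 t0 ->
       ((- dphi m0 t0)%:E + Hamiltonian ell m0 (grad m0 t0) <= 0)%E) /\
  (forall m, Dbar (m, T) -> u m T <= psi m).

Definition viscosity_supersolution Dbar ell (psi : (E -> R) -> R) u : Prop :=
  (forall phi dphi grad, C1_test phi dphi grad ->
     forall m0 t0, 0 < t0 < T -> Dbar (m0, t0) ->
       local_min Dbar (fun m t => u m t - phi m t) m0 t0 ->
       (0 <= (- dphi m0 t0)%:E + Hamiltonian ell m0 (grad m0 t0))%E) /\
  (forall m, Dbar (m, T) -> psi m <= u m T).

End viscosity.

(* Main.v *)
Require Import Defs.
From HB Require Import structures.
From mathcomp Require Import all_boot all_order all_algebra.
From mathcomp Require Import all_classical all_reals all_analysis.
From mathcomp Require Import ess_sup_inf measurable_realfun ring lra.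

Set Implicit Arguments.
Unset Strict Implicit.
Unset Printing Implicit Defensive.

Import Order.TTheory GRing.Theory Num.Theory.
Import numFieldNormedType.Exports.

Local Open Scope classical_set_scope.
Local Open Scope ring_scope.

(** The comparison principle is proved by doubling the variables, with one
    twist that deals with the state constraint.  For [th < 1] close to 1 and a
    small [eps], consider the maximum over pairs of admissible points of

      u1(m,t) - u2(m',t') - |m - th m'|^2 / 2eps - (t - t')^2 / 2eps
        - ka (T - t) - Kp (a - t)_+^2

    ([doubled]).  The equation of the subsolution holds only where the
    constraint is strict, and the factor [th] secures this for the first
    density: [<p, m'> <= delta], and [m] is so close to [th m'] that
    [<p, m> < delta].  The state sets are stable under multiplication by [th]
    because the transported density depends linearly on the initial one.  The
    last penalty keeps the maximum away from time 0 when [u1 - u2] is tested at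
    time [a]; at time 0 the states are also states at all later times, so that
    the inequality there follows from the Lipschitz bounds.

    As [u1] is Lipschitz continuous, testing the maximum against [m = th m'],
    [t = t'] shows that [|m - th m'|] and [|t - t'|] are of order [eps]
    ([max_penalty]).  Both gradients are then multiples of [w = m - th m'], and
    the two Hamiltonians differ, apart from the running cost, by
    [eps^-1 <w, div (a w)>].  Since [2 w div (a w)] is the sum of [w^2 div a]
    and of the divergence of [w^2 a], whose integral vanishes, this is
    [(2eps)^-1 \int w^2 div a], that is O(|w|^2 / eps) = O(eps)
    ([hamiltonian_diff], [Hamiltonian_compare]); the term [ka (T - t)] wins
    and gives the contradiction ([comparison_interior]).

    The maximum has to be attained ([doubling_max]), hence the admissible set
    has to be compact for the L^2 distance ([Xbar_limit]).  Bounded families of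
    states are equi-Lipschitz and supported in a fixed cube, so they converge
    uniformly along ultrafilters ([ultra_uniform]).  That the limit is a state
    ([ulimf_later]) needs two facts.  First, a bound on the W^{k,oo} norm of
    continuous functions passes to pointwise limits ([Wkoo_ultra]): it is
    equivalent to a bound on the iterated finite differences of order at most
    k ([Wkoo_lt_diff_le], [Wkoo_le]).  One direction tests the weak derivative
    against products of sliding averages of bumps; the other one is the weak
    star compactness of difference quotients ([weak_star]).  Secondly, for
    times [tk] converging to [t], the transport along [alpha] starting at time
    [t] is compared with transports starting at time [tk], which is possible
    because controls may be shifted in time ([shift_controls],
    [transport_shift]), and the transported density depends continuously on
    the density, on the point and on the final time ([transport_cvg]).  The
    latter is a property of the flow.  The fields are Lipschitz continuous with
    bounded second differences, the same is true of the flow by Gronwall's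
    inequality ([solves_dist], [solves_diff2]), and such maps are
    differentiable with a Lipschitz continuous derivative ([C11_jacobian]). *)

(** * Row vectors and translation invariance of Lebesgue measure *)

Section rV_norm.
Context (R : realType) (n : nat).
Implicit Types (x y : 'rV[R]_n).

Lemma normr_rV_coord x i : `|x 0 i| <= `|x|.
Proof.
by rewrite /Num.norm/= mx_normrE; apply: (le_bigmax _ (fun ij => `|x ij.1 ij.2|) (0, i)).
Qed.

Lemma normr_rV_le x (e : R) : 0 <= e -> (forall i, `|x 0 i| <= e) -> `|x| <= e.
Proof.
move=> e0 h; rewrite /Num.norm/= mx_normrE; apply: bigmax_le => // -[i j] _ /=.
by rewrite (ord1 i).
Qed.

Lemma normr_rV_lt x (e : R) : 0 < e -> (forall i, `|x 0 i| < e) -> `|x| < e.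
Proof.
move=> e0 h; rewrite /Num.norm/= mx_normrE; apply: bigmax_lt => // -[i j] _ /=.
by rewrite (ord1 i).
Qed.

Lemma open_rVP (A : set 'rV[R]_n) x : open A -> A x ->
  exists2 e : R, 0 < e & forall y, `|y - x| < e -> A y.
Proof.
move=> oA Ax; have : nbhs x A by apply: open_nbhs_nbhs.
move=> /nbhs_ballP[e e0 eA]; exists e => // y yx; apply: eA.
by rewrite mx_norm_ball /ball_ /= distrC.
Qed.

Lemma rat_approx (z e : R) : 0 < e -> exists q : rat, `|ratr q - z| < e.
Proof.
move=> e0; have /rat_in_itvoo[q] : z - e < z + e by lra.
by rewrite in_itv/= => /andP[h1 h2]; exists q; rewrite ltr_norml; apply/andP; split; lra.
Qed.

(** The product sigma-algebra contains the cubes with rational centres, and an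
    open set is the countable union of those that it contains. *)
Lemma open_rV_measurable (A : set 'rV[R]_n) : open A -> measurable A.
Proof.
move=> oA.
pose B (p : 'rV[rat]_n * nat) : set 'rV[R]_n :=
  \bigcap_(i in [set: 'I_n]) [set y | `|y 0 i - ratr (p.1 0 i)| < p.2.+1%:R^-1].
have BE p y : B p y <-> forall i, `|y 0 i - ratr (p.1 0 i)| < p.2.+1%:R^-1.
  by split=> [h i|h i _]; exact: h.
pose F (p : 'rV[rat]_n * nat) := if `[< B p `<=` A >] then B p else set0.
rewrite (_ : A = \bigcup_p F p); last first.
  apply/seteqP; split => [x Ax|x [p _]]; last first.
    by rewrite /F; case: asboolP => // pA /pA.
  have [e e0 eA] := open_rVP oA Ax.
  have e20 : 0 < e / 2 by lra.
  have [k ke] : exists k : nat, k.+1%:R^-1 < e / 2.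
    have := near_infty_natSinv_lt (PosNum e20).
    by move=> [N _ hN]; exists N; exact: (hN N (leqnn N)).
  have k0 : 0 < k.+1%:R^-1 :> R by rewrite invr_gt0.
  pose q : 'rV[rat]_n := \row_i sval (cid (rat_approx (x 0 i) k0)).
  exists (q, k) => //; rewrite /F.
  have Bx : B (q, k) x.
    apply/BE => i /=; rewrite mxE distrC.
    by case: (cid _) => z.
  case: asboolP => // -[]; move=> y /BE hy; apply: eA.
  apply: normr_rV_lt => // i; have h1 := hy i.
  have /BE/(_ i) h2 := Bx.
  rewrite !mxE ltr_norml; move: h1 h2 ke; rewrite /=; set d := k.+1%:R^-1;
  move: d => d; rewrite !ltr_norml => /andP[? ?] /andP[? ?] ?.
  by apply/andP; split; lra.
apply: countable_bigcupT_measurable; first exact: countableP.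
move=> p; rewrite /F; case: asboolP => // _.
apply: fin_bigcap_measurable => // i _.
rewrite -[X in measurable X]setTI.
apply: (measurable_rV_coord i measurableT
  (Y := [set z | `|z - ratr (p.1 0 i)| < p.2.+1%:R^-1])).
rewrite (_ : [set z | _] = ball (ratr (p.1 0 i) : R) p.2.+1%:R^-1).
  by apply: measurable_realfun.open_measurable; exact: ball_open.
by apply/seteqP; split => z /=; rewrite -ball_normE/= distrC.
Qed.

Lemma closed_rV_measurable (A : set 'rV[R]_n) : closed A -> measurable A.
Proof.
move=> cA; rewrite -(setCK A); apply: measurableC.
by apply: open_rV_measurable; rewrite openC.
Qed.

Lemma continuous_rV_measurable (f : 'rV[R]_n -> R) :
  continuous f -> measurable_fun setT f.
Proof.
move=> cf; apply: (measurability _ (measurable_realfun.RGenOpens.measurableE R)).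
move=> _ [_ [a [b ->] <-]]; rewrite setTI; apply: open_rV_measurable.
by move/continuousP : cf; apply; exact: interval_open.
Qed.

End rV_norm.

Section translation.
Context (R : realType).
Local Notation leb := (@lebesgue_measure R).

Lemma lebesgue_measure_shift (a : R) (A : set (measurableTypeR R)) : measurable A ->
  leb ((fun t => t + a) @^-1` A) = leb A.
Proof.
move=> mA; have ms : measurable_fun setT (fun t : measurableTypeR R => (t + a : measurableTypeR R)).
  by apply: continuous_measurable_fun => x; apply: cvgD; [exact: cvg_id|exact: cvg_cst].
pose nu : {measure set (measurableTypeR R) -> \bar R} :=
  measure_function_pushforward__canonical__measure_function_Measure leb ms.
rewrite -[LHS]/(nu A); apply/esym/lebesgue_measure_unique => // X -[[b c] _ <-].
rewrite -[RHS]/(leb ((fun t => t + a) @^-1` `]b, c]%classic)).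
rewrite (_ : _ @^-1` _ = `]b - a, c - a]%classic); last first.
  by apply/seteqP; split => x /=; rewrite !in_itv/= => /andP[? ?]; apply/andP; split; lra.
rewrite !lebesgue_measure_itv/= !lte_fin ltrD2r; case: ifP => // _.
by congr (_%:E); lra.
Qed.

Lemma measurable_shift_rV n (v : 'rV[R]_n) :
  measurable_fun setT (fun x : 'rV[R]_n => x + v).
Proof.
apply: measurable_rVP => i; under eq_fun do rewrite mxE.
apply: measurable_funD; last exact: measurable_cst.
exact: (measurable_rV_coord i).
Qed.

Lemma lebesgue_rV_shift n (v : 'rV[R]_n) (A : set 'rV[R]_n) : measurable A ->
  lebesgue_rV R n ((fun x => x + v) @^-1` A) = lebesgue_rV R n A.
Proof.
elim: n v A => [|n IH] v A mA.
  congr (lebesgue_rV R 0 _); apply/seteqP; split => x /=.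
  - by rewrite (_ : v = 0) ?addr0//; apply/rowP => -[].
  - by rewrite (_ : v = 0) ?addr0//; apply/rowP => -[].
pose v' := (rV_behead v).2.
pose S (p : measurableTypeR R * 'rV[R]_n) : measurableTypeR R * 'rV[R]_n := (p.1 + v 0 0, p.2 + v').
have mS : measurable_fun setT S.
  apply/measurable_fun_pairP; split => /=.
    apply: measurable_funD; last exact: measurable_cst.
    exact: measurable_fst.
  by apply: (measurableT_comp (measurable_shift_rV v')); exact: measurable_snd.
pose mu := (leb \x lebesgue_rV R n)%E.
pose nu : {measure set (measurableTypeR R * 'rV[R]_n) -> \bar R} :=
  measure_function_pushforward__canonical__measure_function_Measure mu mS.
rewrite /= /lebesgue_rV_step /pushforward.
have -> : @rV_cons R n @^-1` ((fun x => x + v) @^-1` A) = S @^-1` (@rV_cons R n @^-1` A).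
  have E p : rV_cons p + v = rV_cons (S p).
    apply/rowP => i; rewrite !mxE; case: (unliftP ord0 i) => [j ->|->] //=.
    by rewrite !mxE.
  by apply/seteqP; split => p /=; rewrite E.
have mB : measurable (@rV_cons R n @^-1` A).
  by rewrite -[X in measurable X]setTI; exact: measurable_rV_cons.
rewrite -[LHS]/(nu (@rV_cons R n @^-1` A)); apply/esym/product_measure_unique => // X Y mX mY.
rewrite -[LHS]/(mu (S @^-1` (X `*` Y))).
rewrite (_ : S @^-1` (X `*` Y) = ((fun t => t + v 0 0) @^-1` X) `*` ((fun y => y + v') @^-1` Y)) //.
rewrite /mu product_measure1E ?IH //.
- by congr (_ * _)%E; exact: lebesgue_measure_shift.
- rewrite -[X in measurable X]setTI.
  have ms : measurable_fun setT (fun t : measurableTypeR R => (t + v 0 0 : measurableTypeR R)).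
    by apply: continuous_measurable_fun => x; apply: cvgD; [exact: cvg_id|exact: cvg_cst].
  exact: ms.
- by rewrite -[X in measurable X]setTI; exact: measurable_shift_rV.
Qed.

Lemma integral_rV_shift n (v : 'rV[R]_n) (f : 'rV[R]_n -> \bar R) :
  measurable_fun setT f ->
  (\int[lebesgue_rV R n]_x f (x + v)%R = \int[lebesgue_rV R n]_x f x)%E.
Proof.
move=> mf.
have h (g : 'rV[R]_n -> \bar R) : measurable_fun setT g -> (forall x, 0 <= g x)%E ->
    (\int[lebesgue_rV R n]_x g (x + v)%R = \int[lebesgue_rV R n]_x g x)%E.
  move=> mg g0.
  have := @ge0_integral_pushforward _ _ _ _ _ _ (measurable_shift_rV v) (lebesgue_rV R n)
     setT g measurableT mg (fun x _ => g0 x).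
  rewrite preimage_setT /= => <-.
  apply: (@eq_measure_integral _ _ _ _ (lebesgue_rV R n)).
    by move=> mT B mB; exact: measurable_shift_rV.
  by move=> mT A mA _; exact: lebesgue_rV_shift.
rewrite [LHS]integralE [RHS]integralE; congr (_ - _)%E.
- have hp := h (f^\+)%E (measurable_funepos mf).
  rewrite -hp; last by move=> x; exact: funepos_ge0.
  by rewrite (funepos_comp f (fun x => x + v)).
- have hn := h (f^\-)%E (measurable_funeneg mf).
  rewrite -hn; last by move=> x; exact: funeneg_ge0.
  by rewrite (funeneg_comp f (fun x => x + v)).
Qed.

Lemma Rintegral_rV_shift n (v : 'rV[R]_n) (f : 'rV[R]_n -> R) :
  measurable_fun setT f ->
  \int[lebesgue_rV R n]_x f (x + v) = \int[lebesgue_rV R n]_x f x.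
Proof.
move=> mf; rewrite /Rintegral; congr fine.
by apply: (integral_rV_shift v (f := EFin \o f)); apply/measurable_EFinP.
Qed.

End translation.

(** * Smooth bumps on the line *)

Section smooth1.
Context {R : realType}.
Implicit Types (f g : R -> R).

(** A quadratic remainder is much more than differentiability requires, but it is
    what is available for functions that are flat at 0. *)
Lemma is_derive_quadratic f (x d C : R) :
  (forall h, `|h| <= 1 -> `|f (h + x) - f x - h * d| <= C * h ^+ 2) ->
  is_derive x 1 f d.
Proof.
move=> H.
have C0 : 0 <= C.
  by have := H 1; rewrite normr1 expr1n mulr1 => /(_ (lexx _)); apply: le_trans.
suff cv : (fun h => h^-1 *: (f (h *: 1 + x) - f x)) @ 0^' --> d.
  split; first by apply/cvg_ex; exists d.
  exact: cvg_lim cv.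
apply/cvgrPdist_lt => e e0; near=> h.
have h0 : h != 0 by near: h; exact: nbhs_dnbhs_neq.
have h1 : `|h| < Num.min 1 (e / (C + 1)).
  near: h; apply: dnbhs0_lt; rewrite lt_min ltr01 divr_gt0// ltr_wpDl//.
move: h1; rewrite lt_min => /andP[h1 he].
rewrite /GRing.scale/= mulr1.
have -> : d - h^-1 * (f (h + x) - f x) = - (h^-1 * (f (h + x) - f x - h * d)).
  by field.
rewrite normrN normrM normfV; apply: (@le_lt_trans _ _ (`|h|^-1 * (C * h ^+ 2))).
  by rewrite ler_wpM2l ?invr_ge0// H// ltW.
rewrite -real_normK ?num_real// expr2 mulrCA mulKf ?normr_eq0//.
apply: (@le_lt_trans _ _ ((C + 1) * `|h|)).
  by rewrite ler_wpM2r// lerDl.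
by rewrite mulrC -ltr_pdivlMr// ltr_wpDl.
Unshelve. all: by end_near. Qed.

Fixpoint Ck (k : nat) f : Prop :=
  if k is j.+1 then (forall x : R, derivable f x 1) /\ Ck j (derive1 f) else True.

Definition smooth f := forall k, Ck k f.

Lemma smooth_derivable f (x : R) : smooth f -> derivable f x 1.
Proof. by move=> /(_ 1%N)[h _]; exact: h. Qed.

Lemma smooth_derive1 f : smooth f -> smooth (derive1 f).
Proof. by move=> sf k; have [_] := sf k.+1. Qed.

Lemma smooth_of_derive f g : (forall x : R, is_derive x (1 : R) f (g x)) -> smooth g -> smooth f.
Proof.
move=> fg sg [//|k]; split=> [x|]; first by have [] := fg x.
rewrite (_ : (derive1 f) = g); first exact: sg.
by apply/funext => x; rewrite derive1E; have [_ ->] := fg x.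
Qed.

Lemma smooth_is_derive f (x : R) : smooth f -> is_derive x 1 f ((derive1 f) x).
Proof. by move=> sf; rewrite derive1E; apply/derivableP/smooth_derivable. Qed.

Lemma smooth_continuous f : smooth f -> continuous f.
Proof.
by move=> sf x; apply/differentiable_continuous/derivable1_diffP/smooth_derivable.
Qed.

Lemma CkD k f g : Ck k f -> Ck k g -> Ck k (f \+ g).
Proof.
elim: k f g => [//|k IH] f g [df cf] [dg cg]; split => [x|]; first exact: derivableD.
rewrite (_ : derive1 (f \+ g) = (derive1 f) \+ (derive1 g)); first exact: IH.
by apply/funext => x; rewrite derive1E (deriveD (df x) (dg x)) /= !derive1E.
Qed.

Lemma CkW k f : Ck k.+1 f -> Ck k f.
Proof. by elim: k f => [//|k IH] f [df /IH cf]; split. Qed.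

Lemma CkM k f g : Ck k f -> Ck k g -> Ck k (f \* g).
Proof.
elim: k f g => [//|k IH] f g cf cg; have [df cf'] := cf; have [dg cg'] := cg.
split => [x|]; first exact: derivableM.
rewrite (_ : derive1 (f \* g) = (f \* (derive1 g)) \+ (g \* (derive1 f))).
  by apply: CkD; apply: IH => //; exact: CkW.
by apply/funext => x; rewrite derive1E (deriveM (df x) (dg x)) /= !derive1E.
Qed.

Lemma smoothD f g : smooth f -> smooth g -> smooth (f \+ g).
Proof. by move=> sf sg k; exact: CkD. Qed.

Lemma smoothM f g : smooth f -> smooth g -> smooth (f \* g).
Proof. by move=> sf sg k; exact: CkM. Qed.

Lemma Ck_cst k (c : R) : Ck k (cst c).
Proof.
elim: k c => [//|k IH] c; split => [x|]; first exact: derivable_cst.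
rewrite (_ : derive1 _ = cst 0) //.
by apply/funext => x; rewrite derive1E derive_cst.
Qed.

Lemma smooth_cst c : smooth (cst c).
Proof. by move=> k; exact: Ck_cst. Qed.

Lemma is_derive_affine f (a b x d : R) : is_derive (b * x + a) 1 f d ->
  is_derive x 1 (fun x => f (b * x + a)) (b * d).
Proof.
move=> fd.
have h : is_derive x 1 (fun x => b * x + a) b.
  apply: (@is_derive_quadratic _ _ _ 0) => t _; rewrite mul0r.
  by rewrite (_ : _ - _ = 0) ?normr0//; ring.
rewrite [b * d]mulrC; exact: (@is_derive1_comp _ f (fun x => b * x + a) x d b).
Qed.

Lemma Ck_affine k f (a b : R) : Ck k f -> Ck k (fun x => f (b * x + a)).
Proof.
elim: k f => [//|k IH] f [df cf].
have D (x : R) : is_derive x (1 : R) (fun x => f (b * x + a)) (b * (derive1 f) (b * x + a)).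
  by apply: is_derive_affine; rewrite derive1E; exact/derivableP.
split => [x|]; first by have [] := D x.
rewrite (_ : derive1 _ = (cst b) \* (fun x => (derive1 f) (b * x + a))).
  by apply: CkM; [exact: Ck_cst|exact: IH].
by apply/funext => x; rewrite derive1E; have [_ ->] := D x.
Qed.

Lemma smooth_affine f (a b : R) : smooth f -> smooth (fun x => f (b * x + a)).
Proof. by move=> sf k; exact: Ck_affine. Qed.

(** Polynomials in 1/x times exp(-1/x), extended by 0: a family that is stable
    under differentiation, so that smoothness follows by induction. *)
Definition flat (p : {poly R}) (x : R) : R :=
  if 0 < x then p.[x^-1] * expR (- x^-1) else 0.

Lemma exp_dominates (k : nat) (t : R) : 0 <= t -> t ^+ k <= k`!%:R * expR t.
Proof.
case: k => [|k] t0; first by rewrite expr0 mul1r -expR0 ler_expR.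
rewrite mulrC -ler_pdivrMr ?ltr0n ?fact_gt0//.
by apply: le_trans (expR_ge1Dxn k t0); rewrite lerDr.
Qed.

(** The exponential beats every power of 1/x; quadratic decay is enough for the
    derivative at 0 to vanish. *)
Lemma flat_bound p : exists C, forall x, `|x| <= 1 -> `|flat p x| <= C * x ^+ 2.
Proof.
exists (\sum_(i < size p) `|p`_i| * (i.+2)`!%:R) => x x1.
rewrite /flat; case: ifPn => [x0|_]; last first.
  by rewrite normr0 mulr_ge0 ?sqr_ge0// sumr_ge0// => i _; rewrite mulr_ge0.
rewrite normrM horner_coef (gtr0_norm (expR_gt0 _)).
apply: (@le_trans _ _ ((\sum_(i < size p) `|p`_i * x^-1 ^+ i|) * expR (- x^-1))).
  by rewrite ler_wpM2r ?expR_ge0// ler_norm_sum.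
rewrite !mulr_suml ler_sum// => i _.
rewrite normrM -!mulrA ler_wpM2l//.
have y0 : 0 < x^-1 by rewrite invr_gt0.
rewrite (ger0_norm (exprn_ge0 i (ltW y0))) expRN ler_pdivrMr ?expR_gt0//.
have := exp_dominates i.+2 (ltW y0); rewrite -(ler_pM2l (exprn_gt0 2 x0)).
move=> h; rewrite [leRHS](_ : _ = x ^+ 2 * ((i.+2)`!%:R * expR x^-1)); last by ring.
apply: le_trans h; rewrite -[in x^-1 ^+ i.+2]addn2 exprD mulrCA -exprMn divff ?gt_eqF//.
by rewrite expr1n mulr1.
Qed.

Lemma is_derive_flat p (x : R) : is_derive x 1 (flat p) (flat ('X^2 * (p - p^`())) x).
Proof.
have [x0|x0|->] := ltgtP x 0.
- rewrite {2}/flat ltNge (ltW x0)/=.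
  have c0 : is_derive x (1 : R) (cst (0 : R)) (0 : R).
    by apply: (@is_derive_quadratic _ _ _ 0) => h _; rewrite mulr0 !subr0 normr0 mul0r.
  apply: (near_eq_is_derive _ c0).
  near=> y; rewrite /flat ltNge ltW//=; near: y; exact: lt_nbhsl.
- rewrite {2}/flat x0.
  suff : is_derive x (1 : R) (fun x => p.[x^-1] * expR (- x^-1)) (('X^2 * (p - p^`())).[x^-1] * expR (- x^-1)).
    apply: near_eq_is_derive; near=> y; rewrite /flat (_ : 0 < y)//; near: y; exact: lt_nbhsr.
  have xn0 : x != 0 by rewrite gt_eqF.
  have i1 : is_derive x (1 : R) (fun x : R => x^-1) (- x ^- 2).
    have := @is_deriveV _ id x 1 1 xn0 (is_derive_id _ _).
    by rewrite /GRing.scale/= mulr1.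
  have i2 : is_derive x (1 : R) (fun x : R => - x^-1) (x ^- 2).
    by have := is_deriveN i1; rewrite opprK.
  have i3 := @is_derive1_comp _ expR (fun x : R => - x^-1) x _ _ (is_derive_expR _) i2.
  have i4 := @is_derive1_comp _ (horner p) (fun x : R => x^-1) x _ _ (is_derive_poly p _) i1.
  apply: (is_derive_eq (is_deriveM i4 i3)).
  rewrite /GRing.scale/= hornerM hornerXn hornerD hornerN exprVn.
  by move: (expR _) => E; field.
have [C HC] := flat_bound p.
rewrite {2}/flat ltxx; apply: (@is_derive_quadratic _ _ _ C) => h h1.
by rewrite addr0 [flat p 0]/flat ltxx mulr0 !subr0; exact: HC.
Unshelve. all: by end_near. Qed.

Lemma smooth_flat p : smooth (flat p).
Proof.
move=> k; elim: k p => [//|k IH] p; split => [x|].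
  by have [] := is_derive_flat p x.
rewrite (_ : derive1 _ = flat ('X^2 * (p - p^`()))); first exact: IH.
by apply/funext => x; rewrite derive1E; have [_ ->] := is_derive_flat p x.
Qed.

(** The product of two flat functions facing each other. *)
Lemma exists_bump (e : R) : 0 < e -> exists rho : R -> R,
  [/\ smooth rho, forall x, 0 <= rho x, forall x, e <= `|x| -> rho x = 0
    & 0 < rho 0].
Proof.
move=> e0; exists ((fun x => flat 1 (1 * x + e)) \* (fun x => flat 1 (-1 * x + e))).
have f0 x : 0 <= flat 1 x.
  by rewrite /flat; case: ifP => // _; rewrite hornerC mul1r expR_ge0.
have fn x : x <= 0 -> flat 1 x = 0 by rewrite /flat ltNge => ->.
split=> [|x|x|] /=.
- by apply: smoothM; apply: smooth_affine; exact: smooth_flat.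
- exact: mulr_ge0.
- rewrite ler_normr => /orP[h|h].
    by rewrite [X in _ * X]fn ?mulr0//; lra.
  by rewrite fn ?mul0r//; lra.
- by rewrite !mulr0 !add0r /flat e0 mulr_gt0// hornerC mul1r expR_gt0.
Qed.

End smooth1.

(** * Sliding averages on the line *)

Section box_average.
Context {R : realType}.
Local Notation leb := (@lebesgue_measure R).
Implicit Types (B : R -> R).

Definition supported1 B (r : R) := forall x, r <= `|x| -> B x = 0.

Lemma supported1_integrable B r : continuous B -> supported1 B r ->
  leb.-integrable setT (EFin \o B).
Proof.
move=> cB sB.
rewrite (_ : EFin \o B = (EFin \o B) \_ `[-r, r]); last first.
  apply/funext => x /=; rewrite patchE; case: ifPn => // /negP.
  rewrite inE/= in_itv/= -ler_norml => /negP; rewrite -ltNge => /ltW rx.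
  by rewrite sB.
rewrite -integrable_mkcond; last exact: measurable_itv.
apply: continuous_compact_integrable; first exact: segment_compact.
exact: continuous_subspaceT.
Qed.

(** The integral over an interval of length h, not divided by h: its derivative
    is then exactly a backward difference of B. *)
Definition box_avg (h : R) B (y : R) : R := \int[leb]_(z in `]y - h, y]) B z.

Section props.
Variables (B : R -> R) (r h : R).
Hypotheses (sB : smooth B) (rB : supported1 B r) (B0 : forall x, 0 <= B x) (h0 : 0 < h).

Let intB D : measurable D -> leb.-integrable D (EFin \o B).
Proof.
move=> mD; apply: integrableS (supported1_integrable (smooth_continuous sB) rB) => //.
Qed.

Let P y := \int[leb]_(z in `]-oo, y]) B z.

Let DP (y : R) : is_derive y (1 : R) P (B y).
Proof.
have [d1 d2] := @continuous_FTC1 _ B (BInfty _ true) y (y + 1)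
  (ltac:(by rewrite ltrDl)) (intB (measurable_itv _)) (ltNyr _) (smooth_continuous sB (x := y)).
by split; [exact: d1|rewrite -derive1E].
Qed.

Lemma box_avgE y : box_avg h B y = P y - P (1 * y + - h).
Proof.
rewrite /box_avg /P Rintegral_itvB ?mul1r//; first exact: intB.
by rewrite leBSide /= gerDl oppr_le0 ltW.
Qed.

Lemma is_derive_box_avg (y : R) : is_derive y (1 : R) (box_avg h B) (B y - B (y - h)).
Proof.
have -> : box_avg h B = P \- (fun y => P (1 * y + - h)).
  by apply/funext => z; rewrite box_avgE.
have d2 : is_derive y (1 : R) (fun y => P (1 * y + - h)) (B (y - h)).
  by rewrite -[B (y - h)]mul1r; apply: is_derive_affine; rewrite mul1r; exact: DP.
by have d1 := DP y; exact: is_deriveB.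
Qed.

Lemma smooth_box_avg : smooth (box_avg h B).
Proof.
apply: (smooth_of_derive is_derive_box_avg).
rewrite (_ : (fun y => _) = B \+ (cst (-1) \* (fun y => B (1 * y + - h)))); last first.
  by apply/funext => y /=; rewrite mulN1r mul1r.
apply: smoothD => //; apply: smoothM; first exact: smooth_cst.
exact: smooth_affine.
Qed.

Lemma box_avg_ge0 y : 0 <= box_avg h B y.
Proof. by apply: Rintegral_ge0. Qed.

Lemma box_avg_supported : supported1 (box_avg h B) (r + h).
Proof.
move=> y ry; rewrite /box_avg (@eq_Rintegral _ _ _ _ _ (cst 0)); last first.
  move=> z; rewrite inE/= in_itv/= => /andP[z1 z2]; apply: rB.
  by move: ry; rewrite !ler_normr => /orP[?|?]; apply/orP; [left|right]; lra.
by rewrite Rintegral_cst//= mul0r.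
Qed.

(** By Tonelli's theorem: each z belongs to ]y - h, y] for a set of y of
    measure h. *)
Lemma integral_box_avg :
  (\int[leb]_y (box_avg h B y)%:E = h%:E * \int[leb]_z (B z)%:E)%E.
Proof.
have mB : measurable_fun setT B.
  by apply: continuous_measurable_fun; exact: smooth_continuous.
pose U : set (measurableTypeR R * measurableTypeR R) := [set q | q.1 - h < q.2 :> R].
pose V : set (measurableTypeR R * measurableTypeR R) := [set q | q.2 <= q.1 :> R].
have m1 : measurable_fun [set: measurableTypeR R * measurableTypeR R] (fun q => q.1 - h : R).
  by apply: measurable_funB; [exact: measurable_fst|exact: measurable_cst].
have mU : measurable U.
  have := measurable_fun_ltr m1 (@measurable_snd _ _ (measurableTypeR R) (measurableTypeR R)).
  by move=> /(_ measurableT [set true]); rewrite setTI; apply.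
have mV : measurable V.
  have := measurable_fun_ler (@measurable_snd _ _ (measurableTypeR R) (measurableTypeR R))
    (@measurable_fst _ _ (measurableTypeR R) (measurableTypeR R)).
  by move=> /(_ measurableT [set true]); rewrite setTI; apply.
(* The integrand as a function on the plane: B restricted to the strip of the
   pairs (y, z) such that y - h < z <= y. *)
pose f (p : measurableTypeR R * measurableTypeR R) : \bar R :=
  (B p.2 * (\1_U p * \1_V p))%:E.
have mf : measurable_fun setT f.
  apply/measurable_EFinP; apply: measurable_funM.
    apply: measurableT_comp; last exact: measurable_snd.
    exact: mB.
  by apply: measurable_funM; exact: measurable_indic.
have f0 p : (0 <= f p)%E by rewrite lee_fin mulr_ge0// mulr_ge0.
transitivity (\int[leb]_y \int[leb]_z f (y, z))%E.
  apply: eq_integral => y _.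
  rewrite /box_avg /Rintegral fineK; last first.
    by apply: integrable_fin_num => //; apply: intB; exact: measurable_itv.
  rewrite [LHS]integral_mkcond; apply: eq_integral => z _.
  rewrite patchE /f !indicE; case: ifPn.
    rewrite inE/= in_itv/= => /andP[z1 z2].
    by rewrite (mem_set (A := U))// (mem_set (A := V))// !mulr1.
  move=> /negP; rewrite inE/= in_itv/= => /negP; rewrite negb_and => /orP[zz|zz].
    by rewrite (memNset (A := U)) ?mul0r ?mulr0//; exact/negP.
  by rewrite (memNset (A := V)) ?mulr0//; exact/negP.
rewrite (@fubini_tonelli _ _ _ _ _ leb leb f mf f0).
transitivity (\int[leb]_z (h%:E * (B z)%:E))%E.
  apply: eq_integral => z _.
  transitivity (\int[leb]_(y in `[z, (z + h)%R[%classic) (B z)%:E)%E.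
    rewrite [RHS]integral_mkcond; apply: eq_integral => y _.
    rewrite patchE /f !indicE; case: ifPn.
      rewrite inE/= in_itv/= => /andP[z1 z2].
      rewrite (mem_set (A := U)); last by rewrite /U/= ltrBlDr.
      by rewrite (mem_set (A := V))// !mulr1.
    move=> /negP; rewrite inE/= in_itv/= => /negP; rewrite negb_and => /orP[zz|zz].
      by rewrite (memNset (A := V)) ?mulr0//; exact/negP.
    by rewrite (memNset (A := U)) ?mul0r ?mulr0//; apply/negP; rewrite /U/= ltrBlDr.
  rewrite integral_cst//= lebesgue_measure_itv/= lte_fin ltrDl h0 muleC.
  by congr (_%:E * _)%E; rewrite addrC addKr.
rewrite ge0_integralZl ?lee_fin ?(ltW h0)//.
  exact/measurable_EFinP.
by move=> z _; rewrite lee_fin.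
Qed.

End props.
End box_average.

(** * Tensor products of functions of one variable *)

Section tensor.
Context {R : realType} {n : nat}.
Local Notation leb := (@lebesgue_measure R).
Local Notation E := 'rV[R]_n.
Implicit Types (B : 'I_n -> R -> R) (f g : E -> R).

Definition tensor B : E -> R := fun x => \prod_i B i (x 0 i).

(** Differentiating or averaging a tensor product in one coordinate only changes
    one of its factors. *)
Definition upd B (j : 'I_n) (b : R -> R) : 'I_n -> R -> R :=
  fun i => if i == j then b else B i.

Lemma tensor_upd B j b x :
  tensor (upd B j b) x = b (x 0 j) * \prod_(i | i != j) B i (x 0 i).
Proof.
rewrite /tensor (bigD1 j)//= /upd eqxx; congr (_ * _).
by apply: eq_bigr => i /negPf ->.
Qed.

Lemma tensorD1 B j x : tensor B x = B j (x 0 j) * \prod_(i | i != j) B i (x 0 i).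
Proof. by rewrite /tensor (bigD1 j). Qed.

Lemma is_derive_line f (x v : E) (d : R) :
  is_derive (0 : R) (1 : R) (fun h : R => f (h *: v + x)) d -> is_derive x v f d.
Proof.
move=> [h1 h2].
have e : (fun h : R => h^-1 *: ((f \o shift x) (h *: v) - f x)) =
  (fun h : R => h^-1 *: (((fun h : R => f (h *: v + x)) \o shift 0) (h *: (1 : R)) - f (0 *: v + x))).
  by apply/funext => h; rewrite /= addr0 [_ *: (1 : R)]mulr1 scale0r add0r.
by split; rewrite ?/derivable ?/derive e.
Qed.

Lemma is_derive_tensor B (j : 'I_n) x : smooth (B j) ->
  is_derive x (delta_mx 0 j) (tensor B) (tensor (upd B j (derive1 (B j))) x).
Proof.
move=> sB; apply: is_derive_line.
rewrite tensor_upd; set c := \prod_(i | _) _.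
have -> : (fun h : R => tensor B (h *: delta_mx 0 j + x)) =
    (fun h => c * B j (1 * h + x 0 j)).
  apply/funext => h; rewrite (tensorD1 _ j) mulrC !mxE !eqxx mulr1 mul1r; congr (_ * _).
  by apply: eq_bigr => i ij; rewrite !mxE eqxx (negPf ij) mulr0 add0r.
rewrite mulrC -[derive1 _ _]mul1r.
have := @is_derive_affine R (B j) (x 0 j) 1 0 (derive1 (B j) (x 0 j)).
rewrite mulr0 add0r => /(_ (smooth_is_derive _ sB)) h.
exact: is_deriveZ.
Qed.

Lemma partial_tensor B j : smooth (B j) ->
  partial j (tensor B) = tensor (upd B j (derive1 (B j))).
Proof.
by move=> sB; apply/funext => x; rewrite /partial; have [_ ->] := is_derive_tensor x sB.
Qed.

Lemma differentiable_tensor B x : (forall i, smooth (B i)) -> differentiable (tensor B) x.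
Proof.
move=> sB; suff h (r : seq 'I_n) : differentiable (fun x : E => \prod_(i <- r) B i (x 0 i)) x by exact: h.
elim: r => [|j r IH].
  by rewrite (_ : (fun _ => _) = cst 1); [exact: differentiable_cst|apply/funext => y; rewrite big_nil].
rewrite (_ : (fun _ => _) = (fun y : E => B j (y 0 j)) * (fun y : E => \prod_(i <- r) B i (y 0 i))).
  apply: differentiableM => //.
  apply: (@differentiable_comp _ _ _ _ (fun y : E => y 0 j) (B j)).
    exact: differentiable_coord.
  by apply/derivable1_diffP/smooth_derivable.
by apply/funext => y; rewrite big_cons.
Qed.

Lemma continuous_tensor B : (forall i, smooth (B i)) -> continuous (tensor B).
Proof. by move=> sB x; exact/differentiable_continuous/differentiable_tensor. Qed.

Lemma smooth_upd B j b : (forall i, smooth (B i)) -> smooth b ->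
  forall i, smooth (upd B j b i).
Proof. by move=> sB sb i; rewrite /upd; case: ifP. Qed.

Lemma supported1_le (b : R -> R) r r' : r <= r' -> supported1 b r -> supported1 b r'.
Proof. by move=> rr sb x rx; apply: sb; exact: le_trans rx. Qed.

(** The radius grows because nothing is known about the derivative at the
    boundary of the support. *)
Lemma supported1_derive1 (b : R -> R) r : supported1 b r -> supported1 (derive1 b) (r + 1).
Proof.
move=> sb x rx; rewrite derive1E.
have c0 : is_derive x (1 : R) (cst (0 : R)) (0 : R).
  by apply: (@is_derive_quadratic _ _ _ _ 0) => h _; rewrite mulr0 !subr0 normr0 mul0r.
suff /near_eq_is_derive/(_ c0)[_ ->//] : \near x, (cst 0 : R -> R) x = b x.
near=> y; rewrite /= sb//.
have : `|x - y| < 1 by near: y; exists 1; rewrite /= ?ltr01.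
by move=> h; have := ler_distD y x 0; rewrite !subr0; lra.
Unshelve. all: by end_near. Qed.

(** Iterated derivatives of a tensor product are again tensor products, which
    turns statements about all derivatives into statements about factors. *)
Lemma foldr_partial_tensor B (s : seq 'I_n) r : (forall i, smooth (B i)) ->
  (forall i, supported1 (B i) r) ->
  exists B' r', [/\ forall i, smooth (B' i), forall i, supported1 (B' i) r' &
    foldr (@partial R n) (tensor B) s = tensor B'].
Proof.
move=> sB rB; elim: s => [|j s [B' [r' [sB' rB' /= ->]]]]; first by exists B, r.
exists (upd B' j (derive1 (B' j))), (r' + 1); split.
- by apply: smooth_upd => //; exact: smooth_derive1.
- move=> i; rewrite /upd; case: ifP => _; first exact: supported1_derive1.
  by apply: supported1_le (rB' i); rewrite lerDl.
- exact: partial_tensor.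
Qed.

Definition cube (r : R) : set E := [set x | `|x| <= r].

Lemma closed_cube r : closed (cube r).
Proof.
have := @closed_comp _ _ (fun x : E => `|x|) [set t | t <= r].
by apply; [move=> x _; exact: norm_continuous|exact: closed_le].
Qed.

Lemma compact_cube r : compact (cube r).
Proof.
apply: bounded_closed_compact; last exact: closed_cube.
exists `|r|; split; first exact: num_real.
by move=> M rM x /le_trans; apply; apply: le_trans (ltW rM); exact: ler_norm.
Qed.

Lemma tensor_supported B r x : 0 <= r -> (forall i, supported1 (B i) r) ->
  r < `|x| -> tensor B x = 0.
Proof.
move=> r0 rB; apply: contraTeq => Bx; rewrite -leNgt; apply: normr_rV_le => // i.
rewrite leNgt; apply: contraNN Bx => /ltW /rB Bi.
by rewrite (tensorD1 _ i) Bi mul0r.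
Qed.

Lemma test_function_tensor B r : (forall i, smooth (B i)) ->
  (forall i, supported1 (B i) r) -> test_function (tensor B).
Proof.
move=> sB rB; split=> [s x|].
  have [B' [r' [sB' _ ->]]] := foldr_partial_tensor s sB rB.
  exact: differentiable_tensor.
have r0 : 0 <= Num.max r 0 by rewrite le_max lexx orbT.
have rB' i : supported1 (B i) (Num.max r 0).
  by apply: supported1_le (rB i); rewrite le_max lexx.
apply: (@subclosed_compact _ _ (cube (Num.max r 0))).
- exact: closed_closure.
- exact: compact_cube.
- rewrite (closure_id (cube _)).1; last exact: closed_cube.
  apply: closure_subset => x /=; apply: contraNle => /(tensor_supported r0 rB') ->.
  by rewrite eqxx.
Qed.

End tensor.

(** * Integrability of compactly supported functions *)

Section integrals.
Context {R : realType}.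
Local Notation leb := (@lebesgue_measure R).
Local Notation mu n := (lebesgue_rV R n).

Lemma measurable_cube n (r : R) : measurable (cube r : set 'rV[R]_n).
Proof. by apply: closed_rV_measurable; exact: closed_cube. Qed.

Lemma cube_fin n (r : R) : (mu n (cube r) < +oo)%E.
Proof.
have h := @lebesgue_rV_box R n (const_mx (- `|r|)) (const_mx `|r|).
apply: (@le_lt_trans _ _ (\prod_(i < n) (`|r| - - `|r|))%:E); last exact: ltry.
rewrite (_ : \prod_(i < n) _ = \prod_(i < n) ((const_mx `|r| : 'rV[R]_n) 0 i - (const_mx (- `|r|) : 'rV[R]_n) 0 i)); last first.
  by apply: eq_bigr => i _; rewrite !mxE.
rewrite -h; last by move=> i; rewrite !mxE; have := normr_ge0 r; lra.
apply: le_measure; rewrite ?inE.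
- exact: measurable_cube.
- rewrite [X in measurable X](_ : _ = cube `|r|); first exact: measurable_cube.
  apply/seteqP; split => x /= hx.
    by apply: normr_rV_le => // i; have := hx i; rewrite !mxE in_itv/= ler_norml.
  by move=> i; rewrite !mxE in_itv/= -ler_norml; apply: le_trans hx; exact: normr_rV_coord.
- move=> x xr i; rewrite !mxE in_itv/= -ler_norml.
  by apply: le_trans (normr_rV_coord _ _) _; apply: le_trans xr _; exact: ler_norm.
Qed.

Lemma integrable_cube_supported n (f : 'rV[R]_n -> R) (K r : R) :
  measurable_fun setT f -> (forall x, `|f x| <= K) ->
  (forall x, r < `|x| -> f x = 0) -> (mu n).-integrable setT (EFin \o f).
Proof.
move=> mf fK fr.
rewrite (_ : EFin \o f = (EFin \o f) \_ (cube r)); last first.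
  apply/funext => x /=; rewrite patchE; case: ifPn => // /negP.
  by rewrite inE => /negP; rewrite -ltNge => /fr ->.
rewrite -integrable_mkcond; last exact: measurable_cube.
apply: measurable_bounded_integrable.
- exact: measurable_cube.
- exact: cube_fin.
- exact: measurable_funTS.
- exists K; split; first exact: num_real.
  by move=> M KM x _ /=; apply: le_trans (ltW KM).
Qed.

Definition locally_bounded n (f : 'rV[R]_n -> R) :=
  forall r : R, exists K, forall x, `|x| <= r -> `|f x| <= K.

Lemma continuous_locally_bounded n (f : 'rV[R]_n -> R) : continuous f -> locally_bounded f.
Proof.
move=> cf r.
have := @continuous_compact _ _ f (cube r) (continuous_subspaceT cf) (@compact_cube R n r).
move=> /compact_bounded[K [_ hK]]; exists (K + 1) => x xr.
by apply: (hK (K + 1)); [rewrite ltrDl|exists x].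
Qed.

Lemma locally_bounded_cst n (f : 'rV[R]_n -> R) K :
  (forall x, `|f x| <= K) -> locally_bounded f.
Proof. by move=> fK r; exists K. Qed.

Lemma integrable_mul_supported n (f g : 'rV[R]_n -> R) (K r : R) :
  measurable_fun setT f -> locally_bounded f ->
  measurable_fun setT g -> (forall x, `|g x| <= K) ->
  (forall x, r < `|x| -> g x = 0) -> (mu n).-integrable setT (EFin \o (f \* g)).
Proof.
move=> mf bf mg gK gr; have [C hC] := bf r.
apply: (@integrable_cube_supported _ _ (`|C| * `|K|) r).
- exact: measurable_funM.
- move=> x /=; rewrite normrM; have [xr|xr] := leP `|x| r.
    apply: ler_pM => //; first by apply: le_trans (hC _ xr) _; exact: ler_norm.
    by apply: le_trans (gK _) _; exact: ler_norm.
  by rewrite gr// normr0 mulr0 mulr_ge0.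
- by move=> x /gr /= ->; rewrite mulr0.
Qed.

(** The n-dimensional measure is built by adding one coordinate at a time, so
    Tonelli's theorem applies inductively. *)
Lemma integral_tensor n (B : 'I_n -> R -> R) (I : 'I_n -> R) :
  (forall i, measurable_fun setT (B i)) -> (forall i t, 0 <= B i t) ->
  (forall i, (\int[leb]_t (B i t)%:E)%E = (I i)%:E) ->
  (\int[mu n]_x (tensor B x)%:E)%E = (\prod_i I i)%:E.
Proof.
elim: n B I => [|n IH] B I mB B0 BI.
  rewrite big_ord0 /= (eq_integral (cst 1%:E)); last by move=> x _; rewrite /tensor big_ord0.
  by rewrite integral_cst//= mul1e diracE mem_set.
pose B' i := B (lift ord0 i).
have mt m (C : 'I_m -> R -> R) : (forall i, measurable_fun setT (C i)) -> measurable_fun setT (tensor C).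
  move=> mC; rewrite /tensor; apply: measurable_prod => i _.
  apply: (measurableT_comp (mC i)); exact: measurable_rV_coord.
have t0 m (C : 'I_m -> R -> R) : (forall i t, 0 <= C i t) -> forall x, 0 <= tensor C x.
  by move=> C0 x; apply: prodr_ge0.
have := @ge0_integral_pushforward _ _ _ _ _ _ (@measurable_rV_cons R n) (leb \x mu n)%E
     setT (EFin \o tensor B) measurableT.
rewrite preimage_setT /= => h.
transitivity (\int[(leb \x mu n)]_p (tensor B (rV_cons p))%:E)%E.
  rewrite -h //.
  - by apply/measurable_EFinP; exact: mt.
  - by move=> x _; rewrite lee_fin; exact: t0.
rewrite fubini_tonelli1; last 2 first.
  - apply/measurable_EFinP; apply: measurableT_comp; [exact: mt|exact: measurable_rV_cons].
  - by move=> p; rewrite lee_fin; exact: t0.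
rewrite /fubini_F.
transitivity (\int[leb]_t ((B ord0 t)%:E * (\prod_i I (lift ord0 i))%:E))%E.
  apply: eq_integral => t _.
  rewrite -(IH B' (fun i => I (lift ord0 i))); [|by move=> i; exact: mB|by move=> i; exact: B0|by move=> i; exact: BI].
  rewrite -ge0_integralZl//; last 3 first.
  - by apply/measurable_EFinP; apply: mt => i; exact: mB.
  - by move=> x _; rewrite lee_fin; apply: t0 => i; exact: B0.
  - by rewrite lee_fin.
  apply: eq_integral => y _; rewrite -EFinM /tensor big_ord_recl rV_cons0/=.
  by congr (_ * _)%:E; apply: eq_bigr => i _; rewrite rV_consS.
rewrite ge0_integralZr//; last 3 first.
- by apply/measurable_EFinP; exact: mB.
- by move=> t _; rewrite lee_fin.
- rewrite lee_fin; apply: prodr_ge0 => i _; rewrite -lee_fin -BI.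
  by apply: integral_ge0 => t _; rewrite lee_fin.
by rewrite BI big_ord_recl EFinM.
Qed.

End integrals.

(** * Finite differences *)

Section differences.
Context {R : realType} {n : nat}.
Local Notation leb := (@lebesgue_measure R).
Local Notation mu := (lebesgue_rV R n).
Local Notation E := 'rV[R]_n.
Implicit Types (f g : E -> R) (s : seq ('I_n * R)) (p : 'I_n * R).

Definition step p : E := p.2 *: delta_mx 0 p.1.
Definition fdiff p f : E -> R := fun x => f (x + step p) - f x.
Definition bdiff p f : E -> R := fun x => f x - f (x - step p).
Definition fdiffs s f : E -> R := foldr fdiff f s.
Definition bdiffs s f : E -> R := foldl (fun g p => bdiff p g) f s.

(** The bound that a mixed derivative in the directions r, bounded by K, would
    give by the mean value theorem, for all positive steps. *)
Definition diff_le (r : seq 'I_n) (K : R) f : Prop :=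
  forall s x, map fst s = r -> (forall p, p \in s -> 0 < p.2) ->
    `|fdiffs s f x| <= K * \prod_(p <- s) p.2.

(** Averaging successively in the directions and over the lengths of s; the
    derivative of the result in these directions is the backward difference of the
    tensor product itself. *)
Definition boxes s (B : 'I_n -> R -> R) : 'I_n -> R -> R :=
  foldl (fun B p => upd B p.1 (box_avg p.2 (B p.1))) B s.

Lemma is_derive_shift_rV g (x c v : E) d : is_derive (x - c) v g d ->
  is_derive x v (fun y => g (y - c)) d.
Proof.
move=> [h1 h2].
have e : (fun h : R => h^-1 *: (((fun y => g (y - c)) \o shift x) (h *: v) - g (x - c))) =
  (fun h : R => h^-1 *: ((g \o shift (x - c)) (h *: v) - g (x - c))).
  by apply/funext => h; rewrite /= addrA.
by split; rewrite ?/derivable ?/derive e.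
Qed.

Lemma is_derive_bdiff g p (v : E) (dg : E -> R) : (forall x, is_derive x v g (dg x)) ->
  forall x, is_derive x v (bdiff p g) (bdiff p dg x).
Proof.
move=> H x; have h1 := H x; have h2 := is_derive_shift_rV (H (x - step p)).
exact: is_deriveB.
Qed.

Lemma is_derive_bdiffs s g (v : E) (dg : E -> R) : (forall x, is_derive x v g (dg x)) ->
  forall x, is_derive x v (bdiffs s g) (bdiffs s dg x).
Proof.
by elim: s g dg => [//|p s IH] g dg H x /=; apply: IH => y; exact: is_derive_bdiff.
Qed.

Lemma partial_bdiffs s g i (dg : E -> R) : (forall x, is_derive x (delta_mx 0 i) g (dg x)) ->
  partial i (bdiffs s g) = bdiffs s dg.
Proof.
by move=> H; apply/funext => x; have [_] := is_derive_bdiffs s H x.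
Qed.

Lemma bdiff_tensor p (B : 'I_n -> R -> R) :
  bdiff p (tensor B) = tensor (upd B p.1 (fun y => B p.1 y - B p.1 (y - p.2))).
Proof.
apply/funext => x; rewrite tensor_upd /bdiff !(tensorD1 _ p.1) mulrBl; congr (_ * _ - _ * _).
  by rewrite !mxE !eqxx mulr1.
by apply: eq_bigr => i ip; rewrite !mxE eqxx (negPf ip) mulr0 subr0.
Qed.

(** The last component records the integrals of the factors, because the bounds
    on finite differences need to be sharp. *)
Definition good_family (B : 'I_n -> R -> R) (r : R) (J : 'I_n -> R) :=
  [/\ forall i, smooth (B i), forall i, supported1 (B i) r,
      forall i t, 0 <= B i t & forall i, (\int[leb]_t (B i t)%:E)%E = (J i)%:E].

Lemma good_upd B r J p : good_family B r J -> 0 < p.2 ->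
  good_family (upd B p.1 (box_avg p.2 (B p.1))) (r + p.2)
    (fun i => if i == p.1 then p.2 * J i else J i).
Proof.
move=> [sB rB B0 BI] p0; split=> [i|i|i t|i].
- by apply: smooth_upd => //; apply: smooth_box_avg.
- rewrite /upd; case: ifP => _; first exact: box_avg_supported.
  by apply: supported1_le (rB i); rewrite lerDl ltW.
- by rewrite /upd; case: ifP => _ //; apply: box_avg_ge0.
- rewrite /upd; case: eqP => [->|_]; last exact: BI.
  by rewrite (integral_box_avg (sB _) (rB _)) ?BI.
Qed.

Lemma good_boxes s B r J : good_family B r J -> (forall p, p \in s -> 0 < p.2) ->
  exists r' J', good_family (boxes s B) r' J' /\
    \prod_i J' i = (\prod_(p <- s) p.2) * \prod_i J i.
Proof.
elim: s B r J => [|p s IH] B r J gB s0.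
  by exists r, J; split => //; rewrite big_nil mul1r.
have p0 : 0 < p.2 by apply: s0; rewrite mem_head.
have [] := IH _ _ _ (good_upd gB p0); first by move=> q qs; apply: s0; rewrite in_cons qs orbT.
move=> r' [J' [gB' JE]]; exists r', J'; split => //.
rewrite JE big_cons [RHS]mulrAC [LHS]mulrC; congr (_ * _).
rewrite (bigD1 p.1)//= eqxx [in RHS](bigD1 p.1)//= mulrA; congr (_ * _).
by apply: eq_bigr => i /negPf ->.
Qed.

Lemma partial_boxes s B r J : good_family B r J -> (forall p, p \in s -> 0 < p.2) ->
  foldr (@partial R n) (tensor (boxes s B)) (map fst s) = bdiffs s (tensor B).
Proof.
elim: s B r J => [//|p s IH] B r J gB s0 /=.
have p0 : 0 < p.2 by apply: s0; rewrite mem_head.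
rewrite (IH _ _ _ (good_upd gB p0)); last by move=> q qs; apply: s0; rewrite in_cons qs orbT.
have [sB rB B0 BI] := gB.
rewrite bdiff_tensor; apply: partial_bdiffs => x.
have := is_derive_tensor x (j := p.1) (B := upd B p.1 (box_avg p.2 (B p.1))).
rewrite {1}/upd eqxx => /(_ (smooth_box_avg (sB _) (rB _) p0)).
congr (is_derive _ _ _ _); rewrite !tensor_upd /upd eqxx; congr (_ * _).
  rewrite derive1E.
  by have [_ ->] := is_derive_box_avg (sB p.1) (rB p.1) p0 (x 0 p.1).
by apply: eq_bigr => i /negPf ->.
Qed.

Lemma integral_good B r J : good_family B r J ->
  (\int[mu]_x (tensor B x)%:E)%E = (\prod_i J i)%:E.
Proof.
move=> [sB rB B0 BI]; apply: integral_tensor => // i.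
by apply: continuous_measurable_fun; exact: smooth_continuous.
Qed.

(** The functions against which locally bounded functions are integrated. *)
Definition nice g := measurable_fun setT g /\
  exists K r, (forall x, `|g x| <= K) /\ (forall x, r < `|x| -> g x = 0).

Lemma measurable_shift f (c : E) : measurable_fun setT f ->
  measurable_fun setT (fun x : E => f (x + c)).
Proof. by move=> mf; apply: (measurableT_comp mf); exact: measurable_shift_rV. Qed.

Lemma nice_shift g (c : E) : nice g -> nice (fun x => g (x + c)).
Proof.
move=> [mg [K [r [gK gr]]]]; split; first exact: measurable_shift.
exists K, (r + `|c|); split => // x xr; apply: gr.
by have := ler_normB (x + c) c; rewrite addrK; lra.
Qed.

Lemma niceB f g : nice f -> nice g -> nice (f \- g).
Proof.
move=> [mg [K [r [gK gr]]]] [mg' [K' [r' [gK' gr']]]]; split; first exact: measurable_funB.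
exists (K + K'), (Num.max r r'); split => x /=.
  by apply: le_trans (ler_normB _ _) _; exact: lerD.
by rewrite gt_max => /andP[/gr -> /gr' ->]; rewrite subr0.
Qed.

Lemma nice_bdiffs s g : nice g -> nice (bdiffs s g).
Proof.
elim: s g => [//|p s IH] g ng; apply: IH; apply: niceB => //.
exact: nice_shift.
Qed.

(** Measurable and locally bounded functions: a class that is stable under
    translations and contains the continuous functions. *)
Definition lmb f := measurable_fun setT f /\ locally_bounded f.

Lemma lmb_shift f (c : E) : lmb f -> lmb (fun x => f (x + c)).
Proof.
move=> [mf bf]; split; first exact: measurable_shift.
move=> r; have [K hK] := bf (r + `|c|); exists K => x xr; apply: hK.
by apply: le_trans (ler_normD _ _) _; rewrite lerD2r.
Qed.

Lemma lmb_fdiffs s f : lmb f -> lmb (fdiffs s f).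
Proof.
move=> bf; elim: s => [//|p s IH] /=.
have [m1 b1] := lmb_shift (step p) IH; have [m2 b2] := IH.
split; first exact: measurable_funB.
move=> r; have [K hK] := b1 r; have [K' hK'] := b2 r; exists (K + K') => x xr.
by apply: le_trans (ler_normB _ _) _; apply: lerD; [exact: hK|exact: hK'].
Qed.

Lemma integrable_lmb_nice f g : lmb f -> nice g -> mu.-integrable setT (EFin \o (f \* g)).
Proof. by move=> [mf bf] [mg [K [r [gK gr]]]]; exact: (@integrable_mul_supported _ _ _ _ K r). Qed.

(** The discrete integration by parts, which is just translation invariance. *)
Lemma integral_bdiff p f g : lmb f -> nice g ->
  \int[mu]_x (f x * bdiff p g x) = - \int[mu]_x (fdiff p f x * g x).
Proof.
move=> lf ng.
have ns : nice (fun x => g (x - step p)) by exact: nice_shift.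
have ls : lmb (fun x => f (x + step p)) by exact: lmb_shift.
transitivity (\int[mu]_x ((f \* g) x - (f \* (fun x => g (x - step p))) x)).
  by apply: eq_Rintegral => x _; rewrite /= -mulrBr.
rewrite (RintegralB _ (integrable_lmb_nice lf ng) (integrable_lmb_nice lf ns))//.
transitivity (- \int[mu]_x (((fun x => f (x + step p)) \* g) x - (f \* g) x)); last first.
  by congr (- _); apply: eq_Rintegral => x _; rewrite /= -mulrBl.
rewrite (RintegralB _ (integrable_lmb_nice ls ng) (integrable_lmb_nice lf ng))// opprB.
congr (_ - _).
rewrite -(Rintegral_rV_shift (step p) (f := f \* (fun x => g (x - step p)))); last first.
  by apply: measurable_funM; [case: lf|case: ns].
by apply: eq_Rintegral => x _; rewrite /= addrK.
Qed.

Lemma integral_bdiffs s f g : lmb f -> nice g ->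
  \int[mu]_x (f x * bdiffs s g x) = (-1) ^+ size s * \int[mu]_x (fdiffs s f x * g x).
Proof.
move=> lf; elim: s g => [|p s IH] g ng /=; first by rewrite expr0 mul1r.
rewrite IH; last exact: (@nice_bdiffs [:: p]).
by rewrite integral_bdiff//; [rewrite exprSr mulrN1 mulrN mulNr|exact: lmb_fdiffs].
Qed.

Lemma nice_tensor B r J : good_family B r J -> nice (tensor B).
Proof.
move=> [sB rB B0 BI]; split; first by apply: continuous_rV_measurable; exact: continuous_tensor.
have r0 : 0 <= Num.max r 0 by rewrite le_max lexx orbT.
have rB' i : supported1 (B i) (Num.max r 0).
  by apply: supported1_le (rB i); rewrite le_max lexx.
have [K hK] := continuous_locally_bounded (continuous_tensor sB) (Num.max r 0).
exists `|K|, (Num.max r 0); split => x; last exact: tensor_supported.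
have [xr|xr] := leP `|x| (Num.max r 0); last by rewrite (tensor_supported r0 rB' xr) normr0.
by apply: le_trans (hK _ xr) _; exact: ler_norm.
Qed.

End differences.

(** * From weak derivatives to finite differences *)

Section weak_to_diff.
Context {R : realType} {n : nat}.
Local Notation leb := (@lebesgue_measure R).
Local Notation mu := (lebesgue_rV R n).
Local Notation E := 'rV[R]_n.

(** The multi-index b as the list of the directions of differentiation. *)
Definition dirs k (b : {ffun 'I_n -> 'I_k.+1}) : seq 'I_n :=
  flatten [seq nseq (b i) i | i <- enum 'I_n].

Lemma size_dirs k (b : {ffun 'I_n -> 'I_k.+1}) : size (dirs b) = mdeg b.
Proof.
rewrite /dirs size_flatten /shape -map_comp sumnE big_map big_enum/=.
by apply: eq_bigr => i _; rewrite size_nseq.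
Qed.

Lemma mpartial_dirs k (b : {ffun 'I_n -> 'I_k.+1}) (f : E -> R) :
  mpartial b f = foldr (@partial R n) f (dirs b).
Proof.
rewrite /mpartial /dirs; elim: (enum 'I_n) => [//|i r IH] /=.
rewrite foldr_cat -IH; elim: (nat_of_ord (b i)) => [//|m IHm] /=.
by rewrite IHm.
Qed.

Lemma ge0_integral_shift1 (a : R) (f : R -> R) :
  measurable_fun setT f -> (forall t, 0 <= f t) ->
  (\int[leb]_t (f (t + a)%R)%:E = \int[leb]_t (f t)%:E)%E.
Proof.
move=> mf f0.
have ms : measurable_fun setT (fun t : measurableTypeR R => (t + a : measurableTypeR R)).
  by apply: continuous_measurable_fun => x; apply: cvgD; [exact: cvg_id|exact: cvg_cst].
have := @ge0_integral_pushforward _ _ _ _ _ _ ms leb setT (EFin \o f) measurableT.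
rewrite preimage_setT /= => <-; last 2 first.
- exact/measurable_EFinP.
- by move=> x _; rewrite lee_fin.
pose nu : {measure set (measurableTypeR R) -> \bar R} :=
  measure_function_pushforward__canonical__measure_function_Measure leb ms.
rewrite -[LHS]/(\int[nu]_t (f t)%:E)%E.
by apply: eq_measure_integral => A mA _; exact: lebesgue_measure_shift.
Qed.

Lemma continuous_rVP (f : E -> R) : continuous f <->
  forall x e, 0 < e -> exists2 d, 0 < d & forall y, `|y - x| < d -> `|f y - f x| < e.
Proof.
split=> [cf x e e0|H x].
  have /nbhs_ballP[d /= d0 hd] : \forall y \near x, `|f x - f y| < e.
    by have := cf x; move=> /cvgrPdist_lt; apply.
  exists d => // y yx; rewrite distrC; apply: hd.
  by rewrite mx_norm_ball /ball_ /= distrC.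
move=> P /nbhs_ballP[e /= e0 eP]; apply/nbhs_ballP.
have [d d0 hd] := H x e e0; exists d => // y.
rewrite mx_norm_ball /ball_ /= => xy; apply: eP.
by rewrite -ball_normE/= distrC; apply: hd; rewrite distrC.
Qed.

Lemma continuous_shift_rV (f : E -> R) (c : E) : continuous f ->
  continuous (fun y : E => f (y + c)).
Proof.
move=> /continuous_rVP cf; apply/continuous_rVP => x e e0.
have [d d0 hd] := cf (x + c) e e0; exists d => // y yx; apply: hd.
by rewrite opprD addrACA subrr addr0.
Qed.

Lemma continuous_fdiffs s (f : E -> R) : continuous f -> continuous (fdiffs s f).
Proof.
move=> cf; elim: s => [//|p s IH] /=.
have /continuous_rVP h1 := continuous_shift_rV (c := step p) IH.
move/continuous_rVP : IH => h2; apply/continuous_rVP => x e e0.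
have e20 : 0 < e / 2 by rewrite divr_gt0.
have [d d0 hd] := h1 x _ e20; have [d' d'0 hd'] := h2 x _ e20.
exists (Num.min d d'); first by rewrite lt_min d0.
move=> y; rewrite lt_min => /andP[/hd yd /hd' yd'].
rewrite /fdiff (_ : _ - _ = (fdiffs s f (y + step p) - fdiffs s f (x + step p)) -
  (fdiffs s f y - fdiffs s f x)); last by ring.
by apply: le_lt_trans (ler_normB _ _) _; rewrite [e]splitr ltrD.
Qed.

Lemma abse_fine_le (x : \bar R) (r : R) : (`|x| <= r%:E)%E -> `|fine x| <= r.
Proof. by case: x => [x||] //=; rewrite ?lee_fin// leye_eq. Qed.

(** Serves to localise an integral at a point. *)
Lemma bump_family (x0 : E) (e : R) : 0 < e -> exists B r J,
  [/\ @good_family R n B r J, 0 < \prod_i J i &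
    forall y, e <= `|y - x0| -> tensor B y = 0].
Proof.
move=> e0; have [rho [sr r0 rs rp]] := exists_bump e0.
have Jp : exists2 J : R, 0 < J & (\int[leb]_t (rho t)%:E)%E = J%:E.
  have ir : leb.-integrable setT (EFin \o rho).
    exact: (@supported1_integrable _ _ e (smooth_continuous sr)).
  exists (\int[leb]_t rho t); last first.
    by rewrite /Rintegral fineK//; exact: integrable_fin_num.
  have cr : {for 0, continuous rho} by apply: smooth_continuous.
  have r20 : 0 < rho 0 / 2 by rewrite divr_gt0.
  have /nbhs_ballP[d /= d0 hd] : \forall t \near 0, `|rho 0 - rho t| < rho 0 / 2.
    by move/cvgrPdist_lt : cr; apply.
  have d20 : 0 < d / 2 by rewrite divr_gt0.
  rewrite -lte_fin /Rintegral fineK; last exact: integrable_fin_num.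
  apply: (@lt_le_trans _ _ (\int[leb]_(t in `[(- (d / 2))%R, (d / 2)%R]) (rho 0%R / 2)%:E)%E).
    rewrite integral_cst//= lebesgue_measure_itv/= lte_fin ifT; last by lra.
    rewrite -EFinD -EFinM.
    by rewrite lte_fin mulr_gt0//; lra.
  apply: (@le_trans _ _ (\int[leb]_(t in `[(- (d / 2))%R, (d / 2)%R]) (rho t)%:E)%E).
    apply: ge0_le_integral => //.
    - by move=> t _; rewrite lee_fin ltW.
    - apply/measurable_EFinP; apply: measurable_funTS.
      by apply: continuous_measurable_fun; exact: smooth_continuous.
    - move=> t; rewrite /= in_itv/= -ler_norml => td; rewrite lee_fin.
      have : ball 0 d t by rewrite -ball_normE/= sub0r normrN; lra.
      by move=> /hd; rewrite ltr_norml => /andP[]; lra.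
  apply: ge0_subset_integral => //.
    apply/measurable_EFinP.
    by apply: continuous_measurable_fun; exact: smooth_continuous.
  by move=> t _; rewrite lee_fin.
have [J J0 JE] := Jp.
exists (fun i t => rho (1 * t + - x0 0 i)), (e + `|x0|), (fun=> J); split.
- split=> [i|i t|i t|i].
  + exact: smooth_affine.
  + move=> te; apply: rs; have := normr_rV_coord x0 i.
    by have := lerB_dist (1 * t) (x0 0 i); rewrite mul1r; lra.
  + exact: r0.
  + rewrite -JE.
    rewrite -(ge0_integral_shift1 (- x0 0 i) (f := rho)) //.
      by apply: eq_integral => t _; rewrite mul1r.
    by apply: continuous_measurable_fun; exact: smooth_continuous.
- exact: prodr_gt0.
- move=> y ye; apply/eqP/negPn/negP => ty.
  suff : `|y - x0| < e by rewrite ltNge ye.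
  apply: normr_rV_lt => // i; rewrite !mxE ltNge; apply: contraNN ty => h.
  by rewrite (tensorD1 _ i) mul1r rs ?mul0r.
Qed.

(** The forward differences of f, tested against a tensor product of bumps, are
    the integral of f against the derivative of the averaged tensor product, hence
    of g against this average, whose integral is known.  Localising the bumps
    gives the bound at each point. *)
Lemma weak_le_diff k (b : {ffun 'I_n -> 'I_k.+1}) (f g : E -> R) (K : R) :
  0 <= K -> continuous f -> weak_derivative b f g ->
  {ae mu, forall x, `|g x| <= K} -> diff_le (dirs b) K f.
Proof.
move=> K0 cf [mf mg lf lg H] gK s x sb s0.
have lmbf : lmb f by split => //; exact: continuous_locally_bounded.
have cw : continuous (fdiffs s f) by exact: continuous_fdiffs.
set c := K * _.
have main B r J : @good_family R n B r J ->
    `|\int[mu]_y (fdiffs s f y * tensor B y)| <= c * \prod_i J i.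
  move=> gB; have nB := nice_tensor gB.
  have [r' [J' [gB' JE]]] := good_boxes gB s0.
  have nB' := nice_tensor gB'; set phi := tensor (boxes s B) in nB' *.
  have tphi : test_function phi by have [? ? _ _] := gB'; exact: (@test_function_tensor _ _ _ r').
  (* The two signs, from the weak derivative and from the discrete integration by
     parts, are both (-1) to the order of the derivative, and cancel. *)
  have := H _ tphi; rewrite mpartial_dirs -sb (partial_boxes gB s0) integral_bdiffs//.
  rewrite -(size_map fst s) sb size_dirs => /(@mulfI _ _); rewrite signr_eq0 => /(_ isT) ->.
  have phi0 y : 0 <= phi y by have [_ _ B0 _] := gB'; apply: prodr_ge0.
  have mphi : measurable_fun setT phi by case: nB'.
  have ile : (\int[mu]_y `|(g y * phi y)%:E| <= (c * \prod_i J i)%:E)%E.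
    apply: (@le_trans _ _ (\int[mu]_y (K%:E * (phi y)%:E))%E).
      apply: ae_ge0_le_integral => //.
      - by apply: measurableT_comp => //; apply/measurable_EFinP; exact: measurable_funM.
      - by move=> y _; rewrite -EFinM lee_fin mulr_ge0.
      - by apply: measurable_funeM; exact/measurable_EFinP.
      - apply: filterS gK => y gy _; rewrite -EFinM lee_fin normrM (ger0_norm (phi0 y)).
        by rewrite ler_wpM2r.
    rewrite ge0_integralZl ?lee_fin//; last 2 first.
    - exact/measurable_EFinP.
    - by move=> y _; rewrite lee_fin.
    by rewrite (integral_good gB') JE -EFinM lee_fin /c mulrA.
  apply: abse_fine_le; apply: le_trans ile; apply: le_abse_integral => //.
  by apply/measurable_EFinP; exact: measurable_funM.
(* If the bound failed at x, it would fail by a definite amount near x, where the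
   bumps are concentrated; the sign sg reduces to positive differences. *)
rewrite leNgt; apply/negP => cx.
have e0 : 0 < (`|fdiffs s f x| - c) / 2 by lra.
have /nbhs_ballP[d /= d0 hd] : \forall y \near x, `|fdiffs s f x - fdiffs s f y| < (`|fdiffs s f x| - c) / 2.
  by have := cw x; move=> /cvgrPdist_lt; apply.
have [B [r [J [gB J0 Bd]]]] := bump_family x d0.
have nB := nice_tensor gB.
have lw := lmb_fdiffs s lmbf.
pose sg : R := Num.sg (fdiffs s f x).
have sgE : sg * fdiffs s f x = `|fdiffs s f x| by rewrite /sg -normrEsg.
have sg1 : `|sg| <= 1 by rewrite /sg normr_sg; case: eqP => _; rewrite ?lexx ?ler01.
have tB0 y : 0 <= tensor B y by have [_ _ B0 _] := gB; apply: prodr_ge0.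
have := main _ _ _ gB; apply/negP; rewrite -ltNge.
set a := (`|fdiffs s f x| + c) / 2.
have ca : c < a by rewrite /a; lra.
apply: (@lt_le_trans _ _ (a * \prod_i J i)); first by rewrite ltr_pM2r.
have -> : a * \prod_i J i = \int[mu]_y (a * tensor B y).
  rewrite RintegralZl//; last first.
    have [mt [K' [r' [h1 h2]]]] := nB.
    exact: (@integrable_cube_supported _ _ _ K' r').
  by rewrite /Rintegral (integral_good gB).
have it : mu.-integrable setT (EFin \o (fdiffs s f \* tensor B)) by exact: integrable_lmb_nice.
apply: (@le_trans _ _ (\int[mu]_y (sg * (fdiffs s f y * tensor B y)))).
  apply: le_Rintegral => //.
  - apply: (@integrable_lmb_nice _ _ (cst a) (tensor B)) => //; split.
      exact: measurable_cst.
    exact: continuous_locally_bounded (@cst_continuous _ _ a).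
  - have := integrableZl measurableT sg it.
    by congr (_.-integrable _ _); apply/funext => y; rewrite /= EFinM.
  - move=> y _; have [yd|yd] := ltP `|y - x| d; last by rewrite Bd// !mulr0.
    rewrite mulrA; apply: ler_wpM2r => //.
    have : ball x d y by rewrite mx_norm_ball /ball_ /= distrC.
    move=> /hd => h1.
    have h2 : `|sg * (fdiffs s f x - fdiffs s f y)| <= (`|fdiffs s f x| - c) / 2.
      rewrite normrM; apply: le_trans (ltW h1).
      by rewrite -[leRHS]mul1r; apply: ler_wpM2r.
    by move: h2; rewrite mulrBr sgE ler_norml => /andP[_]; rewrite /a; lra.
rewrite RintegralZl//; apply: le_trans (ler_norm _) _.
by rewrite normrM -[leRHS]mul1r; apply: ler_wpM2r.
Qed.

(** Together with its converse below, this replaces the Sobolev norm by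
    conditions that mention neither derivatives nor null sets. *)
Lemma Wkoo_lt_diff_le k m (f : E -> 'rV[R]_m) (N : R) :
  (forall j, continuous (fun x => f x 0 j)) -> (Wkoo_norm k f < N%:E)%E ->
  exists K : {ffun 'I_n -> 'I_k.+1} -> R,
  [/\ forall b, 0 <= K b,
     forall b j, (mdeg b <= k)%N -> diff_le (dirs b) (K b) (fun x => f x 0 j) &
     \sum_(b : {ffun 'I_n -> 'I_k.+1} | (mdeg b <= k)%N) K b < N].
Proof.
move=> cf /ereal_inf_lt[_ [g wg ->] SN].
have muT : (0 < mu setT)%E.
  have h := @lebesgue_rV_box R n (const_mx (- 1)) (const_mx 1).
  apply: (@lt_le_trans _ _ (\prod_(i < n) ((const_mx 1 : E) 0 i - (const_mx (- 1) : E) 0 i))%:E).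
    by rewrite lte_fin; apply: prodr_gt0 => i _; rewrite !mxE; lra.
  rewrite -h; last by move=> i; rewrite !mxE; lra.
  apply: le_measure; rewrite ?inE//.
  rewrite [X in measurable X](_ : _ = cube 1); first exact: measurable_cube.
  apply/seteqP; split => x /= hx.
    by apply: normr_rV_le => // i; have := hx i; rewrite !mxE in_itv/= ler_norml.
  by move=> i; rewrite !mxE in_itv/= -ler_norml; apply: le_trans hx; exact: normr_rV_coord.
pose S b := ess_sup mu (fun x => (eucl_norm (g b x))%:E).
have S0 b : (0 <= S b)%E.
  by apply: ess_sup_ger => // x; rewrite lee_fin sqrtr_ge0.
have Sfin b : (mdeg b <= k)%N -> S b \is a fin_num.
  move=> bk; rewrite ge0_fin_numE//; apply: le_lt_trans (ltry N).
  apply: le_trans (ltW SN); rewrite (bigD1 b)//= leeDl//.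
  by apply: sume_ge0 => i _; exact: S0.
exists (fun b => fine (S b)); split.
- by move=> b; rewrite fine_ge0.
- move=> b j bk; apply: weak_le_diff (wg b bk j) _; rewrite ?fine_ge0//.
  have := ess_sup_ge mu (fun x => (eucl_norm (g b x))%:E).
  apply: filterS => x; rewrite -/(S b) -(fineK (Sfin b bk)) lee_fin; apply: le_trans.
  rewrite -(ler_pXn2r (n := 2))//= ?nnegrE ?sqrtr_ge0//.
  rewrite sqr_sqrtr; last by apply: sumr_ge0 => i _; rewrite -expr2 sqr_ge0.
  rewrite real_normK ?num_real// /dot_rV (bigD1 j)//= expr2 lerDl.
  by apply: sumr_ge0 => i _; rewrite -expr2 sqr_ge0.
- rewrite -lte_fin; apply: le_lt_trans SN.
  by rewrite -sumEFin; apply: lee_sum => b bk; rewrite fineK// Sfin.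
Qed.

End weak_to_diff.

(** * Weak-star compactness of bounded sequences *)

Section ultralimits.
Context {R : realType} (U : set_system nat) {UU : UltraFilter U}.

Lemma ultra_cvg (v : nat -> R) (C : R) : (forall k, `|v k| <= C) ->
  exists l : R, v k @[k --> U] --> l.
Proof.
move=> vC.
have uf : UltraFilter (v k @[k --> U]).
  split; first exact: fmap_proper_filter.
  move=> G PG UG; apply/seteqP; split; last exact: UG.
  move=> B GB.
  have [|h] := in_ultra_setVsetC (v @^-1` B) UU; first by [].
  exfalso; apply: (@filter_not_empty _ G); rewrite -(setICr B).
  by apply: filterI => //; apply: UG.
have := @segment_compact R (- C) C; rewrite compact_ultra => /(_ _ uf)[].
  apply: (@filterS _ U _ setT); last exact: filterT.
  by move=> k _ /=; rewrite in_itv/= -ler_norml.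
by move=> l [_ hl]; exists l.
Qed.

(** Limits along ultrafilters exist for all bounded sequences, so that no
    subsequence has to be extracted. *)
Definition ulim (v : nat -> R) : R := get [set l : R | v k @[k --> U] --> l].

Lemma ulimP (v : nat -> R) (C : R) : (forall k, `|v k| <= C) ->
  v k @[k --> U] --> ulim v.
Proof. by move=> vC; apply: (getPex (P := [set l : R | v k @[k --> U] --> l])); exact: ultra_cvg vC. Qed.

Lemma ulim_eq (v : nat -> R) (l : R) : v k @[k --> U] --> l -> ulim v = l.
Proof.
move=> h; apply: (@cvg_unique _ _ (v k @[k --> U])) => //.
by apply: (getPex (P := [set l : R | v k @[k --> U] --> l])); exists l.
Qed.

Lemma ultra_le (v w : nat -> R) (l l' : R) : v k @[k --> U] --> l -> w k @[k --> U] --> l' ->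
  (forall k, v k <= w k) -> l <= l'.
Proof. by move=> vl wl vw; apply: (ler_cvg_to vl wl); apply: nearW. Qed.

Lemma ultra_cvgE (v : nat -> R) (l l' : R) : v k @[k --> U] --> l -> v k @[k --> U] --> l' -> l = l'.
Proof. by move=> h h'; apply: (cvg_unique _ h h'). Qed.

End ultralimits.

Lemma dominated_Rcvg {R : realType} d (T : measurableType d) (mu : {measure set T -> \bar R})
    (f_ : nat -> T -> R) (f g : T -> R) :
  (forall k, measurable_fun setT (f_ k)) -> (forall x, f_ k x @[k --> \oo] --> f x) ->
  mu.-integrable setT (EFin \o g) -> (forall k x, `|f_ k x| <= g x) ->
  (\int[mu]_x f_ k x) @[k --> \oo] --> \int[mu]_x f x.
Proof.
move=> mf ff ig fg.
have mlim : measurable_fun setT f by apply: (measurable_fun_cvg mf) => x _; exact: ff.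
have [] := @dominated_convergence _ _ _ mu setT measurableT (fun k => EFin \o f_ k) (EFin \o f) (EFin \o g).
- by move=> k; exact/measurable_EFinP.
- exact/measurable_EFinP.
- by apply: nearW => x _; apply: cvg_EFin; [apply: nearW|exact: ff].
- exact: ig.
- by apply: nearW => x k _; rewrite lee_fin.
move=> fi _ h.
apply: fine_cvg; rewrite /Rintegral fineK; last exact: integrable_fin_num.
exact: h.
Qed.

Section weak_star.
Context {R : realType} {n : nat}.
Local Notation leb := (@lebesgue_measure R).
Local Notation mu := (lebesgue_rV R n).
Local Notation E := 'rV[R]_n.

(** A finite measure with a positive density makes all bounded functions integrable. *)
Definition weight : E -> R := tensor (fun _ => normal_pdf 0 1).

Lemma measurable_weight : measurable_fun setT weight.
Proof.
apply: measurable_prod => i _; apply: measurableT_comp; last exact: measurable_rV_coord.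
exact: measurable_normal_pdf.
Qed.

Lemma normal_pdf01E (t : R) : normal_pdf 0 1 t = normal_peak 1 * normal_fun 0 1 t.
Proof. by rewrite /normal_pdf oner_eq0. Qed.

Lemma weight_gt0 x : 0 < weight x.
Proof.
apply: prodr_gt0 => i _; rewrite normal_pdf01E.
by rewrite mulr_gt0 ?normal_peak_gt0 ?oner_eq0// expR_gt0.
Qed.

Lemma weight_ge0 x : 0 <= weight x. Proof. exact/ltW/weight_gt0. Qed.

Lemma integral_weight : (\int[mu]_x (weight x)%:E)%E = 1%E.
Proof.
rewrite (@integral_tensor _ _ _ (fun=> 1)).
- by rewrite big1.
- by move=> i; exact: measurable_normal_pdf.
- by move=> i t; exact: normal_pdf_ge0.
- by move=> i; exact: integral_normal_pdf.
Qed.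

Lemma integrable_weight : mu.-integrable setT (EFin \o weight).
Proof.
apply/integrableP; split; first by apply/measurable_EFinP; exact: measurable_weight.
under eq_integral do rewrite /= ger0_norm ?weight_ge0//.
by rewrite integral_weight ltry.
Qed.

Lemma weight_cube (r : R) : exists2 c, 0 < c & forall x, `|x| <= r -> c <= weight x.
Proof.
exists (\prod_(i < n) (normal_peak 1 * expR (- (r ^+ 2 / (1 ^+ 2 *+ 2)))))%R.
  by apply: prodr_gt0 => i _; rewrite mulr_gt0 ?normal_peak_gt0 ?oner_eq0 ?expR_gt0.
move=> x xr; apply: ler_prod => i _.
rewrite mulr_ge0 ?expR_ge0 ?normal_peak_ge0//= normal_pdf01E.
rewrite ler_pM2l ?normal_peak_gt0 ?oner_eq0// /normal_fun ler_expR subr0 mulNr lerN2 ler_wpM2r//.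
rewrite -[X in X <= _]real_normK ?num_real// ler_pXn2r ?nnegrE//.
  exact: le_trans (normr_rV_coord _ _) xr.
exact: le_trans (normr_ge0 x) xr.
Qed.

Section seq.
Variables (U : set_system nat) (d : nat -> E -> R) (K : R).
Hypotheses (UU : UltraFilter U).
Hypotheses (md : forall k, measurable_fun setT (d k)) (dK : forall k x, `|d k x| <= K).

(** The sequence is shifted to make it nonnegative, so that its limit is a
    measure and not a signed measure. *)
Let a k x := (d k x + K) * weight x.

Let K0 : 0 <= K. Proof. by apply: le_trans (dK 0 0); exact: normr_ge0. Qed.

Let a_ge0 k x : 0 <= a k x.
Proof.
by rewrite mulr_ge0 ?weight_ge0//; have := dK k x; rewrite ler_norml => /andP[]; lra.
Qed.

Let a_le k x : a k x <= 2 * K * weight x.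
Proof.
rewrite ler_wpM2r ?weight_ge0//; have := dK k x; rewrite ler_norml => /andP[]; lra.
Qed.

Let ma k : measurable_fun setT (a k).
Proof.
apply: measurable_funM; last exact: measurable_weight.
by apply: measurable_funD => //; exact: measurable_cst.
Qed.

Let bdd (f : E -> R) C := measurable_fun setT f /\ forall x, `|f x| <= C.

Let int_bw f C : bdd f C -> mu.-integrable setT (EFin \o (f \* weight)).
Proof.
move=> [mf fC]; apply: (@le_integrable _ _ _ mu setT measurableT _ (fun x => (C * weight x)%:E)).
- by apply/measurable_EFinP; apply: measurable_funM => //; exact: measurable_weight.
- move=> x _; rewrite lee_fin normrM (ger0_norm (weight_ge0 x)).
  by apply: le_trans (ler_norm _); rewrite ler_wpM2r ?weight_ge0.
- have := integrableZl measurableT C integrable_weight.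
  by congr (_.-integrable _ _); apply/funext => y; rewrite /= EFinM.
Qed.

Let int_fa f C k : bdd f C -> mu.-integrable setT (EFin \o (f \* a k)).
Proof.
move=> [mf fC].
have -> : f \* a k = (f \* (fun x => d k x + K)) \* weight.
  by apply/funext => x; rewrite /= /a mulrA.
apply: (@int_bw _ (C * (2 * K))); split.
  by apply: measurable_funM => //; apply: measurable_funD => //; exact: measurable_cst.
move=> x; rewrite normrM ler_pM//.
by have := dK k x; rewrite !ler_norml => /andP[? ?]; apply/andP; split; lra.
Qed.

Let I f k := \int[mu]_x (f x * a k x).

Let I_le f C k : bdd f C -> `|I f k| <= C * (2 * K).
Proof.
move=> bf; have [mf fC] := bf.
apply: le_trans (le_normr_Rintegral _ (int_fa k bf)) _ => //.
have C0 : 0 <= C by apply: le_trans (fC 0); exact: normr_ge0.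
apply: (@le_trans _ _ (\int[mu]_x (C * (2 * K) * weight x))); last first.
  by rewrite (RintegralZl _ _ integrable_weight)// /Rintegral integral_weight/= mulr1.
apply: le_Rintegral => //.
- by have := integrable_norm (int_fa k bf).
- have := integrableZl measurableT (C * (2 * K)) integrable_weight.
  by congr (_.-integrable _ _); apply/funext => y; rewrite /= EFinM.
- move=> x _; rewrite normrM (ger0_norm (a_ge0 k x)) -mulrA.
  by rewrite ler_pM// mulrA.
Qed.

(** The maximum matters only on nonmeasurable sets, where a measure still has to
    be nonnegative. *)
Let nu (A : set E) : \bar R := (Num.max 0 (ulim U (I (\1_A : E -> R))))%:E.

Let bdd_indic (A : set E) : measurable A -> bdd (\1_A) 1.
Proof.
by move=> mA; split => [|x]; [exact: measurable_indic|rewrite indicE; case: (_ \in _); rewrite /= ?normr1 ?normr0].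
Qed.

Let I_cvg f C : bdd f C -> I f k @[k --> U] --> ulim U (I f).
Proof. by move=> bf; apply: (@ulimP _ _ _ _ (C * (2 * K))) => k; exact: I_le. Qed.

Let ID f g C C' : bdd f C -> bdd g C' ->
  ulim U (I (f \+ g)) = ulim U (I f) + ulim U (I g).
Proof.
move=> bf bg; apply: ulim_eq.
have -> : I (f \+ g) = (fun k => I f k + I g k).
  apply/funext => k; rewrite /I -(RintegralD _ (int_fa k bf) (int_fa k bg))//.
  by apply: eq_Rintegral => x _; rewrite /= mulrDl.
by apply: cvgD; [exact: I_cvg bf|exact: I_cvg bg].
Qed.

Let IZ f C c : bdd f C -> ulim U (I (fun x => c * f x)) = c * ulim U (I f).
Proof.
move=> bf; apply: ulim_eq.
have -> : I (fun x => c * f x) = (fun k => c * I f k).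
  apply/funext => k; rewrite /I -(RintegralZl _ _ (int_fa k bf))//.
  by apply: eq_Rintegral => x _; rewrite /= mulrA.
by apply: cvgMr; exact: I_cvg bf.
Qed.

Let I_ge0 f C : bdd f C -> (forall x, 0 <= f x) -> 0 <= ulim U (I f).
Proof.
move=> bf f0; apply: (ultra_le (v := cst 0) _ (I_cvg bf)); first exact: cvg_cst.
by move=> k; apply: Rintegral_ge0 => x _; rewrite mulr_ge0.
Qed.

(** The limit measure is dominated by a multiple of the weighted Lebesgue
    measure; this yields both its countable additivity and its absolute
    continuity. *)
Let I_wle f C : bdd f C -> (forall x, 0 <= f x) ->
  ulim U (I f) <= 2 * K * \int[mu]_x (f x * weight x).
Proof.
move=> bf f0; apply: (ultra_le (I_cvg bf) (w := cst (2 * K * \int[mu]_x (f x * weight x)))).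
  exact: cvg_cst.
move=> k; rewrite /= -(RintegralZl _ _ (int_bw bf))//; apply: le_Rintegral => //.
- exact: int_fa bf.
- have := integrableZl measurableT (2 * K) (int_bw bf).
  by congr (_.-integrable _ _); apply/funext => y; rewrite /= EFinM.
- move=> x _; rewrite [leRHS](_ : _ = f x * (2 * K * weight x)); first exact: ler_wpM2l.
  by rewrite /=; ring.
Qed.

Let nuE A : measurable A -> nu A = (ulim U (I (\1_A : E -> R)))%:E.
Proof. by move=> mA; congr (_%:E); apply/max_idPr; exact: (I_ge0 (bdd_indic mA)). Qed.

Let nu0 : nu set0 = 0%E.
Proof.
rewrite nuE; last exact: measurable0.
congr (_%:E); apply: ulim_eq.
rewrite (_ : I _ = cst 0); first exact: cvg_cst.
apply/funext => k; rewrite /I indic0 (@eq_Rintegral _ _ _ _ _ (cst 0)).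
  by rewrite Rintegral_cst ?mul0r.
by move=> x _; rewrite /= mul0r.
Qed.

Let nu_ge0 A : (0 <= nu A)%E.
Proof. by rewrite lee_fin le_max lexx. Qed.

Let nuU A B : measurable A -> measurable B -> A `&` B = set0 -> nu (A `|` B) = (nu A + nu B)%E.
Proof.
move=> mA mB AB; rewrite !nuE//; last exact: measurableU.
rewrite -EFinD -(ID (bdd_indic mA) (bdd_indic mB)); congr (ulim U (I _))%:E.
apply/funext => x /=; rewrite !indicE in_setU.
case: (boolP (x \in A)) => xA; case: (boolP (x \in B)) => xB; rewrite /= ?addr0 ?add0r//.
exfalso; have : (A `&` B) x by split; [move: xA|move: xB]; rewrite inE.
by rewrite AB.
Qed.

Let nu_bigsetU (F : nat -> set E) N : (forall i, measurable (F i)) -> trivIset setT F ->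
  nu (\big[setU/set0]_(i < N) F i) = (\sum_(0 <= i < N) nu (F i))%E.
Proof.
move=> mF tF; elim: N => [|N IH]; first by rewrite big_ord0 big_geq.
rewrite big_ord_recr big_nat_recr//= nuU ?IH//; first exact: bigsetU_measurable.
rewrite -subset0 => x [+ FNx]; rewrite -bigcup_mkord => -[i /= iN Fix].
move/trivIsetP : tF => /(_ i N Logic.I Logic.I (negbT (ltn_eqF iN))).
by rewrite -subset0 => /(_ x); apply.
Qed.

Let nu_sigma : semi_sigma_additive nu.
Proof.
move=> F mF tF mUF.
(* Continuity at the empty set: the tails D N decrease to it, and their measure
   is at most 2 K times their weighted Lebesgue measure. *)
pose D N := (\bigcup_i F i) `\` \big[setU/set0]_(i < N) F i.
have mB N : measurable (\big[setU/set0]_(i < N) F i) by exact: bigsetU_measurable.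
have mD N : measurable (D N) by apply: measurableD.
have sumE N : (\sum_(0 <= i < N) nu (F i))%E = (nu (\bigcup_i F i) - nu (D N))%E.
  rewrite -(nu_bigsetU _ mF tF).
  rewrite -[in RHS](@setDUK _ (\big[setU/set0]_(i < N) F i) (\bigcup_i F i)).
    rewrite -/(D N) nuU//; first by rewrite addeK.
    by apply/seteqP; split => // x [Bx []].
  by move=> x; rewrite -bigcup_mkord => -[i _ Fi]; exists i.
have Dw : (2 * K * \int[mu]_x (\1_(D N) x * weight x)) @[N --> \oo] --> (2 * K * 0 : R).
  have i0 : \int[mu]_x cst 0 x = (0 : R) by rewrite Rintegral_cst ?mul0r.
  apply: cvgMr; rewrite -[X in _ --> X]i0.
  apply: (dominated_Rcvg (g := weight)).
  - by move=> N; apply: measurable_funM; [exact: measurable_indic|exact: measurable_weight].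
  - move=> x; case: (pselect ((\bigcup_i F i) x)) => [[i _ Fi]|nF].
      apply: cvg_near_cst; exists i.+1 => // N /= iN.
      rewrite indicE memNset ?mul0r// => -[_]; apply.
      by rewrite -bigcup_mkord; exists i.
    apply: cvg_near_cst; apply: nearW => N.
    by rewrite indicE memNset ?mul0r// => -[].
  - exact: integrable_weight.
  - move=> N x; rewrite normrM (ger0_norm (weight_ge0 x)) ler_piMl ?weight_ge0//.
    by rewrite indicE; case: (_ \in _); rewrite ?normr1 ?normr0.
rewrite mulr0 in Dw.
have D0 : (ulim U (I (\1_(D N) : E -> R))) @[N --> \oo] --> (0 : R).
  apply: (@squeeze_cvgr _ _ _ _ (cst 0) (fun N => 2 * K * \int[mu]_x (\1_(D N) x * weight x))); last 2 first.
  - exact: cvg_cst.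
  - exact: Dw.
  apply: nearW => N; rewrite (I_ge0 (bdd_indic (mD N)))//=.
  exact: (I_wle (bdd_indic (mD N))).
rewrite (_ : (fun _ => _) = (fun N => (nu (\bigcup_i F i) - nu (D N))%E)); last first.
  by apply/funext => N; rewrite sumE.
suff : (nu (\bigcup_i F i) - nu (D N))%E @[N --> \oo] --> (nu (\bigcup_i F i) - 0)%E.
  by rewrite sube0.
apply: cvgeB => //.
- exact: cvg_cst.
- under eq_fun do rewrite nuE//.
  by apply: cvg_EFin; [apply: nearW|exact: D0].
Qed.

HB.instance Definition _ := isMeasure.Build _ _ _ nu nu0 nu_ge0 nu_sigma.

Let nu_fin : fin_num_fun nu.
Proof. by move=> A mA. Qed.

HB.instance Definition _ := @Measure_isFinite.Build _ _ _ nu nu_fin.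

Let nu_dom : nu `<< mu.
Proof.
apply/null_content_dominatesP => A mA muA; rewrite nuE//; congr (_%:E).
apply/eqP; rewrite eq_le (I_ge0 (bdd_indic mA))// andbT.
apply: le_trans (I_wle (bdd_indic mA) _) _ => //.
rewrite (_ : \int[mu]_x _ = 0) ?mulr0//.
transitivity (\int[mu]_(x in A) weight x).
  rewrite [RHS]Rintegral_mkcond; apply: eq_Rintegral => x _.
  by rewrite patchE indicE; case: ifP; rewrite ?mul1r ?mul0r.
rewrite /Rintegral null_set_integral//.
by apply/measurable_EFinP; apply: measurable_funTS; exact: measurable_weight.
Qed.

(** Bounded sequences converge weak-star along ultrafilters.  The limits of
    the integrals over sets form a finite measure that is absolutely continuous;
    its Radon-Nikodym density, corrected for the weight and the shift, is the limit
    function. *)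
Lemma weak_star : exists g : E -> R, [/\ measurable_fun setT g, forall x, `|g x| <= K &
  forall phi, nice phi ->
    (\int[mu]_x (d k x * phi x)) @[k --> U] --> (\int[mu]_x (g x * phi x) : R)].
Proof.
have [f [f0 ff fi fnu]] := radon_nikodym_sigma_finite nu_dom.
pose h x := fine (f x).
have h0 x : 0 <= h x by rewrite fine_ge0.
have hi : mu.-integrable setT (EFin \o h).
  by move: fi; congr (_.-integrable _ _); apply/funext => x; rewrite /= fineK.
have mh : measurable_fun setT h by move/integrableP : hi => [/measurable_EFinP].
have hb psi C : bdd psi C -> mu.-integrable setT (EFin \o (h \* psi)).
  move=> [mp pC]; apply: (@le_integrable _ _ _ mu setT measurableT _ (fun x => (C%:E * (h x)%:E)%E)).
  - by apply/measurable_EFinP; exact: measurable_funM.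
  - move=> x _; rewrite -EFinM lee_fin; apply: le_trans (ler_norm _).
    by rewrite /= normrM (ger0_norm (h0 x)) mulrC ler_wpM2r.
  - exact: (integrableZl measurableT C hi).
pose L psi := ulim U (I psi) = \int[mu]_x (h x * psi x).
have LI A : measurable A -> L (\1_A).
  move=> mA; apply: EFin_inj; rewrite -nuE// fnu// /Rintegral fineK.
    rewrite [LHS]integral_mkcond; apply: eq_integral => x _.
    by rewrite patchE indicE; case: ifP; rewrite ?mulr1 ?mulr0// /h fineK.
  apply: integrable_fin_num => //; exact: (hb _ _ (bdd_indic mA)).
have LD p q C C' : bdd p C -> bdd q C' -> L p -> L q -> L (p \+ q).
  move=> bp bq Lp Lq; rewrite /L (ID bp bq) Lp Lq -(RintegralD _ (hb _ _ bp) (hb _ _ bq))//.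
  by apply: eq_Rintegral => x _; rewrite /= mulrDr.
have LZ p c C : bdd p C -> L p -> L (fun x => c * p x).
  move=> bp Lp; rewrite /L (IZ c bp) Lp -(RintegralZl _ _ (hb _ _ bp))//.
  by apply: eq_Rintegral => x _; rewrite /= mulrCA.
have bD p q C C' : bdd p C -> bdd q C' -> bdd (p \+ q) (C + C').
  move=> [mp pC] [mq qC]; split=> [|x]; first exact: measurable_funD.
  by apply: le_trans (ler_normD _ _) _; exact: lerD.
have bZ p c C : bdd p C -> bdd (fun x => c * p x) (`|c| * C).
  move=> [mp pC]; split=> [|x]; first exact: measurable_funM.
  by rewrite normrM ler_wpM2l.
(* Layer-cake approximation: S j N is psi rounded down to a multiple of
   1/(j + 1), and the error is integrated against both measures. *)
have Lpos psi (C : R) : bdd psi C -> (forall x, 0 <= psi x) -> L psi.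
  move=> bp p0; have [mp pC] := bp.
  pose A j m := [set x | m.+1%:R <= j.+1%:R * psi x].
  have mA j m : measurable (A j m).
    have := measurable_fun_ler (measurable_cst (m.+1%:R : R)) (measurable_funM (measurable_cst (j.+1%:R : R)) mp).
    by move=> /(_ measurableT [set true]); rewrite setTI; apply.
  pose S j N x : R := \sum_(m < N) (j.+1%:R^-1 * \1_(A j m) x).
  have SL j N : L (S j N) /\ exists C', bdd (S j N) C'.
    elim: N => [|N [LS [C' bS]]].
      have -> : S j 0%N = \1_set0 by apply/funext => x; rewrite /S big_ord0 indicE in_set0.
      by split; [exact: LI|exists 1; exact: bdd_indic].
    have -> : S j N.+1 = S j N \+ (fun x => j.+1%:R^-1 * \1_(A j N) x).
      by apply/funext => x; rewrite /S big_ord_recr.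
    have b1 := bZ _ (j.+1%:R^-1) _ (bdd_indic (mA j N)).
    split; last by eexists; exact: bD bS b1.
    apply: (LD _ _ _ _ bS b1) => //.
    by apply: (LZ _ _ _ (bdd_indic (mA j N))); exact: LI.
  have SE j N x : j.+1%:R * C <= N%:R -> 0 <= psi x - S j N x <= j.+1%:R^-1.
    move=> CN; have j0 : 0 < j.+1%:R :> R by rewrite ltr0n.
    set y := j.+1%:R * psi x.
    have y0 : 0 <= y by rewrite mulr_ge0.
    have /andP[t1 t2] := truncn_itv y0.
    have tN : (Num.truncn y <= N)%N.
      rewrite -(ler_nat R); apply: le_trans t1 _; apply: le_trans CN.
      by rewrite ler_pM2l//; apply: le_trans (pC x); exact: ler_norm.
    have -> : S j N x = j.+1%:R^-1 * (Num.truncn y)%:R.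
      rewrite /S -mulr_sumr; congr (_ * _).
      transitivity (\sum_(m < N) (((m < Num.truncn y)%N : nat)%:R : R)).
        apply: eq_bigr => m _; rewrite indicE; congr (nat_of_bool _)%:R.
        by rewrite truncn_gt_nat; apply/idP/idP; rewrite inE.
      rewrite -natr_sum; congr (_%:R); elim: (N) (Num.truncn y) tN => [|N' IH] t tN.
        by rewrite big_ord0; move: tN; rewrite leqn0 => /eqP.
      case: t tN => [|t] tN; first by rewrite big1.
      by rewrite big_ord_recl IH.
    have -> : psi x = j.+1%:R^-1 * y by rewrite /y mulKf ?gt_eqF.
    rewrite -mulrBr; apply/andP; split; first by rewrite mulr_ge0 ?invr_ge0 ?(ltW j0) ?subr_ge0.
    rewrite -[leRHS]mulr1 ler_pM2l ?invr_gt0//.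
    by move: t2; rewrite -natr1; lra.
  have [N NE] : exists N : nat -> nat, forall j, j.+1%:R * C <= (N j)%:R.
    exists (fun j => (Num.truncn (j.+1%:R * C)).+1) => j.
    by apply/ltW/truncnS_gt.
  apply/eqP; rewrite -subr_eq0 -normr_le0.
  set D := \int[mu]_x h x.
  have D0 : 0 <= D by apply: Rintegral_ge0.
  have key j : `|ulim U (I psi) - \int[mu]_x (h x * psi x)| <= (2 * K + D) / j.+1%:R.
    have [SLj [C' bS]] := SL j (N j).
    pose r x := psi x - S j (N j) x.
    have r0 x : 0 <= r x by have /andP[] := SE j (N j) x (NE j).
    have r1 x : r x <= j.+1%:R^-1 by have /andP[] := SE j (N j) x (NE j).
    have br : bdd r j.+1%:R^-1.
      split=> [|x]; last by rewrite ger0_norm.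
      by apply: measurable_funB => //; have [] := bS.
    have pE : psi = S j (N j) \+ r by apply/funext => x; rewrite /r /= addrC subrK.
    have -> : ulim U (I psi) - \int[mu]_x (h x * psi x) = ulim U (I r) - \int[mu]_x (h x * r x).
      rewrite [in LHS]pE (ID bS br) SLj.
      rewrite (_ : \int[mu]_x (h x * (S j (N j) \+ r) x) = \int[mu]_x (h x * S j (N j) x) + \int[mu]_x (h x * r x)).
        by rewrite opprD addrACA subrr add0r.
      rewrite -(RintegralD _ (hb _ _ bS) (hb _ _ br))//.
      by apply: eq_Rintegral => x _; rewrite /= mulrDr.
    apply: le_trans (ler_normB _ _) _; rewrite mulrDl; apply: lerD.
      rewrite ger0_norm; last exact: (I_ge0 br).
      apply: le_trans (I_wle br r0) _; rewrite ler_wpM2l ?mulr_ge0//.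
      have -> : j.+1%:R^-1 = \int[mu]_x (j.+1%:R^-1 * weight x).
        by rewrite (RintegralZl _ _ integrable_weight)// /Rintegral integral_weight mulr1.
      apply: le_Rintegral => //; first exact: int_bw br.
        have := integrableZl measurableT (j.+1%:R^-1) integrable_weight.
        by congr (_.-integrable _ _); apply/funext => y; rewrite /= EFinM.
      by move=> x _; rewrite ler_wpM2r ?weight_ge0.
    rewrite ger0_norm; last by apply: Rintegral_ge0 => x _; rewrite mulr_ge0.
    rewrite mulrC -(RintegralZl _ _ hi)//; apply: le_Rintegral => //; first exact: hb br.
      have := integrableZl measurableT (j.+1%:R^-1) hi.
      by congr (_.-integrable _ _); apply/funext => y; rewrite /= EFinM.
    by move=> x _; rewrite mulrC ler_wpM2r.
  apply/ler_addgt0Pl => e e0; rewrite addr0.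
  have [j je] : exists j : nat, (2 * K + D) / j.+1%:R <= e.
    exists (Num.truncn ((2 * K + D) / e)); rewrite ler_pdivrMr ?ltr0n// [leRHS]mulrC -ler_pdivrMr//.
    exact/ltW/truncnS_gt.
  exact: le_trans (key j) je.
(* A general bounded function becomes nonnegative by adding a constant. *)
have Lall psi (C : R) : bdd psi C -> L psi.
  move=> bp; have [mp pC] := bp.
  have b1 : bdd (cst 1) 1 by split=> [|x]; [exact: measurable_cst|rewrite /= normr1].
  have L1 : L (cst 1) by apply: (Lpos _ _ b1) => x; exact: ler01.
  have bC := bZ _ C _ b1; have LC := LZ _ C _ b1 L1.
  have bq := bD _ _ _ _ bp bC.
  have Lq : L (psi \+ (fun x => C * cst 1 x)).
    apply: (Lpos _ _ bq) => x /=; rewrite mulr1.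
    by have := pC x; rewrite ler_norml => /andP[]; lra.
  have bC' := bZ _ (-1) _ bC; have LC' := LZ _ (-1) _ bC LC.
  have -> : psi = (psi \+ (fun x => C * cst 1 x)) \+ (fun x => -1 * (C * cst 1 x)).
    by apply/funext => x /=; rewrite mulN1r addrK.
  exact: (LD _ _ _ _ bq bC').
have mw := measurable_weight.
(* The density h is at most 2 K weight almost everywhere: integrate the excess z
   over the set A where it is positive. *)
pose A := [set x | 2 * K * weight x < h x].
have mA : measurable A.
  have := measurable_fun_ltr (measurable_funM (measurable_cst (2 * K : R)) mw) mh.
  by move=> /(_ measurableT [set true]); rewrite setTI; apply.
have bA := bdd_indic mA.
pose z x := (h x - 2 * K * weight x) * \1_A x.
have z0 x : 0 <= z x.
  rewrite /z indicE; case: (boolP (x \in A)) => [|_]; last by rewrite mulr0.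
  by rewrite inE mulr1 subr_ge0 => /ltW.
have mz : measurable_fun setT z.
  apply: measurable_funM; last exact: measurable_indic.
  by apply: measurable_funB => //; apply: measurable_funM.
have wA := int_bw bA.
have wA2 : mu.-integrable setT (EFin \o (fun x => 2 * K * (\1_A x * weight x))).
  have := integrableZl measurableT (2 * K) wA.
  by congr (_.-integrable _ _); apply/funext => y; rewrite /= EFinM.
have zE : z = (h \* \1_A) \- (fun x => 2 * K * (\1_A x * weight x)).
  by apply/funext => x; rewrite /z /=; ring.
have zi : mu.-integrable setT (EFin \o z).
  have := integrableB measurableT (hb _ _ bA) wA2.
  by congr (_.-integrable _ _); apply/funext => y; rewrite zE.
have zz : {ae mu, forall x, z x = 0}.
  have iz : \int[mu]_x z x = 0.
    apply/eqP; rewrite eq_le; apply/andP; split; last by apply: Rintegral_ge0.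
    rewrite zE (RintegralB _ (hb _ _ bA) wA2)//.
    rewrite (RintegralZl _ _ wA)// subr_le0 -[leLHS](LI _ mA).
    by apply: (I_wle bA) => x; rewrite indicE.
  have : (\int[mu]_x `|(z x)%:E| = 0)%E.
    under eq_integral do rewrite gee0_abs ?lee_fin//.
    rewrite -[LHS]fineK; first by rewrite -[fine _]/(\int[mu]_x z x) iz.
    exact: integrable_fin_num.
  move=> /ae_eq_integral_abs; move=> /(_ measurableT); case.
    exact/measurable_EFinP.
  move=> N [mN N0 NP]; exists N; split => // x nz; apply: NP => /(_ Logic.I) [].
  exact: nz.
(* Truncation makes the bound by K hold everywhere, not only almost everywhere. *)
exists (fun x => Num.min (h x / weight x) (2 * K) - K).
have mV : measurable_fun setT (fun x => (weight x)^-1).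
  rewrite (_ : (fun _ => _) = (fun x => weight x `^ (-1))); last first.
    by apply/funext => x; rewrite powR_inv1// weight_ge0.
  exact: (measurableT_comp (@measurable_powR R (-1)) mw).
have mg : measurable_fun setT (fun x => Num.min (h x / weight x) (2 * K) - K).
  apply: measurable_funB; last exact: measurable_cst.
  by apply: measurable_minr; [apply: measurable_funM|exact: measurable_cst].
split => [//|x|phi [mphi [C [r [pC pr]]]]].
  have hw : 0 <= h x / weight x by rewrite divr_ge0 ?weight_ge0.
  rewrite ler_norml; apply/andP; split.
    by rewrite lerBrDl subrr le_min hw mulr_ge0.
  by rewrite lerBlDr ge_min; apply/orP; right; rewrite mulr2n mulrDl mul1r.
have nphi : nice phi by split => //; exists C, r.
have [c c0 cw] := weight_cube r.
(* phi divided by the weight is still bounded, because the weight is bounded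
   below on the support of phi. *)
pose psi x := phi x / weight x.
have bpsi : bdd psi (C / c).
  split=> [|x]; first exact: measurable_funM.
  have C0 : 0 <= C by apply: le_trans (pC 0); exact: normr_ge0.
  have [xr|xr] := leP `|x| r; last by rewrite /psi pr// mul0r normr0 divr_ge0// ltW.
  rewrite normrM normfV (gtr0_norm (weight_gt0 x)) ler_pM ?invr_ge0 ?weight_ge0//.
  by rewrite lef_pV2 ?posrE ?weight_gt0//; exact: cw.
have iphi : mu.-integrable setT (EFin \o phi) by exact: (@integrable_cube_supported _ _ _ C r).
have lmb_K (u : E -> R) : measurable_fun setT u -> (forall x, `|u x| <= K) -> lmb u.
  by move=> mf fK; split => //; exact: locally_bounded_cst fK.
have IE k : I psi k = \int[mu]_x (d k x * phi x) + K * \int[mu]_x phi x.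
  rewrite -(RintegralZl _ _ iphi)// -RintegralD//; last 2 first.
  - exact: (integrable_lmb_nice (lmb_K _ (md k) (dK k)) nphi).
  - have := integrableZl measurableT K iphi.
    by congr (_.-integrable _ _); apply/funext => y; rewrite /= EFinM.
  apply: eq_Rintegral => x _; rewrite /psi /a mulrC -mulrA [weight x * _]mulrC divfK ?gt_eqF ?weight_gt0//.
  by rewrite mulrDl.
have -> : (fun k => \int[mu]_x (d k x * phi x)) = (fun k => I psi k - K * \int[mu]_x phi x).
  by apply/funext => k; rewrite IE addrK.
have -> : \int[mu]_x ((Num.min (h x / weight x) (2 * K) - K) * phi x) =
    \int[mu]_x (h x * psi x) - K * \int[mu]_x phi x.
  rewrite -(RintegralZl _ _ iphi)// -RintegralB//; last 2 first.
  - exact: hb bpsi.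
  - have := integrableZl measurableT K iphi.
    by congr (_.-integrable _ _); apply/funext => y; rewrite /= EFinM.
  rewrite /Rintegral; congr fine; apply: ae_eq_integral => //.
  - by apply/measurable_EFinP; apply: measurable_funM.
  - apply/measurable_EFinP; apply: measurable_funB; apply: measurable_funM => //.
    by have [] := bpsi.
  - apply: filterS zz => x zx _ /=; congr (_%:E).
    have hx : h x <= 2 * K * weight x.
      rewrite leNgt; apply/negP => xA; move: zx; rewrite /z indicE mem_set//= mulr1 => /eqP.
      by rewrite subr_eq0 => /eqP hE; move: xA; rewrite /A/= hE ltxx.
    have -> : Num.min (h x / weight x) (2 * K) = h x / weight x.
      by apply/min_idPl; rewrite ler_pdivrMr ?weight_gt0.
    by rewrite /psi; ring.
apply: cvgB; last exact: cvg_cst.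
by rewrite -(Lall _ _ bpsi); exact: I_cvg bpsi.
Qed.

End seq.
End weak_star.

(** * From finite differences to weak derivatives *)

Section diff_to_weak.
Context {R : realType} {n : nat}.
Local Notation mu := (lebesgue_rV R n).
Local Notation E := 'rV[R]_n.

Definition smooth_rV (phi : E -> R) :=
  forall (s : seq 'I_n) x, differentiable (foldr (@partial R n) phi s) x.

Lemma differentiable_is_derive (g : E -> R) (x v : E) : differentiable g x ->
  is_derive x v g ('D_v g x).
Proof. by move=> dg; apply/derivableP; exact: diff_derivable. Qed.

Lemma partial_bdiff p (g : E -> R) i : (forall x, differentiable g x) ->
  partial i (bdiff p g) = bdiff p (partial i g).
Proof.
move=> dg; apply/funext => x.
have := @is_derive_bdiff R n g p (delta_mx 0 i) (partial i g) _ x.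
by case=> // y; exact: differentiable_is_derive.
Qed.

Lemma foldr_partial_bdiff p (phi : E -> R) s : smooth_rV phi ->
  foldr (@partial R n) (bdiff p phi) s = bdiff p (foldr (@partial R n) phi s).
Proof. by move=> sp; elim: s => [//|i s IH] /=; rewrite IH partial_bdiff. Qed.

Lemma differentiable_bdiff p (g : E -> R) : (forall x, differentiable g x) ->
  forall x, differentiable (bdiff p g) x.
Proof.
move=> dg x; apply: differentiableB => //.
apply: (@differentiable_comp _ _ _ _ (fun y : E => y - step p) g); last exact: dg.
by apply: differentiableB => //.
Qed.

Lemma smooth_bdiff (p : 'I_n * R) (phi : E -> R) : smooth_rV phi -> smooth_rV (bdiff p phi).
Proof.
by move=> sp s x; rewrite foldr_partial_bdiff//; apply: differentiable_bdiff; exact: sp.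
Qed.

Lemma is_derive_on_line (g : E -> R) (z v : E) (t : R) : differentiable g (t *: v + z) ->
  is_derive t (1 : R) (fun t => g (t *: v + z)) ('D_v g (t *: v + z)).
Proof.
move=> dg; have [h1 h2] := differentiable_is_derive v dg.
have e : (fun h : R => h^-1 *: (((fun t => g (t *: v + z)) \o shift t) (h *: (1 : R)) - g (t *: v + z))) =
  (fun h : R => h^-1 *: ((g \o shift (t *: v + z)) (h *: v) - g (t *: v + z))).
  by apply/funext => h /=; rewrite [_ *: (1 : R)]mulr1 scalerDl addrA.
by split; rewrite ?/derivable ?/derive e.
Qed.

Lemma normr_delta (i : 'I_n) : `|delta_mx 0 i : E| <= 1.
Proof.
apply: normr_rV_le => // j; rewrite mxE eqxx /=.
by case: eqP => _; rewrite ?normr1 ?normr0.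
Qed.

Lemma bdiff_mvt (g : E -> R) p x : (forall x, differentiable g x) -> 0 < p.2 ->
  exists2 y, `|y - x| <= p.2 & bdiff p g x = p.2 * partial p.1 g y.
Proof.
move=> dg p0; set v : E := delta_mx 0 p.1; set z := x - step p.
have D t := @is_derive_on_line g z v t (dg _).
have [|c] := @MVT R (fun t => g (t *: v + z)) (fun t => 'D_v g (t *: v + z)) 0 p.2 p0 (fun t _ => D t).
  apply: continuous_subspaceT => t.
  by apply/differentiable_continuous/derivable1_diffP; have [] := D t.
rewrite in_itv/= => /andP[c0 c1]; rewrite scale0r add0r subr0 => E1.
exists (c *: v + z).
  rewrite (_ : _ - x = (c - p.2) *: v); last first.
    by rewrite /z /step scalerBl -/v [x - _]addrC addrA addrK.
  rewrite normrZ ler0_norm; last by lra.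
  apply: (@le_trans _ _ (- (c - p.2) * 1)); last by lra.
  by rewrite ler_wpM2l ?normr_delta//; lra.
rewrite /bdiff mulrC -E1; congr (g _ - _).
by rewrite /z /step addrCA subrr addr0.
Qed.

(** The mean value theorem applied once for each direction. *)
Lemma bdiffs_mvt (phi : E -> R) s x (eta : R) : smooth_rV phi ->
  (forall p, p \in s -> 0 < p.2 <= eta) ->
  exists2 y, `|y - x| <= eta *+ size s &
    bdiffs s phi x = (\prod_(p <- s) p.2) * foldr (@partial R n) phi (map fst s) y.
Proof.
elim: s phi x => [|p s IH] phi x sp s0.
  by exists x; rewrite ?subrr ?normr0// big_nil mul1r.
have /andP[p0 p1] : 0 < p.2 <= eta by apply: s0; rewrite mem_head.
have [|y yx E1] := IH _ x (smooth_bdiff p sp).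
  by move=> q qs; apply: s0; rewrite in_cons qs orbT.
rewrite foldr_partial_bdiff// in E1.
have [y' y'y E2] := bdiff_mvt y (sp (map fst s)) p0.
exists y'.
  rewrite (_ : y' - x = (y' - y) + (y - x)); last by rewrite addrA subrK.
  by apply: le_trans (ler_normD _ _) _; rewrite mulrS lerD// (le_trans y'y).
by rewrite /= E1 E2 big_cons mulrCA mulrA.
Qed.

Lemma partial_vanish (g : E -> R) (r : R) i : (forall x, r < `|x| -> g x = 0) ->
  forall x, r < `|x| -> partial i g x = 0.
Proof.
move=> gr x xr; have c0 : is_derive x (delta_mx 0 i) (cst 0 : E -> R) 0 by exact: is_derive_cst.
suff /near_eq_is_derive/(_ c0)[_ h] : \forall y \near x, (cst 0 : E -> R) y = g y by exact: h.
apply/nbhs_ballP; exists (`|x| - r); first by rewrite /= subr_gt0.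
move=> y; rewrite mx_norm_ball /ball_ /= => xy; rewrite gr//.
by have := lerB_dist x y; lra.
Qed.

Lemma foldr_partial_vanish (g : E -> R) (r : R) s : (forall x, r < `|x| -> g x = 0) ->
  forall x, r < `|x| -> foldr (@partial R n) g s x = 0.
Proof. by move=> gr; elim: s => [//|i s IH] /=; exact: partial_vanish. Qed.

Lemma test_function_supported (phi : E -> R) : test_function phi ->
  exists r, forall x, r < `|x| -> phi x = 0.
Proof.
move=> [_ /compact_bounded[r [_ hr]]]; exists (r + 1) => x xr.
apply/eqP/negPn/negP => px; have : `|x| <= r + 1.
  by apply: hr; [rewrite ltrDl|apply: subset_closure].
by rewrite leNgt xr.
Qed.

Lemma nice_continuous (g : E -> R) (r : R) : continuous g ->
  (forall x, r < `|x| -> g x = 0) -> nice g.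
Proof.
move=> cg gr; split; first exact: continuous_rV_measurable.
have [K hK] := continuous_locally_bounded cg r; exists `|K|, r; split => // x.
have [xr|xr] := leP `|x| r; last by rewrite gr ?normr0.
by apply: le_trans (hK _ xr) _; exact: ler_norm.
Qed.

Lemma lmb_loc_integrable (f : E -> R) : lmb f -> loc_integrable f.
Proof.
move=> [mf bf] K cK; have [r [_ hr]] := compact_bounded cK.
have mK : measurable K.
  by apply: closed_rV_measurable; apply: compact_closed => //; exact: norm_hausdorff.
have KS : K `<=` cube (r + 1) by move=> x Kx; apply: hr => //; rewrite ltrDl.
have [C hC] := bf (r + 1).
apply: measurable_bounded_integrable => //.
- apply: (@le_lt_trans _ _ (mu (cube (r + 1)))); last exact: cube_fin.
  by apply: le_measure; rewrite ?inE//; exact: measurable_cube.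
- exact: measurable_funTS.
- exists C; split; first exact: num_real.
  by move=> M CM x /KS xr /=; apply: le_trans (ltW CM); exact: hC.
Qed.

(** The difference quotients of f are bounded by K, and their weak-star limit is
    the weak derivative: discrete integration by parts moves them to the test
    function, where they converge to the classical derivative. *)
Lemma diff_le_weak k (b : {ffun 'I_n -> 'I_k.+1}) (f : E -> R) (K : R) :
  continuous f -> diff_le (dirs b) K f ->
  exists2 g, weak_derivative b f g & forall x, `|g x| <= K.
Proof.
move=> cf fK.
pose h (j : nat) : R := j.+1%:R^-1.
have h0 j : 0 < h j by rewrite invr_gt0.
pose s j : seq ('I_n * R) := [seq (i, h j) | i <- dirs b].
have sb j : map fst (s j) = dirs b by rewrite -map_comp map_id.
have sh j : \prod_(p <- s j) p.2 = h j ^+ mdeg b.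
  by rewrite big_map /= -size_dirs; elim: (dirs b) => [|i r IH]; rewrite ?big_nil// big_cons IH exprS.
have s0 j p : p \in s j -> 0 < p.2 <= h j by move=> /mapP[i _ ->] /=; rewrite h0 lexx.
pose d j x := fdiffs (s j) f x / h j ^+ mdeg b.
have md j : measurable_fun setT (d j).
  apply: measurable_funM; last exact: measurable_cst.
  by apply: continuous_rV_measurable; exact: continuous_fdiffs.
have dK j x : `|d j x| <= K.
  rewrite /d normrM normfV (gtr0_norm (exprn_gt0 _ (h0 j))).
  rewrite ler_pdivrMr ?exprn_gt0// -sh; apply: fK => // p /s0 /andP[]//.
have [U [UU Uoo]] := ultraFilterLemma (_ : ProperFilter (\oo%classic : set_system nat)).
have [g [mg gK gw]] := weak_star UU md dK.
have lf : lmb f by split; [exact: continuous_rV_measurable|exact: continuous_locally_bounded].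
have lg : lmb g by split => //; exact: locally_bounded_cst gK.
exists g => //; split; [by case: lf|by []|exact: lmb_loc_integrable|exact: lmb_loc_integrable|].
move=> phi tphi; have [sphi _] := tphi; have [r pr] := test_function_supported tphi.
have cphi t : continuous (foldr (@partial R n) phi t).
  by move=> x; apply: differentiable_continuous; exact: sphi.
have nphi : nice phi by apply: nice_continuous pr; exact: (cphi [::]).
rewrite mpartial_dirs; set D := foldr _ _ _.
have cD : continuous D by exact: cphi.
have Dr : forall x, r < `|x| -> D x = 0 by exact: foldr_partial_vanish.
have [_ [C [r' [DC _]]]] := nice_continuous cD Dr.
set m := mdeg b.
pose q j x := bdiffs (s j) phi x / h j ^+ m.
have qE j x : exists2 y, `|y - x| <= h j *+ m & q j x = D y.
  have [y yx E1] := bdiffs_mvt x sphi (s0 j).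
  exists y; first by move: yx; rewrite size_map size_dirs.
  by rewrite /q E1 sh sb mulrC mulKf// expf_neq0// gt_eqF.
have h1 j : h j <= 1 by rewrite /h invf_le1 ?ler1n.
have qC j x : `|q j x| <= C by have [y _ ->] := qE j x.
have qr j x : r + m%:R < `|x| -> q j x = 0.
  move=> xr; have [y yx ->] := qE j x; apply: Dr.
  have : h j *+ m <= 1 *+ m by rewrite lerMn2r h1 orbT.
  by have := lerB_dist x y; rewrite distrC; lra.
have dq j : \int[mu]_x (d j x * phi x) = (-1) ^+ m * \int[mu]_x (f x * q j x).
  have sm : size (s j) = m by rewrite size_map size_dirs.
  have i1 : mu.-integrable setT (EFin \o (fdiffs (s j) f \* phi)).
    by apply: integrable_lmb_nice => //; exact: lmb_fdiffs.
  have i2 : mu.-integrable setT (EFin \o (f \* bdiffs (s j) phi)).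
    by apply: integrable_lmb_nice => //; exact: nice_bdiffs.
  transitivity ((h j ^+ m)^-1 * \int[mu]_x (fdiffs (s j) f x * phi x)).
    rewrite -(RintegralZl _ _ i1)//; apply: eq_Rintegral => x _ /=.
    by rewrite /d; ring.
  transitivity ((-1) ^+ m * ((h j ^+ m)^-1 * \int[mu]_x (f x * bdiffs (s j) phi x))).
    have sg : (-1) ^+ m * (-1) ^+ m = 1 :> R by rewrite -exprMn mulrNN mulr1 expr1n.
    rewrite integral_bdiffs// sm.
    by rewrite [RHS](_ : _ = ((-1) ^+ m * (-1) ^+ m) * ((h j ^+ m)^-1 * \int[mu]_x (fdiffs (s j) f x * phi x))); [rewrite sg mul1r|ring].
  congr (_ * _); rewrite -(RintegralZl _ _ i2)//; apply: eq_Rintegral => x _ /=.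
  by rewrite /q; ring.
(* Dominated convergence: the quotients q j of the test function converge to its
   derivative D, are bounded by C and live in one cube. *)
have cvq : (\int[mu]_x (f x * q j x)) @[j --> \oo] --> (\int[mu]_x (f x * D x) : R).
  pose G x := `|f x| * (C * \1_(cube (r + m%:R)) x).
  apply: (dominated_Rcvg (g := G)).
  - move=> j; apply: measurable_funM; first by case: lf.
    apply: measurable_funM; last exact: measurable_cst.
    by have [] := nice_bdiffs (s j) nphi.
  - move=> x; apply: cvgMr; apply/cvgrPdist_lt => e e0.
    have [dl dl0 hdl] := (continuous_rVP D).1 cD x e e0.
    have m1 : 0 < m.+1%:R :> R by rewrite ltr0n.
    near=> j; have [y yx ->] := qE j x; rewrite distrC; apply: hdl.
    apply: le_lt_trans yx _.
    apply: (@le_lt_trans _ _ (h j * m.+1%:R)).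
      by rewrite mulr_natr mulrSr lerDl (ltW (h0 j)).
    rewrite -ltr_pdivlMr//.
    near: j; apply: near_infty_natSinv_lt (PosNum (divr_gt0 dl0 m1)).
  - apply: integrable_lmb_nice.
      have [mf bf] := lf; split; first exact: measurableT_comp.
      by move=> t; have [K' hK'] := bf t; exists K' => x xt; rewrite normr_id; exact: hK'.
    split; first by apply: measurable_funM; [exact: measurable_cst|apply: measurable_indic; exact: measurable_cube].
    exists (`|C|), (r + m%:R); split => x.
      by rewrite normrM ler_piMr// indicE; case: (_ \in _); rewrite ?normr1 ?normr0.
    by move=> xr; rewrite indicE memNset ?mulr0// /cube /= leNgt xr.
  - move=> j x; rewrite /G normrM ler_wpM2l//.
    have [xr|xr] := leP `|x| (r + m%:R).
      by rewrite indicE mem_set// mulr1.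
    by rewrite qr// normr0 mulr_ge0//; apply: le_trans (DC 0); exact: normr_ge0.
have cvU : (\int[mu]_x (d j x * phi x)) @[j --> U] --> ((-1) ^+ m * \int[mu]_x (f x * D x) : R).
  have : (\int[mu]_x (d j x * phi x)) @[j --> \oo] --> ((-1) ^+ m * \int[mu]_x (f x * D x) : R).
    under eq_fun do rewrite dq.
    by apply: cvgMr; exact: cvq.
  by move=> H A /H; exact: Uoo.
have := ultra_cvgE cvU (gw _ nphi) => <-.
by rewrite mulrA -exprMn mulrNN mulr1 expr1n mul1r.
Unshelve. all: by end_near. Qed.

Lemma eucl_norm1 (y : 'rV[R]_1) : eucl_norm y = `|y 0 0|.
Proof. by rewrite /eucl_norm /dot_rV big_ord1 -expr2 sqrtr_sqr. Qed.

(** The Sobolev norm is an infimum over all families of weak derivatives, so it is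
    enough to have one family with the required bounds. *)
Lemma Wkoo_le k (f : E -> R) (K : {ffun 'I_n -> 'I_k.+1} -> R) :
  continuous f -> (forall b, (mdeg b <= k)%N -> diff_le (dirs b) (K b) f) ->
  (Wkoo_norm k (scalar_field f) <= (\sum_(b : {ffun 'I_n -> 'I_k.+1} | (mdeg b <= k)%N) K b)%:E)%E.
Proof.
move=> cf fK.
have H (b : {ffun 'I_n -> 'I_k.+1}) : exists g : E -> R, (mdeg b <= k)%N ->
    weak_derivative b f g /\ forall x, `|g x| <= K b.
  case: (boolP (mdeg b <= k)%N) => bk; last by exists (cst 0).
  by have [u u1 u2] := diff_le_weak cf (fK b bk); exists u.
have [g gP] := choice H.
apply: (@le_trans _ _ (\sum_(b : {ffun 'I_n -> 'I_k.+1} | (mdeg b <= k)%N)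
           ess_sup mu (fun x => (eucl_norm (scalar_field (g b) x))%:E))%E).
  apply: ereal_inf_lbound; exists (fun b => scalar_field (g b)) => // b bk j.
  have [w _] := gP b bk.
  have sE (u : E -> R) : (fun x => scalar_field u x 0 j) = u.
    by apply/funext => x; rewrite mxE (ord1 j) eqxx.
  by rewrite !sE.
rewrite -sumEFin; apply: lee_sum => b bk; apply: ess_sup_ler => x.
by have [_ gK] := gP b bk; rewrite lee_fin eucl_norm1 mxE eqxx mulr1n; exact: gK.
Qed.

End diff_to_weak.

(** * Functions with bounded second differences *)

Section C11.
Context {R : realType} {V : normedModType R}.
Implicit Types (f : V -> R) (x u v : V).

Definition lip_le (B : R) f := forall x u, `|f (x + u) - f x| <= B * `|u|.

(** Controlling second differences instead of second derivatives allows one to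
    work without differentiating the fields and the flow. *)
Definition diff2 f x u v : R := f (x + u + v) - f (x + u) - f (x + v) + f x.

Definition diff2_le (K : R) f := forall x u v, `|diff2 f x u v| <= K * `|u| * `|v|.

Section derivative.
Variables (B K : R) (f : V -> R).
Hypotheses (fB : lip_le B f) (fK : diff2_le K f) (B0 : 0 <= B) (K0 : 0 <= K).
Variables (U : set_system nat).
Hypotheses (UU : UltraFilter U) (Uoo : \oo%classic `<=` U).

Let p (N : nat) : R := 2 ^+ N.
Let p0 N : 0 < p N. Proof. exact: exprn_gt0. Qed.

Let quot x v N : R := p N * (f (x + (p N)^-1 *: v) - f x).

Let quot_le x v N : `|quot x v N| <= B * `|v|.
Proof.
rewrite normrM gtr0_norm// -ler_pdivlMl//; apply: le_trans (fB _ _) _.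
by rewrite normrZ normfV gtr0_norm// mulrCA.
Qed.

(** The derivative along the steps 2^-N; the ultrafilter provides the limit for
    all x and v simultaneously, before it is known that the quotients converge. *)
Definition deriv_dir x v : R := ulim U (quot x v).

Let cvg_quot x v : quot x v N @[N --> U] --> deriv_dir x v.
Proof. exact: ulimP (quot_le x v). Qed.

Lemma deriv_dir_le x v : `|deriv_dir x v| <= B * `|v|.
Proof.
apply: (ultra_le (v := fun N => `|quot x v N|) (w := cst (B * `|v|))).
- by apply: cvg_norm; exact: cvg_quot.
- exact: cvg_cst.
- exact: quot_le.
Qed.

(** Halving the step changes the difference quotient by a second difference, and
    these changes form a geometric series. *)
Lemma deriv_dir_taylor x v : `|f (x + v) - f x - deriv_dir x v| <= K * `|v| ^+ 2.
Proof.
have key N : `|quot x v 0 - quot x v N| <= K * `|v| ^+ 2 * (1 - (p N)^-1).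
  elim: N => [|N IH]; first by rewrite subrr normr0 /p expr0 invr1 subrr mulr0.
  have -> : quot x v 0 - quot x v N.+1 = (quot x v 0 - quot x v N) + (quot x v N - quot x v N.+1) by ring.
  apply: le_trans (ler_normD _ _) _.
  have pS : p N.+1 = 2 * p N by rewrite /p exprS.
  have pn : p N != 0 by rewrite gt_eqF.
  (* The step 2^-N v is twice w, so consecutive quotients differ by 2^N times the
     second difference of f in the directions w, w. *)
  set w := (p N.+1)^-1 *: v.
  have ww : (p N)^-1 *: v = w + w.
    by rewrite /w -scalerDl pS; congr (_ *: _); field.
  have -> : quot x v N - quot x v N.+1 = p N * diff2 f x w w.
    by rewrite /quot -/w ww /diff2 pS addrA; ring.
  have h : `|p N * diff2 f x w w| <= K * `|v| ^+ 2 * ((p N)^-1 - (p N.+1)^-1).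
    rewrite normrM gtr0_norm//.
    apply: (@le_trans _ _ (p N * (K * `|w| * `|w|))); first by rewrite ler_wpM2l// ltW.
    rewrite /w normrZ normfV gtr0_norm// pS.
    rewrite (_ : p N * _ = K * `|v| ^+ 2 * ((p N)^-1 / 4)); last by field.
    rewrite (_ : (p N)^-1 - _ = (p N)^-1 / 2); last by field.
    apply: ler_wpM2l; first by rewrite mulr_ge0 ?sqr_ge0.
    have : 0 < (p N)^-1 by rewrite invr_gt0.
    lra.
  by apply: le_trans (lerD IH h) _; rewrite -mulrDr ler_wpM2l// ?mulr_ge0 ?sqr_ge0//; lra.
have q0 : quot x v 0 = f (x + v) - f x by rewrite /quot /p expr0 invr1 scale1r mul1r.
rewrite -q0; apply: (ultra_le (v := fun N => `|quot x v 0 - quot x v N|) (w := cst (K * `|v| ^+ 2))).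
- by apply: cvg_norm; apply: cvgB; [exact: cvg_cst|exact: cvg_quot].
- exact: cvg_cst.
- move=> N; apply: le_trans (key N) _; rewrite ler_piMr ?mulr_ge0 ?sqr_ge0//.
  by rewrite gerBl ltW// invr_gt0.
Qed.

Let p_cvg (c : R) : (c / p N) @[N --> U] --> (0 : R).
Proof.
have : (c / p N) @[N --> \oo] --> (c * 0 : R).
  apply: cvgMr; rewrite (_ : (fun _ => _) = (fun N => (2^-1 : R) ^+ N)).
    by apply: cvg_expr; rewrite gtr0_norm; lra.
  by apply/funext => N; rewrite exprVn.
by rewrite mulr0 => H A /H; exact: Uoo.
Qed.

(** The defect of additivity of the difference quotients is a second difference,
    of order 2^-N. *)
Lemma deriv_dirD x u v : deriv_dir x (u + v) = deriv_dir x u + deriv_dir x v.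
Proof.
apply/eqP; rewrite -subr_eq0 -normr_le0.
apply: (ultra_le (v := fun N => `|quot x (u + v) N - (quot x u N + quot x v N)|)
   (w := fun N => (K * `|u| * `|v|) / p N)).
- apply: cvg_norm; apply: cvgB; first exact: cvg_quot.
  by apply: cvgD; exact: cvg_quot.
- exact: p_cvg.
- move=> N; set a := (p N)^-1 *: u; set b := (p N)^-1 *: v.
  have -> : quot x (u + v) N - (quot x u N + quot x v N) = p N * diff2 f x a b.
    by rewrite /quot scalerDr -/a -/b /diff2 addrA; ring.
  rewrite normrM gtr0_norm//.
  apply: (@le_trans _ _ (p N * (K * `|a| * `|b|))); first by rewrite ler_wpM2l// ltW.
  rewrite /a /b !normrZ normfV gtr0_norm//.
  have pn : p N != 0 by rewrite gt_eqF.
  by rewrite le_eqVlt; apply/orP; left; apply/eqP; field.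
Qed.

Lemma deriv_dirN x v : deriv_dir x (- v) = - deriv_dir x v.
Proof.
have d0 : deriv_dir x 0 = 0.
  by apply/eqP; rewrite -normr_le0; apply: le_trans (deriv_dir_le _ _) _; rewrite normr0 mulr0.
by apply/eqP; rewrite -addr_eq0 -deriv_dirD addNr d0.
Qed.

Lemma deriv_dirMn x v m : deriv_dir x (v *+ m) = deriv_dir x v *+ m.
Proof.
elim: m => [|m IH]; last by rewrite !mulrS deriv_dirD IH.
by apply/eqP; rewrite !mulr0n -normr_le0; apply: le_trans (deriv_dir_le _ _) _; rewrite normr0 mulr0.
Qed.

(** Additivity gives homogeneity for natural numbers; comparing N d with its
    integral part gives it for real d, up to an error of order 1/N. *)
Lemma deriv_dirZ x (c : R) v : deriv_dir x (c *: v) = c * deriv_dir x v.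
Proof.
suff pos (d : R) : 0 <= d -> deriv_dir x (d *: v) = d * deriv_dir x v.
  have [c0|c0] := leP 0 c; first exact: pos.
  have -> : c *: v = - ((- c) *: v) by rewrite scaleNr opprK.
  by rewrite deriv_dirN pos ?oppr_ge0 1?ltW// mulNr opprK.
move=> d0.
apply/eqP; rewrite -subr_eq0 -normr_le0; apply/ler_addgt0Pl => e e0; rewrite addr0.
pose C := 2 * B * `|v|.
have C0 : 0 <= C by rewrite /C !mulr_ge0.
pose N := (Num.truncn (C / e)).+1.
have N0 : 0 < N%:R :> R by rewrite ltr0n.
have CN : C <= e * N%:R by rewrite -ler_pdivrMl// mulrC; apply/ltW/truncnS_gt.
rewrite -(ler_pM2r N0); apply: le_trans CN.
have Nd0 : 0 <= N%:R * d by rewrite mulr_ge0.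
have /andP[m1 m2] := truncn_itv Nd0; set m := Num.truncn _ in m1 m2.
have E1 : N%:R * deriv_dir x (d *: v) = m%:R * deriv_dir x v + deriv_dir x ((N%:R * d - m%:R) *: v).
  rewrite !mulr_natl -!deriv_dirMn -deriv_dirD; congr deriv_dir.
  rewrite -[in LHS]scaler_nat scalerA -[v *+ m]scaler_nat -scalerDl mulr_natl.
  by rewrite [_ + (_ - _)]addrC subrK.
rewrite -[N%:R in X in X <= _](gtr0_norm N0) -normrM mulrC mulrBr E1.
have -> : m%:R * deriv_dir x v + deriv_dir x ((N%:R * d - m%:R) *: v) - N%:R * (d * deriv_dir x v) =
  deriv_dir x ((N%:R * d - m%:R) *: v) - (N%:R * d - m%:R) * deriv_dir x v by ring.
have m3 : `|N%:R * d - m%:R| <= 1 by rewrite ler_norml; move: m2; rewrite -natr1; lra.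
apply: le_trans (ler_normB _ _) _.
have h1 : `|deriv_dir x ((N%:R * d - m%:R) *: v)| <= B * `|v|.
  apply: le_trans (deriv_dir_le _ _) _; rewrite normrZ; apply: ler_wpM2l => //.
  by rewrite ler_piMl.
have h2 : `|(N%:R * d - m%:R) * deriv_dir x v| <= B * `|v|.
  by rewrite normrM; apply: le_trans (deriv_dir_le x v); rewrite ler_piMl.
by rewrite /C; lra.
Qed.

Lemma deriv_dir_lip x y v : `|deriv_dir x v - deriv_dir y v| <= K * `|x - y| * `|v|.
Proof.
apply: (ultra_le (v := fun N => `|quot x v N - quot y v N|) (w := cst (K * `|x - y| * `|v|))).
- by apply: cvg_norm; apply: cvgB; exact: cvg_quot.
- exact: cvg_cst.
- move=> N; set b := (p N)^-1 *: v.
  have -> : quot x v N - quot y v N = p N * diff2 f y (x - y) b.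
    by rewrite /quot -/b /diff2 [y + (x - y)]addrC subrK; ring.
  rewrite normrM gtr0_norm//.
  apply: (@le_trans _ _ (p N * (K * `|x - y| * `|b|))); first by rewrite ler_wpM2l// ltW.
  rewrite /b normrZ normfV gtr0_norm//.
  have pn : p N != 0 by rewrite gt_eqF.
  by rewrite /= le_eqVlt; apply/orP; left; apply/eqP; field.
Qed.

End derivative.

(** A Lipschitz continuous function with second differences bounded by
    K |u| |v| is of class C^{1,1}. *)
Lemma C11_derivative (B K : R) f : lip_le B f -> diff2_le K f -> 0 <= B -> 0 <= K ->
  exists df : V -> V -> R,
  [/\ forall x u v, df x (u + v) = df x u + df x v,
      forall x c v, df x (c *: v) = c * df x v,
      forall x v, `|df x v| <= B * `|v|,
      forall x v, `|f (x + v) - f x - df x v| <= K * `|v| ^+ 2 &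
      forall x y v, `|df x v - df y v| <= K * `|x - y| * `|v|].
Proof.
move=> fB fK B0 K0.
have [U [UU Uoo]] := ultraFilterLemma (_ : ProperFilter (\oo%classic : set_system nat)).
exists (deriv_dir f U); split.
- by move=> x u v; exact: (@deriv_dirD B K).
- by move=> x c v; exact: (@deriv_dirZ B K).
- by move=> x v; exact: deriv_dir_le.
- by move=> x v; exact: (@deriv_dir_taylor B).
- by move=> x y v; exact: (@deriv_dir_lip B).
Qed.

End C11.

Section C11_rV.
Context {R : realType} {n : nat}.
Local Notation E := 'rV[R]_n.
Implicit Types (f g : E -> R) (x u v : E).
Local Notation e_ i := (delta_mx 0 i : E).

Lemma norm_delta_rV (h : R) i : `|h *: e_ i| <= `|h|.
Proof.
apply: normr_rV_le => // j; rewrite !mxE eqxx /= normrM.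
by case: eqP => _; rewrite ?normr1 ?normr0 ?mulr1 ?mulr0.
Qed.

(** Moving one coordinate after the other. *)
Lemma lip_le_coord g (B : R) : 0 <= B ->
  (forall (i : 'I_n) h x, `|g (x + h *: e_ i) - g x| <= B * `|h|) -> lip_le (n%:R * B) g.
Proof.
move=> B0 H x u.
have key (r : seq 'I_n) : `|g (x + \sum_(i <- r) u 0 i *: e_ i) - g x| <= (size r)%:R * B * `|u|.
  elim: r => [|i r IH]; first by rewrite big_nil addr0 subrr normr0 !mul0r.
  rewrite big_cons [_ + \sum_(_ <- _) _]addrC addrA.
  set y := x + _ in IH *; rewrite (_ : _ - g x = (g (y + u 0 i *: e_ i) - g y) + (g y - g x)); last by ring.
  apply: le_trans (ler_normD _ _) _; rewrite /= -natr1 mulrDl mul1r mulrDl addrC.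
  apply: lerD => //; apply: le_trans (H _ _ _) _.
  by rewrite ler_wpM2l// normr_rV_coord.
have := key (enum 'I_n); rewrite size_enum_ord.
by rewrite big_enum -row_sum_delta.
Qed.

Lemma diff2_le_coord g (K : R) : 0 <= K ->
  (forall (i j : 'I_n) h k x, `|diff2 g x (h *: e_ i) (k *: e_ j)| <= K * `|h| * `|k|) ->
  diff2_le (n%:R * (n%:R * K)) g.
Proof.
move=> K0 H x u v.
have h1 (i : 'I_n) h y : `|diff2 g y u (h *: e_ i)| <= n%:R * (K * `|h|) * `|u|.
  have := @lip_le_coord (fun z => g (z + h *: e_ i) - g z) (K * `|h|).
  rewrite mulr_ge0// => /(_ isT) L.
  have {}L := L (fun j k z => _).
  rewrite (_ : diff2 _ _ _ _ = g (y + u + h *: e_ i) - g (y + u) - (g (y + h *: e_ i) - g y)); last by rewrite /diff2; ring.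
  apply: L => j k z; rewrite mulrAC; apply: le_trans (H j i k h z).
  by rewrite le_eqVlt; apply/orP; left; apply/eqP; congr (`|_|); rewrite /diff2; ring.
have := @lip_le_coord (fun z => g (z + u) - g z) (n%:R * K * `|u|).
rewrite !mulr_ge0// => /(_ isT) L.
rewrite (_ : diff2 _ _ _ _ = g (x + v + u) - g (x + v) - (g (x + u) - g x)); last by rewrite /diff2 [x + v + u]addrAC; ring.
apply: (@le_trans _ _ (n%:R * (n%:R * K * `|u|) * `|v|)); last first.
  by rewrite le_eqVlt; apply/orP; left; apply/eqP; ring.
apply: L => i h z; apply: (@le_trans _ _ (n%:R * (K * `|h|) * `|u|)); last first.
  by rewrite le_eqVlt; apply/orP; left; apply/eqP; ring.
apply: le_trans (h1 i h z).
by rewrite le_eqVlt; apply/orP; left; apply/eqP; congr (`|_|); rewrite /diff2 [z + u + _]addrAC; ring.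
Qed.

Lemma diff_le_lip f (K : R) i : diff_le [:: i] K f ->
  forall h x, `|f (x + h *: e_ i) - f x| <= K * `|h|.
Proof.
move=> H; have pos h x : 0 < h -> `|f (x + h *: e_ i) - f x| <= K * h.
  move=> h0; have := H [:: (i, h)] x erefl; rewrite big_seq1 /= /fdiff /step /=; apply.
  by move=> p; rewrite inE => /eqP ->.
move=> h x; have [h0|h0|->] := ltrgtP h 0; last by rewrite scale0r addr0 subrr normr0 mulr0.
  have := pos (- h) (x + h *: e_ i); rewrite oppr_gt0 => /(_ h0).
  by rewrite scaleNr addrK distrC (ltr0_norm h0).
by rewrite (gtr0_norm h0); exact: pos.
Qed.

Lemma diff_le_diff2 f (K : R) i j : diff_le [:: i; j] K f ->
  forall h k x, `|diff2 f x (h *: e_ i) (k *: e_ j)| <= K * `|h| * `|k|.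
Proof.
move=> H; have pos h k x : 0 < h -> 0 < k -> `|diff2 f x (h *: e_ i) (k *: e_ j)| <= K * h * k.
  move=> h0 k0; have := H [:: (i, h); (j, k)] x erefl; rewrite big_cons big_seq1 /= /fdiff /step /= mulrA.
  rewrite (_ : diff2 _ _ _ _ = f (x + h *: e_ i + k *: e_ j) - f (x + h *: e_ i) - (f (x + k *: e_ j) - f x)); last by rewrite /diff2; ring.
  by apply => p; rewrite !inE => /orP[] /eqP ->.
have posh h k x : 0 < h -> `|diff2 f x (h *: e_ i) (k *: e_ j)| <= K * h * `|k|.
  move=> h0; have [k0|k0|->] := ltrgtP k 0.
  - have := pos h (- k) (x + k *: e_ j) h0; rewrite oppr_gt0 => /(_ k0).
    rewrite (ltr0_norm k0) -normrN; congr (_ <= _); congr (`|_|).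
    by rewrite /diff2 scaleNr addrK [x + k *: _ + h *: _]addrAC addrK; ring.
  - by rewrite (gtr0_norm k0); exact: pos.
  - rewrite scale0r (_ : diff2 _ _ _ _ = 0) ?normr0 ?mulr0//.
    by rewrite /diff2 !addr0; ring.
move=> h k x; have [h0|h0|->] := ltrgtP h 0.
- have := posh (- h) k (x + h *: e_ i); rewrite oppr_gt0 => /(_ h0).
  rewrite (ltr0_norm h0) -normrN; congr (_ <= _); congr (`|_|).
  by rewrite /diff2 scaleNr addrK; ring.
- by rewrite (gtr0_norm h0); exact: posh.
- rewrite scale0r (_ : diff2 _ _ _ _ = 0) ?normr0 ?mulr0 ?mul0r//.
  by rewrite /diff2 !addr0; ring.
Qed.

(** The multi-index of a list of directions; the direction order is lost, which is
    harmless because finite differences in different directions commute. *)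
Definition mults k (r : seq 'I_n) : {ffun 'I_n -> 'I_k.+1} := [ffun l => inord (count_mem l r)].

Lemma dirs_mults k r : (size r <= k)%N -> perm_eq (dirs (mults k r)) r.
Proof.
move=> rk; apply/permP => a; apply/(permP (s1 := dirs (mults k r)) (s2 := r)).
rewrite /perm_eq; apply/allP => i _ /=.
rewrite /dirs count_flatten -map_comp sumnE big_map big_enum /= (bigD1 i)//= big1 => [|l li].
  rewrite addn0 count_nseq /= eqxx mul1n ffunE inordK// ltnS.
  by apply: leq_trans rk; exact: count_size.
by rewrite count_nseq /= (negPf li) mul0n.
Qed.

Lemma mdeg_mults k r : (size r <= k)%N -> mdeg (mults k r) = size r.
Proof. by move=> /dirs_mults /perm_size; rewrite size_dirs. Qed.

(** The finite differences of order at most two, bounded along the coordinate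
    directions, control those in all directions. *)
Lemma Wkoo_lt_C11 k m (f : E -> 'rV[R]_m) (N : R) :
  (forall j, continuous (fun x => f x 0 j)) -> (Wkoo_norm k f < N%:E)%E -> (1 < k)%N ->
  [/\ 0 <= N, forall x, `|f x| <= N, forall j, lip_le (n%:R * N) (fun x => f x 0 j) &
      forall j, diff2_le (n%:R * (n%:R * N)) (fun x => f x 0 j)].
Proof.
move=> cf fN k1; have [K [K0 KP KN]] := Wkoo_lt_diff_le cf fN.
have N0 : 0 <= N by apply: le_trans (ltW KN); exact: sumr_ge0.
have Kb b : (mdeg b <= k)%N -> K b <= N.
  move=> bk; apply: le_trans (ltW KN); rewrite (bigD1 b)//= lerDl.
  exact: sumr_ge0.
have mono r (a b : R) g : a <= b -> diff_le r a g -> diff_le r b g.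
  move=> ab H s x sr s0; apply: le_trans (H s x sr s0) _; rewrite ler_wpM2r//.
  by rewrite big_seq; apply: prodr_ge0 => p ps; exact/ltW/s0.
have G r j : (size r <= k)%N -> exists2 r', perm_eq r' r & diff_le r' N (fun x => f x 0 j).
  move=> rk; exists (dirs (mults k r)); first exact: dirs_mults.
  have dk : (mdeg (mults k r) <= k)%N by rewrite mdeg_mults.
  by apply: mono (KP _ j dk); exact: Kb.
have nN : 0 <= n%:R * N by rewrite mulr_ge0.
split => //.
- move=> x; apply: normr_rV_le => // j.
  have [r' /perm_nilP -> /(_ [::] x erefl)] := G [::] j isT.
  by rewrite big_nil mulr1; apply.
- move=> j; apply: lip_le_coord => // i.
  have [r' /perm_small_eq -> //] := G [:: i] j (ltnW k1).
  exact: diff_le_lip.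
- move=> j; apply: diff2_le_coord => // i l.
  have [r' rr] := G [:: i; l] j k1.
  have [->|->] : r' = [:: i; l] \/ r' = [:: l; i].
    have := perm_size rr; case: r' rr => [//|a [//|b [|//]]] rr _.
    have : a \in [:: i; l] by rewrite -(perm_mem rr) mem_head.
    rewrite !inE => /orP[] /eqP ea; [left|right]; congr (_ :: _) => //; move: rr; rewrite ea.
      by rewrite perm_cons => /perm_small_eq ->.
    rewrite perm_sym (perm_catC [:: i] [:: l]) /= perm_sym perm_cons => /perm_small_eq -> //.
    exact: diff_le_diff2.
  move=> H h h' x; have := diff_le_diff2 H h' h x.
  rewrite mulrAC; congr (_ <= _); congr (`|_|).
  by rewrite /diff2 [x + _ + _]addrAC; ring.
Qed.

Lemma diff_expansion (V W : normedModType R) (f : V -> W) (df : {linear V -> W}) (x : V) :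
  continuous df -> f \o shift x = cst (f x) + df +o_ 0 id ->
  differentiable f x /\ 'd f x = df :> (V -> W).
Proof.
move=> cdf fo; have dE := diff_unique cdf fo; split => //.
by apply/diff_locallyP; rewrite dE; split.
Qed.

(** This identifies the Jacobian matrix, which is defined by a choice of
    derivative, from a Taylor expansion. *)
Lemma jacobian_unique m (f : E -> 'rV[R]_m) x (J : 'M[R]_(n, m)) (C : R) :
  (forall v, `|f (x + v) - f x - v *m J| <= C * `|v| ^+ 2) -> differentiable f x /\ 'J f x = J.
Proof.
move=> H.
have mulJ v : `|v *m J| <= n%:R * `|J| * `|v|.
  apply: normr_rV_le; first by rewrite !mulr_ge0.
  move=> j; rewrite mxE; apply: le_trans (ler_norm_sum _ _ _) _.
  apply: (@le_trans _ _ (\sum_(i < n) `|J| * `|v|)); last first.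
    by rewrite sumr_const card_ord -mulrA mulr_natl.
  apply: ler_sum => i _; rewrite normrM mulrC ler_pM//; last exact: normr_rV_coord.
  by rewrite /Num.norm/= mx_normrE; apply: (le_bigmax _ (fun ij => `|J ij.1 ij.2|) (i, j)).
have cJ : continuous (mulmxr J : E -> 'rV[R]_m).
  apply/(linear_bounded_continuous (mulmxr J : {linear E -> 'rV[R]_m})).
  exists (n%:R * `|J|); split; first by rewrite ger0_real// mulr_ge0.
  move=> N hN; apply/nbhs_ballP; exists 1 => //= y.
  rewrite mx_norm_ball /ball_ /= sub0r normrN => y1.
  apply: le_trans (mulJ y) _; apply: le_trans (ltW hN).
  by rewrite ler_piMr ?mulr_ge0// ltW.
have [df dE] : differentiable f x /\ 'd f x = (mulmxr J : {linear E -> 'rV[R]_m}) :> (E -> 'rV[R]_m).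
  apply: diff_expansion; first exact: cJ.
  apply/eqaddoP => eps e0; apply/nbhs_ballP.
  have C1 : 0 < eps / (`|C| + 1) by rewrite divr_gt0// ltr_wpDl.
  exists (eps / (`|C| + 1)) => //= y; rewrite mx_norm_ball /ball_ /= sub0r normrN => y1.
  rewrite -[X in `|X|]/(f (y + x) - (f x + y *m J)) opprD addrA [y + x]addrC.
  apply: le_trans (H y) _; rewrite expr2 mulrA ler_wpM2r//.
  apply: (@le_trans _ _ ((`|C| + 1) * `|y|)).
    by rewrite ler_wpM2r// (le_trans (ler_norm C))// lerDl.
  by rewrite mulrC -ler_pdivlMr ?ltr_wpDl// ltW.
split => //; apply/matrixP => i j; by rewrite /jacobian /lin1_mx mxE dE /= -rowE mxE.
Qed.

Lemma C11_jacobian m (f : E -> 'rV[R]_m) (B K : R) : 0 <= B -> 0 <= K ->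
  (forall j, lip_le B (fun x => f x 0 j)) -> (forall j, diff2_le K (fun x => f x 0 j)) ->
  [/\ forall x, differentiable f x,
      forall x v, `|f (x + v) - f x - v *m 'J f x| <= K * `|v| ^+ 2,
      forall x i j, `|'J f x i j| <= B &
      forall x y i j, `|'J f x i j - 'J f y i j| <= K * `|x - y|].
Proof.
move=> B0 K0 fB fK.
have /choice[df dfP] j := C11_derivative (fB j) (fK j) B0 K0.
pose J x : 'M[R]_(n, m) := \matrix_(i, j) df j x (e_ i).
have dfE j x v : df j x v = \sum_i v 0 i * df j x (e_ i).
  have [dD dZ _ _ _] := dfP j.
  have d0 : df j x 0 = 0 by rewrite -(scale0r (0 : E)) dZ mul0r.
  rewrite [in LHS](row_sum_delta v) (@big_morph _ _ (df j x) 0 +%R 0 +%R (dD x) d0).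
  by apply: eq_bigr => i _; rewrite dZ.
have fJ x v : `|f (x + v) - f x - v *m J x| <= K * `|v| ^+ 2.
  apply: normr_rV_le => [|j]; first by rewrite mulr_ge0.
  have [_ _ _ h _] := dfP j; have := h x v.
  rewrite !mxE dfE; congr (`|_ - _| <= _).
  by apply: eq_bigr => i _; rewrite mxE.
have JE x : differentiable f x /\ 'J f x = J x := jacobian_unique (fJ x).
split.
- by move=> x; have [] := JE x.
- by move=> x v; rewrite (JE x).2.
- move=> x i j; rewrite (JE x).2 mxE; have [_ _ h _ _] := dfP j.
  apply: le_trans (h _ _) _; rewrite ler_piMr// -[e_ i]scale1r.
  by apply: le_trans (norm_delta_rV _ _) _; rewrite normr1.
- move=> x y i j; rewrite !(JE _).2 !mxE; have [_ _ _ _ h] := dfP j.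
  apply: le_trans (h _ _ _) _; rewrite ler_piMr ?mulr_ge0// -[e_ i]scale1r.
  by apply: le_trans (norm_delta_rV _ _) _; rewrite normr1.
Qed.

End C11_rV.

(** * Caratheodory differential equations *)

Section primitive.
Context {R : realType}.
Local Notation leb := (@lebesgue_measure R).
Implicit Types (f g : R -> R) (t s r : R).

(** Keeping the base point t fixed makes differences of primitives meaningful for
    arguments in both orders. *)
Definition prim t f s : R := \int[leb]_(r in `[t, s]) f r.

Lemma prim_self t f : prim t f t = 0.
Proof. by rewrite /prim set_itv1 Rintegral_set1. Qed.

Lemma integrableS_itv t T s r f : t <= s -> r <= T ->
  leb.-integrable `[t, T] (EFin \o f) -> leb.-integrable `[s, r] (EFin \o f).
Proof.
move=> ts rT; apply: integrableS => //.
by apply: subset_itvScc; rewrite bnd_simp.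
Qed.

Lemma prim_sub t T s r f : t <= s -> s <= r -> r <= T ->
  leb.-integrable `[t, T] (EFin \o f) ->
  prim t f r - prim t f s = \int[leb]_(x in `[s, r]) f x.
Proof.
move=> ts sr rT itf; rewrite /prim Rintegral_itvB ?bnd_simp//; last first.
  exact: integrableS_itv rT itf.
rewrite Rintegral_itv_obnd_cbnd//.
have := integrableS_itv ts rT itf; apply: integrableS => //.
exact: subset_itv_oc_cc.
Qed.

(** The weight exp (l |r - s0|) is chosen because its integral is itself divided by
    l: this is what makes the Gronwall and Picard iterations contract. *)
Lemma exp_integral (k l c s r : R) : l != 0 -> s <= r ->
  (\int[leb]_(x in `[s, r]) (k * expR (l * (x - c)))%:E)%E =
  (k / l * (expR (l * (r - c)) - expR (l * (s - c))))%:E.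
Proof.
move=> l0; rewrite le_eqVlt => /orP[/eqP <-|sr].
  by rewrite set_itv1 integral_set1 subrr mulr0.
pose F x : R := k / l * expR (l * (x - c)).
have dG (k' : R) x : is_derive x (1 : R) (fun x => k' * expR (l * (x - c))) (k' * l * expR (l * (x - c))).
  have h1 : is_derive x (1 : R) (fun x => l * (x - c)) l.
    by apply: is_derive_eq; rewrite subr0 scaler1.
  apply: is_derive_eq.
  by rewrite /GRing.scale /=; ring.
have dF x : is_derive x (1 : R) F (k * expR (l * (x - c))).
  by have := dG (k / l) x; rewrite divfK.
have cG (k' : R) : continuous (fun x => k' * expR (l * (x - c)) : R).
  by move=> x; apply: differentiable_continuous; apply/derivable1_diffP; have [] := dG k' x.
have cF : continuous F := cG _.
rewrite (@continuous_FTC2 R _ F)//.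
- by rewrite /F -EFinB -mulrBr.
- by apply: continuous_subspaceT; exact: cG.
- split.
  + by move=> x _; have [] := dF x.
  + by apply: cvg_at_right_filter; exact: cF.
  + by apply: cvg_at_left_filter; exact: cF.
- by move=> x _; rewrite derive1E; have [_ ->] := dF x.
Qed.

Lemma prim_osc t T s0 f (k l : R) : t <= s0 <= T -> 0 < l -> 0 <= k ->
  leb.-integrable `[t, T] (EFin \o f) ->
  {ae leb, forall r, t <= r <= T -> `|f r| <= k * expR (l * `|r - s0|)} ->
  forall r, t <= r <= T -> `|prim t f r - prim t f s0| <= k / l * (expR (l * `|r - s0|) - 1).
Proof.
move=> /andP[ts0 s0T] l0 k0 itf fk r /andP[tr rT].
(* The two sides of s0 are treated alike, with l' = l on the right and l' = - l on
   the left. *)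
have key (s s' l' : R) : t <= s -> s <= s' -> s' <= T -> l' != 0 ->
    (forall x, s <= x <= s' -> l' * (x - s0) = l * `|x - s0|) ->
    `|prim t f s' - prim t f s| <= k / l' * (expR (l' * (s' - s0)) - expR (l' * (s - s0))).
  move=> ts ss' s'T l'0 h; rewrite (prim_sub ts ss' s'T itf).
  have its := integrableS_itv ts s'T itf.
  apply: le_trans (le_normr_Rintegral _ its) _ => //.
  rewrite -lee_fin -exp_integral// /Rintegral fineK; last first.
    by apply: integrable_fin_num => //; exact: integrable_norm its.
  have mf := measurable_int leb its.
  apply: ae_ge0_le_integral => //.
  - by have := measurable_int leb (integrable_norm its).
  - by move=> x _; rewrite lee_fin mulr_ge0// expR_ge0.
  - apply: measurable_funTS; apply/measurable_EFinP.
    apply: measurable_funM => //; apply: measurableT_comp => //.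
    by apply: measurable_funM => //; apply: measurable_funB.
  - apply: (@filterS _ _ (ae_filter_ringOfSetsType leb)) fk => x H; rewrite /= in_itv/= => /andP[sx xs'].
    rewrite lee_fin h ?sx//; apply: H.
    by rewrite (le_trans ts sx) (le_trans xs' s'T).
have [sr|rs] := leP s0 r.
  have := key s0 r l ts0 sr rT; rewrite gt_eqF// subrr mulr0 expR0 => H.
  have xE x : s0 <= x <= r -> l * (x - s0) = l * `|x - s0|.
    by move=> /andP[sx _]; rewrite ger0_norm// subr_ge0.
  have := H isT xE; rewrite xE ?sr ?lexx//.
have := key r s0 (- l) tr (ltW rs) s0T; rewrite oppr_eq0 gt_eqF// subrr mulr0 expR0 => H.
have xE x : r <= x <= s0 -> - l * (x - s0) = l * `|x - s0|.
  by move=> /andP[_ sx]; rewrite ler0_norm ?subr_le0//; ring.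
have := H isT xE; rewrite xE ?lexx ?(ltW rs)// distrC => h; apply: le_trans h _.
by rewrite invrN mulrN mulNr -mulrN opprB.
Qed.

Lemma prim_lip t T f (N : R) : 0 <= N ->
  leb.-integrable `[t, T] (EFin \o f) ->
  {ae leb, forall r, t <= r <= T -> `|f r| <= N} ->
  forall s r, t <= s <= T -> t <= r <= T -> `|prim t f r - prim t f s| <= N * `|r - s|.
Proof.
move=> N0 itf fN.
suff key s r : t <= s -> s <= r -> r <= T -> `|prim t f r - prim t f s| <= N * (r - s).
  move=> s r /andP[ts sT] /andP[tr rT]; have [sr|rs] := leP s r.
    by rewrite (ger0_norm (_ : 0 <= r - s)) ?subr_ge0//; exact: key.
  by rewrite distrC [`|r - s|]distrC (gtr0_norm (_ : 0 < s - r)) ?subr_gt0//; apply: key => //; exact: ltW.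
move=> ts sr rT; rewrite (prim_sub ts sr rT itf).
have its := integrableS_itv ts rT itf.
apply: le_trans (le_normr_Rintegral _ its) _ => //.
rewrite -lee_fin /Rintegral fineK; last first.
  by apply: integrable_fin_num => //; exact: integrable_norm its.
apply: (@le_trans _ _ (\int[leb]_(x in `[s, r]) (cst N%:E x))%E); last first.
  have e : leb `[s, r]%classic = (r - s)%:E.
    apply: (etrans (lebesgue_measure_itv `[s, r])) => /=.
    rewrite lte_fin; case: ltP => [//|ba]; congr EFin; apply/esym/eqP.
    by rewrite subr_eq0 eq_le ba sr.
  by rewrite integral_cst//= [X in (_ * X)%E]e EFinM.
apply: ae_ge0_le_integral => //.
- by have := measurable_int leb (integrable_norm its).
- apply: (@filterS _ _ (ae_filter_ringOfSetsType leb)) fN => x H; rewrite /= in_itv/= => /andP[sx xs'].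
  by rewrite lee_fin; apply: H; rewrite (le_trans ts sx) (le_trans xs' rT).
Qed.

Lemma primB t T r f g : r <= T -> leb.-integrable `[t, T] (EFin \o f) ->
  leb.-integrable `[t, T] (EFin \o g) ->
  prim t (fun x => f x - g x) r = prim t f r - prim t g r.
Proof.
by move=> rT itf itg; rewrite /prim RintegralB//; exact: (integrableS_itv (lexx t) rT).
Qed.

Lemma eq_prim t r f g : f =1 g -> prim t f r = prim t g r.
Proof. by move=> fg; apply: eq_Rintegral => x _; exact: fg. Qed.

Lemma integrable_sub_itv t T f g : leb.-integrable `[t, T] (EFin \o f) ->
  leb.-integrable `[t, T] (EFin \o g) -> leb.-integrable `[t, T] (EFin \o (fun x => f x - g x)).
Proof. by move=> itf itg; apply: (integrableB _ itf itg). Qed.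

End primitive.

Lemma le_geom {R : realType} (a b c : R) : (forall k, a <= b + (2^-1) ^+ k * c) -> a <= b.
Proof.
move=> H.
have h : (b + (2^-1) ^+ k * c) @[k --> \oo] --> (b + 0 * c : R).
  apply: cvgD; first exact: cvg_cst.
  by apply: cvgMl; apply: cvg_expr; rewrite gtr0_norm; lra.
rewrite mul0r addr0 in h.
by apply: (ler_cvg_to (cvg_cst a) h); exact: nearW.
Qed.

Section gronwall.
Context {R : realType} (t T : R).
Local Notation leb := (@lebesgue_measure R).

(** Two-sided in time, for merely integrable right hand sides.  In the norm
    weighted by exp (2 B |r - s0|) the integral operator is a contraction of ratio
    1/2, so an a priori bound D improves to a bound independent of D. *)
Lemma gronwall m (e f : R -> 'rV[R]_m) (a B D s0 : R) : t <= s0 <= T -> 0 < B -> 0 <= a ->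
  (forall i, leb.-integrable `[t, T] (EFin \o (fun r => f r 0 i))) ->
  (forall s i, t <= s <= T ->
     e s 0 i - e s0 0 i = prim t (fun r => f r 0 i) s - prim t (fun r => f r 0 i) s0) ->
  {ae leb, forall r, t <= r <= T -> `|f r| <= a + B * `|e r|} ->
  (forall r, t <= r <= T -> `|e r| <= D) ->
  forall r, t <= r <= T -> `|e r| <= (`|e s0| + a / B) * expR (2 * B * `|r - s0|).
Proof.
move=> hs0 B0 a0 itf ef fe eD.
pose w (r : R) : R := expR (2 * B * `|r - s0|).
have B2 : 0 < 2 * B by rewrite mulr_gt0.
have w1 r : 1 <= w r by rewrite /w -[leLHS]expR0 ler_expR mulr_ge0// ltW.
have w0 r : 0 < w r by exact: expR_gt0.
have D0 : 0 <= D by apply: le_trans (eD _ hs0).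
pose A : R := `|e s0| + a / B.
have aB : 0 <= a / B by rewrite divr_ge0// ltW.
have A0 : 0 <= A by rewrite addr_ge0.
(* Each step inserts the current bound in the equation and halves the part
   that depends on D. *)
have key (k : nat) r : t <= r <= T -> `|e r| <= (A + (2^-1) ^+ k * D) * w r.
  elim: k r => [|k IH] r tr.
    rewrite expr0 mul1r; apply: le_trans (eD _ tr) _.
    apply: (@le_trans _ _ (A + D)); first by rewrite lerDr.
    by rewrite ler_peMr// addr_ge0.
  rewrite exprS; set d := (2^-1) ^+ k * D in IH; rewrite -mulrA -/d.
  have d0 : 0 <= d by rewrite mulr_ge0// exprn_ge0// invr_ge0.
  have fi i : `|prim t (fun r => f r 0 i) r - prim t (fun r => f r 0 i) s0| <=
      (a + B * (A + d)) / (2 * B) * (w r - 1).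
    apply: (prim_osc hs0 B2 _ (itf i) _ tr).
      by rewrite addr_ge0// mulr_ge0 ?addr_ge0// ltW.
    apply: (@filterS _ _ (ae_filter_ringOfSetsType leb)) fe => x H tx.
    apply: le_trans (normr_rV_coord _ _) _; apply: le_trans (H tx) _.
    rewrite -/(w x) mulrDl; apply: lerD; first by rewrite ler_peMr.
    by rewrite -mulrA; apply: ler_wpM2l; [exact: ltW|exact: IH].
  have wr := w1 r; have wr0 := w0 r.
  apply: normr_rV_le => [|i].
    by rewrite mulr_ge0 ?(ltW wr0)// addr_ge0// mulr_ge0// invr_ge0.
  have -> : e r 0 i = e s0 0 i + (e r 0 i - e s0 0 i) by ring.
  rewrite (ef _ _ tr); apply: le_trans (ler_normD _ _) _.
  apply: le_trans (lerD (normr_rV_coord _ _) (fi i)) _.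
  rewrite (_ : (a + B * (A + d)) / (2 * B) = (a / B + A + d) / 2); last by field; rewrite gt_eqF.
  have h1 : (A + 2^-1 * d) * w r - (`|e s0| + (a / B + A + d) / 2 * (w r - 1)) =
     `|e s0| / 2 * (w r - 1) + d / 2 + a / B by rewrite /A; field; rewrite gt_eqF.
  rewrite -subr_ge0 h1 !addr_ge0// ?mulr_ge0 ?invr_ge0// subr_ge0//.
move=> r tr; rewrite -/(w r) -/A; apply: (@le_geom _ _ _ (D * w r)) => k.
by apply: le_trans (key k r tr) _; rewrite mulrDl -mulrA.
Qed.

End gronwall.

Section ode.
Context {R : realType} {n : nat} (t T N B K : R) (F : R -> 'rV[R]_n -> 'rV[R]_n).
Local Notation E := 'rV[R]_n.
Local Notation leb := (@lebesgue_measure R).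
Implicit Types (g : R -> E).

(** Measurability is required only along continuous curves, the only place where
    the field is evaluated. *)
Definition field_measurable : Prop :=
  forall g, {within `[t, T], continuous g} ->
     forall i, measurable_fun `[t, T] (fun r => F r (g r) 0 i : R).

Definition field_bounds : Prop :=
  {ae leb, forall r, t <= r <= T ->
     [/\ forall x, `|F r x| <= N, forall x y, `|F r x - F r y| <= B * `|x - y| &
         forall x u v, `|F r (x + u + v) - F r (x + u) - F r (x + v) + F r x| <=
           K * `|u| * `|v|]}.

(** The starting value is not imposed: it is [g t], and [t] is only the origin of
    the primitives. *)
Definition solves g : Prop := forall i,
  leb.-integrable `[t, T] (EFin \o (fun r => F r (g r) 0 i)) /\
  forall s, t <= s <= T -> g s 0 i = g t 0 i + prim t (fun r => F r (g r) 0 i) s.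

Hypotheses (FB : field_bounds) (B0 : 0 < B) (N0 : 0 <= N) (K0 : 0 <= K) (tT : t <= T).

Let w (u : R) : R := expR (2 * B * u).

Lemma solves_sub g s r i : solves g -> t <= s <= T -> t <= r <= T ->
  g r 0 i - g s 0 i = prim t (fun r => F r (g r) 0 i) r - prim t (fun r => F r (g r) 0 i) s.
Proof.
by move=> Fg ts tr; have [_ H] := Fg i; rewrite (H r)// (H s)//; ring.
Qed.

Lemma field_le g i : {ae leb, forall r, t <= r <= T -> `|F r (g r) 0 i| <= N}.
Proof.
apply: (@filterS _ _ (ae_filter_ringOfSetsType leb)) FB => r H tr.
by have [h _ _] := H tr; apply: le_trans (h _); exact: normr_rV_coord.
Qed.

Lemma solves_lip g s r : solves g -> t <= s <= T -> t <= r <= T ->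
  `|g r - g s| <= N * `|r - s|.
Proof.
move=> Fg ts tr; apply: normr_rV_le => [|i]; first by rewrite mulr_ge0.
rewrite !mxE (solves_sub _ Fg ts tr).
by apply: (prim_lip N0 (Fg i).1 _ ts tr); exact: field_le.
Qed.

(** The exponent involves [|r - s0|] only, so the estimate can be read forwards and
    backwards in time; the latter gives the injectivity of the flow. *)
Lemma solves_dist g g' s0 r : solves g -> solves g' -> t <= s0 <= T -> t <= r <= T ->
  `|g r - g' r| <= `|g s0 - g' s0| * w `|r - s0|.
Proof.
move=> Fg Fg' ts tr.
have := @gronwall _ t T n (fun r => g r - g' r) (fun r => F r (g r) - F r (g' r)) 0 B
  (`|g s0 - g' s0| + 2 * (N * (T - t))) s0 ts B0 (lexx 0).
rewrite mul0r addr0; apply => //.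
- move=> i; rewrite (_ : (fun _ => _) = (fun r => F r (g r) 0 i - F r (g' r) 0 i)).
    by apply: integrable_sub_itv; [exact: (Fg i).1|exact: (Fg' i).1].
  by apply/funext => x; rewrite !mxE.
- move=> s i ts'; rewrite !mxE.
  have P r' : t <= r' <= T -> prim t (fun r => (F r (g r) - F r (g' r)) 0 i) r' =
    prim t (fun r => F r (g r) 0 i) r' - prim t (fun r => F r (g' r) 0 i) r'.
    move=> /andP[_ r'T]; rewrite -(primB r'T (Fg i).1 (Fg' i).1).
    by apply: eq_prim => x; rewrite !mxE.
  rewrite !P//; have := solves_sub i Fg ts ts'; have := solves_sub i Fg' ts ts'; lra.
- apply: (@filterS _ _ (ae_filter_ringOfSetsType leb)) FB => x H tx.
  by have [_ h _] := H tx; rewrite add0r.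
- move=> s ts'.
  have -> : g s - g' s = (g s0 - g' s0) + ((g s - g s0) - (g' s - g' s0)).
    by apply/rowP => i; rewrite !mxE; ring.
  apply: le_trans (ler_normD _ _) _; rewrite lerD2l mulr2n mulrDl mul1r.
  have sT : N * `|s - s0| <= N * (T - t).
    apply: ler_wpM2l => //; rewrite ler_norml; move/andP: ts => [? ?]; move/andP: ts' => [? ?].
    by apply/andP; split; lra.
  by apply: le_trans (ler_normB _ _) _; apply: lerD; apply: le_trans sT; exact: solves_lip.
Qed.

(** The second difference of the solutions solves a linear equation whose source
    is the second difference of the field along p, gu, gv, of size
    K cu cv. *)
Lemma solves_diff2 p gu gv guv (cu cv : R) : solves p -> solves gu -> solves gv -> solves guv ->
  guv t - gu t - gv t + p t = 0 ->
  (forall r, t <= r <= T -> `|gu r - p r| <= cu) -> (forall r, t <= r <= T -> `|gv r - p r| <= cv) ->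
  forall r, t <= r <= T -> `|guv r - gu r - gv r + p r| <= K * cu * cv / B * w (T - t).
Proof.
move=> Fp Fu Fv Fuv e0 hu hv r tr.
have tt : t <= t <= T by rewrite lexx.
have cu0 : 0 <= cu by apply: le_trans (hu t tt).
have cv0 : 0 <= cv by apply: le_trans (hv t tt).
pose c : R := K * cu * cv.
have c0 : 0 <= c by rewrite /c !mulr_ge0.
have := @gronwall _ t T n (fun r => guv r - gu r - gv r + p r)
  (fun r => F r (guv r) - F r (gu r) - F r (gv r) + F r (p r)) c B
  (4 * (N * (T - t))) t tt B0 c0.
rewrite e0 normr0 add0r => H.
have {}H := H _ _ _ _ r tr; apply: le_trans (H _ _ _ _) _; last first.
- rewrite ler_wpM2l ?divr_ge0 ?(ltW B0)// ler_expR ler_wpM2l ?mulr_ge0 ?(ltW B0)//.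
  by move/andP: tr => [tr rT]; rewrite ger0_norm ?subr_ge0// lerB.
- move=> s ts.
  have -> : guv s - gu s - gv s + p s = (guv s - guv t) - (gu s - gu t) - (gv s - gv t) + (p s - p t).
    by rewrite -[LHS]subr0 -e0; apply/rowP => i; rewrite !mxE; ring.
  have sT g : solves g -> `|g s - g t| <= N * (T - t).
    move=> Fg; apply: le_trans (solves_lip Fg tt ts) _; apply: ler_wpM2l => //.
    by move/andP: ts => [? ?]; rewrite ger0_norm ?subr_ge0// lerB.
  have h1 := sT _ Fuv; have h2 := sT _ Fu; have h3 := sT _ Fv; have h4 := sT _ Fp.
  apply: le_trans (ler_normD _ _) _; have := ler_normB (guv s - guv t - (gu s - gu t)) (gv s - gv t).
  by have := ler_normB (guv s - guv t) (gu s - gu t); lra.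
- apply: (@filterS _ _ (ae_filter_ringOfSetsType leb)) FB => x Hx tx.
  have [_ h1 h2] := Hx tx.
  (* The fourth vertex of the parallelogram spanned by p, gu and gv. *)
  set q := p x + (gu x - p x) + (gv x - p x).
  have -> : F x (guv x) - F x (gu x) - F x (gv x) + F x (p x) =
     (F x q - F x (p x + (gu x - p x)) - F x (p x + (gv x - p x)) + F x (p x)) + (F x (guv x) - F x q).
    by rewrite ![p x + (_ - p x)]addrC !subrK; apply/rowP => i; rewrite !mxE; ring.
  apply: le_trans (ler_normD _ _) _; apply: lerD.
    apply: le_trans (h2 _ _ _) _; rewrite /c; apply: ler_pM; rewrite ?mulr_ge0//; last exact: hv.
    by apply: ler_wpM2l => //; exact: hu.
  apply: le_trans (h1 _ _) _; rewrite le_eqVlt; apply/orP; left; apply/eqP; congr (_ * `|_|).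
  by rewrite /q; apply/rowP => i; rewrite !mxE; ring.
- move=> s i ts; move/andP: (ts) => [_ sT].
  have P r' : r' <= T -> prim t (fun r => (F r (guv r) - F r (gu r) - F r (gv r) + F r (p r)) 0 i) r' =
    prim t (fun r => F r (guv r) 0 i) r' - prim t (fun r => F r (gu r) 0 i) r' -
    (prim t (fun r => F r (gv r) 0 i) r' - prim t (fun r => F r (p r) 0 i) r').
    move=> r'T; rewrite -(primB r'T (Fuv i).1 (Fu i).1) -(primB r'T (Fv i).1 (Fp i).1).
    rewrite -(primB r'T (integrable_sub_itv (Fuv i).1 (Fu i).1) (integrable_sub_itv (Fv i).1 (Fp i).1)).
    by apply: eq_prim => x; rewrite !mxE; ring.
  rewrite !P// !mxE.
  have := congr1 (fun z : E => z 0 i) e0; rewrite !mxE.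
  have := solves_sub i Fu tt ts; have := solves_sub i Fv tt ts.
  have := solves_sub i Fuv tt ts; have := solves_sub i Fp tt ts; lra.
- move=> i; rewrite (_ : (fun _ => _) = (fun r => (F r (guv r) 0 i - F r (gu r) 0 i) - (F r (gv r) 0 i - F r (p r) 0 i))).
    by apply: integrable_sub_itv; apply: integrable_sub_itv;
      [exact: (Fuv i).1|exact: (Fu i).1|exact: (Fv i).1|exact: (Fp i).1].
  by apply/funext => x; rewrite !mxE; ring.
Qed.

Lemma lip_within g (L : R) : (forall s r, t <= s <= T -> t <= r <= T -> `|g r - g s| <= L * `|r - s|) ->
  {within `[t, T], continuous g}.
Proof.
move=> H; apply/subspace_continuousP => s /=; rewrite in_itv/= => ts.
apply/cvgrPdist_lt => e e0.
have d0 : 0 < e / (`|L| + 1) by rewrite divr_gt0// ltr_wpDl.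
apply/nbhs_ballP; exists (e / (`|L| + 1)) => //= r; rewrite /ball /= => sr; rewrite in_itv/= => tr.
apply: le_lt_trans (H _ _ tr ts) _.
apply: (@le_lt_trans _ _ ((`|L| + 1) * `|s - r|)).
  by rewrite ler_wpM2r// (le_trans (ler_norm L))// lerDl.
by rewrite mulrC -ltr_pdivlMr ?ltr_wpDl.
Qed.

Hypothesis FM : field_measurable.

Lemma field_integrable g i : {within `[t, T], continuous g} ->
  leb.-integrable `[t, T] (EFin \o (fun r => F r (g r) 0 i)).
Proof.
move=> cg; have mf := FM cg i; apply/integrableP; split; first exact/measurable_EFinP.
apply: (@le_lt_trans _ _ (\int[leb]_(x in `[t, T]) (cst N%:E x))%E); last first.
  rewrite integral_cst//; apply: lte_mul_pinfty => //.
  by apply: compact_finite_measure; exact: segment_compact.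
apply: ae_ge0_le_integral => //.
- by apply: measurableT_comp => //; exact/measurable_EFinP.
- apply: (@filterS _ _ (ae_filter_ringOfSetsType leb)) (field_le g i) => r H; rewrite /= in_itv/= => tr.
  by rewrite lee_fin; exact: H.
Qed.

(** Picard iteration; the condition may be imposed at any time s0, which gives the
    surjectivity of the flow at once. *)
Lemma solves_exists x s0 : t <= s0 <= T -> exists2 g, solves g & g s0 = x.
Proof.
move=> ts0.
pose f (g : R -> E) i r : R := F r (g r) 0 i.
pose P (g : R -> E) s : E := \row_i (x 0 i + (prim t (f g i) s - prim t (f g i) s0)).
(* The iteration stays among N-Lipschitz curves, for which the field is
   integrable. *)
pose C g := forall s r, t <= s <= T -> t <= r <= T -> `|g r - g s| <= N * `|r - s|.
have itf g i : C g -> leb.-integrable `[t, T] (EFin \o f g i).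
  by move=> Cg; apply: field_integrable; exact: lip_within Cg.
have CP g : C g -> C (P g).
  move=> Cg s r ts tr; apply: normr_rV_le => [|i]; first by rewrite mulr_ge0.
  rewrite !mxE; rewrite (_ : _ - _ = prim t (f g i) r - prim t (f g i) s); last by ring.
  by apply: (prim_lip N0 (itf _ i Cg) _ ts tr); exact: field_le.
(* The contraction of ratio 1/2 for the norm weighted by w. *)
have PP g g' (c : R) : C g -> C g' -> 0 <= c ->
    (forall s, t <= s <= T -> `|g s - g' s| <= c * w `|s - s0|) ->
    forall s, t <= s <= T -> `|P g s - P g' s| <= 2^-1 * c * w `|s - s0|.
  move=> Cg Cg' c0 H s ts; have w0 : 0 < w `|s - s0| by exact: expR_gt0.
  apply: normr_rV_le => [|i]; first by rewrite !mulr_ge0// ltW.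
  have B2 : 0 < 2 * B by rewrite mulr_gt0.
  have k0 : 0 <= B * c by rewrite mulr_ge0// ltW.
  have := @prim_osc _ t T s0 (fun r => f g i r - f g' i r) (B * c) (2 * B) ts0 B2 k0
    (integrable_sub_itv (itf _ i Cg) (itf _ i Cg')).
  move/andP: (ts) => [_ sT]; move/andP: (ts0) => [_ s0T].
  rewrite !mxE => K1; have {}K1 := K1 _ s ts.
  rewrite (primB sT (itf _ i Cg) (itf _ i Cg')) (primB s0T (itf _ i Cg) (itf _ i Cg')) in K1.
  rewrite (_ : _ - _ = prim t (f g i) s - prim t (f g' i) s - (prim t (f g i) s0 - prim t (f g' i) s0)); last by ring.
  apply: le_trans (K1 _) _.
    apply: (@filterS _ _ (ae_filter_ringOfSetsType leb)) FB => r Hr tr.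
    have [_ h _] := Hr tr; rewrite -mulrA.
    apply: le_trans (le_trans (h (g r) (g' r)) _).
      by rewrite /f; have := normr_rV_coord (F r (g r) - F r (g' r)) i; rewrite !mxE.
    by apply: ler_wpM2l; [exact: ltW|exact: H].
  rewrite -/(w _) (_ : B * c / (2 * B) = 2^-1 * c); last by field; rewrite gt_eqF.
  by rewrite ler_wpM2l ?mulr_ge0 ?invr_ge0// gerBl.
pose G k := iter k P (cst x).
have CG k : C (G k).
  elim: k => [|k IH]; last exact: CP.
  by move=> s r _ _; rewrite /= subrr normr0 mulr_ge0.
pose D : R := N * (T - t).
have D0 : 0 <= D by rewrite mulr_ge0// subr_ge0.
have w1 s : 1 <= w `|s - s0| by rewrite -[leLHS]expR0 ler_expR !mulr_ge0// ltW.
have G1 k s : t <= s <= T -> `|G k.+1 s - G k s| <= (2^-1) ^+ k * D * w `|s - s0|.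
  elim: k s => [|k IH] s ts.
    rewrite expr0 mul1r.
    have -> : G 0 s = G 1 s0 by apply/rowP => i; rewrite /G /= !mxE subrr addr0.
    apply: le_trans (CG 1%N s0 s ts0 ts) _; rewrite /D -mulrA; apply: ler_wpM2l => //.
    apply: (@le_trans _ _ (T - t)); last by rewrite ler_peMr// subr_ge0.
    by move/andP: ts0 => [? ?]; move/andP: ts => [? ?]; rewrite ler_norml; apply/andP; split; lra.
  have c0 : 0 <= (2^-1) ^+ k * D by rewrite mulr_ge0// exprn_ge0// invr_ge0.
  by rewrite exprS -[X in _ <= X * _]mulrA; exact: (PP (G k.+1) (G k) _ (CG _) (CG _) c0 IH s ts).
(* Summing the geometric series of the increments. *)
have G2 k j s : t <= s <= T -> `|G (k + j)%N s - G k s| <= (2^-1) ^+ k * (2 * D * w `|s - s0|).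
  move=> ts; pose d : R := (2^-1) ^+ k * (2 * D * w `|s - s0|).
  have d0 : 0 <= d.
    apply: mulr_ge0; first by rewrite exprn_ge0// invr_ge0.
    by apply: mulr_ge0; [rewrite mulr_ge0|exact: expR_ge0].
  suff : `|G (k + j)%N s - G k s| <= (1 - (2^-1) ^+ j) * d.
    by move=> h; apply: le_trans h _; rewrite ler_piMl// gerBl.
  elim: j => [|j IH]; first by rewrite addn0 subrr normr0 expr0 subrr mul0r.
  rewrite addnS (_ : _ - _ = (G (k + j).+1 s - G (k + j)%N s) + (G (k + j)%N s - G k s)); last first.
    by rewrite [RHS]addrA subrK.
  apply: le_trans (ler_normD _ _) _; have := G1 (k + j)%N s ts.
  rewrite exprD exprS /d in IH *; set p := (2^-1) ^+ k in IH *; set q := (2^-1) ^+ j in IH *.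
  move: (w _) IH => z; move: (`|_|) => z1; move: (`|_|) => z2 h1 h2.
  by apply: le_trans (lerD h2 h1) _; rewrite le_eqVlt; apply/orP; left; apply/eqP; field.
have [U [UU Uoo]] := ultraFilterLemma (_ : ProperFilter (\oo%classic : set_system nat)).
pose g s : E := \row_i ulim U (fun k => G k s 0 i).
have cvg_g s i : t <= s <= T -> G k s 0 i @[k --> U] --> g s 0 i.
  move=> ts; rewrite mxE; apply: (@ulimP _ _ _ _ (`|x| + 2 * D * w `|s - s0|)) => k.
  have := G2 0%N k s ts; rewrite expr0 mul1r add0n => h.
  apply: le_trans (normr_rV_coord _ _) _.
  have -> : G k s = x + (G k s - G 0 s) by rewrite /= addrC subrK.
  by apply: le_trans (ler_normD _ _) _; rewrite lerD2l.
have gG k s : t <= s <= T -> `|g s - G k s| <= (2^-1) ^+ k * (2 * D * w `|s - s0|).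
  move=> ts; have w0 : 0 < w `|s - s0| by exact: expR_gt0.
  apply: normr_rV_le => [|i].
    by rewrite (le_trans _ (G2 k 0%N s ts)).
  have h1 : `|G j s 0 i - G k s 0 i| @[j --> U] --> `|g s 0 i - G k s 0 i|.
    by apply: cvg_norm; apply: cvgB; [exact: cvg_g|exact: cvg_cst].
  rewrite [X in `|X|](_ : _ = g s 0 i - G k s 0 i); last by rewrite !mxE.
  apply: (ler_cvg_to h1 (cvg_cst _)).
  apply: Uoo; exists k => // j kj; rewrite -(subnKC kj).
  apply: le_trans (G2 k (j - k)%N s ts).
  by have := normr_rV_coord (G (k + (j - k))%N s - G k s) i; rewrite !mxE.
have Cg : C g.
  move=> s r ts tr; apply: normr_rV_le => [|i]; first by rewrite mulr_ge0.
  rewrite [X in `|X|](_ : _ = g r 0 i - g s 0 i); last by rewrite !mxE.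
  have h1 : `|G j r 0 i - G j s 0 i| @[j --> U] --> `|g r 0 i - g s 0 i|.
    by apply: cvg_norm; apply: cvgB; exact: cvg_g.
  apply: (ultra_le h1 (cvg_cst _)) => k; apply: le_trans (CG k s r ts tr).
  by have := normr_rV_coord (G k r - G k s) i; rewrite !mxE.
have Pg s : t <= s <= T -> g s = P g s.
  move=> ts; apply/eqP; rewrite -subr_eq0 -normr_le0.
  have w0 : 0 < w `|s - s0| by exact: expR_gt0.
  apply: (@le_geom _ _ _ (2 * D * w `|s - s0|)) => k; rewrite add0r.
  have -> : g s - P g s = (g s - G k.+1 s) + (P (G k) s - P g s) by rewrite addrA subrK.
  apply: le_trans (ler_normD _ _) _.
  have h1 := gG k.+1 s ts.
  have c0 : 0 <= (2^-1) ^+ k * (2 * D) :> R.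
    by apply: mulr_ge0; [rewrite exprn_ge0// invr_ge0|rewrite mulr_ge0].
  have h2 := PP _ _ _ (CG k) Cg c0 _ s ts.
  apply: le_trans (lerD h1 (h2 _)) _.
    by move=> r tr; rewrite distrC -mulrA; exact: gG.
  rewrite exprS; set p := (2^-1) ^+ k.
  by rewrite le_eqVlt; apply/orP; left; apply/eqP; field.
exists g; last by rewrite Pg//; apply/rowP => i; rewrite mxE subrr addr0.
move=> i; split; first exact: itf.
have tt : t <= t <= T by rewrite lexx.
by move=> s ts; rewrite (Pg s ts) (Pg t tt) !mxE prim_self; ring.
Qed.

End ode.

(** * The flow of a control *)

Lemma abs_sub_le {R : realType} (t T r s : R) : 0 <= t -> t <= r -> r <= T -> t <= s -> s <= T ->
  `|r - s| <= T.
Proof. by move=> t0 tr rT ts sT; rewrite ler_norml; apply/andP; split; lra. Qed.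

Lemma continuous_addf {R : realType} (S : topologicalType) (V : normedModType R) (f g : S -> V) :
  continuous f -> continuous g -> continuous (fun x => f x + g x).
Proof. by move=> cf cg x; apply: cvgD; [exact: cf|exact: cg]. Qed.

Lemma continuous_subf {R : realType} (S : topologicalType) (V : normedModType R) (f g : S -> V) :
  continuous f -> continuous g -> continuous (fun x => f x - g x).
Proof. by move=> cf cg x; apply: cvgB; [exact: cf|exact: cg]. Qed.

Lemma continuous_scalef {R : realType} (S : topologicalType) (V : normedModType R) (k : R) (f : S -> V) :
  continuous f -> continuous (fun x => k *: f x).
Proof. by move=> cf x; apply: cvgZr; exact: cf. Qed.

Section control_fields.
Context {R : realType} {n : nat} (T M : R).
Local Notation E := 'rV[R]_n.
Local Notation leb := (@lebesgue_measure R).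
Implicit Types (a : E -> E) (alpha : R -> E -> E) (g : R -> E).
Hypotheses (T0 : 0 <= T) (M0 : 0 < M).

Lemma continuous_coord (S : topologicalType) (f : S -> E) i :
  continuous f -> continuous (fun x => f x 0 i : R).
Proof.
move=> cf x; apply: (@continuous_comp _ _ _ f (fun y : E => y 0 i)); first exact: cf.
exact: (@coord_continuous R 1 n 0 i).
Qed.

Lemma V_norm_le a (N : R) : continuous a -> (V_norm a < N%:E)%E -> forall x, `|a x| <= N.
Proof.
move=> ca; rewrite /V_norm gt_max => /andP[h _].
by have [] := Wkoo_lt_C11 (fun j => continuous_coord (i := j) ca) h isT.
Qed.

Lemma simple_control_measurable c t g i : simple_control c -> {within `[t, T], continuous g} ->
  measurable_fun `[t, T] (fun r => c r (g r) 0 i : R).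
Proof.
move=> [m [B [v [mB cv cE]]]] cg.
rewrite (_ : (fun _ => _) = (fun r => \sum_(j < m) (\1_(B j) r : R) * v j (g r) 0 i)); last first.
  by apply/funext => r; rewrite cE summxE; apply: eq_bigr => j _; rewrite mxE.
apply: measurable_sum => j; apply: measurable_funM.
  by apply: measurable_funTS; exact: measurable_indic.
apply: subspace_continuous_measurable_fun => //.
apply: (@within_continuous_comp _ _ _ _ g (fun y => v j y 0 i)) cg => y _.
by apply: continuous_coord; have [] := cv j.
Qed.

Lemma simple_control_continuous (c : R -> E -> E) s : simple_control c -> continuous (c s).
Proof.
move=> [m [B [v [mB cv cE]]]]; rewrite (_ : c s = fun x => \sum_(i < m) (\1_(B i) s : R) *: v i x); last first.
  by apply/funext => x; rewrite cE.
elim: (index_enum _) => [|j r IH].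
  rewrite (_ : (fun _ => _) = cst 0); last by apply/funext => x; rewrite big_nil.
  exact: cst_continuous.
rewrite (_ : (fun _ => _) = (fun x => (\1_(B j) s : R) *: v j x + \sum_(i <- r) (\1_(B i) s : R) *: v i x)); last first.
  by apply/funext => x; rewrite big_cons.
by apply: continuous_addf IH; apply: continuous_scalef; have [h _] := cv j.
Qed.

(** True for simple controls; the norm dominates the supremum, so a strongly
    measurable control is their pointwise limit. *)
Lemma control_measurable alpha t : controls T M alpha -> 0 <= t -> field_measurable t T alpha.
Proof.
move=> [ca [c sc cc] _ _] t0 g cg i.
apply: (@measurable_fun_cvg _ _ _ _ (fun k r => c k r (g r) 0 i)) => [k|r].
  exact: simple_control_measurable.
rewrite /= in_itv/= => /andP[tr rT].
have r0 : 0 <= r <= T by rewrite (le_trans t0 tr).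
apply/cvgrPdist_le => e e0.
have : \forall k \near \oo, (V_norm (fun x => (c k r x - alpha r x)%R) < e%:E)%E.
  have := cc r r0; move=> /(_ [set z | z < e%:E]%E); apply.
  by apply: (open_nbhs_nbhs (_ : open_nbhs _ _)); split; [exact: open_ereal_lt_ereal|rewrite /= lte_fin].
apply: filterS => k h.
have cd : continuous (fun x => c k r x - alpha r x).
  apply: continuous_subf; first exact: simple_control_continuous.
  by have [h' _] := ca r r0.
have := V_norm_le cd h (g r); rewrite distrC => h1; apply: le_trans h1.
by have := normr_rV_coord (alpha r (g r) - c k r (g r)) i; rewrite !mxE distrC [`|_ - alpha _ _|]distrC.
Qed.

Let N := M + 1.
(** The summand 1 makes this Lipschitz constant positive even in dimension 0. *)
Definition ctl_B : R := n%:R * (M + 1) + 1.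
Definition ctl_K : R := n%:R * (n%:R * (M + 1)).

(** The bound [M + 1] comes from the strict inequality that is needed to extract
    weak derivatives from the infimum that defines the norm. *)
Lemma Atilde_field a : Atilde M a ->
  [/\ forall x, `|a x| <= M + 1, forall x y, `|a x - a y| <= ctl_B * `|x - y| &
      forall x u v, `|a (x + u + v) - a (x + u) - a (x + v) + a x| <= ctl_K * `|u| * `|v|].
Proof.
move=> [[ca _] aM].
have h : (Wkoo_norm 3 a < (M + 1)%:E)%E.
  apply: le_lt_trans (_ : M%:E < _)%E; last by rewrite lte_fin ltrDl.
  by apply: le_trans aM; rewrite le_max lexx.
have [N0 h1 h2 h3] := Wkoo_lt_C11 (fun j => continuous_coord (i := j) ca) h isT.
split => //.
- move=> x y; apply: (@le_trans _ _ (n%:R * (M + 1) * `|x - y|)); last first.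
    by rewrite /ctl_B; apply: ler_wpM2r => //; rewrite lerDl.
  apply: normr_rV_le => [|j]; first by rewrite !mulr_ge0.
  by have := h2 j y (x - y); rewrite [y + _]addrC subrK !mxE.
- move=> x u v; apply: normr_rV_le => [|j]; first by rewrite /ctl_K !mulr_ge0.
  by have := h3 j x u v; rewrite /diff2 !mxE.
Qed.

Lemma ctl_B_gt0 : 0 < ctl_B.
Proof. by rewrite /ctl_B ltr_wpDl// mulr_ge0// addr_ge0// ltW. Qed.

Lemma ctl_K_ge0 : 0 <= ctl_K.
Proof. by rewrite /ctl_K !mulr_ge0// addr_ge0// ltW. Qed.

Lemma control_field alpha t : controls T M alpha -> 0 <= t ->
  field_bounds t T (M + 1) ctl_B ctl_K alpha.
Proof.
move=> ca t0; have [_ _ _ ae] := ca; apply: (@filterS _ _ (ae_filter_ringOfSetsType leb)) ae => r H /andP[tr rT].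
by apply: Atilde_field; apply: H; rewrite (le_trans t0 tr).
Qed.

Lemma trajectoryP alpha t x g : controls T M alpha -> 0 <= t -> t <= T ->
  is_trajectory T alpha t x g <-> g t = x /\ solves t T alpha g.
Proof.
move=> ca t0 tT; have tt : t <= t <= T by rewrite lexx.
have M1 : 0 <= M + 1 by rewrite addr_ge0// ltW.
split=> [[cg H]|[gt Fg]].
  have gt : g t = x.
    apply/rowP => i; have [_ ->] := H t tt i.
    by have /= := prim_self t (fun r => alpha r (g r) 0 i); rewrite /prim => ->; rewrite addr0.
  split => // i; have TT : t <= T <= T by rewrite tT lexx.
  by split; [have [] := H T TT i|move=> s ts; have [_ ->] := H s ts i; rewrite gt].
split.
  apply: (@lip_within _ _ t T g (M + 1)) => s r ts tr.
  exact: (solves_lip (control_field ca t0) M1 Fg ts tr).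
move=> s ts i; have [h1 h2] := Fg i; split; last by rewrite -gt; exact: h2.
by move/andP: ts => [_ sT]; exact: (integrableS_itv (lexx t) sT h1).
Qed.

Section flow.
Variables (alpha : R -> E -> E) (t : R).
Hypotheses (ca : controls T M alpha) (t0 : 0 <= t) (tT : t <= T).

Definition flow_W : R := expR (2 * ctl_B * T).
Definition flow_K : R := ctl_K * flow_W * flow_W / ctl_B * flow_W.

Let FF := control_field ca t0.
Let FM := control_measurable ca t0.
Let M1 : 0 <= M + 1. Proof. by rewrite addr_ge0// ltW. Qed.

Lemma flow_solves x : flow T alpha t t x = x /\ solves t T alpha (fun s => flow T alpha t s x).
Proof.
apply/(trajectoryP _ _ ca t0 tT); rewrite /flow.
apply: (xgetPex (cst x) (P := [set gamma | is_trajectory T alpha t x gamma])).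
have [|g Fg gt] := solves_exists FF ctl_B_gt0 M1 tT FM x (s0 := t); first by rewrite lexx.
by exists g; apply/(trajectoryP _ _ ca t0 tT).
Qed.

Lemma flow_init x : flow T alpha t t x = x. Proof. by have [] := flow_solves x. Qed.

Lemma flow_unique g s : solves t T alpha g -> t <= s <= T -> flow T alpha t s (g t) = g s.
Proof.
move=> Fg ts; have [h1 h2] := flow_solves (g t).
have tt : t <= t <= T by rewrite lexx.
have := solves_dist FF ctl_B_gt0 M1 h2 Fg tt ts.
by rewrite h1 subrr normr0 mul0r normr_le0 subr_eq0 => /eqP.
Qed.

Lemma weight_le r s : t <= r <= T -> t <= s <= T -> expR (2 * ctl_B * `|r - s|) <= flow_W.
Proof.
move=> /andP[tr rT] /andP[ts sT]; rewrite ler_expR ler_wpM2l//.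
  by rewrite mulr_ge0// ltW// ctl_B_gt0.
exact: (abs_sub_le t0).
Qed.

Lemma flow_lip s x y : t <= s <= T ->
  `|flow T alpha t s x - flow T alpha t s y| <= flow_W * `|x - y|.
Proof.
move=> ts; have [h1 h2] := flow_solves x; have [h3 h4] := flow_solves y.
have tt : t <= t <= T by rewrite lexx.
have := solves_dist FF ctl_B_gt0 M1 h2 h4 tt ts; rewrite h1 h3 mulrC => h.
by apply: le_trans h _; rewrite ler_wpM2r//; exact: weight_le.
Qed.

(** Uniqueness backwards in time, in quantitative form. *)
Lemma flow_colip s x y : t <= s <= T ->
  `|x - y| <= flow_W * `|flow T alpha t s x - flow T alpha t s y|.
Proof.
move=> ts; have [h1 h2] := flow_solves x; have [h3 h4] := flow_solves y.
have tt : t <= t <= T by rewrite lexx.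
have := solves_dist FF ctl_B_gt0 M1 h2 h4 ts tt; rewrite h1 h3 mulrC => h.
by apply: le_trans h _; rewrite ler_wpM2r//; exact: weight_le.
Qed.

Lemma flow_lip_time s r x : t <= s <= T -> t <= r <= T ->
  `|flow T alpha t r x - flow T alpha t s x| <= (M + 1) * `|r - s|.
Proof. by move=> ts tr; have [_ h] := flow_solves x; exact: (solves_lip FF M1 h ts tr). Qed.

Lemma flow_surj s x : t <= s <= T -> exists y, flow T alpha t s y = x.
Proof.
move=> ts; have [g Fg gs] := solves_exists FF ctl_B_gt0 M1 tT FM x ts.
by exists (g t); rewrite flow_unique.
Qed.

Lemma flow_invK s x : t <= s <= T -> flow T alpha t s (flow_inv T alpha t s x) = x.
Proof.
by move=> ts; apply: (xgetPex x (P := [set y | flow T alpha t s y = x])); exact: flow_surj.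
Qed.

Lemma flow_K_ge0 : 0 <= flow_K.
Proof. by rewrite /flow_K !mulr_ge0 ?ctl_K_ge0 ?invr_ge0 ?expR_ge0// ltW// ctl_B_gt0. Qed.

Lemma flow_diff2 s i : t <= s <= T -> diff2_le flow_K (fun x => flow T alpha t s x 0 i).
Proof.
move=> ts x u v; have [h1 h2] := flow_solves x; have [h3 h4] := flow_solves (x + u).
have [h5 h6] := flow_solves (x + v); have [h7 h8] := flow_solves (x + u + v).
have close z r : t <= r <= T -> `|flow T alpha t r (x + z) - flow T alpha t r x| <= flow_W * `|z|.
  by move=> tr; have := flow_lip (x + z) x tr; rewrite [x + z]addrC addrK.
have e0 : flow T alpha t t (x + u + v) - flow T alpha t t (x + u) - flow T alpha t t (x + v) + flow T alpha t t x = 0.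
  by rewrite h1 h3 h5 h7; apply/rowP => j; rewrite !mxE; ring.
have := solves_diff2 FF ctl_B_gt0 M1 ctl_K_ge0 tT h2 h4 h6 h8 e0 (close u) (close v) ts.
move=> H; apply: le_trans (_ : _ <= ctl_K * (flow_W * `|u|) * (flow_W * `|v|) / ctl_B * flow_W) _.
  have := normr_rV_coord (flow T alpha t s (x + u + v) - flow T alpha t s (x + u) - flow T alpha t s (x + v) + flow T alpha t s x) i.
  rewrite !mxE => h; apply: le_trans h _; apply: le_trans H _; apply: ler_wpM2l.
    by rewrite !mulr_ge0 ?ctl_K_ge0 ?invr_ge0 ?expR_ge0// ltW// ctl_B_gt0.
  by rewrite ler_expR ler_wpM2l ?lerBlDr ?lerDl// mulr_ge0// ltW// ctl_B_gt0.
by rewrite le_eqVlt; apply/orP; left; apply/eqP; rewrite /flow_K; ring.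
Qed.

(** The Jacobian is invertible because the flow expands distances by a definite
    factor: a vector of its kernel would be contracted to second order. *)
Lemma flow_jacobian s : t <= s <= T ->
  [/\ forall x v, `|flow T alpha t s (x + v) - flow T alpha t s x - v *m 'J (flow T alpha t s) x| <= flow_K * `|v| ^+ 2,
      forall x i j, `|'J (flow T alpha t s) x i j| <= flow_W,
      forall x y i j, `|'J (flow T alpha t s) x i j - 'J (flow T alpha t s) y i j| <= flow_K * `|x - y| &
      forall x, \det ('J (flow T alpha t s) x) != 0].
Proof.
move=> ts; have W0 : 0 <= flow_W by exact: expR_ge0.
have L j : lip_le flow_W (fun x => flow T alpha t s x 0 j).
  move=> x u; have := flow_lip (x + u) x ts; rewrite [x + u]addrC addrK; apply: le_trans.
  by have := normr_rV_coord (flow T alpha t s (u + x) - flow T alpha t s x) j; rewrite !mxE.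
have [h0 h1 h2 h3] := C11_jacobian W0 flow_K_ge0 L (fun j => flow_diff2 j ts).
split => // x; rewrite -unitfE -unitmxE -row_free_unit -kermx_eq0.
apply/eqP/row_matrixP => i; rewrite row0; set v := row i _.
have vJ : v *m 'J (flow T alpha t s) x = 0.
  by rewrite /v -row_mul mulmx_ker row0.
apply/eqP; rewrite -normr_le0.
(* Moving by e v, with v in the kernel, displaces the flow by O(e^2) only, whereas
   it must displace it by at least e |v| / flow_W. *)
apply: (@le_geom _ _ _ (flow_W * flow_K * `|v| ^+ 2)) => k; rewrite add0r.
set e := (2^-1) ^+ k; have e0 : 0 < e by rewrite exprn_gt0// invr_gt0.
have := h1 x (e *: v); rewrite -scalemxAl vJ scaler0 subr0 normrZ gtr0_norm// => H.
have := flow_colip (x + e *: v) x ts; rewrite [x + _]addrC addrK normrZ gtr0_norm// => H'.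
rewrite -(ler_pM2l e0); apply: le_trans H' _.
rewrite [_ + x]addrC; apply: le_trans (ler_wpM2l W0 H) _.
by rewrite le_eqVlt; apply/orP; left; apply/eqP; ring.
Qed.

End flow.
End control_fields.

(** * Continuity of the transported density *)

Lemma cvg_det {R : realType} {S : Type} (F : set_system S) {FF : Filter F} n
    (A : S -> 'M[R]_n) (B : 'M[R]_n) :
  (forall i j, A k i j @[k --> F] --> B i j) -> \det (A k) @[k --> F] --> \det B.
Proof.
move=> AB; rewrite /determinant; apply: cvg_big; first exact: add_continuous.
move=> s _; apply: cvgMr; apply: cvg_big; first exact: mul_continuous.
by move=> i _; exact: AB.
Qed.

Lemma cvg_dist_le {R : realType} {S : Type} (F : set_system S) {FF : Filter F} (a b c : S -> R) (l : R) :
  (forall k, `|a k - b k| <= c k) -> c k @[k --> F] --> (0 : R) -> b k @[k --> F] --> l ->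
  a k @[k --> F] --> l.
Proof.
move=> abc c0 bl.
have d0 : (a k - b k) @[k --> F] --> (0 : R).
  apply/cvgrPdist_le => e e0; move/cvgrPdist_le : c0 => /(_ e e0); apply: filterS => k.
  rewrite !sub0r !normrN => h; apply: le_trans (abc k) _; exact: le_trans (ler_norm _) h.
rewrite -[l]add0r (_ : a = fun k => (a k - b k) + b k); last by apply/funext => k; rewrite subrK.
exact: cvgD.
Qed.

(** If two functions with the same Taylor error q are d-close at the two points,
    their slopes p and p' are close; this compares Jacobians without
    differentiating in time. *)
Lemma four_points {R : realType} (a b a' b' p p' e d q : R) : `|a - b - e * p| <= q ->
  `|a' - b' - e * p'| <= q -> `|a - a'| <= d -> `|b - b'| <= d -> `|e * (p - p')| <= 2 * d + 2 * q.
Proof.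
rewrite !ler_norml.
by move=> /andP[? ?] /andP[? ?] /andP[? ?] /andP[? ?]; apply/andP; split; lra.
Qed.

Section transport_limit.
Context {R : realType} {n : nat} (T M : R).
Local Notation E := 'rV[R]_n.
Hypothesis M0 : 0 < M.
Variables (alpha : R -> E -> E) (t : R).
Hypotheses (ca : controls T M alpha) (t0 : 0 <= t) (tT : t <= T).
Local Notation phi := (flow T alpha t).
Local Notation W := (@flow_W R n T M).
Local Notation K := (@flow_K R n T M).

Section along_filter.
Context {S : Type} (F : set_system S) {FF : Filter F}.
Variables (sk : S -> R) (xk : S -> E) (mk : S -> E -> R) (s : R) (x : E) (m : E -> R) (L : R).
Hypotheses (tsk : forall k, t <= sk k <= T) (ts : t <= s <= T).
Hypotheses (sks : sk k @[k --> F] --> s) (xkx : `|xk k - x| @[k --> F] --> (0 : R)).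
Hypotheses (mL : forall k y z, `|mk k y - mk k z| <= L * `|y - z|).
Hypotheses (mkm : forall y, mk k y @[k --> F] --> m y).

Let W0 : 0 <= W. Proof. exact: expR_ge0. Qed.
Let K0 : 0 <= K. Proof. exact: flow_K_ge0. Qed.
Let M1 : 0 <= M + 1. Proof. by rewrite addr_ge0// ltW. Qed.

Let y := flow_inv T alpha t s x.
Let yk k := flow_inv T alpha t (sk k) (xk k).

Let dist_s : `|sk k - s| @[k --> F] --> (0 : R).
Proof. by move: sks => /(cvgB (cvg_cst s)); rewrite subrr => /cvg_norm; rewrite normr0; under eq_fun do rewrite distrC. Qed.

Let yky : `|yk k - y| @[k --> F] --> (0 : R).
Proof.
apply: (@cvg_dist_le _ _ F _ _ (cst 0) (fun k => W * (`|xk k - x| + (M + 1) * `|sk k - s|))).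
- move=> k; rewrite /= subr0 normr_id.
  apply: le_trans (flow_colip M0 ca t0 tT _ _ (tsk k)) _; apply: ler_wpM2l => //.
  rewrite /yk (flow_invK M0 ca t0 tT _ (tsk k)).
  have -> : xk k - phi (sk k) y = (xk k - x) - (phi (sk k) y - phi s y).
    by rewrite {2}/y (flow_invK M0 ca t0 tT _ ts) opprB addrA subrK.
  apply: le_trans (ler_normB _ _) _; rewrite lerD2l.
  exact: (flow_lip_time M0 ca t0 tT).
- rewrite -(mulr0 W) -[in X in _ * X](addr0 0) -[X in _ * (_ + X)](mulr0 (M + 1)).
  by apply: cvgMr; apply: cvgD => //; apply: cvgMr.
- exact: cvg_cst.
Qed.

Let jac_time r r' z i j (e : R) : t <= r <= T -> t <= r' <= T -> 0 < e ->
  `|'J (phi r) z i j - 'J (phi r') z i j| <= 2 * (M + 1) * `|r - r'| / e + 2 * K * e.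
Proof.
move=> tr tr' e0.
have [h1 _ _ _] := flow_jacobian M0 ca t0 tT tr.
have [h2 _ _ _] := flow_jacobian M0 ca t0 tT tr'.
set v : E := e *: delta_mx 0 i.
have v1 : `|v| <= e by apply: le_trans (norm_delta_rV _ _) _; rewrite gtr0_norm.
have vJ (J : 'M[R]_n) : (v *m J) 0 j = e * J i j by rewrite /v -scalemxAl -rowE !mxE.
have sub (a b : E) : `|a 0 j - b 0 j| <= `|a - b|.
  by have := normr_rV_coord (a - b) j; rewrite !mxE.
have sub3 (a b c : E) : `|a 0 j - b 0 j - c 0 j| <= `|a - b - c|.
  by have := normr_rV_coord (a - b - c) j; rewrite !mxE.
have key r1 : t <= r1 <= T -> `|phi r1 (z + v) 0 j - phi r1 z 0 j - e * 'J (phi r1) z i j| <= K * e ^+ 2.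
  move=> tr1; have [h _ _ _] := flow_jacobian M0 ca t0 tT tr1.
  rewrite -vJ; have := h z v => {}h.
  apply: (@le_trans _ _ (K * `|v| ^+ 2)); last first.
    by rewrite ler_wpM2l// lerXn2r ?nnegrE// ltW.
  exact: le_trans (sub3 _ _ _) h.
have k1 := key r tr; have k2 := key r' tr'.
have k3 := flow_lip_time M0 ca t0 tT (z + v) tr' tr; have k4 := flow_lip_time M0 ca t0 tT z tr' tr.
have k5 := le_trans (sub _ _) k3; have k6 := le_trans (sub _ _) k4.
rewrite -(ler_pM2l e0) -[X in X * `|_|](gtr0_norm e0) -normrM.
have -> : e * (2 * (M + 1) * `|r - r'| / e + 2 * K * e) = 2 * ((M + 1) * `|r - r'|) + 2 * (K * e ^+ 2).
  by field; rewrite gt_eqF.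
set d := (M + 1) * `|r - r'| in k5 k6 *; set q := K * e ^+ 2 in k1 k2 *.
exact: four_points k1 k2 k5 k6.
Qed.

(** The Jacobians are equi-Lipschitz in space; in time they are compared by
    interpolation, with a step e that is sent to 0 last. *)
Lemma flow_jacobian_cvg i j : 'J (phi (sk k)) (yk k) i j @[k --> F] --> 'J (phi s) y i j.
Proof.
apply: (@cvg_dist_le _ _ F _ _ (fun k => 'J (phi (sk k)) y i j) (fun k => K * `|yk k - y|)).
- by move=> k; have [_ _ h _] := flow_jacobian M0 ca t0 tT (tsk k); exact: h.
- by rewrite -(mulr0 K); exact: cvgMr.
apply/cvgrPdist_le => e e0.
pose e1 := e / (4 * (K + 1)).
have K1 : 0 < K + 1 by rewrite ltr_wpDl.
have e10 : 0 < e1 by rewrite divr_gt0// mulr_gt0.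
have M2 : 0 < M + 2 by rewrite addr_gt0.
have d0 : 0 < e * e1 / (4 * (M + 2)) by apply: divr_gt0; [exact: mulr_gt0|rewrite mulr_gt0].
move/cvgrPdist_le : dist_s => /(_ _ d0); apply: filterS => k; rewrite sub0r normrN normr_id => h.
rewrite distrC; apply: le_trans (jac_time y i j (tsk k) ts e10) _.
apply: (@le_trans _ _ (e / 2 + e / 2)); last by rewrite -splitr.
apply: lerD.
  rewrite ler_pdivrMr//; apply: (@le_trans _ _ (2 * (M + 2) * (e * e1 / (4 * (M + 2))))).
    apply: ler_pM => //; first by rewrite mulr_ge0.
    by rewrite ler_pM2l//; lra.
  by rewrite le_eqVlt; apply/orP; left; apply/eqP; field; rewrite gt_eqF.
rewrite /e1; apply: (@le_trans _ _ (2 * (K + 1) * (e / (4 * (K + 1))))).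
  by apply: ler_wpM2r; [exact: ltW|lra].
by rewrite le_eqVlt; apply/orP; left; apply/eqP; field; rewrite gt_eqF.
Qed.

(** Joint continuity in the final time, the point and the density, the last one for
    pointwise convergence of equi-Lipschitz densities. *)
Lemma transport_cvg : transport T (sk k) alpha (mk k) t (xk k) @[k --> F] --> transport T s alpha m t x.
Proof.
rewrite /transport; apply: cvgM.
  apply: (@cvg_dist_le _ _ F _ _ (fun k => mk k y) (fun k => L * `|yk k - y|)) => //.
  by rewrite -(mulr0 L); exact: cvgMr.
apply: cvgV; first by have [_ _ _ h] := flow_jacobian M0 ca t0 tT ts; exact: h.
by apply: cvg_det => i j; exact: flow_jacobian_cvg.
Qed.

End along_filter.

Lemma transport_continuous s m L : t <= s <= T -> (forall y z, `|m y - m z| <= L * `|y - z|) ->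
  continuous (transport T s alpha m t).
Proof.
move=> ts mL x; have FF : Filter (nbhs x) := nbhs_filter x.
apply: (@transport_cvg _ (nbhs x) FF (fun=> s) id (fun=> m) s x m L) => //.
- exact: cvg_cst.
- apply/cvgrPdist_le => e e0; apply/nbhs_ballP; exists e => // z.
  by rewrite mx_norm_ball /ball_ /= sub0r normrN normr_id distrC => /ltW.
- by move=> y; exact: cvg_cst.
Qed.

End transport_limit.

(** * The null control and time shifts *)

Section null_field.
Context {R : realType} {n : nat}.
Local Notation E := 'rV[R]_n.
Local Notation mu := (lebesgue_rV R n).

Lemma eucl_norm0 m : eucl_norm (0 : 'rV[R]_m) = 0.
Proof. by rewrite /eucl_norm /dot_rV big1 ?sqrtr0// => i _; rewrite mxE mul0r. Qed.

Lemma weak_derivatives0 k m :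
  weak_derivatives (k := k) (fun _ : E => 0 : 'rV[R]_m) (fun _ _ => 0).
Proof.
move=> b _ j.
have e : (fun x : E => (0 : 'rV[R]_m) 0 j) = cst 0 by apply/funext => x; rewrite mxE.
have l : loc_integrable (cst 0 : E -> R).
  move=> K _; rewrite (_ : _ \o _ = cst 0%E)//; exact: integrable0.
rewrite e; split => // phi tphi.
have z (h : E -> R) : \int[mu]_x (cst 0 x * h x) = 0.
  by rewrite /Rintegral (_ : integral _ _ _ = 0%E)//; apply: integral0_eq => x _; rewrite /= mul0r.
by rewrite !z mulr0.
Qed.

Lemma H1_norm_ge0 m (f : E -> 'rV[R]_m) : (0 <= H1_norm f)%E.
Proof. by apply: le_ereal_inf_tmp => _ [g _ ->]; exact: poweR_ge0. Qed.

Lemma V_norm_ge0 (a : E -> E) : (0 <= V_norm a)%E.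
Proof. by rewrite /V_norm le_max H1_norm_ge0 orbT. Qed.

Lemma V_norm0 : V_norm (fun _ : E => 0 : E) = 0%E.
Proof.
apply/eqP; rewrite eq_le V_norm_ge0 andbT /V_norm ge_max; apply/andP; split.
  apply: le_trans (ereal_inf_lbound _) _.
    by exists (fun _ _ => 0); [exact: weak_derivatives0|reflexivity].
  apply: (@le_trans _ _ (\sum_(b : {ffun 'I_n -> 'I_4} | (mdeg b <= 3)%N) (0 : \bar R))%E); last by rewrite big1.
  by apply: lee_sum => b _; apply/ess_supP; apply: nearW => x; rewrite eucl_norm0.
apply: le_trans (ereal_inf_lbound _) _.
  by exists (fun _ _ => 0); [exact: weak_derivatives0|reflexivity].
rewrite big1 => [|b _]; first by rewrite poweR0r// invr_neq0.
by apply: integral0_eq => x _; rewrite eucl_norm0 expr0n.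
Qed.

Lemma control_space0 : control_space (fun _ : E => 0 : E).
Proof. by split; [exact: cst_continuous|rewrite V_norm0]. Qed.

Lemma Atilde0 (M : R) : 0 <= M -> Atilde M (fun _ : E => 0 : E).
Proof. by move=> M0; split; [exact: control_space0|rewrite V_norm0 lee_fin]. Qed.

End null_field.

Import HBNNSimple.

Lemma ge0_integral_le_ae {R : realType} d (S : measurableType d) (mu : {measure set S -> \bar R})
    (D : set S) (f : S -> \bar R) (c : R) : measurable D -> (forall x, 0 <= f x)%E -> 0 <= c ->
  {ae mu, forall x, D x -> (f x <= c%:E)%E} -> (\int[mu]_(x in D) f x <= c%:E * mu D)%E.
Proof.
move=> mD f0 c0 fc; rewrite ge0_integralE//; apply: ge_ereal_sup => _ [h hf <-].
rewrite -integralT_nnsfun -integral_cst// [leRHS]integral_mkcond.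
apply: ae_ge0_le_integral => //.
- by move=> x _; rewrite lee_fin; exact: fun_ge0.
- exact/measurable_EFinP.
- by move=> x _; rewrite erestrict_ge0// => y _; rewrite lee_fin.
- by apply/(measurable_restrictT _ mD); exact: measurable_cst.
apply: (@filterS _ _ (ae_filter_ringOfSetsType mu)) fc => x H _.
have := hf x; rewrite !patchE; case: ifPn => // xD h1.
by apply: le_trans h1 _; apply: H; rewrite inE in xD.
Qed.

Section shift_control.
Context {R : realType} {n : nat} (T M : R).
Local Notation E := 'rV[R]_n.
Local Notation leb := (@lebesgue_measure R).
Hypotheses (T0 : 0 <= T) (M0 : 0 < M).

(** Outside the time interval the control is extended by the null control, which
    lies in all the sets of controls. *)
Definition shift_ctl (tau : R) (alpha : R -> E -> E) : R -> E -> E :=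
  fun r => if 0 <= r - tau <= T then alpha (r - tau) else fun=> 0.

Lemma ae_shift (tau : R) (P : R -> Prop) : {ae leb, forall r, P r} -> {ae leb, forall r, P (r - tau)}.
Proof.
move=> [A [mA A0 PA]]; exists ((fun r => r + - tau) @^-1` A); split.
- rewrite -[_ @^-1` _]setTI.
  have ms : measurable_fun setT (fun t : measurableTypeR R => (t + - tau : measurableTypeR R)).
    by apply: continuous_measurable_fun => x; apply: cvgD; [exact: cvg_id|exact: cvg_cst].
  exact: ms.
- by rewrite (lebesgue_measure_shift (- tau) mA).
- by move=> x /= h; apply: PA.
Qed.

Lemma shift_ctl_strong tau alpha : strongly_measurable T alpha -> strongly_measurable T (shift_ctl tau alpha).
Proof.
move=> [c sc cc]; pose I : set R := [set r | 0 <= r - tau <= T].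
exists (fun k => fun r => if 0 <= r - tau <= T then c k (r - tau) else fun=> 0) => [k|s sT].
  have [m [B [v [mB cv cE]]]] := sc k.
  have ms : measurable_fun setT (fun t : measurableTypeR R => (t - tau : measurableTypeR R)).
    by apply: continuous_measurable_fun => x; apply: cvgB; [exact: cvg_id|exact: cvg_cst].
  have mI : measurable I.
    rewrite (_ : I = `[tau, T + tau]%classic); first exact: measurable_itv.
    by apply/seteqP; split => x; rewrite /I /= in_itv/= => /andP[? ?]; apply/andP; split; lra.
  exists m, (fun i => I `&` ((fun r => r - tau) @^-1` B i)), v; split => //.
    move=> i; apply: measurableI => //; rewrite -[_ @^-1` _]setTI.
    exact: (ms measurableT _ (mB i)).
  move=> s x; case: ifPn => h.
    rewrite cE; apply: eq_bigr => i _; rewrite !indicE in_setI.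
    have sI : s \in I by rewrite inE.
    by rewrite sI /=; congr (_%:R *: _); congr nat_of_bool; apply/idP/idP; rewrite !inE.
  rewrite big1 // => i _; rewrite indicE in_setI (_ : s \in I = false) ?scale0r//.
  by apply/negbTE/negP; rewrite inE => h'; rewrite /I /= h' in h.
rewrite /shift_ctl; case: ifPn => h; first exact: cc.
rewrite (_ : (fun _ : E => 0 - 0) = (fun=> 0)) ?V_norm0; first exact: cvg_cst.
by apply/funext => x; rewrite subr0.
Qed.

(** Shifting time is what allows states at different times to be compared
    without any continuity of the controls in time. *)
Lemma shift_controls tau alpha : controls T M alpha -> controls T M (shift_ctl tau alpha).
Proof.
move=> [ca sa _ aa].
have aeA : {ae leb, forall s, Atilde M (shift_ctl tau alpha s)}.
  apply: (@filterS _ _ (ae_filter_ringOfSetsType leb)) (ae_shift tau aa) => s h.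
  by rewrite /shift_ctl; case: ifPn => // _; exact/Atilde0/ltW.
split.
- by move=> s _; rewrite /shift_ctl; case: ifPn => [/ca//|_]; exact: control_space0.
- exact: shift_ctl_strong.
- have M2 : 0 <= M ^+ 2 by rewrite sqr_ge0.
  apply: le_lt_trans (ge0_integral_le_ae (c := M ^+ 2) _ _ M2 _) _ => //.
  + by move=> s; apply: expe_ge0; exact: V_norm_ge0.
  + apply: (@filterS _ _ (ae_filter_ringOfSetsType leb)) aeA => s [_ h] _.
    by rewrite EFin_expe lee_sqr ?V_norm_ge0// lee_fin ltW.
  + by apply: lte_mul_pinfty => //; apply: compact_finite_measure; exact: segment_compact.
- by apply: (@filterS _ _ (ae_filter_ringOfSetsType leb)) aeA => s h _.
Qed.

(** The null control shows that the set of controls is not empty: states may be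
    transported without moving. *)
Lemma zero_controls : controls T M (fun _ _ => 0 : E).
Proof.
split.
- by move=> s _; exact: control_space0.
- exists (fun _ _ _ => 0) => [k|s sT].
    exists 0%N, (fun=> set0), (fun _ _ => 0); split => //; first by move=> i; exact: control_space0.
    by move=> s x; rewrite big_ord0.
  rewrite (_ : (fun _ : E => 0 - 0) = (fun=> 0)) ?V_norm0; first exact: cvg_cst.
  by apply/funext => x; rewrite subr0.
- by rewrite V_norm0 integral0_eq// => s _; rewrite expe2 mule0.
- by apply: nearW => s _; exact/Atilde0/ltW.
Qed.

End shift_control.

Section shift_flow.
Context {R : realType} {n : nat} (T M : R).
Local Notation E := 'rV[R]_n.
Local Notation leb := (@lebesgue_measure R).
Hypothesis M0 : 0 < M.

Lemma integral_shift1 (a : R) (f : R -> \bar R) : measurable_fun setT f ->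
  (\int[leb]_t f (t + a)%R = \int[leb]_t f t)%E.
Proof.
move=> mf.
have ms : measurable_fun setT (fun t : measurableTypeR R => (t + a : measurableTypeR R)).
  by apply: continuous_measurable_fun => x; apply: cvgD; [exact: cvg_id|exact: cvg_cst].
pose nu : {measure set (measurableTypeR R) -> \bar R} :=
  measure_function_pushforward__canonical__measure_function_Measure leb ms.
have h (g : R -> \bar R) : measurable_fun setT g -> (forall x, 0 <= g x)%E ->
    (\int[leb]_x g (x + a)%R = \int[leb]_x g x)%E.
  move=> mg g0.
  have := @ge0_integral_pushforward _ _ _ _ _ _ ms leb setT g measurableT mg (fun x _ => g0 x).
  rewrite preimage_setT /= => <-; rewrite -[LHS]/(\int[nu]_t g t)%E.
  by apply: eq_measure_integral => A mA _; exact: lebesgue_measure_shift.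
rewrite [LHS]integralE [RHS]integralE; congr (_ - _)%E.
- by rewrite -(h _ (measurable_funepos mf))// (funepos_comp f (fun x => x + a)).
- by rewrite -(h _ (measurable_funeneg mf))// (funeneg_comp f (fun x => x + a)).
Qed.

Lemma integral_itv_shift (a t s : R) (f : R -> \bar R) : measurable_fun `[t + a, s + a] f ->
  (\int[leb]_(r in `[t, s]) f (r + a)%R = \int[leb]_(r in `[(t + a)%R, (s + a)%R]) f r)%E.
Proof.
move=> mf; rewrite integral_mkcond [RHS]integral_mkcond -[RHS](integral_shift1 a); last first.
  by apply/(measurable_restrictT _ (measurable_itv `[t + a, s + a])).
apply: eq_integral => x _; rewrite !patchE; congr (if _ then _ else _).
by apply/idP/idP; rewrite !inE /= !in_itv/= !lerD2r.
Qed.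

Lemma measurable_itv_shift (a t s : R) (f : R -> \bar R) : measurable_fun `[t + a, s + a] f ->
  measurable_fun `[t, s] (fun r => f (r + a)).
Proof.
move=> mf.
have ms : measurable_fun `[t, s] (fun t : measurableTypeR R => (t + a : measurableTypeR R)).
  apply: measurable_funTS; apply: continuous_measurable_fun => x.
  by apply: cvgD; [exact: cvg_id|exact: cvg_cst].
apply: (measurable_comp (F := `[t + a, s + a]) _ _ mf ms) => //.
by move=> _ [r] /= + <-; rewrite !in_itv/= !lerD2r.
Qed.

Lemma integrable_itv_shift (a t s : R) (f : R -> R) :
  leb.-integrable `[t + a, s + a] (EFin \o f) ->
  leb.-integrable `[t, s] (EFin \o (fun r => f (r + a))).
Proof.
move=> /integrableP[mf ioo]; apply/integrableP; split.
  exact: (measurable_itv_shift mf).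
rewrite (integral_itv_shift (f := fun r => `|(EFin \o f) r|%E))//.
exact: measurableT_comp.
Qed.

Lemma solves_shift (F G : R -> E -> E) t s (a : R) g : t <= s ->
  (forall r x, t <= r <= s -> F (r + a) x = G r x) ->
  solves (t + a) (s + a) F g -> solves t s G (fun r => g (r + a)).
Proof.
move=> ts FG Fg i; have [h1 h2] := Fg i.
have e r : t <= r <= s -> F (r + a) (g (r + a)) 0 i = G r (g (r + a)) 0 i by move=> tr; rewrite FG.
have its := integrable_itv_shift h1; split.
  apply: eq_integrable its => // r; rewrite inE /= in_itv/= => tr.
  by rewrite e.
move=> r /andP[tr rs]; rewrite h2 ?lerD2r ?tr//; congr (_ + _).
rewrite /prim /Rintegral -integral_itv_shift; last first.
  apply: measurable_funS (measurable_int leb h1) => //.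
  by apply: subset_itvScc; rewrite bnd_simp// lerD2r.
congr fine; apply: eq_integral => z; rewrite inE /= in_itv/= => /andP[tz zr].
by rewrite e// tz (le_trans zr rs).
Qed.

(** Both sides solve the same equation on [[t, s]], with the same initial value. *)
Lemma flow_shift (alpha : R -> E -> E) t s (a : R) : controls T M alpha -> 0 <= t -> t <= s -> s <= T ->
  0 <= t + a -> s + a <= T ->
  flow T (shift_ctl T a alpha) (t + a) (s + a) = flow T alpha t s.
Proof.
move=> ca t0 ts sT ta sa; apply/funext => x.
have cs : controls T M (shift_ctl T a alpha) by exact: shift_controls.
have tT := le_trans ts sT.
have taT : t + a <= T by apply: le_trans sa; rewrite lerD2r.
have [h1 h2] := flow_solves M0 ca t0 tT x.
have [h3 h4] := flow_solves M0 cs ta taT x.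
have rs (F : R -> E -> E) (g : R -> E) (t' s' T' : R) : s' <= T' -> solves t' T' F g -> solves t' s' F g.
  move=> sT' Fg i; have [k1 k2] := Fg i; split; first exact: (integrableS_itv (lexx _) sT' k1).
  by move=> r /andP[tr rs']; apply: k2; rewrite tr (le_trans rs' sT').
have h5 := rs _ _ _ _ _ sT h2; have h6 := rs _ _ _ _ _ sa h4.
have h7 := @solves_shift _ alpha t s a _ ts _ h6.
have fb : field_bounds t s (M + 1) (@ctl_B R n M) (@ctl_K R n M) alpha.
  apply: (@filterS _ _ (ae_filter_ringOfSetsType leb)) (control_field ca t0) => r H /andP[tr rs'].
  by apply: H; rewrite tr (le_trans rs' sT).
have tt : t <= t <= s by rewrite lexx.
have ss : t <= s <= s by rewrite ts lexx.
have M1 : 0 <= M + 1 by rewrite addr_ge0// ltW.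
have := solves_dist fb (ctl_B_gt0 M0) M1 (h7 _) h5 tt ss.
rewrite h3 h1 subrr normr0 mul0r => H; apply/eqP; rewrite -subr_eq0 -normr_le0; apply: H.
move=> r y /andP[tr rs']; rewrite /shift_ctl addrK.
by rewrite (le_trans t0 tr) (le_trans rs' sT).
Qed.

Lemma transport_shift (alpha : R -> E -> E) t s (a : R) m : controls T M alpha -> 0 <= t -> t <= s -> s <= T ->
  0 <= t + a -> s + a <= T ->
  transport T (s + a) (shift_ctl T a alpha) m (t + a) = transport T s alpha m t.
Proof.
by move=> ca t0 ts sT ta sa; apply/funext => x; rewrite /transport /flow_inv (flow_shift ca).
Qed.

End shift_flow.

(** * The space of square integrable functions *)

(** Optimisation over l of the arithmetic-geometric mean inequality; this is the
    step from positivity of quadratic forms to the Cauchy-Schwarz inequality. *)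
Lemma ler_sqrt_mul {R : realType} (p x y : R) : 0 <= x -> 0 <= y ->
  (forall l, 0 < l -> 2 * p <= l * x + y / l) -> p <= Num.sqrt x * Num.sqrt y.
Proof.
move=> x0 y0 H; have sx := sqrtr_ge0 x; have sy := sqrtr_ge0 y.
rewrite -(sqr_sqrtr x0) -(sqr_sqrtr y0) in H.
set a := Num.sqrt x in H sx *; set b := Num.sqrt y in H sy *.
apply/ler_addgt0Pr => e e0.
pose d := e / (a + b + 1).
have ab1 : 0 < a + b + 1 by lra.
have d0 : 0 < d by rewrite divr_gt0.
pose l := (b + d) / (a + d).
have ad : 0 < a + d by lra.
have bd : 0 < b + d by lra.
have l0 : 0 < l by rewrite divr_gt0.
have h1 := H l l0.
have h2 : l * a ^+ 2 <= (b + d) * a.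
  rewrite /l expr2 [_ / _ * _]mulrA; rewrite (_ : _ / _ * a * a = (b + d) * a * (a / (a + d))); last by field; rewrite gt_eqF.
  by rewrite ler_piMr ?mulr_ge0 ?(ltW bd)// ler_pdivrMr// mul1r; lra.
have h3 : b ^+ 2 / l <= (a + d) * b.
  rewrite /l expr2 (_ : _ * b / _ = (a + d) * b * (b / (b + d))); last by field; rewrite !gt_eqF.
  by rewrite ler_piMr ?mulr_ge0 ?(ltW ad)// ler_pdivrMr// mul1r; lra.
have h4 : d * (a + b) <= e.
  by rewrite /d mulrAC ler_pdivrMr// ler_wpM2l ?(ltW e0)//; lra.
nra.
Qed.

Section L2_space.
Context {R : realType} {n : nat}.
Local Notation E := 'rV[R]_n.
Local Notation mu := (lebesgue_rV R n).
Implicit Types (f g h : E -> R).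

Lemma L2P f : L2 f <-> measurable_fun setT f /\ mu.-integrable setT (fun x => (f x ^+ 2)%:E).
Proof.
have e x : (`|(EFin \o f) x| `^ 2)%E = (f x ^+ 2)%:E.
  by rewrite [(_ \o _) x]/= abse_EFin poweR_EFin powR_mulrn// real_normK// num_real.
split=> [fL|[mf fi]].
  split; last exact: Lfun2_integrable_sqr.
  have : f \in Lfun mu 2%:E by exact: fL.
  by rewrite inE => /andP[]; rewrite inE.
rewrite /L2 /= ; apply/andP; rewrite !inE /=; split => //.
rewrite /finite_norm unlock; under eq_integral do rewrite e.
apply: poweR_lty; move/integrableP : fi => [_]; apply: le_lt_trans.
apply: ge0_le_integral => //.
- by move=> x _; rewrite lee_fin sqr_ge0.
- by apply/measurable_EFinP; exact: measurable_funX.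
- by apply: measurableT_comp => //; apply/measurable_EFinP; exact: measurable_funX.
- by move=> x _; exact: lee_abs.
Qed.

Lemma L2_mul f g : L2 f -> L2 g -> mu.-integrable setT (fun x => (f x * g x)%:E).
Proof.
move=> /L2P[mf fi] /L2P[mg gi].
apply: (le_integrable measurableT _ _ (integrableD measurableT fi gi)).
  by apply/measurable_EFinP; exact: measurable_funM.
move=> x _; rewrite /= lee_fin [leRHS]ger0_norm ?addr_ge0 ?sqr_ge0// normrM.
rewrite -(real_normK (num_real (f x))) -(real_normK (num_real (g x))).
have := sqr_ge0 (`|f x| - `|g x|); rewrite sqrrB.
by have := normr_ge0 (f x); have := normr_ge0 (g x); move: `|f x| `|g x| => a b ? ?; nra.
Qed.

Lemma L2_lin (c d : R) f g : L2 f -> L2 g -> L2 (fun x => c * f x + d * g x).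
Proof.
move=> fL gL; have /L2P[mf fi] := fL; have /L2P[mg gi] := gL; apply/L2P; split.
  by apply: measurable_funD; apply: measurable_funM.
have h := integrableD measurableT (integrableZl measurableT (c ^+ 2) fi)
  (integrableD measurableT (integrableZl measurableT (d ^+ 2) gi) (integrableZl measurableT (2 * c * d) (L2_mul fL gL))).
congr (_.-integrable _ _): h; apply/funext => x; rewrite /= -!EFinM -!EFinD; congr EFin.
by ring.
Qed.

Lemma L2Z (c : R) f : L2 f -> L2 (fun x => c * f x).
Proof.
by move=> fL; have := L2_lin c 0 fL fL; congr L2; apply/funext => x; rewrite mul0r addr0.
Qed.

Lemma L2B f g : L2 f -> L2 g -> L2 (f \- g).
Proof.
by move=> fL gL; have := L2_lin 1 (-1) fL gL; congr L2; apply/funext => x; rewrite mul1r mulN1r.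
Qed.

Lemma L2_inner_sym f g : L2_inner f g = L2_inner g f.
Proof. by apply: eq_Rintegral => x _; rewrite mulrC. Qed.

Lemma L2_inner_lin (c d : R) f g h : L2 f -> L2 g -> L2 h ->
  L2_inner (fun x => c * f x + d * g x) h = c * L2_inner f h + d * L2_inner g h.
Proof.
move=> fL gL hL; have fh := L2_mul fL hL; have gh := L2_mul gL hL.
have sc (k : R) g' : mu.-integrable setT (fun x => (g' x)%:E) -> mu.-integrable setT (fun x => (k * g' x)%:E).
  by move=> it; have := integrableZl measurableT k it; congr (_.-integrable _ _); apply/funext => x; rewrite /= EFinM.
rewrite /L2_inner -RintegralZl// -RintegralZl// -RintegralD//; [|exact: sc|exact: sc].
by apply: eq_Rintegral => x _; ring.
Qed.

Lemma L2_inner_linr (c d : R) f g h : L2 f -> L2 g -> L2 h ->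
  L2_inner h (fun x => c * f x + d * g x) = c * L2_inner h f + d * L2_inner h g.
Proof. by move=> fL gL hL; rewrite L2_inner_sym L2_inner_lin// ![L2_inner _ h]L2_inner_sym. Qed.

Lemma L2_innerBr f g h : L2 f -> L2 g -> L2 h -> L2_inner h (f \- g) = L2_inner h f - L2_inner h g.
Proof.
move=> fL gL hL; have := L2_inner_linr 1 (-1) fL gL hL; rewrite mul1r mulN1r => <-.
by congr (L2_inner h); apply/funext => x; rewrite mul1r mulN1r.
Qed.

Lemma L2_innerZl (c : R) f h : L2 f -> L2 h -> L2_inner (fun x => c * f x) h = c * L2_inner f h.
Proof.
move=> fL hL; have := L2_inner_lin c 0 fL fL hL; rewrite mul0r addr0 => <-.
by congr (L2_inner _ h); apply/funext => x; rewrite mul0r addr0.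
Qed.

Lemma L2_inner_ge0 f : 0 <= L2_inner f f.
Proof. by apply: Rintegral_ge0 => x _; rewrite -expr2 sqr_ge0. Qed.

Lemma L2_norm_ge0 f : 0 <= L2_norm f.
Proof. by rewrite fine_ge0// Lnorm_ge0. Qed.

Lemma L2_normE f : L2_norm f = Num.sqrt (L2_inner f f).
Proof.
rewrite /L2_norm unlock.
under eq_integral => x _ do rewrite [(_ \o _) x]/= abse_EFin poweR_EFin powR_mulrn// real_normK ?num_real// expr2.
by rewrite fine_poweR powR12_sqrt//; exact: L2_inner_ge0.
Qed.

Lemma sqr_L2_norm f : L2_norm f ^+ 2 = L2_inner f f.
Proof. by rewrite L2_normE sqr_sqrtr// L2_inner_ge0. Qed.

Lemma sqr_L2_lin (c d : R) f g : L2 f -> L2 g ->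
  L2_norm (fun x => c * f x + d * g x) ^+ 2 =
  c ^+ 2 * L2_norm f ^+ 2 + 2 * c * d * L2_inner f g + d ^+ 2 * L2_norm g ^+ 2.
Proof.
move=> fL gL; have hL := L2_lin c d fL gL; rewrite !sqr_L2_norm L2_inner_lin// !L2_inner_linr//.
by rewrite [L2_inner g f]L2_inner_sym; ring.
Qed.

Lemma L2_cauchy_schwarz f g : L2 f -> L2 g -> `|L2_inner f g| <= L2_norm f * L2_norm g.
Proof.
move=> fL gL; rewrite !L2_normE.
have key (s : R) : s ^+ 2 = 1 -> s * L2_inner f g <= Num.sqrt (L2_inner f f) * Num.sqrt (L2_inner g g).
  move=> s2; apply: ler_sqrt_mul; [exact: L2_inner_ge0|exact: L2_inner_ge0|] => l l0.
  have := sqr_L2_lin l (- s) fL gL; rewrite sqrrN s2 mul1r !sqr_L2_norm => h.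
  have := L2_inner_ge0 (fun x => l * f x + - s * g x); rewrite h.
  move: (L2_inner f f) (L2_inner f g) (L2_inner g g) => x y z h'; rewrite -(ler_pM2l l0).
  rewrite (_ : l * (l * x + z / l) = l ^+ 2 * x + z); last by field; rewrite gt_eqF.
  by rewrite -subr_ge0; apply: le_trans h' _; rewrite le_eqVlt; apply/orP; left; apply/eqP; ring.
have h1 := key 1 (expr1n _ _); have h2 := key (-1) (etrans (sqrrN _) (expr1n _ _)).
rewrite mul1r in h1; rewrite mulN1r in h2.
by rewrite ler_norml h1 andbT lerNl.
Qed.

Lemma L2_normD f g : L2 f -> L2 g -> L2_norm (f \+ g) <= L2_norm f + L2_norm g.
Proof.
move=> fL gL; rewrite -(@ler_pXn2r _ 2)// ?nnegrE ?addr_ge0 ?L2_norm_ge0//.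
rewrite (_ : f \+ g = fun x => 1 * f x + 1 * g x); last by apply/funext => x; rewrite !mul1r.
rewrite sqr_L2_lin// sqrrD; have := ler_norm (L2_inner f g); have := L2_cauchy_schwarz fL gL.
move: (L2_inner f g) (L2_norm f) (L2_norm g) => x y z; lra.
Qed.

Lemma L2_normZ (c : R) f : L2 f -> L2_norm (fun x => c * f x) = `|c| * L2_norm f.
Proof.
move=> fL; have cL := L2Z c fL; rewrite !L2_normE L2_innerZl// L2_inner_sym L2_innerZl//.
by rewrite mulrA -expr2 sqrtrM ?sqr_ge0// sqrtr_sqr.
Qed.

Lemma L2_distC f g : L2_dist f g = L2_dist g f.
Proof.
rewrite /L2_dist !L2_normE; congr Num.sqrt; apply: eq_Rintegral => x _ /=; ring.
Qed.

Lemma L2_dist_triangle f g h : L2 f -> L2 g -> L2 h -> L2_dist f h <= L2_dist f g + L2_dist g h.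
Proof.
move=> fL gL hL; rewrite /L2_dist (_ : f \- h = (f \- g) \+ (g \- h)).
  by apply: L2_normD; exact: L2B.
by apply/funext => x /=; rewrite addrA subrK.
Qed.

Lemma L2_dist_ge0 f g : 0 <= L2_dist f g. Proof. exact: L2_norm_ge0. Qed.

Lemma L2_distxx f : L2_dist f f = 0.
Proof.
rewrite /L2_dist L2_normE (_ : L2_inner _ _ = 0) ?sqrtr0//.
rewrite /L2_inner /Rintegral integral0_eq// => x _; by rewrite /= subrr mul0r.
Qed.

Lemma L2_supported r f (B : R) : measurable_fun setT f -> (forall x, ~ cube r x -> f x = 0) ->
  (forall x, `|f x| <= B) -> L2 f /\ L2_norm f <= B * Num.sqrt (fine (mu (cube r))).
Proof.
move=> mf fr fB.
have B0 : 0 <= B by apply: le_trans (fB 0).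
have i2 : mu.-integrable setT (fun x => (f x ^+ 2)%:E).
  apply: (@integrable_cube_supported _ _ (fun x => f x ^+ 2) (B ^+ 2) r).
  - exact: measurable_funX.
  - by move=> x; rewrite normrX lerXn2r ?nnegrE.
  - by move=> x xr; rewrite fr ?expr0n// /cube /= leNgt xr.
split; first exact/L2P.
rewrite L2_normE -[B]ger0_norm// -sqrtr_sqr -sqrtrM ?sqr_ge0// ler_sqrt; last first.
  by rewrite mulr_ge0 ?sqr_ge0// fine_ge0.
have cfin : mu (cube r) \is a fin_num by rewrite ge0_fin_numE// cube_fin.
rewrite -lee_fin EFinM [(fine (mu (cube r)))%:E]fineK//.
have -> : ((B ^+ 2)%:E * mu (cube r) = \int[mu]_(x in cube r) (cst (B ^+ 2)%:E x))%E.
  by rewrite integral_cst//; exact: measurable_cube.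
rewrite /L2_inner /Rintegral.
have e : (\int[mu]_x (f x * f x)%:E = \int[mu]_(x in cube r) (f x ^+ 2)%:E)%E.
  rewrite [RHS]integral_mkcond; apply: eq_integral => x _; rewrite patchE.
  by case: ifPn; rewrite ?expr2// notin_setE => /fr ->; rewrite mul0r.
have ic := integrableS measurableT (measurable_cube r) (@subsetT _ _) i2.
rewrite e fineK; last by apply: integrable_fin_num => //; exact: measurable_cube.
apply: ge0_le_integral => //; first exact: measurable_cube.
- by move=> x _; rewrite lee_fin sqr_ge0.
- by have := measurable_int mu ic.
- by move=> x _; rewrite /= lee_fin -real_normK ?num_real// lerXn2r ?nnegrE.
Qed.

Lemma sqr_L2_dist f g c : L2 f -> L2 g -> L2 c ->
  L2_dist g c ^+ 2 = L2_dist f c ^+ 2 + 2 * L2_inner (f \- c) (g \- f) + L2_dist g f ^+ 2.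
Proof.
move=> fL gL cL.
have := sqr_L2_lin 1 1 (L2B fL cL) (L2B gL fL); rewrite !expr1n !mulr1 !mul1r => <-.
congr (L2_norm _ ^+ 2); apply/funext => x /=; ring.
Qed.

(** The only test functions that are needed: a quadratic function of the density
    plus a function of time with a Lipschitz continuous derivative. *)
Lemma C1_test_quadratic T (lam : R) (c : E -> R) (h h' : R -> R) (C : R) : L2 c -> 0 <= C ->
  (forall s t, `|h s - h t - h' t * (s - t)| <= C * `|s - t| ^+ 2) ->
  (forall s t, `|h' s - h' t| <= C * `|s - t|) ->
  C1_test T (fun f t => lam * L2_dist f c ^+ 2 + h t) (fun _ t => h' t)
    (fun f _ x => 2 * lam * (f x - c x)).
Proof.
move=> cL C0 hC h'C f t fL tT; have fcL := L2B fL cL; split.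
- exact: (L2Z _ fcL).
- move=> e e0; have D0 : 0 < `|lam| + C + 1 by rewrite ltr_wpDl// addr_ge0.
  exists (e / (`|lam| + C + 1)); first by rewrite divr_gt0.
  move=> g s gL sT; set r := L2_dist g f; set tau := `|s - t| => rd td.
  rewrite (sqr_L2_dist fL gL cL) (_ : L2_inner (fun x => 2 * lam * _) _ = 2 * lam * L2_inner (f \- c) (g \- f)); last first.
    by rewrite -(L2_innerZl _ fcL (L2B gL fL)).
  rewrite (_ : _ - _ = lam * r ^+ 2 + (h s - h t - h' t * (s - t))); last by rewrite -/r; ring.
  apply: le_trans (ler_normD _ _) _; have h1 := hC s t; rewrite -/tau in h1.
  have r0 : 0 <= r by exact: L2_dist_ge0.
  have tau0 : 0 <= tau by exact: normr_ge0.
  have l1 : `|lam * r ^+ 2| = `|lam| * r ^+ 2 by rewrite normrM [X in _ * X]ger0_norm ?sqr_ge0.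
  rewrite ltr_pdivlMr// in rd; rewrite ltr_pdivlMr// in td.
  rewrite l1; apply: le_trans (lerD (lexx _) h1) _; rewrite mulrDr.
  have lam0 := normr_ge0 lam; apply: lerD; rewrite expr2 mulrA ler_wpM2r//.
    by apply: le_trans (ltW rd); rewrite mulrC ler_wpM2l//; lra.
  by apply: le_trans (ltW td); rewrite mulrC ler_wpM2l//; lra.
- move=> e e0; have lam0 := normr_ge0 lam; have D0 : 0 < 2 * `|lam| + C + 1 by lra.
  exists (e / (2 * `|lam| + C + 1)); first by rewrite divr_gt0.
  move=> g s gL sT; set r := L2_dist g f; set tau := `|s - t| => rd td.
  have r0 : 0 <= r by exact: L2_dist_ge0.
  have tau0 : 0 <= tau by exact: normr_ge0.
  rewrite ltr_pdivlMr// in rd; rewrite ltr_pdivlMr// in td.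
  split.
    apply: le_lt_trans (h'C s t) _; apply: le_lt_trans td.
    by rewrite mulrC ler_wpM2l//; lra.
  rewrite /L2_dist (_ : _ \- _ = fun x => (2 * lam) * (g \- f) x); last by apply/funext => x /=; ring.
  rewrite L2_normZ; last exact: L2B.
  rewrite -/r normrM ger0_norm//; apply: le_lt_trans rd.
  by rewrite mulrC ler_wpM2l//; lra.
Qed.

End L2_space.

(** * Euclidean distance and closedness of Sobolev bounds *)

Section euclid.
Context {R : realType} {n : nat}.
Local Notation E := 'rV[R]_n.
Implicit Types (x y : E) (A : set E).

Lemma dot_rV_ge0 x : 0 <= dot_rV x x.
Proof. by apply: sumr_ge0 => i _; rewrite -expr2 sqr_ge0. Qed.

Lemma eucl_norm_ge0 x : 0 <= eucl_norm x. Proof. exact: sqrtr_ge0. Qed.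

Lemma normr_le_eucl x : `|x| <= eucl_norm x.
Proof.
apply: normr_rV_le => [|i]; first exact: eucl_norm_ge0.
rewrite -sqrtr_sqr ler_sqrt ?dot_rV_ge0// /dot_rV (bigD1 i)//= -expr2 lerDl.
by apply: sumr_ge0 => j _; rewrite -expr2 sqr_ge0.
Qed.

Lemma eucl_norm_le x : eucl_norm x <= n%:R * `|x|.
Proof.
rewrite -[leRHS]ger0_norm ?mulr_ge0// -sqrtr_sqr ler_sqrt ?sqr_ge0// /dot_rV.
apply: (@le_trans _ _ (\sum_(i < n) `|x| ^+ 2)).
  apply: ler_sum => i _; rewrite -expr2 -real_normK ?num_real//.
  by rewrite lerXn2r ?nnegrE// normr_rV_coord.
rewrite sumr_const card_ord exprMn -[leLHS]mulr_natl ler_wpM2r ?sqr_ge0//.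
by rewrite -natrX ler_nat -{1}[n]mul1n expnS expn1; case: (n) => // k; rewrite leq_mul.
Qed.

Lemma eucl_normD x y : eucl_norm (x + y) <= eucl_norm x + eucl_norm y.
Proof.
have xy : dot_rV x y <= eucl_norm x * eucl_norm y.
  apply: ler_sqrt_mul; rewrite ?dot_rV_ge0// => l l0.
  rewrite /dot_rV !mulr_sumr mulr_suml -big_split; apply: ler_sum => i _ /=.
  have := sqr_ge0 (l * x 0 i - y 0 i); rewrite -(pmulr_lge0 _ (_ : 0 < l^-1)) ?invr_gt0// => h.
  rewrite -subr_ge0; apply: le_trans h _; rewrite le_eqVlt; apply/orP; left; apply/eqP.
  by field; rewrite gt_eqF.
rewrite -(@ler_pXn2r _ 2)// ?nnegrE ?addr_ge0 ?eucl_norm_ge0//.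
rewrite sqrrD /eucl_norm !sqr_sqrtr ?dot_rV_ge0// -!/(eucl_norm _).
have -> : dot_rV (x + y) (x + y) = dot_rV x x + 2 * dot_rV x y + dot_rV y y.
  by rewrite /dot_rV mulr_sumr -!big_split; apply: eq_bigr => i _ /=; rewrite !mxE; ring.
by rewrite lerD2r lerD2l; lra.
Qed.

Let dists x A := [set eucl_norm (x - y) | y in A].

Let has_inf_dists x A : A !=set0 -> has_inf (dists x A).
Proof.
move=> [y Ay]; split; first by exists (eucl_norm (x - y)), y.
by exists 0 => _ [z _ <-]; exact: eucl_norm_ge0.
Qed.

Lemma eucl_dist_ge0 x A : A !=set0 -> 0 <= eucl_dist x A.
Proof.
move=> A0; apply: lb_le_inf; first by have [] := has_inf_dists x A0.
by move=> _ [z _ <-]; exact: eucl_norm_ge0.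
Qed.

Lemma eucl_dist_le x y A : A y -> eucl_dist x A <= eucl_norm (x - y).
Proof.
move=> Ay; apply: ge_inf; last by exists y.
by have [] := has_inf_dists x (ex_intro _ y Ay).
Qed.

Lemma eucl_dist_adherent x A e : A !=set0 -> 0 < e ->
  exists2 y, A y & eucl_norm (x - y) < eucl_dist x A + e.
Proof. by move=> A0 e0; have [_ [y Ay <-] h] := inf_adherent e0 (has_inf_dists x A0); exists y. Qed.

Lemma eucl_dist_lip x y A : A !=set0 -> `|eucl_dist x A - eucl_dist y A| <= n%:R * `|x - y|.
Proof.
move=> A0; have key (u v : E) : eucl_dist u A <= eucl_dist v A + n%:R * `|u - v|.
  apply/ler_addgt0Pr => e e0; have [z Az zv] := eucl_dist_adherent v A0 e0.
  apply: le_trans (eucl_dist_le u Az) _.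
  rewrite (_ : u - z = (v - z) + (u - v)); last by rewrite [v - z + _]addrC addrA subrK.
  apply: le_trans (eucl_normD _ _) _; rewrite addrAC; apply: lerD; first exact: ltW.
  exact: eucl_norm_le.
have h1 := key x y; have h2 := key y x; rewrite distrC in h2.
by rewrite ler_norml; apply/andP; split; lra.
Qed.

Lemma lip_continuous (f : E -> R) (L : R) : (forall x y, `|f x - f y| <= L * `|x - y|) -> continuous f.
Proof.
move=> fL; apply/continuous_rVP => x e e0.
have L1 : 0 < `|L| + 1 by rewrite ltr_wpDl.
exists (e / (`|L| + 1)); first by rewrite divr_gt0.
move=> y yx; apply: le_lt_trans (fL y x) _.
apply: (@le_lt_trans _ _ ((`|L| + 1) * `|y - x|)).
  by rewrite ler_wpM2r// (le_trans (ler_norm L))// lerDl.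
by rewrite mulrC -ltr_pdivlMr.
Qed.

Lemma continuous_eucl_dist A : A !=set0 -> continuous (fun x => eucl_dist x A).
Proof. by move=> A0; apply: lip_continuous => x y; exact: eucl_dist_lip. Qed.

Lemma closed_enlarged (M : R) A t : A !=set0 -> closed (enlarged M A t).
Proof.
move=> A0; rewrite (_ : enlarged M A t = (fun x => eucl_dist x A) @^-1` [set r | r <= M * t])//.
apply: preimage_closed; last exact: closed_le.
by move=> x _; exact: continuous_eucl_dist.
Qed.

(** One cube contains the supports of all states at all times. *)
Lemma enlarged_bounded (M T : R) A : A !=set0 -> bounded_set A ->
  exists2 r : R, 0 <= r & forall t x, M * t <= M * T -> enlarged M A t x -> `|x| <= r.
Proof.
move=> A0 [b [_ bA]]; have bA' y : A y -> `|y| <= `|b| + 1.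
  by move=> Ay; apply: (bA (`|b| + 1)) => //; rewrite ltr_pwDr// ler_norm.
exists (`|b| + 1 + (`|M * T| + 1)); first by rewrite !addr_ge0.
move=> t x tT xA; have [y Ay xy] := eucl_dist_adherent x A0 ltr01.
rewrite -[x](subrK y) addrC; apply: le_trans (ler_normD _ _) _; apply: lerD; first exact: bA'.
apply: le_trans (normr_le_eucl _) _; apply: le_trans (ltW xy) _; rewrite lerD2r.
by apply: le_trans xA _; apply: le_trans tT _; exact: ler_norm.
Qed.

End euclid.

Section ultra_Wkoo.
Context {R : realType} {n : nat} (U : set_system nat) {UU : UltraFilter U}.
Local Notation E := 'rV[R]_n.

Lemma fdiffs_cvg (s : seq ('I_n * R)) (fk : nat -> E -> R) (f : E -> R) :
  (forall x, fk k x @[k --> U] --> f x) -> forall x, fdiffs s (fk k) x @[k --> U] --> fdiffs s f x.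
Proof.
by move=> H; elim: s => [//|p s IH] x /=; apply: cvgB; exact: IH.
Qed.

(** Finite differences involve finitely many values, so their bounds are stable
    under pointwise convergence. *)
Lemma diff_le_ultra r (Kk : nat -> R) (K : R) (fk : nat -> E -> R) (f : E -> R) :
  (forall x, fk k x @[k --> U] --> f x) -> Kk k @[k --> U] --> K ->
  (forall k, diff_le r (Kk k) (fk k)) -> diff_le r K f.
Proof.
move=> fkf KkK H s x sr s0.
apply: (ultra_le (v := fun k => `|fdiffs s (fk k) x|) (w := fun k => Kk k * \prod_(p <- s) p.2)).
- by apply: cvg_norm; exact: fdiffs_cvg.
- by apply: cvgMl.
- by move=> k; exact: H.
Qed.

Lemma scalar_coord (f : E -> R) (j : 'I_1) : (fun x => scalar_field f x 0 j) = f.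
Proof. by apply/funext => x; rewrite /scalar_field mxE (ord1 j) eqxx mulr1n. Qed.

(** The closedness of Sobolev balls under pointwise convergence of continuous
    functions. *)
Lemma Wkoo_ultra k (fk : nat -> E -> R) (f : E -> R) (c : R) :
  (forall j, continuous (fk j)) -> continuous f -> (forall x, fk j x @[j --> U] --> f x) ->
  (forall j, Wkoo_norm k (scalar_field (fk j)) <= c%:E)%E ->
  (Wkoo_norm k (scalar_field f) <= c%:E)%E.
Proof.
move=> cfk cf fkf H; apply/lee_addgt0Pr => e e0.
have Hj j : exists K : {ffun 'I_n -> 'I_k.+1} -> R,
    [/\ forall b, 0 <= K b, forall b, (mdeg b <= k)%N -> diff_le (dirs b) (K b) (fk j) &
     \sum_(b : {ffun 'I_n -> 'I_k.+1} | (mdeg b <= k)%N) K b < c + e].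
  have cs i : continuous (fun x => scalar_field (fk j) x 0 i) by rewrite scalar_coord.
  have lt : (Wkoo_norm k (scalar_field (fk j)) < (c + e)%:E)%E.
    by apply: le_lt_trans (H j) _; rewrite lte_fin ltrDl.
  have [K [K0 KP KS]] := Wkoo_lt_diff_le cs lt; exists K; split => // b bk.
  by have := KP b ord0 bk; rewrite scalar_coord.
have /choice[K KP] := Hj.
have Kle j b : (mdeg b <= k)%N -> `|K j b| <= c + e.
  move=> bk; have [K0 _ KS] := KP j; rewrite ger0_norm//; apply: le_trans (ltW KS).
  by rewrite (bigD1 b)//= lerDl; apply: sumr_ge0.
pose L b : R := if (mdeg b <= k)%N then ulim U (fun j => K j b) else 0.
have Lcvg b : (mdeg b <= k)%N -> K j b @[j --> U] --> L b.
  by move=> bk; rewrite /L bk; exact: (ulimP (fun j => Kle j b bk)).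
apply: (@le_trans _ _ (\sum_(b : {ffun 'I_n -> 'I_k.+1} | (mdeg b <= k)%N) L b)%:E).
  apply: Wkoo_le => // b bk; apply: diff_le_ultra fkf (Lcvg b bk) _ => j.
  by have [_ h _] := KP j; exact: h.
rewrite -EFinD lee_fin.
apply: (ultra_le (v := fun j => \sum_(b : {ffun 'I_n -> 'I_k.+1} | (mdeg b <= k)%N) K j b) (w := cst (c + e))).
- by apply: cvg_big => [|b bk]; [exact: add_continuous|exact: Lcvg].
- exact: cvg_cst.
- by move=> j; have [_ _ /ltW] := KP j.
Qed.

End ultra_Wkoo.

(** * State sets *)

Lemma continuous_mull {R : realType} (S : topologicalType) (c : R) (f : S -> R) :
  continuous f -> continuous (fun x => c * f x).
Proof. by move=> cf x; apply: cvgMr; exact: cf. Qed.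

Section Wkoo_misc.
Context {R : realType} {n : nat}.
Local Notation E := 'rV[R]_n.

Lemma Wkoo_lt_scalar k (f : E -> R) (N : R) : continuous f ->
  (Wkoo_norm k (scalar_field f) < N%:E)%E ->
  exists K : {ffun 'I_n -> 'I_k.+1} -> R,
    [/\ forall b, 0 <= K b, forall b, (mdeg b <= k)%N -> diff_le (dirs b) (K b) f &
     \sum_(b : {ffun 'I_n -> 'I_k.+1} | (mdeg b <= k)%N) K b < N].
Proof.
move=> cf fN; have cs i : continuous (fun x => scalar_field f x 0 i) by rewrite scalar_coord.
have [K [K0 KP KS]] := Wkoo_lt_diff_le cs fN; exists K; split => // b bk.
by have := KP b ord0 bk; rewrite scalar_coord.
Qed.

Lemma Wkoo_lt_scalar_C11 k (f : E -> R) (N : R) : continuous f -> (1 < k)%N ->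
  (Wkoo_norm k (scalar_field f) < N%:E)%E ->
  [/\ 0 <= N, forall x, `|f x| <= N, lip_le (n%:R * N) f & diff2_le (n%:R * (n%:R * N)) f].
Proof.
move=> cf k1 fN; have cs i : continuous (fun x => scalar_field f x 0 i) by rewrite scalar_coord.
have [N0 h1 h2 h3] := Wkoo_lt_C11 cs fN k1; split => //.
- move=> x; have := h1 x; apply: le_trans.
  by have := normr_rV_coord (scalar_field f x) ord0; rewrite /scalar_field mxE eqxx mulr1n.
- by have := h2 ord0; rewrite scalar_coord.
- by have := h3 ord0; rewrite scalar_coord.
Qed.

Lemma Wkoo_scale k (f : E -> R) (th c : R) : continuous f -> 0 <= th <= 1 ->
  (Wkoo_norm k (scalar_field f) <= c%:E)%E ->
  (Wkoo_norm k (scalar_field (fun x => (th * f x)%R)) <= c%:E)%E.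
Proof.
move=> cf /andP[th0 th1] fc; apply/lee_addgt0Pr => e e0.
have lt : (Wkoo_norm k (scalar_field f) < (c + e)%:E)%E.
  by apply: le_lt_trans fc _; rewrite lte_fin ltrDl.
have [K [K0 KP KS]] := Wkoo_lt_scalar cf lt.
have fE s x : fdiffs s (fun x => th * f x) x = th * fdiffs s f x.
  by elim: s x => [//|p s IH] x /=; rewrite /fdiff !IH mulrBr.
apply: le_trans (Wkoo_le (K := fun b => th * K b) _ _) _.
- exact: continuous_mull.
- by move=> b bk s x sb s0; rewrite fE normrM ger0_norm// -mulrA ler_wpM2l//; exact: KP.
- rewrite -EFinD lee_fin -mulr_sumr; apply: le_trans (ltW KS).
  by rewrite ler_piMl// sumr_ge0.
Qed.

Lemma fdiffs_cst s (c : R) : fdiffs s (cst c : E -> R) = cst (if s is [::] then c else 0).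
Proof. by elim: s => [//|p s IH] /=; rewrite IH; apply/funext => x; rewrite /fdiff subrr. Qed.

(** The norm of a constant is finite and nonzero, which is all that is needed to
    draw information on [C] from its defining inequality. *)
Lemma Wkoo_cst1 : exists2 w : R, 1 <= w & Wkoo_norm 2 (scalar_field (cst 1 : E -> R)) = w%:E.
Proof.
have c1 : continuous (cst 1 : E -> R) := @cst_continuous _ _ _.
have up : (Wkoo_norm 2 (scalar_field (cst 1%R : E -> R)) <= (\sum_(b : {ffun 'I_n -> 'I_3} | (mdeg b <= 2)%N) (if mdeg b == 0%N then 1 else 0 : R)%R)%:E)%E.
  apply: Wkoo_le => // b bk s x sb s0; rewrite fdiffs_cst.
  have -> : mdeg b = size s by rewrite -size_dirs -sb size_map.
  case: s sb s0 => [_ _|p s _ _] /=; first by rewrite big_nil mul1r normr1.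
  by rewrite normr0 mul0r.
have lo (N : R) : (Wkoo_norm 2 (scalar_field (cst 1%R : E -> R)) < N%:E)%E -> 1 <= N.
  by move=> /(Wkoo_lt_scalar_C11 (k := 2) c1 isT)[_ h _ _]; have := h 0; rewrite /= normr1.
case: (Wkoo_norm _ _) up lo => [w| |] up lo.
- exists w => //; apply/ler_addgt0Pr => e e0; apply: lo.
  by rewrite lte_fin ltrDl.
- by rewrite leye_eq in up.
- by have := lo 0 (ltNyr 0); rewrite ler10.
Qed.

End Wkoo_misc.

Section states.
Context {R : realType} {n : nat} (T M C CU : R) (Omt : set 'rV[R]_n).
Local Notation E := 'rV[R]_n.
Local Notation mu := (lebesgue_rV R n).
Hypotheses (T0 : 0 < T) (M0 : 0 < M) (CU0 : 0 < CU).
Hypotheses (C_bound : transport_bound n T M C).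
Hypotheses (Omt0 : Omt !=set0) (Omtb : bounded_set Omt).
Implicit Types (m : E -> R).
Local Notation later := (later_states T M C CU Omt).
Local Notation state := (state_set T M C CU Omt).

Lemma transport_init alpha m t : controls T M alpha -> 0 <= t -> t <= T ->
  transport T t alpha m t = m.
Proof.
move=> ca t0 tT; have tt : t <= t <= T by rewrite lexx.
have fE : flow T alpha t t = id by apply/funext => x; exact: (flow_init M0 ca t0 tT).
have iE x : flow_inv T alpha t t x = x.
  by have := flow_invK M0 ca t0 tT x tt; rewrite fE.
apply/funext => x; rewrite /transport iE fE.
have [_ ->] : differentiable (id : E -> E) x /\ 'J (id : E -> E) x = 1%:M.
  apply: (jacobian_unique (C := 0)) => v.
  by rewrite mulmx1 mul0r [x + v]addrC addrK subrr normr0.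
by rewrite det1 divr1.
Qed.

(** The null control leaves the constant density 1 unchanged. *)
Lemma C_ge1 : 1 <= C.
Proof.
have [w w1 wE] := @Wkoo_cst1 R n.
have zc := @zero_controls R n T M M0.
have tE := transport_init (cst 1) zc (ltW T0) (lexx T).
have := C_bound (ltW T0) (lexx T) (lexx T) zc (mbar := cst 1).
rewrite tE wE => H.
have : (w%:E <= C%:E * w%:E)%E.
  by apply: H; split; [exact: cst_continuous|rewrite wE ltry].
rewrite -EFinM lee_fin -{1}[w]mul1r ler_pM2r//; exact: lt_le_trans w1.
Qed.

(** States at time 0 are states at all positive times by the choice of the
    constant C. *)
Lemma initial_later m t : 0 < t <= T -> initial_states CU Omt m -> later t m.
Proof.
move=> /andP[t0 tT] [mW m_ge0 mC mS]; split => //.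
  move=> x /mS Ox; rewrite /enlarged /=; apply: le_trans (eucl_dist_le x Ox) _.
  by rewrite subrr eucl_norm0 mulr_ge0// ltW.
move=> s alpha /andP[ts sT] ca.
apply: le_trans (C_bound (ltW t0) ts sT ca mW) _.
rewrite EFinM lee_pmul2l// ?lte_fin; last exact: lt_le_trans C_ge1.
by apply: le_trans mC; rewrite le_max lexx.
Qed.

(** The transport over an interval of length zero is the identity. *)
Lemma later_Wkoo t m : 0 <= t -> t <= T -> later t m ->
  (Wkoo_norm 2 (scalar_field m) <= (C * CU)%:E)%E.
Proof.
move=> t0 tT [_ _ _ H]; have zc := @zero_controls R n T M M0.
by have := H t _ _ zc; rewrite (transport_init m zc t0 tT) lexx tT; apply.
Qed.

Lemma later_enlargedS s t : s <= t -> enlarged M Omt s `<=` enlarged M Omt t.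
Proof. by move=> st x /= h; apply: le_trans h _; rewrite ler_wpM2l// ltW. Qed.

Lemma later_final t m : 0 <= t -> t <= T -> later t m -> later T m.
Proof.
move=> t0 tT mt; have mC := later_Wkoo t0 tT mt.
have [mW m_ge0 mS _] := mt; split; [exact: mW|exact: m_ge0|exact: subset_trans mS (later_enlargedS tT)|].
move=> s alpha sT ca; have -> : s = T by apply/eqP; rewrite eq_le andbC.
by rewrite (transport_init m ca (ltW T0) (lexx T)).
Qed.

Lemma state_final t m : 0 <= t <= T -> state t m -> later T m.
Proof.
move=> /andP[t0 tT]; rewrite /state_set; case: eqP => [_|_ mt].
  by apply: initial_later; rewrite T0 lexx.
exact: later_final mt.
Qed.

Lemma state_T m : later T m -> state T m.
Proof. by rewrite /state_set gt_eqF. Qed.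

Definition state_B : R := C * CU + 1.

Lemma state_B_gt0 : 0 < state_B.
Proof.
by rewrite /state_B ltr_wpDl// mulr_ge0// ?(ltW CU0)// (le_trans ler01 C_ge1).
Qed.

Lemma later_facts t m : 0 <= t -> t <= T -> later t m ->
  [/\ continuous m, forall x, `|m x| <= state_B, lip_le (n%:R * state_B) m,
      diff2_le (n%:R * (n%:R * state_B)) m & forall x, ~ enlarged M Omt t x -> m x = 0].
Proof.
move=> t0 tT mt; have mC := later_Wkoo t0 tT mt; have [[cm _] _ mS _] := mt.
have lt : (Wkoo_norm 2 (scalar_field m) < state_B%:E)%E.
  by apply: le_lt_trans mC _; rewrite lte_fin ltrDl.
have [_ h1 h2 h3] := Wkoo_lt_scalar_C11 (k := 2) cm isT lt; split => // x nx.
apply/eqP; apply: contra_notT nx => mx; apply: mS.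
by apply: subset_closure.
Qed.

(** The transport is linear in the density, and scaling by at most 1 decreases
    the norm. *)
Lemma later_scale t m (th : R) : 0 <= t -> t <= T -> 0 <= th <= 1 -> later t m ->
  later t (fun x => th * m x).
Proof.
move=> t0 tT th01 mt; have [cm mB mL _ m0] := later_facts t0 tT mt.
have mC := later_Wkoo t0 tT mt; have [mW m_ge0 mS mT] := mt.
have c' : continuous (fun x => th * m x) by exact: continuous_mull.
split.
- by split => //; apply: le_lt_trans (Wkoo_scale cm th01 mC) _; rewrite ltry.
- by move=> x; rewrite mulr_ge0//; have /andP[] := th01.
- apply: subset_trans mS; apply: closureS => x /=; apply: contraNN => /eqP ->.
  by rewrite mulr0.
- move=> s alpha ts ca; have := mT s alpha ts ca.
  rewrite (_ : transport T s alpha (fun x => th * m x) t = fun x => th * transport T s alpha m t x); last first.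
    by apply/funext => x; rewrite /transport mulrA.
  apply: Wkoo_scale => //; apply: (transport_continuous M0 ca t0 tT ts (L := n%:R * state_B)).
  by move=> y z; have := mL z (y - z); rewrite [z + _]addrC subrK.
Qed.

Section closed.
Variables (U : set_system nat).
Hypotheses (UU : UltraFilter U) (Uoo : \oo%classic `<=` U).
Variables (mk : nat -> E -> R) (tk : nat -> R) (t : R).
Hypotheses (tk0 : forall k, 0 <= tk k <= T) (mkt : forall k, later (tk k) (mk k)).
Hypotheses (tkt : tk k @[k --> U] --> t).

Let mkf k := let: conj a b := andP (tk0 k) in later_facts a b (mkt k).

Definition ulimf : E -> R := fun x => ulim U (fun k => mk k x).

Lemma ulimf_cvg x : mk k x @[k --> U] --> ulimf x.
Proof. by apply: (@ulimP _ _ _ _ state_B) => k; have [_ h _ _ _] := mkf k; exact: h. Qed.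

Lemma ulim_time : 0 <= t <= T.
Proof.
apply/andP; split.
  by apply: (ultra_le (v := cst 0) (w := tk)) => //; [exact: cvg_cst|move=> k; have /andP[] := tk0 k].
by apply: (ultra_le (v := tk) (w := cst T)) => //; [exact: cvg_cst|move=> k; have /andP[] := tk0 k].
Qed.

Lemma lip_sub m L : lip_le L m -> forall x y, `|m x - m y| <= L * `|x - y|.
Proof. by move=> mL x y; have := mL y (x - y); rewrite [y + _]addrC subrK. Qed.

Lemma ulimf_lip x y : `|ulimf x - ulimf y| <= n%:R * state_B * `|x - y|.
Proof.
apply: (ultra_le (v := fun k => `|mk k x - mk k y|) (w := cst (n%:R * state_B * `|x - y|))).
- by apply: cvg_norm; apply: cvgB; exact: ulimf_cvg.
- exact: cvg_cst.
- by move=> k; have [_ _ h _ _] := mkf k; exact: lip_sub.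
Qed.

(** The transport of the limit along alpha, from t to s, is the limit of the
    transports of [mk k] from [tk k], along the control shifted by [tk k - t].  The
    final time is cut off so that the shifted interval stays in [[0, T]]. *)
Lemma ulimf_later : later t ulimf.
Proof.
have /andP[t0 tT] := ulim_time.
have cu : continuous ulimf by apply: lip_continuous; exact: ulimf_lip.
have WC : (Wkoo_norm 2 (scalar_field ulimf) <= (C * CU)%:E)%E.
  apply: (Wkoo_ultra (U := U) (fk := mk)) => //.
  - by move=> k; have [] := mkf k.
  - exact: ulimf_cvg.
  - by move=> k; have /andP[a b] := tk0 k; exact: later_Wkoo (mkt k).
split.
- by split => //; apply: le_lt_trans WC _; rewrite ltry.
- move=> x; apply: (ultra_le (v := cst 0) (w := fun k => mk k x)); [exact: cvg_cst|exact: ulimf_cvg|].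
  by move=> k; have [_ h _ _] := mkt k; exact: h.
- rewrite (closure_id (enlarged M Omt t)).1; last exact: closed_enlarged.
  apply: closureS => x /= ux; rewrite /enlarged /= leNgt; apply/negP => xt.
  have [k [/= h1 h2]] : exists k, M * tk k < eucl_dist x Omt /\ mk k x != 0.
    have c1 : M * tk k @[k --> U] --> M * t by exact: cvgMr.
    have f1 : \forall k \near U, M * tk k < eucl_dist x Omt by apply: (cvgr_lt _ c1).
    have f2 : \forall k \near U, mk k x != 0.
      have c2 : mk k x @[k --> U] --> ulimf x by exact: ulimf_cvg.
      by apply: (cvgr_neq0 _ c2).
    have [k hk] := filter_ex (filterI f1 f2); by exists k.
  have [_ _ _ _ z] := mkf k; move/eqP : h2; apply; apply: z.
  by rewrite /enlarged /=; apply/negP; rewrite -ltNge.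
- move=> s alpha /andP[ts sT] ca.
  (* The shift tau k may have either sign; sk k + tau k never exceeds T, and sk
     converges to s because tau converges to 0. *)
  pose tau k := tk k - t; pose sk k := Num.min s (T - tau k).
  have tskT k : t <= sk k <= T /\ sk k + tau k <= T.
    have /andP[a b] := tk0 k; rewrite /sk /tau le_min ge_min ts sT /=.
    split; first by rewrite andbT; lra.
    by rewrite -lerBrDr ge_min lexx orbT.
  have ttau k : t + tau k = tk k by rewrite /tau addrC subrK.
  apply: (Wkoo_ultra (U := U) (fk := fun k => transport T (sk k) alpha (mk k) t)).
  + move=> k; have [_ _ h _ _] := mkf k.
    by apply: (transport_continuous M0 ca t0 tT (tskT k).1 (L := n%:R * state_B)); exact: lip_sub.
  + by apply: (transport_continuous M0 ca t0 tT (L := n%:R * state_B)); [rewrite ts|exact: ulimf_lip].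
  + move=> x; apply: (transport_cvg (M := M) M0 ca t0 tT (L := n%:R * state_B)) => //.
    * by move=> k; exact: (tskT k).1.
    * by rewrite ts.
    * apply: (cvg_dist_le (F := U) (a := sk) (b := fun=> s) (c := fun k => `|tk k - t|) (l := s)); last exact: cvg_cst.
        move=> k; rewrite /sk /= -/(tau k); case: (leP s (T - tau k)) => h; first by rewrite subrr normr0.
        rewrite (ltr0_norm (_ : T - tau k - s < 0)) ?subr_lt0//.
        by apply: le_trans (ler_norm (tau k)); rewrite lerNl; lra.
      have c1 : `|tk k - t| @[k --> U] --> `|t - t| by apply: cvg_norm; apply: cvgB => //; exact: cvg_cst.
      by rewrite subrr normr0 in c1.
    * by rewrite subrr normr0; exact: cvg_cst.
    * by move=> k; have [_ _ h _ _] := mkf k; exact: lip_sub.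
    * exact: ulimf_cvg.
  + move=> k; have [/andP[a b] c] := tskT k; have /andP[a' b'] := tk0 k.
    have ca' := shift_controls M0 (tau k) ca.
    have a2 : 0 <= t + tau k by rewrite ttau.
    have e := @transport_shift R n T M M0 alpha t (sk k) (tau k) (mk k) ca t0 a b a2 c.
    rewrite ttau in e; rewrite -e.
    have [_ _ _ h] := mkt k.
    have cc : tk k <= sk k + tau k <= T by rewrite c andbT -{1}(ttau k) lerD2r.
    exact: (h _ _ cc ca').
Qed.

End closed.

End states.

(** * Compactness of the states in mean square *)

Section ultra_uniform.
Context {R : realType} {n : nat} (U : set_system nat) {UU : UltraFilter U}.
Local Notation E := 'rV[R]_n.
Local Notation mu := (lebesgue_rV R n).
Variables (fk : nat -> E -> R) (f : E -> R) (L r : R).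
Hypotheses (L0 : 0 <= L) (fkL : forall k x y, `|fk k x - fk k y| <= L * `|x - y|).
Hypotheses (fL : forall x y, `|f x - f y| <= L * `|x - y|).
Hypotheses (fkf : forall x, fk k x @[k --> U] --> f x).
Hypotheses (fkr : forall k x, r < `|x| -> fk k x = 0).

Lemma ultra_vanish x : r < `|x| -> f x = 0.
Proof.
move=> xr; have h : fk k x @[k --> U] --> f x by exact: fkf.
rewrite (_ : (fun k => fk k x) = cst 0) in h.
  by apply: (ultra_cvgE h); exact: cvg_cst.
by apply/funext => k; rewrite fkr.
Qed.

(** Otherwise points x_k where fk and f differ by more than e would have a limit
    along U, where equicontinuity contradicts pointwise convergence. *)
Lemma ultra_uniform (e : R) : 0 < e -> \forall k \near U, forall x, `|fk k x - f x| <= e.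
Proof.
move=> e0; set A := [set k | forall x, `|fk k x - f x| <= e].
have [//|UA] := in_ultra_setVsetC A UU.
have /choice[xk xkP] k : exists x : E, `|x| <= `|r| /\ (~ A k -> e < `|fk k x - f x|).
  have [Ak|nAk] := pselect (A k); first by exists 0; rewrite normr0.
  have [x xe] : exists x, e < `|fk k x - f x|.
    apply/not_existsP => h; apply: nAk => x; rewrite leNgt; apply/negP; exact: h.
  exists x; split => //; rewrite leNgt; apply/negP => xr.
  have rx : r < `|x| by apply: le_lt_trans xr; exact: ler_norm.
  by move: xe; rewrite fkr// ultra_vanish// subrr normr0 ltNge (ltW e0).
pose x : E := \row_i ulim U (fun k => xk k 0 i).
have xc i : xk k 0 i @[k --> U] --> x 0 i.
  rewrite mxE; apply: (@ulimP _ _ _ _ `|r|) => k.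
  by apply: le_trans (normr_rV_coord _ _) _; have [] := xkP k.
pose D k : R := \sum_i `|xk k 0 i - x 0 i|.
have D0 : D k @[k --> U] --> (0 : R).
  rewrite -(_ : \sum_(i < n) `|x 0 i - x 0 i| = 0); last by rewrite big1// => i _; rewrite subrr normr0.
  apply: cvg_big => [|i _]; first exact: add_continuous.
  by apply: cvg_norm; apply: cvgB; [exact: xc|exact: cvg_cst].
have xD k : `|xk k - x| <= D k.
  apply: normr_rV_le => [|i]; first exact: sumr_ge0.
  by rewrite !mxE /D (bigD1 i)//= mxE lerDl sumr_ge0.
have key k : `|fk k (xk k) - f (xk k)| <= 2 * L * D k + `|fk k x - f x|.
  rewrite (_ : _ - _ = (fk k (xk k) - fk k x) + (fk k x - f x) - (f (xk k) - f x)); last by ring.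
  apply: le_trans (ler_normB _ _) _; apply: le_trans (lerD (ler_normD _ _) (lexx _)) _.
  have h1 := le_trans (fkL k (xk k) x) (ler_wpM2l L0 (xD k)).
  have h2 := le_trans (fL (xk k) x) (ler_wpM2l L0 (xD k)).
  move: h1 h2; move: (`|fk k (xk k) - _|) (`|f (xk k) - _|) (`|fk k x - _|) => a b c; lra.
have c0 : 2 * L * D k + `|fk k x - f x| @[k --> U] --> 2 * L * 0 + `|f x - f x|.
  apply: cvgD; first exact: cvgMr.
  by apply: cvg_norm; apply: cvgB; [exact: fkf|exact: cvg_cst].
rewrite mulr0 subrr normr0 addr0 in c0.
have n1 : \forall k \near U, 2 * L * D k + `|fk k x - f x| < e by apply: (cvgr_lt _ c0).
have [k [/= k1 k2]] := filter_ex (filterI n1 UA).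
have [_ /(_ k2) h] := xkP k; exfalso.
by have := lt_le_trans h (key k); rewrite ltNge => /negP; apply; exact: ltW.
Qed.

Lemma ultra_L2 : L2_dist (fk k) f @[k --> U] --> (0 : R).
Proof.
apply/cvgrPdist_le => e e0; set v := Num.sqrt (fine (mu (cube r))).
have v0 : 0 <= v by exact: sqrtr_ge0.
have v1 : 0 < v + 1 by rewrite ltr_wpDl.
have := ultra_uniform (_ : 0 < e / (v + 1)); rewrite divr_gt0// => /(_ isT).
apply: filterS => k H; rewrite sub0r normrN ger0_norm ?L2_dist_ge0//.
have mfk : measurable_fun setT (fk k).
  by apply: continuous_rV_measurable; apply: lip_continuous; exact: fkL.
have mf : measurable_fun setT f.
  by apply: continuous_rV_measurable; apply: lip_continuous; exact: fL.
have z x : ~ cube r x -> (fk k \- f) x = 0.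
  by rewrite /cube /= => /negP; rewrite -ltNge => xr; rewrite fkr// ultra_vanish// subrr.
have [_ h] := L2_supported (measurable_funB mfk mf) z H.
apply: le_trans h _; rewrite -/v -mulrAC ler_pdivrMr//.
by apply: ler_wpM2l; [exact: ltW|rewrite lerDl].
Qed.

End ultra_uniform.

Section states_L2.
Context {R : realType} {n : nat} (T M C CU : R) (Omt Om : set 'rV[R]_n).
Local Notation E := 'rV[R]_n.
Local Notation mu := (lebesgue_rV R n).
Hypotheses (T0 : 0 < T) (M0 : 0 < M) (CU0 : 0 < CU).
Hypotheses (C_bound : transport_bound n T M C).
Hypotheses (Omt0 : Omt !=set0) (Omtb : bounded_set Omt) (Om0 : Om !=set0).
Implicit Types (m : E -> R).
Local Notation later := (later_states T M C CU Omt).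

Lemma states_cube : exists2 r : R, 0 <= r & forall t m, 0 <= t -> t <= T -> later t m ->
  forall x, r < `|x| -> m x = 0.
Proof.
have [r r0 H] := enlarged_bounded M T Omt0 Omtb; exists r => // t m t0 tT mt x rx.
have [_ _ _ _ h] := later_facts M0 t0 tT mt; apply: h => xe.
have tM : M * t <= M * T by apply: ler_wpM2l => //; exact: ltW.
by have := H t x tM xe; rewrite leNgt rx.
Qed.

Lemma states_L2 : exists B : R, forall t m, 0 <= t -> t <= T -> later t m -> L2 m /\ L2_norm m <= B.
Proof.
have [r r0 H] := states_cube.
exists (state_B C CU * Num.sqrt (fine (mu (cube r)))) => t m t0 tT mt.
have [cm mB _ _ _] := later_facts M0 t0 tT mt.
apply: L2_supported => //; first exact: continuous_rV_measurable.
move=> x; rewrite /cube /= => /negP; rewrite -ltNge; exact: H mt x.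
Qed.

Lemma states_ultra_L2 (U : set_system nat) (mk : nat -> E -> R) (tk : nat -> R) :
  UltraFilter U -> (forall k, 0 <= tk k <= T) -> (forall k, later (tk k) (mk k)) ->
  L2_dist (mk k) (ulimf U mk) @[k --> U] --> (0 : R).
Proof.
move=> UU tk0 mkt; have [r r0 H] := states_cube.
have L0 : 0 <= n%:R * state_B C CU.
  by rewrite mulr_ge0// ltW// (state_B_gt0 T0 M0 CU0 C_bound).
apply: (ultra_L2 (L := n%:R * state_B C CU) (r := r)) => //.
- move=> k; have /andP[a b] := tk0 k; have [_ _ h _ _] := later_facts M0 a b (mkt k).
  exact: lip_sub.
- exact: (ulimf_lip M0 UU tk0 mkt).
- move=> x; exact: (ulimf_cvg M0 UU tk0 mkt).
- by move=> k x; have /andP[a b] := tk0 k; exact: (H _ _ a b (mkt k)).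
Qed.

(** The constraint is integrated over the enlarged set at time T only, so its
    weight is cut off there and becomes square integrable. *)
Lemma constraint_inner : exists2 p : E -> R, L2 p &
  forall m, L2 m -> constraint T M Omt Om m = (L2_inner p m)%:E.
Proof.
have [r r0 H] := enlarged_bounded M T Omt0 Omtb.
have menl : measurable (enlarged M Omt T) by apply: closed_rV_measurable; exact: closed_enlarged.
have mp : measurable_fun setT (fun x : E => eucl_dist x Om).
  by apply: continuous_rV_measurable; exact: continuous_eucl_dist.
have [y Omy] := Om0.
pose p := (fun x : E => eucl_dist x Om) \_ (enlarged M Omt T).
have h1 : measurable_fun setT p by apply/(measurable_restrictT _ menl); exact: measurable_funTS.
have h2 x : ~ cube r x -> p x = 0.
  rewrite /p patchE; case: ifPn => // /set_mem xe []; rewrite /cube /=.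
  by apply: H xe.
have h3 x : `|p x| <= n%:R * (r + `|y|).
  rewrite /p patchE; case: ifPn => [/set_mem xe|_].
    rewrite ger0_norm ?eucl_dist_ge0//; apply: le_trans (eucl_dist_le x Omy) _.
    apply: le_trans (eucl_norm_le _) _; rewrite ler_wpM2l//.
    by apply: le_trans (ler_normB _ _) _; rewrite lerD2r; apply: H xe.
  by rewrite normr0 mulr_ge0// addr_ge0.
have [pL _] := L2_supported h1 h2 h3.
exists p => // m mL; rewrite /constraint /L2_inner /Rintegral fineK; last first.
  by apply: integrable_fin_num => //; exact: L2_mul.
rewrite [LHS]integral_mkcond; apply: eq_integral => x _; rewrite /p !patchE.
by case: ifPn => // _; rewrite mul0r.
Qed.

End states_L2.

(** * The divergence term of the Hamiltonian *)

Lemma ler_halfN {R : realType} (x z : R) : - 2 * x <= z -> - x <= z / 2.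
Proof. by lra. Qed.

Section divergence_free.
Context {R : realType} {n : nat}.
Local Notation E := 'rV[R]_n.
Local Notation mu := (lebesgue_rV R n).
Local Notation e_ i := (delta_mx 0 i : E).
Implicit Types (f g m w : E -> R) (a : E -> E).

Lemma is_derive_seq f x (v : E) (d : R) : is_derive x v f d ->
  k.+1%:R * (f (x + k.+1%:R^-1 *: v) - f x) @[k --> \oo] --> d.
Proof.
move=> [fd <-].
have h0 : (fun k => k.+1%:R^-1 : R) @ \oo --> 0^'.
  move=> A /nbhs_ballP[e /= e0 eA].
  have := @cvg_harmonic R; move=> /cvgrPdist_lt /(_ e e0); apply: filterS => k hk.
  by apply: eA => //=; rewrite ?invr_eq0 ?pnatr_eq0.
have := cvg_comp _ _ h0 fd; apply: cvg_trans; apply: near_eq_cvg; apply: nearW => k /=.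
by rewrite invrK [_ *: v + x]addrC.
Qed.

(** By translation invariance the difference quotients of v have zero integral,
    and they converge boundedly to the derivative. *)
Lemma integral_partial0 (v dv : E -> R) i (B r : R) :
  (forall x, is_derive x (e_ i) v (dv x)) -> (forall x y, `|v x - v y| <= B * `|x - y|) ->
  (forall x, r < `|x| -> v x = 0) -> mu.-integrable setT (EFin \o dv) /\ \int[mu]_x dv x = 0.
Proof.
move=> dvP vB vr.
pose q k x : R := k.+1%:R * (v (x + k.+1%:R^-1 *: e_ i) - v x).
have qdv x : q k x @[k --> \oo] --> dv x by exact: is_derive_seq.
have mv : measurable_fun setT v.
  by apply: continuous_rV_measurable; apply: lip_continuous; exact: vB.
have mvs (c : E) : measurable_fun setT (fun x : E => v (x + c)).
  exact: (measurableT_comp mv (measurable_shift_rV c)).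
have mq k : measurable_fun setT (q k) by apply: measurable_funM => //; exact: measurable_funB.
have mdv : measurable_fun setT dv by apply: (measurable_fun_cvg mq) => x _; exact: qdv.
have B0 : 0 <= `|B| by [].
have qB k x : `|q k x| <= `|B|.
  rewrite normrM gtr0_norm// -ler_pdivlMl//.
  apply: le_trans (vB _ _) _; rewrite addrAC subrr add0r.
  apply: (@le_trans _ _ (`|B| * `|k.+1%:R^-1 *: e_ i|)); first by rewrite ler_wpM2r// ler_norm.
  rewrite mulrC ler_wpM2r//.
  by apply: le_trans (norm_delta_rV _ _) _; rewrite gtr0_norm.
have dvB x : `|dv x| <= `|B|.
  have h : `|q k x| @[k --> \oo] --> `|dv x| by apply: cvg_norm; exact: qdv.
  by apply: (ler_cvg_to h (cvg_cst `|B|)); exact: nearW.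
have dvr x : r < `|x| -> dv x = 0.
  by move=> xr; have [_ <-] := dvP x; exact: (partial_vanish i vr).
have idv : mu.-integrable setT (EFin \o dv) by exact: (integrable_cube_supported mdv dvB dvr).
split => //.
pose r1 := `|r| + 1.
have qr k x : r1 < `|x| -> q k x = 0.
  move=> xr; rewrite /q !vr ?subrr ?mulr0//; first by apply: le_lt_trans xr; rewrite /r1 (le_trans (ler_norm r))// lerDl.
  have h1 : `|k.+1%:R^-1 *: e_ i| <= 1.
    apply: le_trans (norm_delta_rV _ _) _; rewrite gtr0_norm//.
    by rewrite invf_le1// ler1n.
  have h2 : `|x| <= `|x + k.+1%:R^-1 *: e_ i| + 1.
    rewrite -{1}[x](addrK (k.+1%:R^-1 *: e_ i)); apply: le_trans (ler_normB _ _) _.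
    by rewrite lerD2l.
  by have := ler_norm r; rewrite /r1 in xr; move: (`|x + _|) h2 => z h2 h3; lra.
have iB : mu.-integrable setT (EFin \o (fun x => `|B| * \1_(cube r1) x)).
  apply: (@integrable_cube_supported _ _ _ `|B| r1).
  - by apply: measurable_funM => //; apply: measurable_indic; exact: measurable_cube.
  - by move=> x; rewrite normrM normr_id indicE ler_piMr//; case: (_ \in _); rewrite ?normr1 ?normr0.
  - move=> x xr; rewrite indicE memNset ?mulr0//; rewrite /cube /=; apply/negP; by rewrite -ltNge.
have lim := dominated_Rcvg mq qdv iB _.
have {}lim : (\int[mu]_x q k x) @[k --> \oo] --> \int[mu]_x dv x.
  apply: lim => k x; have [xr|xr] := leP `|x| r1.
    by rewrite indicE mem_set// mulr1.
  by rewrite qr// normr0 mulr_ge0.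
have iv : mu.-integrable setT (EFin \o v).
  have cv : continuous v by apply: lip_continuous; exact: vB.
  have [K hK] := continuous_locally_bounded cv r1.
  apply: (@integrable_cube_supported _ _ _ `|K| r) => // x.
  have [xr|xr] := leP `|x| r1; first exact: le_trans (hK x xr) (ler_norm K).
  by rewrite vr ?normr0//; apply: le_lt_trans xr; rewrite /r1 (le_trans (ler_norm r))// lerDl.
have ivs (c : E) : mu.-integrable setT (EFin \o (fun x : E => v (x + c))).
  apply/integrableP; split; first exact/measurable_EFinP.
  have := @integral_rV_shift R n c (fun x => `|(EFin \o v) x|%E); rewrite /= => ->.
    by have /integrableP[] := iv.
  by apply/measurable_EFinP; exact: measurableT_comp.
have q0 k : \int[mu]_x q k x = 0.
  rewrite /q RintegralZl//; last exact: (integrableB _ (ivs _) iv).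
  by rewrite RintegralB// Rintegral_rV_shift// subrr mulr0.
rewrite (_ : (fun k => _) = cst 0) in lim; last by apply/funext => k; exact: q0.
exact: (cvg_unique _ lim (cvg_cst _)).
Qed.

(** The density and the components of the fields are in this class, so that all
    products below are classically differentiable. *)
Definition C11 (B K : R) f := [/\ 0 <= B, 0 <= K, lip_le B f & diff2_le K f].

Lemma C11_partial B K f i : C11 B K f ->
  [/\ forall x, is_derive x (e_ i) f (partial i f x), forall x, `|partial i f x| <= B &
      forall x y, `|partial i f x - partial i f y| <= K * `|x - y|].
Proof.
move=> [B0 K0 fB fK]; have [df [dD dZ dB dT dL]] := C11_derivative fB fK B0 K0.
have H x : is_derive x (e_ i) f (df x (e_ i)).
  have lim : (fun h : R => h^-1 *: ((f \o shift x) (h *: e_ i) - f x)) @ 0^' --> df x (e_ i).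
    apply/cvgrPdist_le => e e0; have K1 : 0 < K + 1 by rewrite ltr_wpDl.
    apply/nbhs_ballP; exists (e / (K + 1)) => /=; first by rewrite divr_gt0.
    move=> h; rewrite /ball /= sub0r normrN => he h0.
    have hn : 0 < `|h| by rewrite normr_gt0.
    have := dT x (h *: e_ i); rewrite dZ => T1.
    rewrite -(ler_pM2l hn) -normrM mulrBr /GRing.scale /= mulrA divff// mul1r [h *: _ + x]addrC distrC.
    apply: le_trans T1 _; apply: (@le_trans _ _ (K * `|h| ^+ 2)).
      by rewrite ler_wpM2l// lerXn2r ?nnegrE// norm_delta_rV.
    rewrite expr2 mulrA mulrAC mulrC ler_wpM2l//.
    by move: he; rewrite ltr_pdivlMr// => /ltW; apply: le_trans; rewrite mulrC ler_wpM2l// lerDl.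
  by apply: DeriveDef; [exact: (cvgP _ lim)|exact: (cvg_lim _ lim)].
have pE x : partial i f x = df x (e_ i) by have [_ <-] := H x.
have e1 : `|e_ i| <= 1 by rewrite -[e_ i]scale1r; apply: le_trans (norm_delta_rV _ _) _; rewrite normr1.
split.
- by move=> x; rewrite pE.
- by move=> x; rewrite pE; apply: le_trans (dB _ _) _; rewrite ler_piMr.
- by move=> x y; rewrite !pE; apply: le_trans (dL _ _ _) _; rewrite ler_piMr// mulr_ge0.
Qed.

Lemma C11_cts B K f : C11 B K f -> continuous f.
Proof. by move=> [_ _ fB _]; apply: (lip_continuous (L := B)); exact: lip_sub. Qed.

Lemma C11_partial_cts B K f i : C11 B K f -> continuous (partial i f).
Proof. by move=> fC; have [_ _ h] := C11_partial i fC; exact: (lip_continuous h). Qed.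

Lemma C11_lin B K B' K' (c d : R) f g : C11 B K f -> C11 B' K' g ->
  C11 (`|c| * B + `|d| * B') (`|c| * K + `|d| * K') (fun x => c * f x + d * g x).
Proof.
move=> [B0 K0 fB fK] [B0' K0' gB gK]; split; rewrite ?addr_ge0 ?mulr_ge0//.
- move=> x u; rewrite (_ : _ - _ = c * (f (x + u) - f x) + d * (g (x + u) - g x)); last by ring.
  apply: le_trans (ler_normD _ _) _; rewrite !normrM mulrDl -!mulrA.
  by apply: lerD; apply: ler_wpM2l.
- move=> x u v; rewrite (_ : diff2 _ _ _ _ = c * diff2 f x u v + d * diff2 g x u v); last by rewrite /diff2; ring.
  apply: le_trans (ler_normD _ _) _; rewrite !normrM !mulrDl -!mulrA.
  by apply: lerD; apply: ler_wpM2l => //; rewrite mulrA.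
Qed.

Lemma partial_lin B K B' K' (c d : R) f g i x : C11 B K f -> C11 B' K' g ->
  partial i (fun x => c * f x + d * g x) x = c * partial i f x + d * partial i g x.
Proof.
move=> fC gC; have [df _ _] := C11_partial i fC; have [dg _ _] := C11_partial i gC.
have h1 := df x; have h2 := dg x.
have h : is_derive x (e_ i) (fun x => c * f x + d * g x) (c * partial i f x + d * partial i g x).
  exact: (@is_deriveD _ _ _ (fun x => c *: (f x : R^o)) (fun x => d *: (g x : R^o))).
by have [_ h'] := h; exact: h'.
Qed.

Lemma partial_mul B K B' K' f g i x : C11 B K f -> C11 B' K' g ->
  is_derive x (e_ i) (fun x => f x * g x) (f x * partial i g x + g x * partial i f x).
Proof.
move=> fC gC; have [df _ _] := C11_partial i fC; have [dg _ _] := C11_partial i gC.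
have h1 := df x; have h2 := dg x.
exact: (@is_deriveM _ _ f g).
Qed.

Lemma divergence_scale B K B' K' m a x : C11 B K m -> (forall i, C11 B' K' (fun x => a x 0 i)) ->
  divergence (fun x => m x *: a x) x =
  \sum_i (m x * partial i (fun x => a x 0 i) x + a x 0 i * partial i m x).
Proof.
move=> mC aC; apply: eq_bigr => i _.
rewrite (_ : (fun y => (m y *: a y) 0 i) = (fun y => m y * a y 0 i)); last by apply/funext => y; rewrite mxE.
by have [_ h'] := partial_mul i x mC (aC i); exact: h'.
Qed.

Section hamiltonian.
Variables (a : E -> E) (A B K Ka r : R) (m m' : E -> R) (th : R).
Hypotheses (aA : forall x, `|a x| <= A) (aC : forall i, C11 A Ka (fun x => a x 0 i)).
Hypotheses (mC : C11 B K m) (mC' : C11 B K m').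
Hypotheses (mr : forall x, r < `|x| -> m x = 0) (mr' : forall x, r < `|x| -> m' x = 0).
Hypotheses (mB : forall x, `|m x| <= B) (mB' : forall x, `|m' x| <= B).

Let A0 : 0 <= A. Proof. exact: le_trans (normr_ge0 _) (aA 0). Qed.
Let B0 : 0 <= B. Proof. exact: le_trans (normr_ge0 _) (mB 0). Qed.

Let div_L2 g : C11 B K g -> (forall x, r < `|x| -> g x = 0) -> (forall x, `|g x| <= B) ->
  L2 (divergence (fun x => g x *: a x)).
Proof.
move=> gC gr gB.
rewrite (_ : divergence _ = fun x => \sum_i (g x * partial i (fun x => a x 0 i) x + a x 0 i * partial i g x)); last first.
  by apply/funext => x; exact: divergence_scale gC aC.
set G := fun x => _.
have h1 : measurable_fun setT G.
  apply: measurable_sum => i; apply: measurable_funD; apply: measurable_funM; apply: continuous_rV_measurable.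
  - exact: C11_cts gC.
  - exact: C11_partial_cts (aC i).
  - exact: C11_cts (aC i).
  - exact: C11_partial_cts gC.
have h2 x : ~ cube r x -> G x = 0.
  rewrite /cube /= => /negP; rewrite -ltNge => xr.
  by rewrite /G big1// => i _; rewrite gr// (partial_vanish i gr)// mul0r mulr0 addr0.
have h3 x : `|G x| <= \sum_(i < n) (B * A + A * B).
  apply: le_trans (ler_norm_sum _ _ _) _; apply: ler_sum => i _.
  apply: le_trans (ler_normD _ _) _; rewrite !normrM.
  have [_ k1 _] := C11_partial i (aC i); have [_ k2 _] := C11_partial i gC.
  apply: lerD; apply: ler_pM => //.
  exact: le_trans (normr_rV_coord _ _) _.
by have [] := L2_supported h1 h2 h3.
Qed.

Let w x := m x - th * m' x.

Lemma hamiltonian_L2 : [/\ L2 (divergence (fun x => m x *: a x)),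
  L2 (divergence (fun x => m' x *: a x)) & L2 w].
Proof.
split; [exact: div_L2|exact: div_L2|].
have mL : L2 m.
  have [] // := @L2_supported R n r m B (continuous_rV_measurable (C11_cts mC)).
  by move=> x; rewrite /cube /= => /negP; rewrite -ltNge; exact: mr.
have mL' : L2 m'.
  have [] // := @L2_supported R n r m' B (continuous_rV_measurable (C11_cts mC')).
  by move=> x; rewrite /cube /= => /negP; rewrite -ltNge; exact: mr'.
have := L2_lin 1 (- th) mL mL'; congr L2; apply/funext => x.
by rewrite mul1r mulNr.
Qed.

(** Pointwise, 2 w div (w a) = div (w^2 a) + w^2 div a, and the first term has zero
    integral. *)
Lemma hamiltonian_diff :
  th * L2_inner w (divergence (fun x => m' x *: a x)) - L2_inner w (divergence (fun x => m x *: a x)) <=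
  n%:R * A / 2 * L2_norm w ^+ 2.
Proof.
have [dL dL' wL] := hamiltonian_L2.
pose W := `|1| * B + `|- th| * B.
have wE : w = fun x => 1 * m x + - th * m' x by apply/funext => x; rewrite /w mul1r mulNr.
have wC : C11 W (`|1| * K + `|- th| * K) w by rewrite wE; exact: C11_lin.
have W0 : 0 <= W by rewrite addr_ge0// mulr_ge0.
have wB x : `|w x| <= W.
  rewrite wE; apply: le_trans (ler_normD _ _) _; rewrite !normrM.
  by apply: lerD; apply: ler_wpM2l.
have wr x : r < `|x| -> w x = 0 by move=> xr; rewrite /w mr// mr'// mulr0 subrr.
have [_ _ wl _] := wC.
(* dv i is the i-th partial derivative of w^2 a_i. *)
pose dv i x := (w x * w x) * partial i (fun x => a x 0 i) x + a x 0 i * (w x * partial i w x + w x * partial i w x).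
have D0 i : mu.-integrable setT (EFin \o dv i) /\ \int[mu]_x dv i x = 0.
  apply: (@integral_partial0 (fun x => (w x * w x) * a x 0 i) _ i (3 * W ^+ 2 * A) r).
  - move=> x; have d1 := partial_mul i x wC wC; have [da _ _] := C11_partial i (aC i).
    have d2 := da x.
    exact: (@is_deriveM _ _ (fun x => w x * w x) (fun x => a x 0 i)).
  - move=> x y; have [_ _ al _] := aC i.
    have h1 := lip_sub wl x y; have h2 := lip_sub al x y.
    have h3 : `|a x 0 i| <= A by apply: le_trans (normr_rV_coord _ _) _.
    rewrite (_ : _ - _ = a x 0 i * (w x + w y) * (w x - w y) + w y * w y * (a x 0 i - a y 0 i)); last by ring.
    apply: le_trans (ler_normD _ _) _; rewrite !normrM.
    have h4 : `|w x + w y| <= W + W by apply: le_trans (ler_normD _ _) _; apply: lerD.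
    have h5 : `|a x 0 i| * `|w x + w y| * `|w x - w y| <= A * (W + W) * (W * `|x - y|).
      by apply: ler_pM => //; apply: ler_pM.
    have h6 : `|w y| * `|w y| * `|a x 0 i - a y 0 i| <= W * W * (A * `|x - y|).
      by apply: ler_pM => //; apply: ler_pM.
    by apply: le_trans (lerD h5 h6) _; rewrite le_eqVlt; apply/orP; left; apply/eqP; ring.
  - by move=> x xr; rewrite wr// !mul0r.
have DS (s : seq 'I_n) : mu.-integrable setT (EFin \o (fun x => \sum_(i <- s) dv i x)) /\ \int[mu]_x (\sum_(i <- s) dv i x) = 0.
  elim: s => [|i s [IH1 IH2]].
    rewrite (_ : (fun x => _) = cst 0); last by apply/funext => x; rewrite big_nil.
    split; first exact: integrable0.
    by rewrite /Rintegral integral0_eq.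
  rewrite (_ : (fun x => _) = (fun x => dv i x + \sum_(i <- s) dv i x)); last by apply/funext => x; rewrite big_cons.
  have [i1 i2] := D0 i; split; first exact: (integrableD _ i1 IH1).
  by rewrite RintegralD// i2 IH2 addr0.
have [iS S0] := DS (index_enum 'I_n).
pose D x := divergence (fun x => m x *: a x) x - th * divergence (fun x => m' x *: a x) x.
have DL : L2 D.
  have := L2_lin 1 (- th) dL dL'; congr L2; apply/funext => x; rewrite /D.
  by rewrite mul1r mulNr.
have DE x : 2 * (w x * D x) = \sum_i dv i x + w x ^+ 2 * \sum_i partial i (fun x => a x 0 i) x.
  rewrite /D (divergence_scale x mC aC) (divergence_scale x mC' aC) !mulr_sumr -sumrB !mulr_sumr -big_split.
  apply: eq_bigr => i _ /=; rewrite /dv.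
  have -> : partial i w x = partial i m x - th * partial i m' x.
    by rewrite wE (partial_lin 1 (- th) i x mC mC') mul1r mulNr.
  by rewrite /w; ring.
have iD : L2_inner w D = L2_inner w (divergence (fun x => m x *: a x)) - th * L2_inner w (divergence (fun x => m' x *: a x)).
  have := L2_inner_linr 1 (- th) dL dL' wL; rewrite mul1r mulNr => <-.
  by congr (L2_inner w); apply/funext => x; rewrite /D mul1r mulNr.
rewrite -opprB -iD.
have Sa x : `|\sum_i partial i (fun x => a x 0 i) x| <= n%:R * A.
  apply: le_trans (ler_norm_sum _ _ _) _; apply: (@le_trans _ _ (\sum_(i < n) A)).
    by apply: ler_sum => i _; have [_ h _] := C11_partial i (aC i).
  by rewrite sumr_const card_ord mulr_natl.
have iwD := L2_mul wL DL; have iww := L2_mul wL wL.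
have isc (k : R) (g : E -> R) : mu.-integrable setT (EFin \o g) -> mu.-integrable setT (EFin \o (fun x => k * g x)).
  by move=> it; have := integrableZl measurableT k it; congr (_.-integrable _ _); apply/funext => x; rewrite /= EFinM.
have le1 : \int[mu]_x (- 2 * (w x * D x)) <= \int[mu]_x (-1 * (\sum_i dv i x) + n%:R * A * (w x * w x)).
  apply: le_Rintegral => //; first exact: isc.
    by apply: (integrableD _ (isc _ _ iS) (isc _ _ iww)).
  move=> x _; rewrite mulNr DE mulN1r opprD lerD2l -mulNr mulrC -[w x * w x]expr2.
  rewrite mulrN -mulNr; apply: ler_wpM2r; first exact: sqr_ge0.
  by apply: le_trans (Sa x); rewrite -normrN ler_norm.
rewrite RintegralZl// RintegralD// in le1; last 2 first.
- exact: isc.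
- exact: isc.
rewrite !RintegralZl// S0 mulr0 add0r in le1.
rewrite sqr_L2_norm /L2_inner.
by rewrite mulrAC; exact: ler_halfN le1.
Qed.

End hamiltonian.

End divergence_free.

(** * Comparison of two Hamiltonians *)

Section positive_part.
Context {R : realType}.
Implicit Types (x y : R).

Definition pos x : R := Num.max x 0.

Lemma pos_ge0 x : 0 <= pos x. Proof. by rewrite le_max lexx orbT. Qed.

Lemma pos_lip x y : `|pos x - pos y| <= `|x - y|.
Proof.
rewrite /pos; case: (leP x 0) => x0; case: (leP y 0) => y0; rewrite ?subrr ?normr0//.
- by rewrite sub0r normrN (gtr0_norm y0) distrC ler_normr; apply/orP; left; lra.
- by rewrite subr0 (gtr0_norm x0) ler_normr; apply/orP; left; lra.
Qed.

(** The squared positive part is the penalty in time; unlike the positive part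
    it is differentiable with a Lipschitz continuous derivative. *)
Lemma pos_sqr_taylor x y : `|pos y ^+ 2 - pos x ^+ 2 - 2 * pos x * (y - x)| <= (y - x) ^+ 2.
Proof.
rewrite /pos; case: (leP x 0) => x0; case: (leP y 0) => y0.
- by rewrite (_ : _ - _ = 0) ?normr0 ?sqr_ge0//; ring.
- rewrite (_ : _ - _ = y ^+ 2) ?ger0_norm ?sqr_ge0//; last by ring.
  have xy : 0 <= - x * y by rewrite mulr_ge0 ?oppr_ge0// ltW.
  rewrite -subr_ge0 (_ : _ - _ = 2 * (- x * y) + x ^+ 2); last by ring.
  by apply: addr_ge0; [exact: mulr_ge0|exact: sqr_ge0].
- have xy : 0 <= x * - y by rewrite mulr_ge0 ?oppr_ge0// ltW.
  rewrite (_ : _ - _ = x ^+ 2 + 2 * (x * - y)); last by ring.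
  rewrite ger0_norm; last by apply: addr_ge0; [exact: sqr_ge0|exact: mulr_ge0].
  rewrite -subr_ge0 [X in 0 <= X](_ : _ = y ^+ 2) ?sqr_ge0//; ring.
- rewrite (_ : _ - _ = (y - x) ^+ 2); last by ring.
  by rewrite ger0_norm// sqr_ge0.
Qed.

End positive_part.

Lemma ham_scalar {R : realType} (th e I I' l l' y q d : R) : 0 < e -> e * I - l <= y ->
  l - l' <= d -> th * I' - I <= q -> th * e * I' - l' <= y + q * e + d.
Proof.
move=> e0 h1 h2 h3; have h4 := ler_wpM2l (ltW e0) h3.
rewrite mulrBr mulrCA mulrA [e * q]mulrC in h4.
by move: (th * e * I') (e * I) (q * e) h1 h4 => x z u; lra.
Qed.

Section compare.
Context {R : realType} {n : nat} (T M C CU Ll : R) (Omt : set 'rV[R]_n).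
Context (ell : ('rV[R]_n -> R) -> ('rV[R]_n -> 'rV[R]_n) -> R).
Local Notation E := 'rV[R]_n.
Hypotheses (T0 : 0 < T) (M0 : 0 < M) (CU0 : 0 < CU).
Hypotheses (C_bound : transport_bound n T M C).
Hypotheses (Omt0 : Omt !=set0) (Omtb : bounded_set Omt).
Hypothesis ell_cost : running_cost T M C CU Omt Ll ell.
Local Notation later := (later_states T M C CU Omt).

Definition ham_A : R := M + 1 + @ctl_B R n M.

Lemma Atilde_C11 (a : E -> E) : Atilde M a -> (forall x, `|a x| <= ham_A) /\
  forall i, C11 ham_A (@ctl_K R n M) (fun x => a x 0 i).
Proof.
move=> aM; have [h1 h2 h3] := Atilde_field aM.
have B0 := ltW (@ctl_B_gt0 R n M M0); have K0 := @ctl_K_ge0 R n M M0.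
have M1 : 0 <= M + 1 by rewrite addr_ge0// ltW.
split; first by move=> x; apply: le_trans (h1 x) _; rewrite lerDl.
move=> i; split => //; first by rewrite addr_ge0.
- move=> x u; have := h2 (x + u) x; rewrite [in X in _ <= _ * X](addrC x) addrK => h.
  have := normr_rV_coord (a (x + u) - a x) i; rewrite !mxE => h'.
  apply: le_trans h' _; apply: le_trans h _; rewrite /ham_A; apply: ler_wpM2r => //.
  by rewrite lerDr.
- move=> x u v; have := normr_rV_coord (a (x + u + v) - a (x + u) - a (x + v) + a x) i.
  by rewrite !mxE => h'; apply: le_trans h' _; exact: h3.
Qed.

Lemma later_C11 :
  exists B K r : R, forall m : E -> R, later T m ->
  [/\ C11 B K m, forall x, `|m x| <= B & forall x, r < `|x| -> m x = 0].
Proof.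
have [r r0 rP] := states_cube T C CU M0 Omt0 Omtb.
have sB := ltW (state_B_gt0 T0 M0 CU0 C_bound).
exists (n%:R * state_B C CU + state_B C CU), (n%:R * (n%:R * state_B C CU)), r => m' mT.
have [cm mB mL mK _] := later_facts M0 (ltW T0) (lexx T) mT; split.
- split; [by rewrite addr_ge0// mulr_ge0|by rewrite !mulr_ge0| |exact: mK].
  by move=> x u; apply: le_trans (mL x u) _; rewrite ler_wpM2r// lerDl.
- by move=> x; apply: le_trans (mB x) _; rewrite lerDr mulr_ge0.
- by move=> x; exact: (rP T m' (ltW T0) (lexx T) mT).
Qed.

(** Both suprema are over the same controls, so it suffices to compare the two
    expressions for each control. *)
Lemma Hamiltonian_compare m m' (th eps y : R) : later T m -> later T m' -> 0 < eps ->
  (Hamiltonian M ell m (fun x => (eps^-1 * (m x - th * m' x))%R) <= y%:E)%E ->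
  (Hamiltonian M ell m' (fun x => (th * eps^-1 * (m x - th * m' x))%R) <=
   (y + n%:R * ham_A / 2 * L2_dist m (fun x => (th * m' x)%R) ^+ 2 / eps + Ll * L2_dist m m')%:E)%E.
Proof.
move=> mT mT' e0 H; apply: ge_ereal_sup => _ [a aM <-]; rewrite lee_fin.
have [B [K [r P]]] := later_C11.
have [mC mB mr] := P m mT; have [mC' mB' mr'] := P m' mT'.
have [aA aC] := Atilde_C11 aM.
set w := fun x => m x - th * m' x.
have [dL dL' wL] := hamiltonian_L2 th aA aC mC mC' mr mr' mB mB'.
have key := hamiltonian_diff th aA aC mC mC' mr mr' mB mB'.
rewrite -/w in wL key.
have H1 : L2_inner (fun x => eps^-1 * w x) (divergence (fun x => m x *: a x)) - ell m a <= y.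
  by rewrite -lee_fin; apply: le_trans H; apply: ereal_sup_ubound; exists a.
rewrite L2_innerZl// in H1; rewrite L2_innerZl//.
have H2 : `|ell m a - ell m' a| <= Ll * L2_dist m m'.
  by have [_ _ _ h] := ell_cost; apply: h => //; exact: state_T.
have H3 := le_trans (ler_norm _) H2.
rewrite -/(L2_norm w) in key; rewrite /L2_dist -/w.
have e1 : 0 < eps^-1 by rewrite invr_gt0.
exact: (ham_scalar e1 H1 H3 key).
Qed.

End compare.

(** * Maxima of the doubled functional *)

Lemma sub4_le {R : realType} (x a b c d : R) : 0 <= a -> 0 <= b -> 0 <= c -> 0 <= d ->
  x - a - b - c - d <= x.
Proof. by move=> *; lra. Qed.

Section doubling.
Context {R : realType} {n : nat} (T M C CU delta : R) (Omt Om : set 'rV[R]_n).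
Local Notation E := 'rV[R]_n.
Hypotheses (T0 : 0 < T) (M0 : 0 < M) (CU0 : 0 < CU).
Hypotheses (C_bound : transport_bound n T M C).
Hypotheses (Omt0 : Omt !=set0) (Omtb : bounded_set Omt) (Om0 : Om !=set0).
Local Notation later := (later_states T M C CU Omt).
Local Notation Xbar := (Xc_bar T M C CU Omt Om delta).
Implicit Types (m : E -> R) (t : R).

Lemma Xbar_later m t : Xbar (m, t) -> 0 < t -> later t m.
Proof. by move=> [_ + _] t0; rewrite /= /state_set gt_eqF. Qed.

Lemma Xbar_final m t : Xbar (m, t) -> later T m.
Proof. by move=> [tT mt _]; exact: (state_final T0 M0 C_bound tT mt). Qed.

Lemma Xbar_L2 m t : Xbar (m, t) -> L2 m.
Proof.
move=> /Xbar_final mT; have [B P] := states_L2 T C CU M0 Omt0 Omtb.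
by have [] := P T m (ltW T0) (lexx T) mT.
Qed.

Lemma Xbar_norm : exists2 B : R, 0 <= B & forall m t, Xbar (m, t) -> L2_norm m <= B.
Proof.
have [B P] := states_L2 T C CU M0 Omt0 Omtb; exists `|B| => // m t /Xbar_final mT.
have [_ h] := P T m (ltW T0) (lexx T) mT; exact: le_trans h (ler_norm B).
Qed.

Section limit.
Variables (U : set_system nat) (mk : nat -> E -> R) (tk : nat -> R) (b : R).
Hypotheses (UU : UltraFilter U) (b0 : 0 < b).
Hypotheses (Xk : forall k, Xbar (mk k, tk k)) (btk : forall k, b <= tk k).

Let tkT k : 0 <= tk k <= T. Proof. by have [] := Xk k. Qed.
Let mkt k : later (tk k) (mk k).
Proof. by apply: (Xbar_later (Xk k)); exact: lt_le_trans (btk k). Qed.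

(** Sequential compactness of the constrained set, in the form of limits along an
    ultrafilter, away from time 0. *)
Lemma Xbar_limit : exists m t, [/\ Xbar (m, t), b <= t, L2_dist (mk k) m @[k --> U] --> (0 : R) &
  tk k @[k --> U] --> t].
Proof.
pose t := ulim U tk; pose m := ulimf U mk.
have tc : tk k @[k --> U] --> t.
  by apply: (@ulimP _ _ _ _ T) => k; have /andP[h1 h2] := tkT k; rewrite ger0_norm.
have mc : L2_dist (mk k) m @[k --> U] --> (0 : R).
  exact: (states_ultra_L2 T0 M0 CU0 C_bound Omt0 Omtb UU tkT mkt).
have mt : later t m := ulimf_later M0 Omt0 UU tkT mkt tc.
have bt : b <= t by apply: (ultra_le (v := cst b) (w := tk)) => //; exact: cvg_cst.
have tT : 0 <= t <= T := ulim_time UU tkT tc.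
have t0 : 0 < t := lt_le_trans b0 bt.
have mL : L2 m.
  by have [B P] := states_L2 T C CU M0 Omt0 Omtb; have /andP[h1 h2] := tT; have [] := P t m h1 h2 mt.
exists m, t; split => //; split => //=; first by rewrite /state_set gt_eqF.
have [p pL pE] := constraint_inner T M Omt0 Omtb Om0.
rewrite pE// lee_fin.
apply: (ultra_le (v := fun k => L2_inner p (mk k)) (w := cst delta)).
- apply: (cvg_dist_le (F := U) (b := fun=> L2_inner p m) (c := fun k => L2_norm p * L2_dist (mk k) m)).
  + move=> k; have mkL := Xbar_L2 (Xk k).
    rewrite -L2_innerBr//; apply: L2_cauchy_schwarz => //; exact: L2B.
  + by rewrite -(mulr0 (L2_norm p)); exact: cvgMr.
  + exact: cvg_cst.
- exact: cvg_cst.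
- by move=> k; have [_ _ h] := Xk k; move: h; rewrite /= pE ?lee_fin//; exact: Xbar_L2 (Xk k).
Qed.

End limit.

Section maximum.
Variables (u1 u2 : (E -> R) -> R -> R) (L : R).
Hypotheses (L0 : 0 < L) (u1_lip : lipschitz_L2 Xbar L u1) (u2_lip : lipschitz_L2 Xbar L u2).
Variables (th eps ka Kp a b : R).
Hypotheses (b0 : 0 < b) (eps0 : 0 < eps) (ka0 : 0 <= ka) (Kp0 : 0 <= Kp).

(** The factor [th] is in front of the second density: then the first density is
    close to an interior point of the constraint. *)
Definition doubled m t m' t' : R := u1 m t - u2 m' t' - L2_dist m (fun x => th * m' x) ^+ 2 / (2 * eps) -
  (t - t') ^+ 2 / (2 * eps) - ka * (T - t) - Kp * pos (a - t) ^+ 2.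

Let D m t := Xbar (m, t) /\ b <= t.

Lemma u_bound m' t' : Xbar (m', t') -> exists B, forall m t, Xbar (m, t) ->
  u1 m t - u1 m' t' <= B /\ u2 m' t' - u2 m t <= B.
Proof.
move=> X'; have [B B0 BP] := Xbar_norm; exists (L * (2 * B + T)) => m t X.
have h0 (m1 m2 : E -> R) t1 t2 : Xbar (m1, t1) -> Xbar (m2, t2) -> L2_dist m1 m2 + `|t1 - t2| <= 2 * B + T.
  move=> X1 X2; apply: lerD.
    have m1L := Xbar_L2 X1; have m2L := Xbar_L2 X2.
    have := L2_normD m1L (L2Z (-1) m2L); rewrite (L2_normZ _ m2L) normrN1 mul1r => h.
    rewrite /L2_dist (_ : m1 \- m2 = m1 \+ (fun x => -1 * m2 x)); last by apply/funext => x /=; rewrite mulN1r.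
    by apply: le_trans h _; rewrite mulr2n mulrDl mul1r; apply: lerD; [exact: BP X1|exact: BP X2].
  have [/andP[a1 b1] _ _] := X1; have [/andP[a2 b2] _ _] := X2.
  exact: (abs_sub_le (lexx 0)).
split.
  apply: le_trans (ler_norm _) _; apply: le_trans (u1_lip X X') _.
  by apply: ler_wpM2l; [exact: ltW|exact: h0].
apply: le_trans (ler_norm _) _; apply: le_trans (u2_lip X' X) _.
by apply: ler_wpM2l; [exact: ltW|exact: h0].
Qed.

Lemma doubled_le m t m' t' : 0 <= T - t -> doubled m t m' t' <= u1 m t - u2 m' t'.
Proof.
move=> tT; have e2 : 0 <= (2 * eps)^-1 by rewrite invr_ge0 mulr_ge0// ltW.
have h1 : 0 <= L2_dist m (fun x => th * m' x) ^+ 2 / (2 * eps) by rewrite mulr_ge0 ?sqr_ge0.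
have h2 : 0 <= (t - t') ^+ 2 / (2 * eps) by rewrite mulr_ge0 ?sqr_ge0.
have h3 : 0 <= ka * (T - t) by rewrite mulr_ge0.
have h4 : 0 <= Kp * pos (a - t) ^+ 2 by rewrite mulr_ge0 ?sqr_ge0.
exact: sub4_le.
Qed.

Lemma doubled_cvg (U : set_system nat) (mk mk' : nat -> E -> R) (tk tk' : nat -> R) m m' t t' :
  UltraFilter U -> (forall k, Xbar (mk k, tk k)) -> (forall k, Xbar (mk' k, tk' k)) ->
  Xbar (m, t) -> Xbar (m', t') ->
  L2_dist (mk k) m @[k --> U] --> (0 : R) -> L2_dist (mk' k) m' @[k --> U] --> (0 : R) ->
  tk k @[k --> U] --> t -> tk' k @[k --> U] --> t' ->
  doubled (mk k) (tk k) (mk' k) (tk' k) @[k --> U] --> doubled m t m' t'.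
Proof.
move=> UU Xk Xk' X X' mm mm' tt tt'.
have abs0 (s : nat -> R) (l : R) : s k @[k --> U] --> l -> `|s k - l| @[k --> U] --> (0 : R).
  move=> sl; rewrite -(normr0 R) -(subrr l); apply: cvg_norm; apply: cvgB => //; exact: cvg_cst.
have lipc (u : (E -> R) -> R -> R) (nk : nat -> E -> R) (sk : nat -> R) m1 t1 :
    lipschitz_L2 Xbar L u -> (forall k, Xbar (nk k, sk k)) -> Xbar (m1, t1) ->
    L2_dist (nk k) m1 @[k --> U] --> (0 : R) -> sk k @[k --> U] --> t1 ->
    u (nk k) (sk k) @[k --> U] --> u m1 t1.
  move=> ul nX X1 n1 s1.
  apply: (cvg_dist_le (F := U) (b := fun=> u m1 t1) (c := fun k => L * (L2_dist (nk k) m1 + `|sk k - t1|))).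
  - by move=> k; exact: ul.
  - rewrite -(mulr0 L) -[in X in _ * X](addr0 0); apply: cvgMr; apply: cvgD => //; exact: abs0.
  - exact: cvg_cst.
have mL := Xbar_L2 X; have mL' := Xbar_L2 X'.
have dc : L2_dist (mk k) (fun x => th * mk' k x) @[k --> U] --> L2_dist m (fun x => th * m' x).
  apply: (cvg_dist_le (F := U) (b := fun=> L2_dist m (fun x => th * m' x))
    (c := fun k => L2_dist (mk k) m + `|th| * L2_dist (mk' k) m')).
  - move=> k; have kL := Xbar_L2 (Xk k); have kL' := Xbar_L2 (Xk' k).
    have thd : L2_dist (fun x => th * mk' k x) (fun x => th * m' x) = `|th| * L2_dist (mk' k) m'.
      rewrite /L2_dist -L2_normZ; last exact: L2B.
      by congr L2_norm; apply/funext => x /=; rewrite mulrBr.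
    have t1 := L2_dist_triangle kL mL (L2Z th kL').
    have t2 := L2_dist_triangle mL (L2Z th mL') (L2Z th kL').
    have t3 := L2_dist_triangle mL kL (L2Z th mL').
    have t4 := L2_dist_triangle kL (L2Z th kL') (L2Z th mL').
    rewrite -thd ler_norml; rewrite [L2_dist (fun x => th * m' x) _]L2_distC in t2.
    rewrite [L2_dist m (mk k)]L2_distC in t3.
    move: t1 t2 t3 t4; move: (L2_dist _ _) (L2_dist _ _) (L2_dist _ _) (L2_dist _ _) (L2_dist _ _) => *.
    by apply/andP; split; lra.
  - rewrite -(addr0 0); apply: cvgD => //; rewrite -(mulr0 `|th|); exact: cvgMr.
  - exact: cvg_cst.
have pc : pos (a - tk k) @[k --> U] --> pos (a - t).
  apply: (cvg_dist_le (F := U) (b := fun=> pos (a - t)) (c := fun k => `|tk k - t|)).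
  - by move=> k; apply: le_trans (pos_lip _ _) _; rewrite (_ : _ - _ = - (tk k - t)) ?normrN//; ring.
  - exact: abs0.
  - exact: cvg_cst.
have sq (s : nat -> R) (l : R) : s k @[k --> U] --> l -> s k ^+ 2 @[k --> U] --> l ^+ 2.
  by move=> sl; rewrite expr2; under eq_fun do rewrite expr2; exact: cvgM.
rewrite /doubled; apply: cvgB; last by apply: cvgMr; exact: sq.
apply: cvgB; last by apply: cvgMr; apply: cvgB => //; exact: cvg_cst.
apply: cvgB; last by apply: cvgMl; apply: sq; exact: cvgB.
apply: cvgB; last by apply: cvgMl; exact: sq.
by apply: cvgB; [exact: (lipc u1)|exact: (lipc u2)].
Qed.

(** Points that approach the supremum have a limit along an ultrafilter, and the
    functional is continuous there. *)
Lemma doubling_max m1 t1 : D m1 t1 -> exists m t m' t', [/\ D m t, D m' t' &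
  forall n1 s1 n2 s2, D n1 s1 -> D n2 s2 -> doubled n1 s1 n2 s2 <= doubled m t m' t'].
Proof.
move=> D1; have [X1 b1] := D1; have [B BP] := u_bound X1.
pose A : set R := [set y | exists m t m' t', [/\ D m t, D m' t' & y = doubled m t m' t']].
have supA : has_sup A.
  split; first by exists (doubled m1 t1 m1 t1), m1, t1, m1, t1.
  exists (u1 m1 t1 - u2 m1 t1 + 2 * B) => _ [m [t [m' [t' [[X _] [X' _] ->]]]]].
  have [h1 _] := BP _ _ X; have [_ h2] := BP _ _ X'.
  have [/andP[_ tT] _ _] := X.
  apply: (le_trans (doubled_le m m' t' _)); first by rewrite subr_ge0.
  by lra.
have /choice[z zP] k : exists z : ((E -> R) * R) * ((E -> R) * R),
    [/\ D z.1.1 z.1.2, D z.2.1 z.2.2 & sup A - k.+1%:R^-1 < doubled z.1.1 z.1.2 z.2.1 z.2.2].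
  have k0 : 0 < k.+1%:R^-1 :> R by rewrite invr_gt0.
  have [_ [m [t [m' [t' [Dm Dm' ->]]]]] h] := sup_adherent k0 supA.
  by exists ((m, t), (m', t')).
have [U [UU Uoo]] := ultraFilterLemma (_ : ProperFilter (\oo%classic : set_system nat)).
have Xk k : Xbar ((z k).1.1, (z k).1.2) by have [[]] := zP k.
have Xk' k : Xbar ((z k).2.1, (z k).2.2) by have [_ []] := zP k.
have bk k : b <= (z k).1.2 by have [[]] := zP k.
have bk' k : b <= (z k).2.2 by have [_ []] := zP k.
have [m [t [X bt mc tc]]] := Xbar_limit UU b0 Xk bk.
have [m' [t' [X' bt' mc' tc']]] := Xbar_limit UU b0 Xk' bk'.
exists m, t, m', t'; split => // n1 s1 n2 s2 Dn1 Dn2.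
apply: (@le_trans _ _ (sup A)).
  by apply: ub_le_sup; [have [] := supA|exists n1, s1, n2, s2].
have Pc := doubled_cvg UU Xk Xk' X X' mc mc' tc tc'.
have h0 : sup A - k.+1%:R^-1 @[k --> U] --> sup A - 0.
  apply: cvgB; first exact: cvg_cst.
  have : (k.+1%:R^-1 : R) @[k --> \oo] --> (0 : R) := cvg_harmonic.
  by move=> H V /H; exact: Uoo.
rewrite subr0 in h0.
by apply: (ultra_le h0 Pc) => k; have [_ _ /ltW] := zP k.
Qed.

End maximum.

End doubling.

(** * The comparison principle *)

Lemma adde_le0 {R : realType} (d : R) (h : \bar R) : ((- d)%:E + h <= 0)%E -> (h <= d%:E)%E.
Proof. by case: h => [h| |]//; rewrite ?leNye// -EFinD !lee_fin addrC subr_le0. Qed.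

(** All smallness conditions on the parameters are linear; they are collected in
    a list so that one parameter meets them all. *)
Lemma ex_small {R : realType} (s : seq (R * R)) : (forall p, p \in s -> 0 <= p.1 /\ 0 < p.2) ->
  exists2 e : R, 0 < e & forall p, p \in s -> p.1 * e <= p.2.
Proof.
elim: s => [|p s IH] H; first by exists 1.
have [q qs|e e0 eP] := IH; first by apply: H; rewrite inE qs orbT.
have [p1 p2] := H p (mem_head _ _); have p11 : 0 < p.1 + 1 by rewrite ltr_wpDl.
exists (Num.min e (p.2 / (p.1 + 1))); first by rewrite lt_min e0 divr_gt0.
move=> q; rewrite inE => /orP[/eqP ->|qs].
  apply: (@le_trans _ _ ((p.1 + 1) * (p.2 / (p.1 + 1)))); last by rewrite mulrC divfK// gt_eqF.
  by apply: ler_pM => //; [rewrite le_min (ltW e0) divr_ge0// ltW|rewrite lerDl|rewrite ge_min lexx orbT].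
have [q1 _] := H q (mem_behead (s := p :: s) qs).
by apply: le_trans (eP q qs); apply: ler_wpM2l => //; rewrite ge_min lexx.
Qed.

Lemma penalty_scalar {R : realType} (d tau eps Cst : R) : 0 <= d -> 0 <= tau -> 0 < eps -> 0 <= Cst ->
  d ^+ 2 / (2 * eps) + tau ^+ 2 / (2 * eps) <= Cst * (d + tau) -> d + tau <= 4 * Cst * eps.
Proof.
move=> d0 tau0 e0 Cst0; rewrite -mulrDl ler_pdivrMr ?mulr_gt0// => h.
have r0 : 0 <= d + tau by rewrite addr_ge0.
have h2 : (d + tau) ^+ 2 <= 4 * Cst * eps * (d + tau).
  have := sqr_ge0 (d - tau); rewrite sqrrB sqrrD => h3.
  rewrite (_ : Cst * (d + tau) * (2 * eps) = (4 * Cst * eps * (d + tau)) / 2) in h; last by field.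
  by move: h h3; move: (4 * _ * _ * _) (d ^+ 2) (tau ^+ 2) (d * tau) => x y z v *; lra.
move: r0; rewrite le_eqVlt => /orP[/eqP r0|r0]; last by rewrite -(ler_pM2r r0) -expr2.
rewrite -r0 in h *; by rewrite !mulr_ge0// ltW.
Qed.

Lemma sqr_quot_le {R : realType} (x eps : R) : 0 < eps -> `|x ^+ 2 / (2 * eps)| <= eps^-1 * `|x| ^+ 2.
Proof.
move=> e0; have e1 : 0 < eps^-1 by rewrite invr_gt0.
rewrite normrM normrX mulrC ler_wpM2r ?sqr_ge0// invfM normrM (gtr0_norm e1) ler_piMl ?(ltW e1)//.
by rewrite gtr0_norm ?invr_gt0// invf_le1// ler1n.
Qed.

Lemma min_scalar {R : realType} (U V x y k p V0 x0 y0 : R) :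
  U - V - x - y - k - p <= U - V0 - x0 - y0 - k - p -> V0 - (- x0 + - y0) <= V - (- x + - y).
Proof. by move=> *; lra. Qed.

Lemma penalty_terms {R : realType} (U0 U1 V x y k k' q q' L d c1 c2 : R) :
  U1 - V - 0 - 0 - k' - q' <= U0 - V - x - y - k - q -> U0 - U1 <= L -> k' - k <= c1 -> q' - q <= c2 ->
  L + c1 + c2 <= d -> x + y <= d.
Proof. by move=> *; lra. Qed.

Lemma adde_ge0_le {R : realType} (d : R) (h : \bar R) : (0 <= (- d)%:E + h)%E -> (d%:E <= h)%E.
Proof. by case: h => [h| |]//; rewrite ?leey// -EFinD !lee_fin addrC subr_ge0. Qed.

Lemma six_le {R : realType} (x1 x2 x3 x4 x5 x6 : R) : 0 <= x3 -> 0 <= x5 ->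
  x1 + x2 + x4 + x6 <= x1 + x2 + (x3 + x4) + (x5 + x6).
Proof. by move=> *; lra. Qed.

Lemma terminal_scalar {R : realType} (x y z u0 u3 u4 u5 p0 p1 : R) : u3 <= p0 -> p1 <= u5 ->
  u0 - u3 <= y -> p0 - p1 <= z -> u5 - u4 <= x -> u0 - u4 <= z + (y + x).
Proof. by move=> *; lra. Qed.

Lemma max_scalar {R : realType} (A U x y k p A0 x0 y0 k0 p0 : R) :
  A - U - x - y - k - p <= A0 - U - x0 - y0 - k0 - p0 ->
  A - (x + (y + k + p)) <= A0 - (x0 + (y0 + k0 + p0)).
Proof. by move=> *; lra. Qed.

Lemma three_le {R : realType} (s x y z e1 e2 mn : R) : 0 <= s -> 0 <= x -> 0 <= y -> 0 <= z ->
  (x + y + z) * s <= mn -> mn <= e1 -> mn <= e2 -> [/\ x * s <= e1, y * s <= e1 & z * s <= e2].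
Proof.
move=> s0 x0 y0 z0; rewrite !mulrDl.
have := mulr_ge0 x0 s0; have := mulr_ge0 y0 s0; have := mulr_ge0 z0 s0.
by move: (x * s) (y * s) (z * s) => u v w *; split; lra.
Qed.

Lemma test_scalar {R : realType} (u v w q k e1 e2 : R) : u - v <= q -> q <= e1 -> k <= e2 ->
  (u - w) - e1 - e2 <= v - w - k.
Proof. by move=> *; lra. Qed.

Lemma bound_scalar {R : realType} (u v u' v' B : R) : u - u' <= B -> v' - v <= B -> u - v <= u' - v' + 2 * B.
Proof. by move=> *; lra. Qed.

Lemma penalty_contra {R : realType} (e U B q : R) : 0 < e -> e - e / 16 - e / 4 <= U - q -> U <= B ->
  B + 1 <= q -> False.
Proof. by move=> *; lra. Qed.

Lemma time_scalar {R : realType} (a t t' : R) : 0 < a -> a / 2 + a / 4 < t -> t - t' <= a / 8 -> a / 2 < t'.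
Proof. by move=> *; lra. Qed.

Lemma early_scalar {R : realType} (a t : R) : t <= a / 2 + a / 4 -> a / 4 <= a - t.
Proof. by move=> *; lra. Qed.

Lemma sqr_div_le {R : realType} (A c e d : R) : 0 <= A -> 0 < e -> 0 <= d -> d <= c * e ->
  A * d ^+ 2 / e <= A * c ^+ 2 * e.
Proof.
move=> A0 e0 d0 dce; rewrite ler_pdivrMr// (_ : A * c ^+ 2 * e * e = A * (c * e) ^+ 2); last by ring.
by apply: ler_wpM2l => //; rewrite ler_sqr ?nnegrE// (le_trans d0).
Qed.

Lemma initial_contra {R : realType} (u v u' v' q : R) : 0 < u - v -> 4 * q <= u - v ->
  u - u' <= q -> v' - v <= q -> u' <= v' -> False.
Proof. by move=> *; lra. Qed.

Lemma terminal_contra {R : realType} (e q U x y z w : R) : 0 < e -> 0 <= q -> e - e / 16 - e / 4 <= U - q ->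
  U <= x + y -> x <= z + w -> z + y <= e / 8 -> w <= e / 16 -> False.
Proof. by move=> *; lra. Qed.

Lemma constraint_scalar {R : realType} (s x y z e : R) : 0 < s -> x - y <= z -> z <= s / 2 -> y <= e - s -> x < e.
Proof. by move=> *; lra. Qed.

Lemma final_contra {R : realType} (k x y z q : R) : 0 < k -> x <= x - k - q + y + z -> y <= k / 4 ->
  z <= k / 4 + k / 4 -> 0 <= q -> False.
Proof. by move=> *; lra. Qed.

Lemma ham_A_ge0 {R : realType} n (M : R) : 0 < M -> 0 <= @ham_A R n M.
Proof. by move=> M0; have h := ltW (@ctl_B_gt0 R n M M0); have h' := ltW M0; rewrite addr_ge0// addr_ge0. Qed.

Section final.
Context {R : realType} {n : nat} (T M C CU delta : R) (Omt Om : set 'rV[R]_n).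
Context (ell : ('rV[R]_n -> R) -> ('rV[R]_n -> 'rV[R]_n) -> R).
Context (psi : ('rV[R]_n -> R) -> R) (Ll Lpsi L : R) (u1 u2 : ('rV[R]_n -> R) -> R -> R).
Local Notation E := 'rV[R]_n.
Hypotheses (T0 : 0 < T) (M0 : 0 < M) (CU0 : 0 < CU).
Hypotheses (C_bound : transport_bound n T M C).
Hypotheses (Omt0 : Omt !=set0) (Omtb : bounded_set Omt) (Om0 : Om !=set0) (delta0 : 0 < delta).
Hypotheses (Ll0 : 0 < Ll) (ell_cost : running_cost T M C CU Omt Ll ell).
Hypotheses (Lpsi0 : 0 < Lpsi) (psi_cost : terminal_cost T M C CU Omt Lpsi psi).
Local Notation later := (later_states T M C CU Omt).
Local Notation Xbar := (Xc_bar T M C CU Omt Om delta).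
Local Notation Xo := (Xc T M C CU Omt Om delta).
Hypotheses (L0 : 0 < L) (u1_lip : lipschitz_L2 Xbar L u1) (u2_lip : lipschitz_L2 Xbar L u2).
Hypothesis u1_sub : viscosity_subsolution T M Xo Xbar ell psi u1.
Hypothesis u2_super : viscosity_supersolution T M Xbar ell psi u2.
Implicit Types (m : E -> R) (t : R).

Lemma Xc_sub m t : Xo (m, t) -> Xbar (m, t).
Proof. by move=> [h1 h2 h3]; split => //; exact: ltW. Qed.

Lemma Xbar_T m t : Xbar (m, t) -> Xbar (m, T).
Proof.
move=> X; have mT := Xbar_final T0 M0 C_bound X; have [_ _ h] := X.
by split => //=; [rewrite lexx ltW|exact: state_T].
Qed.

Lemma Xbar_scale m t th : Xbar (m, t) -> 0 < t -> 0 <= th <= 1 -> Xbar ((fun x => th * m x), t).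
Proof.
move=> X t0 th01; have [tT _ h] := X; have mt := Xbar_later X t0; have /andP[a b] := tT.
have mL := Xbar_L2 T0 M0 C_bound Omt0 Omtb X.
have mt' := later_scale M0 a b th01 mt.
split; [exact: tT|by rewrite /= /state_set gt_eqF|].
have [p pL pE] := constraint_inner T M Omt0 Omtb Om0.
rewrite /= (pE _ mL) lee_fin in h; rewrite pE; last exact: L2Z.
rewrite lee_fin L2_inner_sym L2_innerZl// L2_inner_sym.
have /andP[th0 th1] := th01.
by apply: (@le_trans _ _ (th * delta)); [rewrite ler_wpM2l|rewrite ler_piMl// ltW].
Qed.

(** Moving both points to the final time costs the Lipschitz constant; there
    the two terminal inequalities apply. *)
Lemma terminal_le m t m' t' : Xbar (m, t) -> Xbar (m', t') ->
  u1 m t - u2 m' t' <= Lpsi * L2_dist m m' + L * (`|t - T| + `|t' - T|).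
Proof.
move=> X X'; have XT := Xbar_T X; have XT' := Xbar_T X'.
have h1 := u1_lip X XT; have h2 := u2_lip XT' X'; rewrite !L2_distxx !add0r in h1 h2.
have h3 := u1_sub.2 m XT; have h4 := u2_super.2 m' XT'.
have [_ _ _ h5] := psi_cost; have h6 := h5 m m' (state_T T0 (Xbar_final T0 M0 C_bound X)) (state_T T0 (Xbar_final T0 M0 C_bound X')).
rewrite distrC in h2; have h7 := le_trans (ler_norm _) h1; have h8 := le_trans (ler_norm _) h6.
rewrite distrC [`|T - t'|]distrC in h2; have h9 := le_trans (ler_norm _) h2.
rewrite mulrDr; move: h3 h4 h7 h8 h9.
exact: terminal_scalar.
Qed.

Section at_maximum.
Variables (th eps ka Kp a b : R) (m0 m0' : E -> R) (t0 t0' : R).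
Hypotheses (b0 : 0 < b) (eps0 : 0 < eps) (ka0 : 0 <= ka) (Kp0 : 0 <= Kp) (a0 : 0 <= a).
Hypotheses (th0 : 0 < th) (th1 : th <= 1).
Local Notation Phi := (doubled T u1 u2 th eps ka Kp a).
Hypotheses (X0 : Xbar (m0, t0)) (X0' : Xbar (m0', t0')) (bt0 : b <= t0) (bt0' : b <= t0').
Hypothesis Pmax : forall m t m' t', Xbar (m, t) -> b <= t -> Xbar (m', t') -> b <= t' ->
  Phi m t m' t' <= Phi m0 t0 m0' t0'.

Let m0L : L2 m0. Proof. exact: (Xbar_L2 T0 M0 C_bound Omt0 Omtb X0). Qed.
Let m0L' : L2 m0'. Proof. exact: (Xbar_L2 T0 M0 C_bound Omt0 Omtb X0'). Qed.

(** With the second point frozen, the penalties form a test function for u1, with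
    gradient (m - th m') / eps. *)
Lemma max_subsolution : Xo (m0, t0) -> b < t0 -> t0 < T ->
  (Hamiltonian M ell m0 (fun x => (eps^-1 * (m0 x - th * m0' x))%R) <=
   ((t0 - t0') / eps - ka - 2 * Kp * pos (a - t0))%:E)%E.
Proof.
move=> Xo0 bt t0T.
pose h t := (t - t0') ^+ 2 / (2 * eps) + ka * (T - t) + Kp * pos (a - t) ^+ 2.
pose h' t := (t - t0') / eps - ka - 2 * Kp * pos (a - t).
have e1 : 0 < eps^-1 by rewrite invr_gt0.
have hT s t : `|h s - h t - h' t * (s - t)| <= (eps^-1 + 2 * Kp) * `|s - t| ^+ 2.
  have := pos_sqr_taylor (a - t) (a - s); set q := _ - _ - _ => hq.
  rewrite (_ : _ - _ = (s - t) ^+ 2 / (2 * eps) + Kp * q); last by rewrite /h /h' /q; field; rewrite gt_eqF.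
  have e2 : (a - s - (a - t)) ^+ 2 = `|s - t| ^+ 2 by rewrite real_normK ?num_real//; ring.
  rewrite e2 in hq; apply: le_trans (ler_normD _ _) _; rewrite [`|Kp * q|]normrM (ger0_norm Kp0) [leRHS]mulrDl.
  apply: lerD.
    exact: sqr_quot_le.
  apply: le_trans (ler_wpM2l Kp0 hq) _; rewrite ler_wpM2r ?sqr_ge0// mulr2n mulrDl mul1r lerDl; exact: Kp0.
have hL s t : `|h' s - h' t| <= (eps^-1 + 2 * Kp) * `|s - t|.
  rewrite (_ : _ - _ = eps^-1 * (s - t) - 2 * Kp * (pos (a - s) - pos (a - t))); last by rewrite /h'; ring.
  apply: le_trans (ler_normB _ _) _; rewrite !normrM (gtr0_norm e1) (ger0_norm Kp0) mulrDl lerD2l.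
  rewrite (_ : `|2| = 2 :> R); last by rewrite ger0_norm.
  apply: ler_wpM2l; first by rewrite mulr_ge0.
  by apply: le_trans (pos_lip _ _) _; rewrite (_ : a - s - (a - t) = - (s - t)) ?normrN//; ring.
have C0 : 0 <= eps^-1 + 2 * Kp by rewrite addr_ge0 ?mulr_ge0// ltW.
have test := C1_test_quadratic (T := T) (2 * eps)^-1 (L2Z th m0L') C0 hT hL.
have h01 : 0 < t0 < T by rewrite t0T andbT (lt_le_trans b0).
have lmax : local_max Xo (fun m t => u1 m t - ((2 * eps)^-1 * L2_dist m (fun x => th * m0' x) ^+ 2 + h t)) m0 t0.
  exists (t0 - b); first by rewrite subr_gt0.
  move=> m t X _ tt; have tb : b <= t.
    by move: tt; rewrite distrC => tt; have := le_lt_trans (ler_norm _) tt; rewrite ltrD2l ltrN2 => /ltW.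
  have := Pmax (Xc_sub X) tb X0' bt0'; rewrite /doubled /h => H.
  by rewrite ![(2 * eps)^-1 * _]mulrC; exact: max_scalar H.
have := u1_sub.1 _ _ _ test m0 t0 h01 Xo0 lmax => /adde_le0; rewrite -/(h' t0).
congr (_ <= _)%E; congr (Hamiltonian M ell m0 _); apply/funext => x; field; rewrite gt_eqF//.
Qed.

(** With the first point frozen, the penalties are written around [th^-1 m0], so
    that they form a quadratic test function for u2. *)
Lemma max_supersolution : b < t0' -> t0' < T ->
  (((t0 - t0') / eps)%:E <= Hamiltonian M ell m0' (fun x => (th * eps^-1 * (m0 x - th * m0' x))%R))%E.
Proof.
move=> bt t0T; have thn : th != 0 by rewrite gt_eqF.
pose h t := - ((t0 - t) ^+ 2 / (2 * eps)); pose h' t := (t0 - t) / eps.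
have e1 : 0 < eps^-1 by rewrite invr_gt0.
have hT s t : `|h s - h t - h' t * (s - t)| <= eps^-1 * `|s - t| ^+ 2.
  rewrite (_ : _ - _ = - ((s - t) ^+ 2 / (2 * eps))); last by rewrite /h /h'; field; rewrite gt_eqF.
  by rewrite normrN; exact: sqr_quot_le.
have hL s t : `|h' s - h' t| <= eps^-1 * `|s - t|.
  rewrite (_ : _ - _ = - (eps^-1 * (s - t))); last by rewrite /h'; ring.
  by rewrite normrN normrM (gtr0_norm e1).
have test := C1_test_quadratic (T := T) (- (th ^+ 2 / (2 * eps))) (L2Z th^-1 m0L) (ltW e1) hT hL.
have h01 : 0 < t0' < T by rewrite t0T andbT (lt_le_trans b0).
have conv f : L2 f -> - (th ^+ 2 / (2 * eps)) * L2_dist f (fun x => th^-1 * m0 x) ^+ 2 =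
    - (L2_dist m0 (fun x => th * f x) ^+ 2 / (2 * eps)).
  move=> fL; rewrite /L2_dist (_ : m0 \- _ = fun x => - th * (f \- (fun x => th^-1 * m0 x)) x).
    rewrite L2_normZ; last exact: L2B (L2Z _ m0L).
    by rewrite normrN (gtr0_norm th0); field; rewrite gt_eqF.
  by apply/funext => x /=; field.
have lmin : local_min Xbar (fun m t => u2 m t - (- (th ^+ 2 / (2 * eps)) * L2_dist m (fun x => th^-1 * m0 x) ^+ 2 + h t)) m0' t0'.
  exists (t0' - b); first by rewrite subr_gt0.
  move=> m t X _ tt; have tb : b <= t.
    by move: tt; rewrite distrC => tt; have := le_lt_trans (ler_norm _) tt; rewrite ltrD2l ltrN2 => /ltW.
  have mL := Xbar_L2 T0 M0 C_bound Omt0 Omtb X.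
  have := Pmax X0 bt0 X tb; rewrite /doubled => H.
  by rewrite (conv _ mL) (conv _ m0L') /h; exact: min_scalar H.
have := u2_super.1 _ _ _ test m0' t0' h01 X0' lmin => /adde_ge0_le.
congr (_ <= _)%E; congr (Hamiltonian M ell m0' _); apply/funext => x; field.
by rewrite thn gt_eqF.
Qed.

(** The maximum is tested against the point where the first variable is replaced
    by the scaled second one: it makes the quadratic penalties vanish and, by the
    Lipschitz bound, changes u1 by a multiple of the distance only. *)
Lemma max_penalty : L2_dist m0 (fun x => th * m0' x) + `|t0 - t0'| <= 4 * (L + ka + 2 * a * Kp) * eps.
Proof.
have tb : 0 < t0' := lt_le_trans b0 bt0'.
have th01 : 0 <= th <= 1 by rewrite th1 ltW.
have Xth := Xbar_scale X0' tb th01.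
have := Pmax Xth bt0' X0' bt0'; rewrite /doubled L2_distxx subrr expr0n /= !mul0r => H.
set d := L2_dist m0 (fun x => th * m0' x) in H *; set tau := `|t0 - t0'|.
have d0 : 0 <= d by exact: L2_dist_ge0.
have tau0 : 0 <= tau by exact: normr_ge0.
have h1 := le_trans (ler_norm _) (u1_lip X0 Xth); rewrite -/d -/tau in h1.
have h2 : ka * (T - t0') - ka * (T - t0) <= ka * tau.
  by rewrite -mulrBr ler_wpM2l// (le_trans _ (ler_norm _)) 1?le_eqVlt//; apply/orP; left; apply/eqP; ring.
have posa t : b <= t -> pos (a - t) <= a.
  move=> bt; rewrite /pos ge_max a0 andbT gerBl; exact: le_trans (ltW b0) bt.
have h3 : Kp * pos (a - t0') ^+ 2 - Kp * pos (a - t0) ^+ 2 <= 2 * a * Kp * tau.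
  rewrite -mulrBr subr_sqr (_ : 2 * a * Kp * tau = Kp * (tau * (a + a))); last by ring.
  apply: ler_wpM2l => //; apply: le_trans (ler_norm _) _; rewrite normrM.
  apply: ler_pM => //.
    by apply: le_trans (pos_lip _ _) _; rewrite (_ : a - t0' - (a - t0) = t0 - t0')//; ring.
  by rewrite ger0_norm ?addr_ge0 ?pos_ge0//; apply: lerD; exact: posa.
apply: penalty_scalar => //; first by rewrite !addr_ge0 ?mulr_ge0// ltW.
have tE : (t0 - t0') ^+ 2 = tau ^+ 2 by rewrite /tau real_normK ?num_real.
rewrite -tE; apply: (penalty_terms H h1 h2 h3).
rewrite [leRHS]mulrDl [X in _ <= X + _]mulrDl ![_ * (d + tau)]mulrDr.
have k1 : 0 <= ka * d by rewrite mulr_ge0.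
have k2 : 0 <= 2 * a * Kp * d by rewrite !mulr_ge0.
move: (L * d) (L * tau) (ka * d) (ka * tau) (2 * a * Kp * d) (2 * a * Kp * tau) k1 k2 => x1 x2 x3 x4 x5 x6 k1 k2.
exact: six_le.
Qed.

End at_maximum.

Lemma doubled_le_penalty (th eps ka Kp a : R) m t m' t' : 0 < eps -> 0 <= ka -> t <= T ->
  doubled T u1 u2 th eps ka Kp a m t m' t' <= u1 m t - u2 m' t' - Kp * pos (a - t) ^+ 2.
Proof.
move=> eps0 ka0 tT; have e2 : 0 <= (2 * eps)^-1 by rewrite invr_ge0 mulr_ge0// ltW.
have h1 : 0 <= L2_dist m (fun x => th * m' x) ^+ 2 / (2 * eps) by rewrite mulr_ge0 ?sqr_ge0.
have h2 : 0 <= (t - t') ^+ 2 / (2 * eps) by rewrite mulr_ge0 ?sqr_ge0.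
have h3 : 0 <= ka * (T - t) by rewrite mulr_ge0 ?subr_ge0.
by rewrite /doubled lerD2r; have := sub4_le (u1 m t - u2 m' t') h1 h2 h3 (lexx 0); rewrite subr0.
Qed.

Lemma L2_dist_scale m sg : L2 m -> 0 <= sg -> L2_dist m (fun x => (1 - sg) * m x) = sg * L2_norm m.
Proof.
move=> mL sg0; rewrite /L2_dist (_ : _ \- _ = fun x => sg * m x).
  by rewrite L2_normZ// ger0_norm.
by apply/funext => x /=; ring.
Qed.

(** If u1 - u2 had the positive value eta at (m1, a), then all parameters could be
    chosen, in the order Kp, ka, th, eps, such that the maximum of the doubled
    functional is at least eta/2 and is attained at interior times, where the two
    viscosity inequalities contradict each other by the amount ka/4. *)
Lemma comparison_interior m1 a : Xbar (m1, a) -> 0 < a -> u1 m1 a <= u2 m1 a.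
Proof.
move=> X1 a0; rewrite leNgt; apply/negP => lt21.
pose eta := u1 m1 a - u2 m1 a; have eta0 : 0 < eta by rewrite subr_gt0.
(* UB is a bound of u1 - u2 over all pairs of points, and Kp makes the penalty in
   time exceed it as soon as t <= 3a/4. *)
have [B B0 BP] := Xbar_norm CU delta Om T0 M0 C_bound Omt0 Omtb.
have [B' B'P] := u_bound T0 M0 C_bound Omt0 Omtb L0 u1_lip u2_lip X1.
pose UB := `|eta + 2 * B'|; have UB0 : 0 <= UB by exact: normr_ge0.
have [Kp Kp0 KpE] : exists2 Kp, 0 <= Kp & UB + 1 = Kp * (a / 4) ^+ 2.
  exists (16 * (UB + 1) / a ^+ 2); last by field; rewrite gt_eqF.
  by rewrite !mulr_ge0 ?addr_ge0// invr_ge0 sqr_ge0.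
have T1 : 0 < 4 * (T + 1) by rewrite mulr_gt0// addr_gt0.
have [ka ka0 kaT] : exists2 ka, 0 < ka & ka * T <= eta / 4.
  exists (eta / (4 * (T + 1))); first by rewrite divr_gt0.
  rewrite invfM mulrA mulrAC ler_pdivrMr ?addr_gt0// mulrDr mulr1 lerDl.
  by rewrite divr_ge0// ltW.
(* th = 1 - sg; a state is moved by at most sg B when it is scaled by th. *)
pose mn := Num.min (eta / 16) (ka / 4); have mn0 : 0 < mn by rewrite lt_min !divr_gt0.
have [sg sg0 sgP] : exists2 e : R, 0 < e & forall p, p \in [:: ((L + Lpsi + Ll) * B, mn); (1, 2^-1)] -> p.1 * e <= p.2.
  apply: ex_small => p; rewrite !inE => /orP[/eqP ->|/eqP ->] /=; split => //.
  by rewrite mulr_ge0// !addr_ge0 ?ltW.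
have /= sgB := sgP _ (mem_head _ _).
have /= sg1 : 1 * sg <= 2^-1 by apply: (sgP (1, 2^-1)); rewrite !inE eqxx orbT.
rewrite mul1r in sg1.
have sgB0 : 0 <= B * sg by rewrite mulr_ge0// ltW.
have mn1 : mn <= eta / 16 by rewrite ge_min lexx.
have mn2 : mn <= ka / 4 by rewrite ge_min lexx orbT.
have [sgL sgLpsi sgLl] : [/\ L * (B * sg) <= eta / 16, Lpsi * (B * sg) <= eta / 16 & Ll * (B * sg) <= ka / 4].
  rewrite -mulrA in sgB; exact: (three_le sgB0 (ltW L0) (ltW Lpsi0) (ltW Ll0) sgB mn1 mn2).
pose th := 1 - sg.
have th0 : 0 < th by rewrite subr_gt0 (le_lt_trans sg1)// invf_lt1// ltr1n.
have th1 : th <= 1 by rewrite /th gerBl ltW.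
have th01 : 0 <= th <= 1 by rewrite th1 ltW.
pose Cst := 4 * (L + ka + 2 * a * Kp).
have Cst0 : 0 <= Cst.
  by rewrite mulr_ge0// !addr_ge0 ?(ltW L0) ?(ltW ka0)// !mulr_ge0 ?(ltW a0).
have [p pL pE] := constraint_inner T M Omt0 Omtb Om0.
have [A A0 AE] : exists2 A, 0 <= A & n%:R * @ham_A R n M / 2 = A.
  by exists (n%:R * @ham_A R n M / 2) => //; rewrite !mulr_ge0 ?(@ham_A_ge0 _ n _ M0).
(* The requirements on eps.  By max_penalty the distances are at most Cst eps,
   which is made small with respect to: the distance of 3a/4 to a/2, the terminal
   error, the divergence term, the running cost, the gap in the constraint. *)
pose cs := [:: (Cst, a / 8); ((Lpsi + L) * Cst, eta / 8); (A * Cst ^+ 2, ka / 4); (Ll * Cst, ka / 4);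
  (L2_norm p * Cst, sg * delta / 2)].
have [eps eps0 epsP] : exists2 e : R, 0 < e & forall q, q \in cs -> q.1 * e <= q.2.
  have e1 : 0 <= (Lpsi + L) * Cst by rewrite mulr_ge0// addr_ge0 ?(ltW L0) ?(ltW Lpsi0).
  have e2 : 0 <= A * Cst ^+ 2 by apply: mulr_ge0 => //; exact: sqr_ge0.
  have e3 : 0 <= Ll * Cst by apply: mulr_ge0 => //; exact: ltW.
  have e4 : 0 <= L2_norm p * Cst by apply: mulr_ge0 => //; exact: L2_norm_ge0.
  have e5 : 0 < sg * delta / 2 by rewrite divr_gt0// mulr_gt0.
  have [e6 e7 e8] : [/\ 0 < a / 8, 0 < eta / 8 & 0 < ka / 4] by split; rewrite divr_gt0.
  by apply: ex_small => q; rewrite !inE => /or4P[/eqP ->|/eqP ->|/eqP ->|/orP[/eqP ->|/eqP ->]].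
have /= eps1 : Cst * eps <= a / 8 by apply: (epsP (_, _)); rewrite mem_head.
have /= eps2 : (Lpsi + L) * Cst * eps <= eta / 8 by apply: (epsP (_, _)); rewrite !inE eqxx ?orbT.
have /= eps3 : A * Cst ^+ 2 * eps <= ka / 4 by apply: (epsP (_, _)); rewrite !inE eqxx ?orbT.
have /= eps4 : Ll * Cst * eps <= ka / 4 by apply: (epsP (_, _)); rewrite !inE eqxx ?orbT.
have /= eps5 : L2_norm p * Cst * eps <= sg * delta / 2 by apply: (epsP (_, _)); rewrite !inE eqxx ?orbT.
have b0 : 0 < a / 2 by rewrite divr_gt0.
have ab : a / 2 <= a by rewrite ler_pdivrMr// ler_peMr ?ler1n// ltW.
have [m [t [m' [t' [[X bt] [X' bt'] Pmax]]]]] := doubling_max T0 M0 CU0 C_bound Omt0 Omtb Om0 L0 u1_lip u2_lip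
  th a b0 eps0 (ltW ka0) Kp0 (conj X1 ab).
have mL := Xbar_L2 T0 M0 C_bound Omt0 Omtb X; have mL' := Xbar_L2 T0 M0 C_bound Omt0 Omtb X'.
have m1L := Xbar_L2 T0 M0 C_bound Omt0 Omtb X1.
have Pmax' n1 s1 n2 s2 : Xbar (n1, s1) -> a / 2 <= s1 -> Xbar (n2, s2) -> a / 2 <= s2 ->
    doubled T u1 u2 th eps ka Kp a n1 s1 n2 s2 <= doubled T u1 u2 th eps ka Kp a m t m' t'.
  by move=> *; apply: Pmax; split.
set d := L2_dist m (fun x => th * m' x); set tau := `|t - t'|.
have pen : d + tau <= Cst * eps := max_penalty b0 eps0 (ltW ka0) Kp0 (ltW a0) th0 th1 X X' bt bt' Pmax'.
have d0 : 0 <= d by exact: L2_dist_ge0.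
have tau0 : 0 <= tau by exact: normr_ge0.
have dm : L2_dist m m' <= d + B * sg.
  apply: le_trans (L2_dist_triangle mL (L2Z th mL') mL') _; rewrite lerD2l L2_distC L2_dist_scale//; last exact: ltW.
  by rewrite mulrC ler_wpM2r ?(ltW sg0)//; exact: BP X'.
(* The value of the doubled functional at the pair th m1, m1 at time a. *)
have Xth := Xbar_scale X1 a0 th01.
have Ptest : eta - eta / 16 - eta / 4 <= doubled T u1 u2 th eps ka Kp a m t m' t'.
  apply: le_trans (Pmax' _ _ _ _ Xth ab X1 ab).
  rewrite /doubled L2_distxx !subrr expr0n /= !mul0r /pos maxxx expr0n /= mulr0 !subr0.
  have h := le_trans (ler_norm _) (u1_lip X1 Xth); rewrite subrr normr0 addr0 L2_dist_scale ?(ltW sg0)// in h.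
  have h2 : L * (sg * L2_norm m1) <= eta / 16.
    apply: le_trans sgL; apply: ler_wpM2l; first exact: ltW.
    rewrite mulrC ler_wpM2r ?(ltW sg0)//; exact: BP X1.
  have h3 : ka * (T - a) <= eta / 4.
    by apply: le_trans kaT; apply: ler_wpM2l; [exact: ltW|rewrite gerBl ltW].
  exact: (test_scalar (u2 m1 a) h h2 h3).
have [/andP[_ tT] _ _] := X; have [/andP[_ tT'] _ _] := X'.
have Ple := le_trans Ptest (doubled_le_penalty th Kp a m m' t' eps0 (ltW ka0) tT).
have pp : 0 <= Kp * pos (a - t) ^+ 2 by rewrite mulr_ge0 ?sqr_ge0.
have Ub : u1 m t - u2 m' t' <= UB.
  have [h1 _] := B'P _ _ X; have [_ h2] := B'P _ _ X'.
  by apply: le_trans (ler_norm _); exact: bound_scalar.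
have t34 : a / 2 + a / 4 < t.
  rewrite ltNge; apply/negP => h.
  have : a / 4 <= pos (a - t).
    by rewrite /pos le_max; apply/orP; left; exact: early_scalar.
  move=> h2; have h3 : UB + 1 <= Kp * pos (a - t) ^+ 2.
    by rewrite KpE; apply: ler_wpM2l => //; rewrite ler_sqr ?nnegrE ?pos_ge0// divr_ge0// ltW.
  exact: (penalty_contra eta0 Ple Ub h3).
have dE : d <= Cst * eps by apply: le_trans pen; rewrite lerDl.
have tauE : tau <= Cst * eps by apply: le_trans pen; rewrite lerDr.
have t12 : a / 2 < t'.
  have h := le_trans (ler_norm _) (le_trans tauE eps1).
  exact: (time_scalar a0 t34 h).
have b1 : a / 2 < t by apply: le_lt_trans t34; rewrite lerDl divr_ge0// ltW.
(* If one of the two times were T, the terminal inequality would bound u1 - u2 by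
   less than eta/2. *)
have noT : `|t - T| + `|t' - T| = tau -> False.
  move=> e; have h := terminal_le X X'; rewrite e in h.
  have h1 : Lpsi * L2_dist m m' <= Lpsi * (d + B * sg) by apply: ler_wpM2l => //; exact: ltW.
  have h2 : Lpsi * d + L * tau <= eta / 8.
    apply: le_trans eps2; rewrite -mulrA mulrDl; apply: lerD; apply: ler_wpM2l => //; exact: ltW.
  rewrite mulrDr in h1.
  exact: (terminal_contra eta0 pp Ple h h1 h2 sgLpsi).
have ltT : t < T.
  rewrite lt_neqAle tT andbT; apply/negP => /eqP e; apply: noT.
  by rewrite /tau e subrr normr0 add0r distrC.
have ltT' : t' < T.
  rewrite lt_neqAle tT' andbT; apply/negP => /eqP e; apply: noT.
  by rewrite /tau e subrr normr0 addr0.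
(* Scaling by th leaves a gap of sg delta in the constraint, and m is closer
   than half of it to th m'. *)
have Xm : Xo (m, t).
  have [h1 h2 _] := X; have [_ _ h3] := X'; split => //=.
  rewrite /= (pE _ mL') lee_fin in h3; rewrite (pE _ mL) lte_fin.
  have h4 := L2_cauchy_schwarz pL (L2B mL (L2Z th mL')).
  rewrite L2_innerBr// in h4; last exact: L2Z.
  have h5 : L2_inner p (fun x => th * m' x) = th * L2_inner p m'.
    by rewrite L2_inner_sym L2_innerZl// L2_inner_sym.
  rewrite h5 in h4; have h6 := le_trans (ler_norm _) h4.
  have h7 : L2_norm p * d <= sg * delta / 2.
    by apply: le_trans eps5; rewrite -mulrA; apply: ler_wpM2l => //; exact: L2_norm_ge0.
  have h8 : th * L2_inner p m' <= delta - sg * delta.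
    by rewrite -[X in X - _]mul1r -mulrBl; apply: ler_wpM2l => //; exact: ltW.
  exact: (constraint_scalar (mulr_gt0 sg0 delta0) h6 h7 h8).
have sub := max_subsolution b0 eps0 Kp0 X' bt bt' Pmax' Xm b1 ltT.
have sup := max_supersolution b0 eps0 th0 X X' bt bt' Pmax' t12 ltT'.
have mT := Xbar_final T0 M0 C_bound X; have mT' := Xbar_final T0 M0 C_bound X'.
have cmp := Hamiltonian_compare T0 M0 CU0 C_bound Omt0 Omtb ell_cost mT mT' eps0 sub.
have := le_trans sup cmp; rewrite lee_fin AE -/d => fin.
have f1 : A * d ^+ 2 / eps <= ka / 4.
  by apply: le_trans eps3; exact: sqr_div_le.
have f2 : Ll * L2_dist m m' <= ka / 4 + ka / 4.
  apply: (@le_trans _ _ (Ll * (d + B * sg))); first by apply: ler_wpM2l => //; exact: ltW.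
  rewrite mulrDr; apply: lerD => //; apply: le_trans eps4; rewrite -mulrA; apply: ler_wpM2l => //; exact: ltW.
have f3 : 0 <= 2 * Kp * pos (a - t) by rewrite !mulr_ge0 ?pos_ge0.
exact: (final_contra ka0 fin f1 f2 f3).
Qed.

(** At time 0 no equation is available; the point is moved to a short positive
    time, at the expense of a Lipschitz error. *)
Lemma comparison m t : Xbar (m, t) -> u1 m t - u2 m t <= 0.
Proof.
move=> X; have [/andP[t0 tT] mt h] := X.
move: t0; rewrite le_eqVlt => /orP[/eqP /= e|t0]; last by rewrite subr_le0; exact: comparison_interior.
rewrite /= -e in mt.
rewrite leNgt; apply/negP => eta0.
pose eta := u1 m t - u2 m t; pose r := Num.min T (eta / (4 * L)).
have L4 : 0 < 4 * L by rewrite mulr_gt0.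
have r0 : 0 < r by rewrite lt_min T0 divr_gt0.
have rT : r <= T by rewrite ge_min lexx.
have re : 4 * L * r <= eta by rewrite mulrC -ler_pdivlMr// ge_min lexx orbT.
have mr : Xbar (m, r).
  split => //=; first by rewrite ltW.
  move: mt; rewrite /= /state_set eqxx gt_eqF// => mt.
  by apply: (initial_later T0 M0 C_bound) => //; rewrite r0 rT.
have h1 := u1_lip X mr; have h2 := u2_lip mr X; rewrite !L2_distxx !add0r -e !(subr0, sub0r) ?normrN (gtr0_norm r0) in h1 h2.
have h3 := comparison_interior mr r0; have h4 := le_trans (ler_norm _) h1; have h5 := le_trans (ler_norm _) h2.
rewrite -mulrA /eta -e in re; rewrite -e in eta0; exact: (initial_contra eta0 re h4 h5 h3).
Qed.

End final.

Theorem theorem5p3 (R : realType) (n : nat) (T M C CU delta : R)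
    (Omt Om : set 'rV[R]_n)
    (ell : ('rV[R]_n -> R) -> ('rV[R]_n -> 'rV[R]_n) -> R)
    (psi : ('rV[R]_n -> R) -> R) (Ll Lpsi L : R)
    (u1 u2 : ('rV[R]_n -> R) -> R -> R)
    (n_ge1 : (1 <= n)%N) (T_gt0 : 0 < T) (M_gt0 : 0 < M) (CU_gt0 : 0 < CU)
    (C_bound : transport_bound n T M C)
    (Omt_open : open Omt) (Omt_bounded : bounded_set Omt)
    (Om_sub : Om `<=` Omt) (Om_neq0 : Om !=set0) (Om_open : open Om)
    (Om_convex : convex_set (Om : set (convex_lmodType 'rV[R]_n)))
    (Om_boundary : has_divergence_theorem Om)
    (delta_gt0 : 0 < delta)
    (Ll_gt0 : 0 < Ll) (ell_cost : running_cost T M C CU Omt Ll ell)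
    (Lpsi_gt0 : 0 < Lpsi) (psi_cost : terminal_cost T M C CU Omt Lpsi psi)
    (u1_cont : continuous_L2 (Xc_bar T M C CU Omt Om delta) u1)
    (u2_cont : continuous_L2 (Xc_bar T M C CU Omt Om delta) u2)
    (L_gt0 : 0 < L)
    (u1_lip : lipschitz_L2 (Xc_bar T M C CU Omt Om delta) L u1)
    (u2_lip : lipschitz_L2 (Xc_bar T M C CU Omt Om delta) L u2)
    (u1_sub : viscosity_subsolution T M (Xc T M C CU Omt Om delta)
                (Xc_bar T M C CU Omt Om delta) ell psi u1)
    (u2_super : viscosity_supersolution T M
                  (Xc_bar T M C CU Omt Om delta) ell psi u2) :
  forall m t, Xc_bar T M C CU Omt Om delta (m, t) -> u1 m t - u2 m t <= 0.
Proof.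
have Omt0 : Omt !=set0 by have [x Omx] := Om_neq0; exists x; exact: Om_sub.
move=> m t; exact: (comparison T_gt0 M_gt0 CU_gt0 C_bound Omt0 Omt_bounded Om_neq0 delta_gt0
  Ll_gt0 ell_cost Lpsi_gt0 psi_cost L_gt0 u1_lip u2_lip u1_sub u2_super).
Qed.
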